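(* Let $m>2$ be an integer, $f(\vec x,\vec w)\in L^\infty(\Omega\times\mathcal{S}^1)$ and $h(\vec x_0,\vec w)\in L^\infty(\Gamma^-)$ satisfying the compatibility condition $$\int_{\Omega\times\mathcal{S}^1}f\,d\vec w\,d\vec x-\epsilon\int_{\partial\Omega}\int_{\vec w\cdot\vec\nu<0}h(\vec x_0,\vec w)(\vec w\cdot\vec\nu)\,d\vec w\,d\vec x_0=0 .$$ Then, for all sufficiently small $\epsilon>0$, the steady neutron transport problem $$\epsilon\vec w\cdot\nabla_x u+u-\bar u=f\ \text{ in }\Omega\times\mathcal{S}^1,\qquad u(\vec x_0,\vec w)=\mathcal{P}[u](\vec x_0)+h(\vec x_0,\vec w)\ \text{ for }\vec x_0\in\partial\Omega,\ \vec w\cdot\vec\nu<0,$$ with the normalization $\int_{\Omega\times\mathcal{S}^1}u\,d\vec w\,d\vec x=0$, has a unique solution $u(\vec x,\vec w)\in L^\infty(\Omega\times\mathcal{S}^1)$, and it satisfies $$\|u\|_{L^\infty(\Omega\times\mathcal{S}^1)}\le C\Big(\frac1{\epsilon^{1+\frac1m}}\|f\|_{L^2(\Omega\times\mathcal{S}^1)}+\frac1{\epsilon^{2+\frac1m}}\|f\|_{L^{\frac{2m}{2m-1}}(\Omega\times\mathcal{S}^1)}+\|f\|_{L^\infty(\Omega\times\mathcal{S}^1)}$$ $$\qquad+\frac1{\epsilon^{1+\frac1m}}\|h\|_{L^2(\Gamma^-)}+\frac1{\epsilon^{\frac1m}}\|h\|_{L^m(\Gamma^-)}+\|h\|_{L^\infty(\Gamma^-)}\Big),$$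 with $C$ depending only on $\Omega$ and $m$.
   Context: $\Omega\subset\mathbb{R}^2$ is a bounded convex domain with $\partial\Omega\in C^2$ and outward unit normal $\vec\nu$; $\mathcal{S}^1$ is the unit circle; $0<\epsilon\ll1$. $\Gamma^-=\{(\vec x,\vec w):\vec x\in\partial\Omega,\ \vec w\in\mathcal{S}^1,\ \vec w\cdot\vec\nu<0\}$. $\bar u(\vec x)=\frac1{2\pi}\int_{\mathcal{S}^1}u\,d\vec w$, $\mathcal{P}[u](\vec x_0)=\frac12\int_{\vec w\cdot\vec\nu>0}u(\vec x_0,\vec w)(\vec w\cdot\vec\nu)\,d\vec w$. For $1\le p<\infty$, $\|f\|_{L^p(\Omega\times\mathcal{S}^1)}=\big(\int_\Omega\int_{\mathcal{S}^1}|f|^p\,d\vec w\,d\vec x\big)^{1/p}$ and $\|f\|_{L^p(\Gamma^-)}=\big(\iint_{\Gamma^-}|f|^p|\vec w\cdot\vec\nu|\,d\vec w\,d\vec x\big)^{1/p}$; $L^\infty$ norms are (essential) suprema. *)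

(* Defs.v *)
From HB Require Import structures.
From mathcomp Require Import all_boot all_order all_algebra.
From mathcomp Require Import all_classical all_reals all_analysis.

Set Implicit Arguments.
Unset Strict Implicit.
Unset Printing Implicit Defensive.

Import Order.TTheory GRing.Theory Num.Theory.
Import numFieldNormedType.Exports.

Local Open Scope classical_set_scope.
Local Open Scope ring_scope.

Definition dot (R : realType) (x y : R * R) : R := x.1 * y.1 + x.2 * y.2.

Definition frontier (T : topologicalType) (A : set T) : set T :=
  closure A `\` A°.

Definition C1_curve (R : realType) (c : R -> R * R) : Prop :=
  (forall t, derivable c t 1) /\ continuous (derive1 c).

Definition C2_fun (R : realType) (g : R -> R) : Prop :=
  [/\ forall t, derivable g t 1,
      forall t, derivable (derive1 g) t 1
    & continuous (derive1 (derive1 g))].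

(* Near each boundary point, in an orthonormal frame (e, n) centred there, the
   domain is the strict epigraph of a C^2 function. *)
Definition C2_boundary (R : realType) (Omega : set (R * R)) : Prop :=
  forall x0, frontier Omega x0 ->
  exists (r : R) (e n : R * R) (g : R -> R),
    [/\ 0 < r, [/\ dot e e = 1, dot n n = 1 & dot e n = 0], C2_fun g
      & forall x, dot (x - x0) (x - x0) < r ^+ 2 ->
          (Omega x <-> g (dot (x - x0) e) < dot (x - x0) n)].

Definition bounded_convex_C2_domain (R : realType) (Omega : set (R * R))
    : Prop :=
  [/\ open Omega, Omega !=set0, bounded_set Omega, convex_set Omega
    & C2_boundary Omega].

(* Arc length on the boundary is given by a unit-speed parametrization of
   period [len]; a bounded convex domain with C^2 boundary has exactly one
   boundary curve, so such a parametrization exists and is unique up to the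
   choice of base point and orientation.  [normal] is only constrained on the
   boundary, where it is the outward unit normal. *)
Record boundary_data (R : realType) (Omega : set (R * R)) := BoundaryData {
  len : R;
  curve : R -> R * R;
  normal : R * R -> R * R;
  len_gt0 : 0 < len;
  curve_C1 : C1_curve curve;
  curve_unit_speed : forall t, dot (derive1 curve t) (derive1 curve t) = 1;
  curve_periodic : forall t, curve (t + len) = curve t;
  curve_inj : set_inj `[0, len[ curve;
  curve_range : curve @` `[0, len[ = frontier Omega;
  normal_unit : forall t, dot (normal (curve t)) (normal (curve t)) = 1;
  normal_orth : forall t, dot (normal (curve t)) (derive1 curve t) = 0;
  normal_outward : forall t, \forall d \near 0^'+,
    Omega (curve t - d *: normal (curve t)) /\
    ~ Omega (curve t + d *: normal (curve t))
}.

(* Directions are parametrized by the angle in [0, 2 pi[, so that arc length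
   on the unit circle becomes Lebesgue measure. *)
Definition dir (R : realType) (theta : R) : R * R := (cos theta, sin theta).

Definition angles (R : realType) : set R := `[0, 2 * pi[.

Definition leb2 (R : realType) := (@lebesgue_measure R \x @lebesgue_measure R)%E.
Definition leb3 (R : realType) := (@leb2 R \x @lebesgue_measure R)%E.

Definition in_angle (R : realType) (f : R * R -> R * R -> R)
    (z : (R * R) * R) : R := f z.1 (dir z.2).

Definition phase (R : realType) (Omega : set (R * R)) : set ((R * R) * R) :=
  Omega `*` @angles R.

Definition phase_int (R : realType) (Omega : set (R * R))
    (f : R * R -> R * R -> R) : R :=
  \int[@leb3 R]_(z in phase Omega) in_angle f z.

Definition phase_norm (R : realType) (Omega : set (R * R)) (p : \bar R)
    (f : R * R -> R * R -> R) : \bar R :=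
  'N[@leb3 R]_p [EFin \o (in_angle f \_ (phase Omega))].

Definition phase_Linfty (R : realType) (Omega : set (R * R))
    (f : R * R -> R * R -> R) : Prop :=
  in_angle f \_ (phase Omega) \in Lfun (@leb3 R) +oo%E.

Definition velocity_average (R : realType) (u : R * R -> R * R -> R)
    (x : R * R) : R :=
  (2 * pi)^-1 * \int[@lebesgue_measure R]_(theta in @angles R) u x (dir theta).

Section boundary.
Context (R : realType) (Omega : set (R * R)) (b : boundary_data Omega).
Implicit Types (f g h : R * R -> R * R -> R) (z : R * R).

(* The first coordinate of [z] is arc length, the second the angle. *)
Definition on_boundary f z : R := f (curve b z.1) (dir z.2).

Definition flux z : R := dot (dir z.2) (normal b (curve b z.1)).

Definition Gamma : set (R * R) := `[0, len b[ `*` @angles R.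
Definition Gamma_minus : set (R * R) := [set z | Gamma z /\ flux z < 0].

Definition Gamma_Linfty f : Prop :=
  on_boundary f \_ Gamma \in Lfun (@leb2 R) +oo%E.

Definition Gamma_minus_Linfty h : Prop :=
  on_boundary h \_ Gamma_minus \in Lfun (@leb2 R) +oo%E.

Definition Gamma_minus_norm_infty h : \bar R :=
  'N[@leb2 R]_+oo [EFin \o (on_boundary h \_ Gamma_minus)].

Definition Gamma_minus_norm (p : R) h : \bar R :=
  ((\int[@leb2 R]_(z in Gamma_minus)
      (`|on_boundary h z| `^ p * `|flux z|)%:E) `^ p^-1)%E.

Definition outgoing_average g (x0 : R * R) : R :=
  2^-1 * \int[@lebesgue_measure R]_(theta in
            [set theta | @angles R theta /\ 0 < dot (dir theta) (normal b x0)])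
           (g x0 (dir theta) * dot (dir theta) (normal b x0)).

Definition C1_test (phi : (R * R) * (R * R) -> R) : Prop :=
  forall v, (forall p, derivable phi p v) /\ continuous (fun p => 'D_v phi p).

(* [v] is the weak derivative w . grad_x u on phase space, and [g] is the trace
   of [u] on the boundary: both are characterized by Green's identity (test
   functions supported in the interior give the distributional derivative,
   the others give the trace). *)
Definition transport_derivative_trace (u v g : R * R -> R * R -> R) : Prop :=
  forall phi, C1_test phi ->
    phase_int Omega (fun x w =>
      v x w * phi (x, w) + u x w * 'D_w (fun y => phi (y, w)) x) =
    \int[@leb2 R]_(z in Gamma)
      (on_boundary (fun x w => g x w * phi (x, w)) z * flux z).

Definition transport_solution (eps : R) (f h u : R * R -> R * R -> R) : Prop :=
  phase_Linfty Omega u /\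
  exists v g : R * R -> R * R -> R,
    [/\ phase_Linfty Omega v /\ Gamma_Linfty g,
        transport_derivative_trace u v g,
        {ae @leb3 R, forall z : (R * R) * R, phase Omega z ->
          eps * in_angle v z + in_angle u z - velocity_average u z.1 =
          in_angle f z},
        {ae @leb2 R, forall z, Gamma_minus z ->
          on_boundary g z =
          outgoing_average g (curve b z.1) + on_boundary h z}
      & phase_int Omega u = 0].

Definition compatible (eps : R) f h : Prop :=
  phase_int Omega f -
  eps * \int[@leb2 R]_(z in Gamma_minus) (on_boundary h z * flux z) = 0.

End boundary.

(* Main.v *)
Require Import Defs.
From HB Require Import structures.
From mathcomp Require Import all_boot all_order all_algebra.
From mathcomp Require Import all_classical all_reals all_analysis.
From mathcomp Require Import measurable_realfun ess_sup_inf.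
From mathcomp Require Import ring lra.
Import Order.TTheory GRing.Theory Num.Theory.
Import numFieldNormedType.Exports.
Local Open Scope classical_set_scope.
Local Open Scope ring_scope.
Set Implicit Arguments.
Unset Strict Implicit.
Unset Printing Implicit Defensive.

(** Along characteristics the equation is the ODE eps U' + U = ubar + f, so a
    solution is determined by its velocity average inside Omega and its outgoing
    average on the boundary, together a function V that is a fixed point of an
    averaging operator K. Doeblin minorization on a square inside Omega and the
    invariant measure 2 pi dx + 2 eps dt of K give existence under the
    compatibility condition. The energy identity bounds u - ubar in L^2; since two
    points of a convex set are joined by a characteristic, it also controls the
    oscillation of V down to scale eps, where K turns averages of |V| into a
    supremum bound. Test functions exp(x.w/eps) k1(w1) k2(w2) k3(p) K(s) show that
    a weak solution of the homogeneous problem is a mild one, hence zero. *)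

(** The contraction rate of the averaging operator is exponentially small in 1/eps: it gives
    existence at fixed eps and nothing uniform, so the estimate must come from the energy, which
    only sees the square root of the product of the supremum and the L^1 norm of f. Passing from L^2
    to a supremum is the obstacle. Over a square of side r the double oscillation of V is at most
    r^4/eps times the energy norms, while the squared area inside a convex domain is of order r^4,
    so the mean oscillation has the same bound at every scale. Going from the whole domain to scale
    eps in 4m steps of ratio q, with q^(4m) of order eps, costs q^-2/eps per step; absorbing the
    supremum into the quadratic energy bound squares this cost, and eps^-2 q^-4 is of order
    eps^(-2-1/m), the factor of the L^1 norm of f, itself controlled by its L^(2m/(2m-1)) norm. The
    constants in the bound on V depend only on m, on a bound d for the coordinates in the domain and
    on the size eta of a square inside it. *)

Lemma indicT (T : Type) (R : pzRingType) (A : set T) x : A x -> \1_A x = 1 :> R.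
Proof. by move=> Ax; rewrite indicE mem_set. Qed.

Lemma indicN (T : Type) (R : pzRingType) (A : set T) x : ~ A x -> \1_A x = 0 :> R.
Proof. by move=> Ax; rewrite indicE memNset. Qed.


Lemma measurable_cos (R : realType) : measurable_fun setT (@cos R).
Proof. by apply: continuous_measurable_fun; exact: continuous_cos. Qed.

Lemma measurable_sin (R : realType) : measurable_fun setT (@sin R).
Proof. by apply: continuous_measurable_fun; exact: continuous_sin. Qed.

Ltac mfun := repeat first [ assumption | match goal with
 | |- measurable_fun _ (fun x => x) => exact: measurable_id
 | |- measurable_fun _ id => exact: measurable_id
 | |- measurable_fun _ (fun x => ?c) => exact: measurable_cst
 | |- measurable_fun _ (fun x => cos x) => exact: measurable_cos
 | |- measurable_fun _ (@cos _) => exact: measurable_cos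
 | |- measurable_fun _ (fun x => sin x) => exact: measurable_sin
 | |- measurable_fun _ (@sin _) => exact: measurable_sin
 | |- measurable_fun _ (fun x => expR x) => exact: measurable_expR
 | |- measurable_fun _ (fun x => fst x) => exact: measurable_fst
 | |- measurable_fun _ (fun x => snd x) => exact: measurable_snd
 | |- measurable_fun _ fst => exact: measurable_fst
 | |- measurable_fun _ snd => exact: measurable_snd
 | |- measurable_fun _ (pair ?c) => exact: pair1_measurable
 | |- measurable_fun _ (fun x => (@?f x, @?g x)) => apply: measurable_fun_pair
 | |- measurable_fun _ (fun x => @?f x + - (@?g x)) => apply: measurable_funB
 | |- measurable_fun _ (fun x => @?f x + @?g x) => apply: measurable_funD
 | |- measurable_fun _ (fun x => @?f x * @?g x) => apply: measurable_funM
 | |- measurable_fun _ (fun x => - @?f x) => apply: measurable_funN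
 | |- measurable_fun _ (fun x => expR (@?f x)) => apply: (measurableT_comp (@measurable_expR _))
 | |- measurable_fun _ (fun x => cos (@?f x)) => apply: (measurableT_comp (@measurable_cos _))
 | |- measurable_fun _ (fun x => sin (@?f x)) => apply: (measurableT_comp (@measurable_sin _))
 | |- measurable_fun _ (fun x => fst (@?f x)) => apply: (measurableT_comp measurable_fst)
 | |- measurable_fun _ (fun x => snd (@?f x)) => apply: (measurableT_comp measurable_snd)
 | mF : measurable_fun setT ?F |- measurable_fun _ (fun x => ?F (@?g x)) => apply: (measurableT_comp mF)
 end ].
Lemma eq_ler (R : numDomainType) (x y : R) : x = y -> x <= y.
Proof. by move=> ->. Qed.

Lemma norm_unit_coordinate (R : realDomainType) (u v : R) : u * u + v * v = 1 -> `|u| <= 1.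
Proof.
move=> h; rewrite -(@ler_pXn2r _ 2)// ?nnegrE// expr1n real_normK ?num_real//.
by rewrite -h expr2 lerDl -expr2 sqr_ge0.
Qed.

Lemma norm_indic_le1 (T : Type) (R : numDomainType) (A : set T) x : `|\1_A x : R| <= 1.
Proof. by rewrite indicE; case: (_ \in _); rewrite ?normr0 ?normr1. Qed.

(** * Bounded measurable functions *)

Section bounded_measurable.
Context d (T : measurableType d) (R : realType).
Implicit Types (D E : set T) (f g : T -> R).

(** Measurability is asked on the whole space and boundedness only on [D]. Restriction and
    composition are then immediate, and on a set of finite measure every such function is
    integrable, which settles the side conditions of all real integrals below. *)
Definition bmo D f := measurable_fun setT f /\ exists M, forall x, D x -> `|f x| <= M.

Lemma bmo_bd D f M : measurable_fun setT f -> (forall x, D x -> `|f x| <= M) ->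
  bmo D f.
Proof. by move=> mf fM; split => //; exists M. Qed.

Lemma bmoS D E f : E `<=` D -> bmo D f -> bmo E f.
Proof. by move=> ED [mf [M fM]]; split => //; exists M => x /ED /fM. Qed.

Lemma bmo_cst D (c : R) : bmo D (fun=> c).
Proof. by apply: (bmo_bd (M := `|c|)). Qed.

Lemma bmoD D f g : bmo D f -> bmo D g -> bmo D (fun x => f x + g x).
Proof.
move=> [mf [M fM]] [mg [N gN]]; apply: (bmo_bd (M := M + N)).
  exact: measurable_funD.
by move=> x Dx; rewrite (le_trans (ler_normD _ _))// lerD ?fM ?gN.
Qed.

Lemma bmoM D f g : bmo D f -> bmo D g -> bmo D (fun x => f x * g x).
Proof.
move=> [mf [M fM]] [mg [N gN]]; apply: (bmo_bd (M := M * N)).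
  exact: measurable_funM.
by move=> x Dx; rewrite normrM ler_pM ?fM ?gN.
Qed.

Lemma bmoN D f : bmo D f -> bmo D (fun x => - f x).
Proof.
move=> [mf [M fM]]; apply: (bmo_bd (M := M)); first exact: measurable_funN.
by move=> x Dx; rewrite normrN fM.
Qed.

Lemma bmoB D f g : bmo D f -> bmo D g -> bmo D (fun x => f x - g x).
Proof. by move=> bf bg; apply: bmoD => //; exact: bmoN. Qed.

Lemma bmoZ D c f : bmo D f -> bmo D (fun x => c * f x).
Proof. by move=> bf; apply: bmoM => //; exact: bmo_cst. Qed.

Lemma bmoX D f n : bmo D f -> bmo D (fun x => f x ^+ n).
Proof.
move=> bf; elim: n => [|n IH].
  rewrite (_ : (fun x => f x ^+ 0) = fun=> 1); first exact: bmo_cst.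
  by apply/funext => x; rewrite expr0.
rewrite (_ : (fun x => f x ^+ n.+1) = fun x => f x * f x ^+ n); first exact: bmoM.
by apply/funext => x; rewrite exprS.
Qed.

Lemma bmo_norm D f : bmo D f -> bmo D (fun x => `|f x|).
Proof.
move=> [mf [M fM]]; apply: (bmo_bd (M := M)); first exact: measurableT_comp.
by move=> x Dx; rewrite normr_id fM.
Qed.

Lemma bmo_indic D (A : set T) : measurable A -> bmo D (fun x => \1_A x).
Proof.
move=> mA; apply: (bmo_bd (M := 1)); first exact: measurable_indic.
by move=> x _; exact: norm_indic_le1.
Qed.

End bounded_measurable.

Lemma bmo_comp d d' (T : measurableType d) (T' : measurableType d') (R : realType)
    (D : set T) (E : set T') (f : T -> R) (g : T' -> T) :
  bmo D f -> measurable_fun setT g -> (forall x, E x -> D (g x)) ->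
  bmo E (fun x => f (g x)).
Proof.
move=> [mf [M fM]] mg ED; apply: (bmo_bd (M := M)); first exact: measurableT_comp.
by move=> x /ED /fM.
Qed.

(** * Real-valued integrals over sets of finite measure *)

Section Rint.
Context d (T : measurableType d) (R : realType) (mu : {measure set T -> \bar R}).
Context (D : set T) (mD : measurable D) (fD : (mu D < +oo)%E).
Implicit Types (f g : T -> R).

Lemma bmo_integrable f : bmo D f -> mu.-integrable D (EFin \o f).
Proof.
move=> [mf [M fM]]; apply: measurable_bounded_integrable => //.
  exact: measurable_funTS.
exists M; split; first exact: num_real.
by move=> N MN x Dx; apply: le_trans (fM _ Dx) (ltW MN).
Qed.

Lemma Rint_fin f : bmo D f ->
  ((\int[mu]_(x in D) f x)%:E = \int[mu]_(x in D) (f x)%:E)%E.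
Proof.
by move=> bf; rewrite /Rintegral fineK//; apply: integrable_fin_num => //; exact: bmo_integrable.
Qed.

Lemma RintD f g : bmo D f -> bmo D g ->
  \int[mu]_(x in D) (f x + g x) = \int[mu]_(x in D) f x + \int[mu]_(x in D) g x.
Proof. by move=> bf bg; rewrite RintegralD//; exact: bmo_integrable. Qed.

Lemma RintB f g : bmo D f -> bmo D g ->
  \int[mu]_(x in D) (f x - g x) = \int[mu]_(x in D) f x - \int[mu]_(x in D) g x.
Proof. by move=> bf bg; rewrite RintegralB//; exact: bmo_integrable. Qed.

Lemma RintZ c f : bmo D f ->
  \int[mu]_(x in D) (c * f x) = c * \int[mu]_(x in D) f x.
Proof. by move=> bf; rewrite RintegralZl//; exact: bmo_integrable. Qed.

Lemma RintN f : bmo D f ->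
  \int[mu]_(x in D) (- f x) = - \int[mu]_(x in D) f x.
Proof.
move=> bf; rewrite -mulN1r -RintZ//; apply: eq_Rintegral => x _; by rewrite mulN1r.
Qed.

Lemma Rint_le f g : bmo D f -> bmo D g -> (forall x, D x -> f x <= g x) ->
  \int[mu]_(x in D) f x <= \int[mu]_(x in D) g x.
Proof. by move=> bf bg fg; apply: le_Rintegral => //; exact: bmo_integrable. Qed.

Lemma Rint_abs f : bmo D f ->
  `|\int[mu]_(x in D) f x| <= \int[mu]_(x in D) `|f x|.
Proof. by move=> bf; apply: le_normr_Rintegral => //; exact: bmo_integrable. Qed.

Lemma Rint_bound f M : bmo D f -> (forall x, D x -> `|f x| <= M) ->
  `|\int[mu]_(x in D) f x| <= M * fine (mu D).
Proof.
move=> bf fM; apply: (le_trans (Rint_abs bf)); rewrite -Rintegral_cst//.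
by apply: Rint_le => //; [exact: bmo_norm|exact: bmo_cst].
Qed.

Lemma Rint_le_cst f M : bmo D f -> (forall x, D x -> f x <= M) ->
  \int[mu]_(x in D) f x <= M * fine (mu D).
Proof.
move=> bf fM; rewrite -Rintegral_cst//.
by apply: Rint_le => //; exact: bmo_cst.
Qed.

(** The square of [|f| - c] has a nonnegative integral for every [c], and the optimal [c] is the
    mean [I / m]. When [m = 0] this mean makes no sense, but then [I] vanishes. *)
Lemma Rint_cauchy_schwarz f : bmo D f ->
  (\int[mu]_(x in D) `|f x|) ^+ 2 <= fine (mu D) * \int[mu]_(x in D) f x ^+ 2.
Proof.
move=> bf; have bf' := bmo_norm bf; have bf2 := bmoX 2 bf.
set m := fine (mu D); set I := \int[mu]_(x in D) `|f x|; set J := Rintegral _ _ _.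
have m0 : 0 <= m by rewrite fine_ge0.
have key : forall c, 0 <= J - 2 * c * I + c ^+ 2 * m.
  move=> c; rewrite -Rintegral_cst// -RintZ// -RintB//; last exact: bmoZ.
  rewrite -RintD//; last 2 first.
  - by apply: bmoB => //; exact: bmoZ.
  - exact: bmo_cst.
  apply: Rintegral_ge0 => x _.
  rewrite -[f x ^+ 2]real_normK ?num_real//.
  by rewrite (_ : _ - _ + _ = (`|f x| - c) ^+ 2) ?sqr_ge0//; ring.
have [m00|mp] := eqVneq m 0.
  have I0 : I <= 0.
    have := Rint_bound (f := fun x => `|f x|) bf'; case: (bf) => _ [M fM].
    move=> /(_ M); rewrite -/I -/m m00 mulr0 => H.
    apply: le_trans (ler_norm _) (H _) => x Dx; rewrite normr_id; exact: fM.
  have : 0 <= I by apply: Rintegral_ge0.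
  by move=> ?; rewrite m00 mul0r (_ : I = 0) ?expr0n//; apply/eqP; rewrite eq_le I0.
have {}mp : 0 < m by rewrite lt_def mp.
have := key (I / m); rewrite -(ler_pM2l mp) mulr0.
have -> : m * (J - 2 * (I / m) * I + (I / m) ^+ 2 * m) = m * J - I ^+ 2.
  by field; rewrite gt_eqF.
by rewrite subr_ge0.
Qed.

End Rint.

Lemma Rint_restrict d (T : measurableType d) (R : realType)
    (mu : {measure set T -> \bar R}) (D : set T) (f : T -> R) :
  \int[mu]_(x in D) f x = \int[mu]_x (\1_D x * f x).
Proof.
rewrite Rintegral_mkcond; apply: eq_Rintegral => x _.
by rewrite patchE indicE; case: ifPn => _; rewrite ?mul1r ?mul0r.
Qed.

Lemma Rint_restrictI d (T : measurableType d) (R : realType)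
    (mu : {measure set T -> \bar R}) (D E : set T) (f : T -> R) :
  \int[mu]_(x in D `&` E) f x = \int[mu]_(x in D) (\1_E x * f x).
Proof.
rewrite Rintegral_mkcondr; apply: eq_Rintegral => x _.
by rewrite patchE indicE; case: ifPn => _; rewrite ?mul1r ?mul0r.
Qed.

(** * Integrals with a parameter, and Fubini for bounded functions *)

Section Rint_param.
Context d1 d2 (T1 : measurableType d1) (T2 : measurableType d2) (R : realType).
Context (m1 : {sigma_finite_measure set T1 -> \bar R})
        (m2 : {sigma_finite_measure set T2 -> \bar R}).
Context (D1 : set T1) (D2 : set T2).
Context (mD1 : measurable D1) (mD2 : measurable D2).
Context (fD1 : (m1 D1 < +oo)%E) (fD2 : (m2 D2 < +oo)%E).

(** No integrability of the sections is assumed: Tonelli makes the integrals of the positive and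
    negative parts measurable, and [fine] is measurable, so the default values taken at infinite
    integrals do no harm. *)
Lemma Rint_param_meas (f : T1 -> T2 -> R) :
  measurable_fun setT (fun z : T1 * T2 => f z.1 z.2) ->
  measurable_fun setT (fun x => \int[m2]_(y in D2) f x y).
Proof.
move=> mf; rewrite /Rintegral.
apply: measurableT_comp; first exact: fine_measurable.
rewrite (_ : (fun x => _) = (fun x => \int[m2]_y ((\1_D2 y * f x y)%R)%:E)%E); last first.
  apply/funext => x; rewrite integral_mkcond; apply: eq_integral => y _.
  by rewrite patchE indicE; case: ifPn => _; rewrite ?mul1r ?mul0r.
pose g (z : T1 * T2) : \bar R := (\1_D2 z.2 * f z.1 z.2)%:E.
have mg : measurable_fun setT g.
  apply/measurable_EFinP; apply: measurable_funM => //.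
  by apply: measurableT_comp => //; exact: measurable_indic.
rewrite (_ : (fun x => _) = (fun x => fubini_F m2 g^\+ x - fubini_F m2 g^\- x)%E).
  apply: emeasurable_funB; apply: measurable_fun_fubini_tonelli_F => //.
    exact: measurable_funepos.
  exact: measurable_funeneg.
apply/funext => x; rewrite integralE /fubini_F.
by congr (_ - _)%E; apply: eq_integral => y _; rewrite ?funeposE ?funenegE /g.
Qed.

Lemma bmo_Rint (f : T1 -> T2 -> R) :
  bmo (D1 `*` D2) (fun z => f z.1 z.2) ->
  bmo D1 (fun x => \int[m2]_(y in D2) f x y).
Proof.
move=> [mf [M fM]]; apply: (bmo_bd (M := M * fine (m2 D2))).
  exact: Rint_param_meas.
move=> x D1x; apply: Rint_bound => //.
  apply: (bmo_bd (M := M)).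
    exact: (measurableT_comp mf (pair1_measurable x)).
  by move=> y D2y; apply: (fM (x, y)).
by move=> y D2y; apply: (fM (x, y)).
Qed.

Let g_int (f : T1 -> T2 -> R) :
  bmo (D1 `*` D2) (fun z => f z.1 z.2) ->
  (m1 \x m2)%E.-integrable setT (fun z => (\1_(D1 `*` D2) z * f z.1 z.2)%:E).
Proof.
move=> bf.
have mD : measurable (D1 `*` D2) by exact: measurableX.
have : (m1 \x m2)%E.-integrable (D1 `*` D2) (EFin \o (fun z => f z.1 z.2)).
  apply: bmo_integrable => //.
  by rewrite [ltLHS]product_measure1E// lte_mul_pinfty// ge0_fin_numE.
move=> /(integrable_mkcond _ mD); apply: eq_integrable => // z _.
by rewrite patchE indicE/=; case: ifPn => _; rewrite ?mul1r ?mul0r.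
Qed.

Lemma Rint_prod (f : T1 -> T2 -> R) :
  bmo (D1 `*` D2) (fun z => f z.1 z.2) ->
  \int[(m1 \x m2)%E]_(z in D1 `*` D2) f z.1 z.2 =
  \int[m1]_(x in D1) \int[m2]_(y in D2) f x y.
Proof.
move=> bf; have E := integral12_prod_meas1 (g_int bf).
rewrite [LHS]Rint_restrict {1}/Rintegral -E {1}/Rintegral; congr fine.
rewrite [RHS]integral_mkcond; apply: eq_integral => x _.
rewrite /fubini_F patchE; case: ifPn => xD1; last first.
  rewrite integral0_eq// => y _; rewrite indicE.
  by rewrite (_ : _ \in _ = false) ?mul0r//; apply/negP; rewrite inE => -[/= /mem_set]; rewrite (negPf xD1).
rewrite Rint_fin//; last first.
  case: (bf) => mf [M fM]; apply: (bmo_bd (M := M)).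
    exact: (measurableT_comp mf (pair1_measurable x)).
  by move=> y D2y; apply: (fM (x, y)); split => //; exact: set_mem.
rewrite [RHS]integral_mkcond; apply: eq_integral => y _.
rewrite patchE indicE; case: ifPn => yD2.
  by rewrite mem_set ?mul1r//; split => /=; exact: set_mem.
by rewrite memNset ?mul0r// => -[_ /= /mem_set]; rewrite (negPf yD2).
Qed.

Lemma Rint_swap (f : T1 -> T2 -> R) :
  bmo (D1 `*` D2) (fun z => f z.1 z.2) ->
  \int[m1]_(x in D1) \int[m2]_(y in D2) f x y =
  \int[m2]_(y in D2) \int[m1]_(x in D1) f x y.
Proof.
move=> bf; rewrite -Rint_prod//; have E := integral21_prod_meas1 (g_int bf).
rewrite [LHS]Rint_restrict {1}/Rintegral -E {1}/Rintegral; congr fine.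
rewrite [RHS]integral_mkcond; apply: eq_integral => y _.
rewrite /fubini_G patchE; case: ifPn => yD2; last first.
  rewrite integral0_eq// => x _; rewrite indicE.
  by rewrite memNset ?mul0r// => -[_ /= /mem_set]; rewrite (negPf yD2).
rewrite Rint_fin//; last first.
  case: (bf) => mf [M fM]; apply: (bmo_bd (M := M)).
    exact: (measurableT_comp mf (pair2_measurable y)).
  by move=> x D1x; apply: (fM (x, y)); split => //; exact: set_mem.
rewrite [RHS]integral_mkcond; apply: eq_integral => x _.
rewrite patchE indicE; case: ifPn => xD1.
  by rewrite mem_set ?mul1r//; split => /=; exact: set_mem.
by rewrite memNset ?mul0r// => -[/= /mem_set]; rewrite (negPf xD1).
Qed.

End Rint_param.

(** Changes of variables are proved for nonnegative functions and carried to signed ones here: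
    nonnegative weights come out of positive and negative parts. Integrability is not asked, since
    [Rintegral] is [fine] of the extended integral on both sides. *)
Lemma Rint_transfer d1 d2 (T1 : measurableType d1) (T2 : measurableType d2)
    (R : realType) (m1 : {measure set T1 -> \bar R}) (m2 : {measure set T2 -> \bar R})
    (psi : T2 -> T1) (k1 : T1 -> R) (k2 : T2 -> R) :
  (forall x, 0 <= k1 x) -> (forall y, 0 <= k2 y) ->
  (forall F : T1 -> \bar R, measurable_fun setT F -> (forall x, 0 <= F x)%E ->
     (\int[m1]_x (F x * (k1 x)%:E) = \int[m2]_y (F (psi y) * (k2 y)%:E))%E) ->
  forall f : T1 -> R, measurable_fun setT f ->
    \int[m1]_x (f x * k1 x) = \int[m2]_y (f (psi y) * k2 y).
Proof.
move=> k10 k20 H f mf; rewrite /Rintegral; congr fine.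
rewrite [LHS]integralE [RHS]integralE; congr (_ - _)%E.
- transitivity (\int[m1]_x (((EFin \o f)^\+ x) * (k1 x)%:E))%E.
    apply: eq_integral => x _; rewrite !funeposE/=.
    by rewrite -!EFin_max -EFinM maxr_pMl// mul0r.
  rewrite H//; last exact/measurable_funepos/measurable_EFinP.
  apply: eq_integral => y _; rewrite !funeposE/=.
  by rewrite -!EFin_max -EFinM maxr_pMl// mul0r.
- transitivity (\int[m1]_x (((EFin \o f)^\- x) * (k1 x)%:E))%E.
    apply: eq_integral => x _; rewrite !funenegE/=.
    by rewrite -!EFin_max -EFinM maxr_pMl// mul0r mulNr.
  rewrite H//; last exact/measurable_funeneg/measurable_EFinP.
  apply: eq_integral => y _; rewrite !funenegE/=.
  by rewrite -!EFin_max -EFinM maxr_pMl// mul0r mulNr.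
Qed.

(** * Changes of variables as equalities of weighted image measures *)

Section weighted_pushforward.
Context d1 d2 (T1 : measurableType d1) (T2 : measurableType d2) (R : realType).
Context (m : {measure set T2 -> \bar R}) (psi : T2 -> T1) (k : T2 -> R).
Context (mpsi : measurable_fun setT psi) (mk : measurable_fun setT k).
Context (k0 : forall y, 0 <= k y).

(** The image by [psi] of the measure of density [k]. The three proofs are arguments so that a
    measure structure can be attached to the applied term. *)
Definition wpush of measurable_fun setT psi & measurable_fun setT k &
  (forall y, 0 <= k y) := fun A : set T1 => (\int[m]_y ((\1_A (psi y) * k y)%R)%:E)%E.
Local Notation wp := (wpush mpsi mk k0).

Let ind_ge0 (A : set T1) y : (0 <= ((\1_A (psi y) * k y)%R)%:E :> \bar R)%E.
Proof. by rewrite lee_fin mulr_ge0// indicE. Qed.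

Let m_ind (A : set T1) : measurable A ->
  measurable_fun setT (fun y => ((\1_A (psi y) * k y)%R)%:E : \bar R).
Proof.
move=> mA; apply/measurable_EFinP; apply: measurable_funM => //.
exact: (measurableT_comp (measurable_indic mA)).
Qed.

Let wpush0 : wp set0 = 0%E.
Proof. by rewrite /wpush integral0_eq// => y _; rewrite indic0 mul0r. Qed.

Let wpush_ge0 A : (0 <= wp A)%E.
Proof. exact: integral_ge0. Qed.

Let wpush_sigma_additive : semi_sigma_additive wp.
Proof.
move=> F mF tF mUF.
rewrite [X in _ --> X](_ : _ = \sum_(n <oo) wp (F n))%E.
  by apply: is_cvg_nneseries => n _ _; exact: wpush_ge0.
rewrite /wpush -integral_nneseries//; last first.
  by move=> n; exact: m_ind.
apply: eq_integral => y _.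
transitivity (\sum_(n <oo) ((k y)%:E * (\1_(F n) (psi y))%:E))%E; last first.
  by apply: eq_eseriesr => n _; rewrite mulrC EFinM.
rewrite nneseriesZl; last by move=> n _; rewrite lee_fin indicE.
rewrite mulrC EFinM; congr (_ * _)%E.
(* Pointwise, summing the indicators of the disjoint sets [F n] is sigma-additivity of the Dirac
   mass at [psi y]. *)
have := measure_sigma_additive (mu := dirac (psi y)) mF tF.
move=> /(_ R)/cvg_lim H; rewrite -[LHS]H //.
Qed.

HB.instance Definition _ := isMeasure.Build _ _ _ wp
  wpush0 wpush_ge0 wpush_sigma_additive.

End weighted_pushforward.

Section ge0_integral_wpush.
Import HBNNSimple.

(** Both sides are monotone limits along the same sequence of simple functions, so the equality need
    only be known on indicators. *)
Lemma ge0_integral_wpush d1 d2 (T1 : measurableType d1) (T2 : measurableType d2)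
    (R : realType) (m1 : {measure set T1 -> \bar R}) (m2 : {measure set T2 -> \bar R})
    (psi : T2 -> T1) (k1 : T1 -> R) (k2 : T2 -> R) :
  measurable_fun setT psi -> measurable_fun setT k1 -> measurable_fun setT k2 ->
  (forall x, 0 <= k1 x) -> (forall y, 0 <= k2 y) ->
  (forall A, measurable A -> \int[m1]_x ((\1_A x * k1 x)%R)%:E =
     \int[m2]_y ((\1_A (psi y) * k2 y)%R)%:E)%E ->
  forall F : T1 -> \bar R, measurable_fun setT F -> (forall x, 0 <= F x)%E ->
     (\int[m1]_x (F x * (k1 x)%:E) = \int[m2]_y (F (psi y) * (k2 y)%:E))%E.
Proof.
move=> mpsi mk1 mk2 k10 k20 H F mF F0.
pose g := nnsfun_approx measurableT mF.
have gF x : EFin (g n x) @[n --> \oo] --> F x.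
  exact: (cvg_nnsfun_approx measurableT mF (fun x _ => F0 x)).
have gnd x : {homo (fun n => g n x) : a b / (a <= b)%N >-> a <= b}.
  by move=> a b ab; exact/lefP/(nd_nnsfun_approx measurableT mF).
have lim1 (k : R) x : 0 <= k -> (F x * k%:E = limn (fun n => (g n x * k)%:E))%E.
  move=> kge0; apply/esym/cvg_lim => //.
  rewrite (_ : (fun n => _) = (fun n => (g n x)%:E * k%:E)%E)//.
  by apply: cvgeMr => //; exact: gF.
transitivity (\int[m1]_x limn (fun n => (g n x * k1 x)%:E))%E.
  by apply: eq_integral => x _; exact: lim1.
transitivity (\int[m2]_y limn (fun n => (g n (psi y) * k2 y)%:E))%E; last first.
  by apply: eq_integral => y _; rewrite -lim1.
rewrite monotone_convergence//; last 3 first.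
- by move=> n; apply/measurable_EFinP; exact: measurable_funM.
- by move=> n x _; rewrite lee_fin mulr_ge0.
- by move=> x _ a b ab; rewrite lee_fin ler_wpM2r// gnd.
rewrite monotone_convergence//; last 3 first.
- move=> n; apply/measurable_EFinP; apply: measurable_funM => //.
  exact: (measurableT_comp (measurable_funPT (g n))).
- by move=> n x _; rewrite lee_fin mulr_ge0.
- by move=> x _ a b ab; rewrite lee_fin ler_wpM2r// gnd.
congr (limn _); apply/funext => n.
have gE x (k : R) : (g n x * k)%:E =
    (\sum_(r \in range (g n)) (r * (\1_(g n @^-1` [set r]) x * k))%:E)%E.
  rewrite fsumEFin//; congr EFin; rewrite [in LHS]fimfunE mulr_fsuml.
  by apply: eq_fsbigr => r _; rewrite mulrA.
(* A negative [r] is not a value of the nonnegative function [g n]: its level set is empty and the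
   term is 0. *)
have r_ge0 r x (k : R) : 0 <= k ->
    (0 <= (r * (\1_(g n @^-1` [set r]) x * k))%:E :> \bar R)%E.
  move=> kge0; rewrite lee_fin; have [r0|r0] := leP 0 r.
    by rewrite mulr_ge0// mulr_ge0// indicE.
  by rewrite preimage_nnfun0// indic0 mul0r mulr0.
have mpre r : measurable (g n @^-1` [set r]) by [].
transitivity (\sum_(r \in range (g n))
    \int[m1]_x ((r * (\1_(g n @^-1` [set r]) x * k1 x))%R)%:E)%E.
  rewrite -ge0_integral_fsum//.
  - by apply: eq_integral => x _; rewrite gE.
  - move=> r; apply/measurable_EFinP; apply: measurable_funM => //.
    by apply: measurable_funM => //; exact: measurable_indic.
  - by move=> r x _; exact: r_ge0.
transitivity (\sum_(r \in range (g n))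
    \int[m2]_y ((r * (\1_(g n @^-1` [set r]) (psi y) * k2 y))%R)%:E)%E; last first.
  rewrite -ge0_integral_fsum//.
  - by apply: eq_integral => x _; rewrite gE.
  - move=> r; apply/measurable_EFinP; apply: measurable_funM => //.
    by apply: measurable_funM => //; exact: (measurableT_comp (measurable_indic (mpre r))).
  - by move=> r x _; exact: r_ge0.
apply: eq_fsbigr => r; rewrite inE => -[x0 _ <-].
under eq_integral do rewrite EFinM.
under [RHS]eq_integral do rewrite EFinM.
rewrite ge0_integralZl//; last 3 first.
- apply/measurable_EFinP; apply: measurable_funM => //; exact: measurable_indic.
- by move=> x _; rewrite lee_fin mulr_ge0// indicE.
- by rewrite lee_fin.
rewrite ge0_integralZl//; last 3 first.
- apply/measurable_EFinP; apply: measurable_funM => //.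
  exact: (measurableT_comp (measurable_indic (mpre _))).
- by move=> x _; rewrite lee_fin mulr_ge0// indicE.
- by rewrite lee_fin.
by congr (_ * _)%E; exact: H.
Qed.

End ge0_integral_wpush.

(** * Change of variables on a segment *)

Section one_dimensional_change_of_variables.
Context (R : realType).
Notation mu := (@lebesgue_measure R).
Implicit Types (a b c x t : R).

(** Open left half-lines are stable under intersection and generate the Borel sets, and those ending
    at integers exhaust the line with finite mass. *)
Lemma measure_unique_rays (m1 m2 : {measure set (measurableTypeR R) -> \bar R}) :
  (forall x, m1 `]-oo, x[%classic = m2 `]-oo, x[%classic) ->
  (forall x, m1 `]-oo, x[%classic < +oo)%E ->
  forall A, measurable A -> m1 A = m2 A.
Proof.
move=> m12 m1oo A mA.
refine (@measure_unique _ R (measurableTypeR R) (@RGenInftyO.G R) (fun n => `]-oo, n%:R[%classic) _ _ _ _ m1 m2 _ _ A mA) => //.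
- exact: RGenInftyO.measurableE.
- move=> _ _ [x ->] [y ->]; exists (Num.min x y).
  apply/seteqP; split => z /=; rewrite !in_itv/= lt_min.
    by move=> [-> ->].
  by move=> /andP[-> ->].
- by move=> n; exists n%:R.
- apply/seteqP; split => // x _.
  exists (Num.bound `|x|) => //=; rewrite in_itv/=.
  by apply: le_lt_trans (ler_norm _) _; exact: archi_boundP.
- by move=> _ [x ->].
Qed.

Lemma derive_within_continuous (p p' : R -> R) a b :
  (forall t, a <= t <= b -> is_derive t 1 p (p' t)) -> {within `[a, b], continuous p}.
Proof.
move=> dp; apply: continuous_in_subspaceT => t; rewrite inE/= in_itv/= => tab.
have [+ _] := dp _ tab; move/derivable1_diffP; exact: differentiable_continuous.
Qed.

Lemma FTC_segment (p p' : R -> R) a b : a <= b ->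
  (forall t, a <= t <= b -> is_derive t 1 p (p' t)) ->
  (forall t, a <= t <= b -> {for t, continuous p'}) ->
  (\int[mu]_(t in `[a, b]) (p' t)%:E = (p b - p a)%:E)%E.
Proof.
rewrite le_eqVlt => /predU1P[<- _ _|ab dp cp].
  by rewrite set_itv1 integral_set1 subrr.
rewrite (@continuous_FTC2 _ p' p)//.
- by apply: continuous_in_subspaceT => t; rewrite inE/= in_itv/=; exact: cp.
- have cont t : a <= t <= b -> {for t, continuous p}.
    by move=> /dp[+ _]; move/derivable1_diffP; exact: differentiable_continuous.
  split.
  + by move=> t; rewrite in_itv/= => /andP[at_ tb]; have [] := dp t; rewrite ?ltW.
  + by apply: cvg_at_right_filter; apply: cont; rewrite lexx ltW.
  + by apply: cvg_at_left_filter; apply: cont; rewrite lexx ltW.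
- move=> t; rewrite in_itv/= => /andP[at_ tb].
  by rewrite derive1E; have [|_ ->] := dp t; rewrite ?ltW.
Qed.

Lemma derive_pos_incr (p p' : R -> R) a b :
  (forall t, a <= t <= b -> is_derive t 1 p (p' t)) ->
  (forall t, a <= t <= b -> 0 < p' t) ->
  forall x y, a <= x -> x < y -> y <= b -> p x < p y.
Proof.
move=> dp p0 x y ax xy yb.
have [||c] := @MVT R p p' x y xy.
- move=> t; rewrite in_itv/= => /andP[xt ty]; apply: dp.
  by rewrite (le_trans ax (ltW xt)) (le_trans (ltW ty) yb).
- apply: derive_within_continuous => t /andP[xt ty]; apply: dp.
  by rewrite (le_trans ax xt) (le_trans ty yb).
rewrite in_itv/= => /andP[xc cy] E.
rewrite -subr_gt0 E mulr_gt0 ?subr_gt0// p0//.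
by rewrite (le_trans ax (ltW xc)) (le_trans (ltW cy) yb).
Qed.

(** Both sides are finite measures of [A], so half-lines suffice. There monotonicity turns the
    preimage into a segment, whose end is found by the intermediate value theorem, and the
    fundamental theorem of calculus evaluates the integral. *)
Lemma cov_segment_incr (p p' : R -> R) a b : a <= b ->
  measurable_fun setT p -> measurable_fun setT p' ->
  (forall t, a <= t <= b -> is_derive t 1 p (p' t)) ->
  (forall t, a <= t <= b -> {for t, continuous p'}) ->
  (forall t, a <= t <= b -> 0 < p' t) ->
  forall A, measurable A ->
  (\int[mu]_(t in `[a, b]) ((\1_A (p t) * `|p' t|)%R)%:E = mu (A `&` `[p a, p b]))%E.
Proof.
move=> ab mp mp' dp cp p0 A mA.
have incr := derive_pos_incr dp p0.
have incrW x y : a <= x -> x <= y -> y <= b -> p x <= p y.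
  by rewrite (le_eqVlt x) => ax /predU1P[-> //|xy yb]; rewrite ltW// incr.
pose k t := \1_`[a, b] t * `|p' t|.
have mk : measurable_fun setT k.
  by apply: measurable_funM; [exact: measurable_indic|exact: measurableT_comp].
have k0 t : 0 <= k t by rewrite mulr_ge0// indicE.
have toset (B : set R) : (\int[mu]_t ((\1_B (p t) * k t)%R)%:E =
    \int[mu]_(t in `[a, b]) ((\1_B (p t) * `|p' t|)%R)%:E)%E.
  rewrite [RHS]integral_mkcond; apply: eq_integral => t _.
  rewrite patchE /k indicE mulrCA indicE; case: ifPn => _; rewrite ?mul1r ?mul0r//.
pose m1 := wpush mu mp mk k0; pose m2 := mrestr mu (measurable_itv `[p a, p b]).
rewrite -toset -[LHS]/(m1 A) -[RHS]/(m2 A).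
have sub c : a <= c <= b -> (\int[mu]_(t in `[a, c]) `|p' t|%:E = (p c - p a)%:E)%E.
  move=> /andP[ac cb].
  have dp' t : a <= t <= c -> is_derive t 1 p (p' t).
    by move=> /andP[at_ tc]; apply: dp; rewrite at_ (le_trans tc).
  rewrite -(FTC_segment ac dp'); last first.
    by move=> t /andP[at_ tc]; apply: cp; rewrite at_ (le_trans tc).
  apply: eq_integral => t; rewrite inE/= in_itv/= => /andP[at_ tc].
  by rewrite gtr0_norm// p0// at_ (le_trans tc).
have ray x : m1 `]-oo, x[%classic = m2 `]-oo, x[%classic.
  rewrite /m1 /wpush toset /m2 /mrestr.
  have [xa|ax] := leP x (p a).
    rewrite integral0_eq.
      rewrite (_ : _ `&` _ = set0) ?measure0//; apply/seteqP; split => // z /=.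
      rewrite !in_itv/= => -[zx /andP[az _]]; move: zx.
      by rewrite ltNge (le_trans xa az).
    move=> t /=; rewrite in_itv/= => /andP[at_ tb]; rewrite indicE memNset ?mul0r//=.
    by rewrite in_itv/=; apply/negP; rewrite -leNgt (le_trans xa)// incrW.
  have [bx|xb] := ltP (p b) x.
    rewrite (_ : _ `&` _ = `[p a, p b]%classic); last first.
      apply/seteqP; split => z /=; rewrite !in_itv/=; first by case.
      by move=> /andP[-> zb]; rewrite zb (le_lt_trans zb bx).
    rewrite lebesgue_measure_itv/= lte_fin.
    rewrite (_ : (if _ then _ else _) = (p b - p a)%:E); last first.
      move: ab; rewrite le_eqVlt => /predU1P[->|ab]; first by rewrite ltxx subrr.
      by rewrite incr.
    rewrite -sub ?lexx ?ab//; apply: eq_integral => t; rewrite inE/= in_itv/= => /andP[at_ tb].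
    rewrite indicE mem_set ?mul1r//= in_itv/=; apply: le_lt_trans bx; exact: incrW.
  have [|c] := IVT ab (derive_within_continuous dp) (v := x).
    by rewrite minEle maxEle incrW//= (ltW ax) xb.
  rewrite in_itv/= => /andP[ac cb] pcx.
  rewrite (_ : _ `&` _ = `[p a, x[%classic); last first.
    apply/seteqP; split => z /=; rewrite !in_itv/=; first by move=> [-> /andP[->]].
    by move=> /andP[-> zx]; rewrite zx (le_trans (ltW zx) xb).
  rewrite lebesgue_measure_itv/= lte_fin ax EFinN -EFinD -pcx -sub ?ac//.
  rewrite -[RHS]integral_itv_bndo_bndc; last first.
    apply/measurable_EFinP; apply: measurable_funTS; exact: measurableT_comp.
  rewrite integral_mkcond [RHS]integral_mkcond; apply: eq_integral => t _.
  rewrite !patchE !mem_setE !in_itv/= indicE.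
  have [/andP[at_ tb]|] := boolP (a <= t <= b); last first.
    case: ifPn => // /andP[-> tc]; by rewrite (le_trans (ltW tc)).
  rewrite at_/=; have [tc|ct] := ltP t c.
    by rewrite mem_set ?mul1r//= in_itv/= incr.
  by rewrite memNset ?mul0r//= in_itv/=; apply/negP; rewrite -leNgt incrW.
refine (@measure_unique_rays
  (@wpush _ _ (measurableTypeR R) (measurableTypeR R) R mu p k mp mk k0) (mrestr mu (measurable_itv `[p a, p b])) ray _ A mA).
move=> x; rewrite [ltLHS](ray x) /m2 /mrestr.
apply: (@le_lt_trans _ _ (mu `[p a, p b])).
  apply: le_measure; rewrite ?inE; [exact: measurableI|exact: measurable_itv|exact: subIsetr].
by rewrite lebesgue_measure_itv/=; case: ifP => _; rewrite ?ltry// -EFinB ltry.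
Qed.

(** The decreasing case is the increasing one for [- p], by invariance of Lebesgue measure under
    reflection. *)
Lemma cov_segment (p p' : R -> R) a b : a <= b ->
  measurable_fun setT p -> measurable_fun setT p' ->
  (forall t, a <= t <= b -> is_derive t 1 p (p' t)) ->
  (forall t, a <= t <= b -> {for t, continuous p'}) ->
  (forall t, a <= t <= b -> 0 < p' t) \/ (forall t, a <= t <= b -> p' t < 0) ->
  measurable (p @` `[a, b]) /\
  forall A, measurable A ->
  (\int[mu]_(t in `[a, b]) ((\1_A (p t) * `|p' t|)%R)%:E = mu (A `&` (p @` `[a, b])))%E.
Proof.
have incr_case (q q' : R -> R) : a <= b ->
  (forall t, a <= t <= b -> is_derive t 1 q (q' t)) ->
  (forall t, a <= t <= b -> 0 < q' t) -> q @` `[a, b] = `[q a, q b]%classic.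
  move=> ab dq q0; apply/seteqP; split => z /=.
    move=> [t]; rewrite !in_itv/= => /andP[at_ tb] <-.
    have incr := derive_pos_incr dq q0.
    have incrW x y : a <= x -> x <= y -> y <= b -> q x <= q y.
      by rewrite (le_eqVlt x) => ax /predU1P[-> //|xy yb]; rewrite ltW// incr.
    by rewrite !incrW.
  rewrite in_itv/= => /andP[az zb].
  have [|c cab <-] := IVT ab (derive_within_continuous dq) (v := z).
    by rewrite minEle maxEle (le_trans az zb) az.
  by exists c.
move=> ab mp mp' dp cp [p0|p0].
  rewrite (incr_case _ _ ab dp p0); split => // A mA.
  exact: cov_segment_incr.
have dq t : a <= t <= b -> is_derive t 1 (fun x => - p x) (- p' t).
  by move=> /dp h; exact: is_deriveN.
have q0 t : a <= t <= b -> 0 < - p' t by move=> /p0; rewrite oppr_gt0.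
have cq t : a <= t <= b -> {for t, continuous (fun x => - p' x)}.
  by move=> /cp h; exact: continuousN.
have imN (B : set R) : p @` B = -%R @^-1` ((fun x => - p x) @` B).
  apply/seteqP; split => z /= [t Bt]; first by move=> <-; exists t.
  by move=> /oppr_inj <-; exists t.
have mN : measurable_fun setT (fun x => - p x) by exact: measurable_funN.
have mN' : measurable_fun setT (fun x => - p' x) by exact: measurable_funN.
split.
  rewrite imN (incr_case _ _ ab dq q0).
  rewrite -[X in measurable X]setTI.
  by apply: oppr_measurable => //; exact: measurable_itv.
move=> A mA.
have mNA : measurable (-%R @^-1` A).
  by rewrite -[X in measurable X]setTI; exact: oppr_measurable.
have := cov_segment_incr ab mN mN' dq cq q0 mNA.
have -> : -%R @^-1` A `&` `[- p a, - p b] = -%R @^-1` (A `&` (p @` `[a, b])).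
  rewrite imN (incr_case _ _ ab dq q0) preimage_setI; congr (_ `&` _).
  by apply/seteqP; split => z /=; rewrite opprK.
rewrite -[X in _ = X -> _]/(pushforward mu (-%R : R -> measurableTypeR R) _).
rewrite lebesgue_measureN; last first.
  apply: measurableI => //; rewrite imN (incr_case _ _ ab dq q0).
  rewrite -[X in measurable X]setTI.
  by apply: oppr_measurable => //; exact: measurable_itv.
move=> <-; apply: eq_integral => t _.
by rewrite normrN !indicE; congr ((nat_of_bool _)%:R * _)%:E;
  apply/idP/idP; rewrite !inE/= opprK.
Qed.

End one_dimensional_change_of_variables.

(** * Change of variables on an open set of the line *)

Section change_of_variables_open.
Context (R : realType).
Notation mu := (@lebesgue_measure R).

(** By continuity [p'] keeps its sign near each point, so countably many rational segments of
    constant sign cover [T]. Once they are made disjoint their images are disjoint by injectivity,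
    and the formula on segments is summed. *)
Lemma cov_open (p p' : R -> R) (T : set R) : open T ->
  measurable_fun setT p -> measurable_fun setT p' ->
  (forall t, T t -> is_derive t 1 p (p' t)) ->
  (forall t, T t -> {for t, continuous p'}) ->
  (forall t, T t -> p' t != 0) ->
  (forall x y, T x -> T y -> p x = p y -> x = y) ->
  measurable (p @` T) /\
  forall A, measurable A ->
  (\int[mu]_(t in T) ((\1_A (p t) * `|p' t|)%R)%:E = mu (A `&` (p @` T)))%E.
Proof.
move=> oT mp mp' dp cp p0 pinj.
pose good a b := [/\ a <= b, (forall t, a <= t <= b -> T t) &
  (forall t, a <= t <= b -> 0 < p' t) \/ (forall t, a <= t <= b -> p' t < 0)].
(* An enumeration of the segments with rational ends; an index that does not code a good segment
   gives the empty set. *)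
pose J n : set R := if @unpickle (rat * rat)%type n is Some q then
  if `[< good (ratr q.1) (ratr q.2) >] then `[ratr q.1, ratr q.2]%classic else set0
  else set0.
have JP n : J n = set0 \/ exists a b, good a b /\ J n = `[a, b]%classic.
  rewrite /J; case: (unpickle n) => [[q1 q2]|]; last by left.
  by case: asboolP => h; [right; exists (ratr q1), (ratr q2)|left].
have mJ n : measurable (J n).
  by case: (JP n) => [->//|[a [b [_ ->]]]]; exact: measurable_itv.
have JT n : J n `<=` T.
  by case: (JP n) => [->//|[a [b [[_ h _] ->]]]] t /=; rewrite in_itv/=; exact: h.
have TJ : T = \bigcup_n J n.
  apply/seteqP; split; last by move=> t [n _ /JT].
  move=> t Tt.
  have : \forall y \near t, T y /\ 0 < p' y * p' t.
    near=> y; split; first by near: y; exact: open_nbhs_nbhs.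
    have : `|p' t - p' y| < `|p' t|.
      near: y; move/cvgrPdist_lt: (cp _ Tt); apply; rewrite normr_gt0; exact: p0.
    rewrite ltr_norml; have [pt|pt|] := ltgtP (p' t) 0; last by move/eqP; rewrite (negPf (p0 _ Tt)).
      by rewrite ltr0_norm// => /andP[? ?]; rewrite nmulr_lgt0//; lra.
    by rewrite gtr0_norm// => /andP[? ?]; rewrite mulr_gt0//; lra.
  move=> /nbhs_ballP[e /= e0 he].
  have [q1] : exists q : rat, ratr q \in `](t - e), t[%R.
    by apply: rat_in_itvoo; rewrite ltrBlDr ltrDl.
  have [q2] : exists q : rat, ratr q \in `]t, (t + e)[%R.
    by apply: rat_in_itvoo; rewrite ltrDl.
  rewrite !in_itv/= => /andP[t2 e2] /andP[e1 t1].
  have [N HN] : exists N, unpickle N = Some (q1, q2).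
    by exists (pickle (q1, q2)); exact: pickleK.
  exists N; first exact: Logic.I.
  rewrite /J HN/=.
  have inball s : ratr q1 <= s <= ratr q2 -> T s /\ 0 < p' s * p' t.
    move=> /andP[s1 s2]; apply: he; rewrite /ball/= ltr_norml.
    by apply/andP; split; lra.
  case: asboolP => [_|]; first by rewrite /= in_itv/= !ltW.
  case; split; [by rewrite ltW// (lt_trans t1)|by move=> s /inball[]|].
  have [pt|pt|] := ltgtP (p' t) 0; last by move/eqP; rewrite (negPf (p0 _ Tt)).
    by right => s /inball[_]; rewrite nmulr_lgt0.
  by left => s /inball[_]; rewrite pmulr_lgt0.
pose D := seqDU J.
have DJ n : D n `<=` J n by exact: subset_seqDU.
have mD n : measurable (D n).
  by apply: measurableD => //; exact: bigsetU_measurable.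
have TD : T = \bigcup_n D n by rewrite TJ seqDU_bigcup_eq.
have cseg n : measurable (p @` J n) /\
  forall A, measurable A ->
  (\int[mu]_(t in J n) ((\1_A (p t) * `|p' t|)%R)%:E = mu (A `&` (p @` J n)))%E.
  case: (JP n) => [->|[a [b [[ab Tab sgn] ->]]]].
    rewrite image_set0; split => // A mA.
    by rewrite setI0 measure0 integral_set0.
  by apply: cov_segment => // t /Tab Tt; [exact: dp|exact: cp].
have pD n : p @` D n = p @` J n `\` \big[setU/set0]_(k < n) (p @` J k).
  rewrite /D /seqDU; apply/seteqP; split => z /=.
    move=> [t [Jt nJ] <-]; split; first by exists t.
    rewrite -(bigcup_mkord n (fun k => p @` J k)) => -[k kn [s Js pst]]; apply: nJ.
    rewrite -bigcup_mkord; exists k => //.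
    by rewrite -(pinj s t)//; [exact: JT Js|exact: JT Jt].
  move=> [[t Jt <-] nJ]; exists t => //; split => //.
  rewrite -bigcup_mkord => -[k kn Jk]; apply: nJ.
  by rewrite -(bigcup_mkord n (fun k => p @` J k)); exists k => //; exists t.
have mpD n : measurable (p @` D n).
  rewrite pD; apply: measurableD; first exact: (cseg n).1.
  by apply: bigsetU_measurable => k _; exact: (cseg k).1.
have pT : p @` T = \bigcup_n (p @` D n) by rewrite TD image_bigcup.
split; first by rewrite pT; exact: bigcupT_measurable.
move=> A mA.
rewrite [in LHS]TD ge0_integral_bigcup//; last 2 first.
- apply/measurable_EFinP; apply: measurable_funTS; apply: measurable_funM.
    exact: (measurableT_comp (measurable_indic mA)).
  exact: measurableT_comp.
- exact: trivIset_seqDU.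
transitivity (\sum_(n <oo) mu (A `&` (p @` D n)))%E.
  apply: eq_eseriesr => n _.
  have -> : A `&` (p @` D n) = A `&` (p @` D n) `&` (p @` J n).
    by rewrite -setIA; congr (_ `&` _); rewrite setIidl//; apply: image_subset.
  rewrite -(cseg n).2; last exact: measurableI.
  rewrite integral_mkcond [RHS]integral_mkcond; apply: eq_integral => t _.
  rewrite !patchE !indicE.
  have [tJ|tJ] := boolP (t \in J n); last first.
    by rewrite memNset// => /DJ /mem_set; rewrite (negPf tJ).
  have [tD|tD] := boolP (t \in D n).
    rewrite in_setI; congr ((nat_of_bool _)%:R * _)%:E.
    by rewrite [X in _ && X]mem_set ?andbT//; exists t => //; exact: set_mem.
  rewrite memNset ?mul0r// => -[_ [s Ds pst]].
  move: tD; rewrite -(pinj s t)//; first by rewrite mem_set.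
    exact/(@JT n)/DJ.
  by apply: (@JT n); exact: set_mem.
rewrite pT setI_bigcupr.
apply/cvg_lim; first exact: ereal_hausdorff.
apply: measure_semi_sigma_additive.
- by move=> n; apply: (measurableI _ _ mA); exact: mpD.
- apply/trivIsetP => i j _ _ ij; apply/seteqP; split => // z [[_ [s Ds <-]] [_ [t Dt pst]]].
  have st : s = t by apply: pinj => //; [exact/(@JT i)/DJ|exact/(@JT j)/DJ].
  have /trivIsetP/(_ i j Logic.I Logic.I ij) : trivIset setT D by exact: trivIset_seqDU.
  by move=> /seteqP[/(_ s)+ _]; apply; split => //; rewrite st.
- by apply: bigcupT_measurable => n; apply: (measurableI _ _ mA); exact: mpD.
Unshelve. all: by end_near. Qed.

Lemma cov_open_ge0 (p p' : R -> R) (T : set R) : open T ->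
  measurable_fun setT p -> measurable_fun setT p' ->
  (forall t, T t -> is_derive t 1 p (p' t)) ->
  (forall t, T t -> {for t, continuous p'}) ->
  (forall t, T t -> p' t != 0) ->
  (forall x y, T x -> T y -> p x = p y -> x = y) ->
  forall F : R -> \bar R, measurable_fun setT F -> (forall x, 0 <= F x)%E ->
  (\int[mu]_(t in T) (F (p t) * `|p' t|%:E) = \int[mu]_(x in p @` T) F x)%E.
Proof.
move=> oT mp mp' dp cp p0 pinj F mF F0.
have [mpT H] := cov_open oT mp mp' dp cp p0 pinj.
have mT : measurable T by exact: open_measurable.
have := @ge0_integral_wpush _ _ (measurableTypeR R) (measurableTypeR R) R mu mu p
  (\1_(p @` T)) (fun t => \1_T t * `|p' t|).
move=> /(_ mp (measurable_indic mpT)) h.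
have mk : measurable_fun setT (fun t : measurableTypeR R => \1_T t * `|p' t|).
  by apply: measurable_funM; [exact: measurable_indic|exact: measurableT_comp].
move: h => /(_ mk) h.
have i0 x : 0 <= \1_(p @` T) x :> R by rewrite indicE.
have j0 x : 0 <= \1_T x * `|p' x| by rewrite indicE mulr_ge0.
move: h => /(_ i0 j0) h.
rewrite integral_mkcond [RHS]integral_mkcond.
transitivity (\int[mu]_x (F x * (\1_(p @` T) x)%:E))%E; last first.
  by apply: eq_integral => x _; rewrite patchE indicE; case: ifPn; rewrite ?mule1 ?mule0.
rewrite h//.
  apply: eq_integral => t _; rewrite patchE indicE; case: ifPn => _.
    by rewrite mul1r.
  by rewrite mul0r mule0.
move=> A mA.
transitivity (mu (A `&` (p @` T))).
  have mAp : measurable (A `&` (p @` T)) by exact: measurableI.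
  have := @integral_indic _ (measurableTypeR R) R mu setT measurableT (A `&` (p @` T)) mAp.
  rewrite setIT => <-; apply: eq_integral => x _; rewrite !indicE in_setI.
  by case: (_ \in A); case: (_ \in p @` T); rewrite ?(mul1r,mul0r,mulr0).
rewrite -H// [LHS]integral_mkcond. apply: eq_integral => t _; rewrite patchE.
by rewrite [\1_T t]indicE; case: ifPn; rewrite ?mul1r// mul0r mulr0.
Qed.

End change_of_variables_open.

(** * Planar Lebesgue measure as a factor of products *)

Section leb2_sigma_finite.
Context (R : realType).

(** The product theorems applied to [leb3] have [leb2] as a factor and ask for its sigma-finiteness
    under that name. *)
Lemma leb2_sigma_finite : sigma_finite setT (@leb2 R).
Proof.
have /sigma_finiteP[F [TF ndF Foo]] := sigma_finiteT (@lebesgue_measure R).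
exists (fun n => F n `*` F n).
 rewrite -setXTT TF predeqE => -[x y]; split.
    move=> [/= [n _ Fnx] [k _ Gky]]; exists (maxn n k) => //; split.
    - by move: x Fnx; exact/subsetPset/ndF/leq_maxl.
    - by move: y Gky; exact/subsetPset/ndF/leq_maxr.
  by move=> [n _ []/= ? ?]; split; exists n.
move=> k; have [? ?] := Foo k.
split; first exact: measurableX.
by rewrite [ltLHS]product_measure1E// lte_mul_pinfty// ge0_fin_numE.
Qed.

HB.instance Definition _ :=
  Measure.copy (@leb2 R) (@lebesgue_measure R \x @lebesgue_measure R)%E.
HB.instance Definition _ :=
  Measure_isSigmaFinite.Build _ _ _ (@leb2 R) leb2_sigma_finite.

End leb2_sigma_finite.

(** * Tonelli and invariance of Lebesgue measure under affine maps *)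

Section product_lebesgue.
Context (R : realType).
Notation mu := (@lebesgue_measure R).
Notation T1 := (measurableTypeR R).
Local Open Scope ereal_scope.

Lemma leb2_tonelli1 (F : T1 * T1 -> \bar R) : measurable_fun setT F ->
  (forall z, 0 <= F z) -> \int[@leb2 R]_z F z = \int[mu]_x \int[mu]_y F (x, y).
Proof. exact: fubini_tonelli1. Qed.

Lemma leb2_tonelli2 (F : T1 * T1 -> \bar R) : measurable_fun setT F ->
  (forall z, 0 <= F z) -> \int[@leb2 R]_z F z = \int[mu]_y \int[mu]_x F (x, y).
Proof. exact: fubini_tonelli2. Qed.

Lemma leb3_tonelli1 (F : T1 * T1 * T1 -> \bar R) : measurable_fun setT F ->
  (forall z, 0 <= F z) -> \int[@leb3 R]_z F z = \int[@leb2 R]_x \int[mu]_y F (x, y).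
Proof. move=> mF F0; refine (@fubini_tonelli1 _ _ _ _ R (@leb2 R) mu F mF F0). Qed.

Lemma leb3_tonelli2 (F : T1 * T1 * T1 -> \bar R) : measurable_fun setT F ->
  (forall z, 0 <= F z) -> \int[@leb3 R]_z F z = \int[mu]_y \int[@leb2 R]_x F (x, y).
Proof. move=> mF F0; refine (@fubini_tonelli2 _ _ _ _ R (@leb2 R) mu F mF F0). Qed.

Lemma leb_affine (c b : R) (F : T1 -> \bar R) : c != 0%R ->
  measurable_fun setT F -> (forall x, 0 <= F x) ->
  \int[mu]_x (F (c * x + b)%R * `|c|%:E) = \int[mu]_x F x.
Proof.
move=> c0 mF F0.
have mp : measurable_fun setT (fun x : R => c * x + b)%R by mfun.
have mp' : measurable_fun setT (fun x : R => c) by [].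
have dp (t : R) : setT t -> is_derive t 1%R (fun x : R => c * x + b)%R c.
  have h := is_deriveD (is_deriveZ c (is_derive_id t 1%R)) (is_derive_cst b t 1%R).
  by move=> _; apply: (is_derive_eq h); rewrite addr0 /GRing.scale/= mulr1.
have cp (t : R) : setT t -> {for t, continuous (fun x : R => c)}.
  by move=> _; exact: cvg_cst.
have p0 (t : R) : setT t -> c != 0%R by [].
have inj (x y : R) : setT x -> setT y -> (c * x + b = c * y + b)%R -> x = y.
  by move=> _ _ /addIr /(mulfI c0).
have := cov_open_ge0 (@openT R) mp mp' dp cp p0 inj mF F0.
have -> // : [set (c * x + b)%R | x in setT] = [set: R].
apply/seteqP; split => // x _; exists (c^-1 * (x - b))%R => //.
by rewrite mulrA divff// mul1r subrK.
Qed.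

Lemma leb_translate (b : R) (F : T1 -> \bar R) :
  measurable_fun setT F -> (forall x, 0 <= F x) ->
  \int[mu]_x F (x + b)%R = \int[mu]_x F x.
Proof.
move=> mF F0; rewrite -(@leb_affine 1 b F)//.
by apply: eq_integral => x _; rewrite normr1 mule1 mul1r.
Qed.

Lemma leb_scale (c : R) (F : T1 -> \bar R) : c != 0%R ->
  measurable_fun setT F -> (forall x, 0 <= F x) ->
  \int[mu]_x (F (c * x)%R * `|c|%:E) = \int[mu]_x F x.
Proof.
move=> c0 mF F0; rewrite -(@leb_affine c 0 F)//.
by apply: eq_integral => x _; rewrite addr0.
Qed.

Lemma leb_opp (F : T1 -> \bar R) :
  measurable_fun setT F -> (forall x, 0 <= F x) ->
  \int[mu]_x F (- x)%R = \int[mu]_x F x.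
Proof.
move=> mF F0; rewrite -(@leb_scale (-1) F)//.
by apply: eq_integral => x _; rewrite normrN1 mule1 mulN1r.
Qed.

Lemma leb2_translate (a : R * R) (F : T1 * T1 -> \bar R) :
  measurable_fun setT F -> (forall x, 0 <= F x) ->
  \int[@leb2 R]_x F (x + a)%R = \int[@leb2 R]_x F x.
Proof.
move=> mF F0.
have mFa : measurable_fun setT (fun x : T1 * T1 => F (x + a)%R).
  apply: (measurableT_comp mF).
  by apply: measurable_fun_pair; apply: measurable_funD.
rewrite (leb2_tonelli1 mFa (fun=> F0 _)) (leb2_tonelli1 mF (fun=> F0 _)).
rewrite -(leb_translate a.1 (F := fun x => \int[mu]_y F (x, y))); last 2 first.
- exact: (measurable_fun_fubini_tonelli_F F).
- by move=> x; exact: integral_ge0.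
apply: eq_integral => x _.
rewrite -(leb_translate a.2 (F := fun y => F (x + a.1, y)%R))//.
exact: (measurableT_comp mF (pair1_measurable _)).
Qed.

Lemma leb2_shear1 (c : R) (F : T1 * T1 -> \bar R) :
  measurable_fun setT F -> (forall x, 0 <= F x) ->
  \int[@leb2 R]_z F (z.1 + c * z.2, z.2)%R = \int[@leb2 R]_z F z.
Proof.
move=> mF F0.
have mG : measurable_fun setT (fun z : T1 * T1 => F (z.1 + c * z.2, z.2)%R) by mfun.
rewrite (leb2_tonelli2 mG (fun=> F0 _)) (leb2_tonelli2 mF (fun=> F0 _)); apply: eq_integral => y _ /=.
rewrite (leb_translate (c * y)%R (F := fun x => F (x, y)))//.
exact: (measurableT_comp mF (pair2_measurable _)).
Qed.

Lemma leb2_shear2 (c : R) (F : T1 * T1 -> \bar R) :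
  measurable_fun setT F -> (forall x, 0 <= F x) ->
  \int[@leb2 R]_z F (z.1, z.2 + c * z.1)%R = \int[@leb2 R]_z F z.
Proof.
move=> mF F0.
have mG : measurable_fun setT (fun z : T1 * T1 => F (z.1, z.2 + c * z.1)%R) by mfun.
rewrite (leb2_tonelli1 mG (fun=> F0 _)) (leb2_tonelli1 mF (fun=> F0 _)); apply: eq_integral => y _ /=.
rewrite (leb_translate (c * y)%R (F := fun x => F (y, x)))//.
exact: (measurableT_comp mF (pair1_measurable _)).
Qed.

Lemma leb2_opp (F : T1 * T1 -> \bar R) :
  measurable_fun setT F -> (forall x, 0 <= F x) ->
  \int[@leb2 R]_z F (- z.1, - z.2)%R = \int[@leb2 R]_z F z.
Proof.
move=> mF F0.
have mG : measurable_fun setT (fun z : T1 * T1 => F (- z.1, - z.2)%R) by mfun.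
rewrite (leb2_tonelli1 mG (fun=> F0 _)) (leb2_tonelli1 mF (fun=> F0 _)).
rewrite -(leb_opp (F := fun x => \int[mu]_y F (x, y))); last 2 first.
- exact: (measurable_fun_fubini_tonelli_F F).
- by move=> x; exact: integral_ge0.
apply: eq_integral => x _ /=.
rewrite -(leb_opp (F := fun y => F (- x, y)%R))//.
exact: (measurableT_comp mF (pair1_measurable _)).
Qed.

Lemma leb2_swap (F : T1 * T1 -> \bar R) :
  measurable_fun setT F -> (forall x, 0 <= F x) ->
  \int[@leb2 R]_z F (z.2, z.1) = \int[@leb2 R]_z F z.
Proof.
move=> mF F0.
have mG : measurable_fun setT (fun z : T1 * T1 => F (z.2, z.1)) by mfun.
by rewrite (leb2_tonelli1 mG (fun=> F0 _)) (leb2_tonelli2 mF (fun=> F0 _)).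
Qed.

(* A rotation is a product of three shears unless its angle is a multiple of pi. *)
Lemma leb2_rotation (theta : R) (F : T1 * T1 -> \bar R) :
  measurable_fun setT F -> (forall x, 0 <= F x) ->
  \int[@leb2 R]_z F (z.2 * cos theta - z.1 * sin theta,
                     z.2 * sin theta + z.1 * cos theta)%R = \int[@leb2 R]_z F z.
Proof.
move=> mF F0; set a := cos theta; set c := sin theta.
have ac : (a ^+ 2 + c ^+ 2 = 1)%R by exact: cos2Dsin2.
have [c0|c0] := eqVneq c 0%R.
  have a2 : (a * a = 1)%R by rewrite -ac c0; ring.
  have [a1|a1] : a = 1%R \/ a = (-1)%R.
    have /eqP : ((a - 1) * (a + 1) = 0)%R by rewrite -[X in _ = X](subrr 1)%R -{3}a2; ring.
    by rewrite mulf_eq0 subr_eq0 addr_eq0 => /orP[]/eqP; tauto.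
  - rewrite -[RHS]leb2_swap//; apply: eq_integral => z _.
    by rewrite c0 a1 !mulr0 !mulr1 subr0 add0r.
  - rewrite -[RHS]leb2_opp// -[RHS](leb2_swap (F := fun z => F (- z.1, - z.2)%R))//.
      by apply: eq_integral => z _; rewrite c0 a1 !mulr0 !mulrN1 subr0 add0r.
    by apply: (measurableT_comp mF); apply: measurable_fun_pair;
      exact: measurable_funN.
(* Shears by [(a - 1) / c], [c] and [(a - 1) / c] compose to the rotation. The last swap is there
   because the first coordinate of [z] is the distance to the line and the second the abscissa. *)
pose F1 (z : T1 * T1) := F (z.1 + (a - 1) / c * z.2, z.2)%R.
have mF1 : measurable_fun setT F1 by rewrite /F1; mfun.
pose F2 (z : T1 * T1) := F1 (z.1, z.2 + c * z.1)%R.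
have mF2 : measurable_fun setT F2 by rewrite /F2; mfun.
pose F3 (z : T1 * T1) := F2 (z.1 + (a - 1) / c * z.2, z.2)%R.
have mF3 : measurable_fun setT F3 by rewrite /F3; mfun.
have E1 := leb2_shear1 ((a - 1) / c)%R mF F0.
have E2 := leb2_shear2 c mF1 (fun=> F0 _).
have E3 := leb2_shear1 ((a - 1) / c)%R mF2 (fun=> F0 _).
have E4 := leb2_swap mF3 (fun=> F0 _).
refine (etrans _ (etrans E4 (etrans E3 (etrans E2 E1)))); apply: eq_integral => z _.
rewrite /F3 /F2 /F1 /=.
have k : ((a - 1) / c * c = a - 1)%R by rewrite mulfVK.
have k2 : ((a - 1) / c * (a + 1) = - c)%R.
  have -> : ((a - 1) / c * (a + 1) = (a ^+ 2 - (a ^+ 2 + c ^+ 2)) / c)%R.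
    by rewrite ac; field.
  by field.
congr F; congr pair; apply/esym.
  transitivity (z.2 * (1 + (a - 1) / c * c) + z.1 * ((a - 1) / c * (2 + (a - 1) / c * c)))%R.
    by ring.
  by rewrite k (_ : 2 + (a - 1) = a + 1)%R ?k2; ring.
transitivity (z.2 * c + z.1 * (1 + (a - 1) / c * c))%R; first by ring.
by rewrite k; ring.
Qed.

End product_lebesgue.

(* Point with abscissa [s] on the line of direction [theta] at signed distance [p] from the origin. *)
Definition pt (R : realType) (theta p s : R) : R * R :=
  (s * cos theta - p * sin theta, s * sin theta + p * cos theta).

Lemma integral_angles_split (R : realType) (G : measurableTypeR R -> \bar R) :
  measurable_fun setT G -> (forall x, 0 <= G x)%E ->
  (\int[lebesgue_measure]_(x in @angles R) G x =
   \int[lebesgue_measure]_(x in `]0%R, pi[) G x +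
   \int[lebesgue_measure]_(x in `]pi, (2 * pi)%R[) G x)%E.
Proof.
move=> mG G0; have pi0 := @pi_gt0 R.
rewrite (integral_itv_obnd_cbnd (r := 0)); last exact: measurable_funTS.
rewrite (integral_itv_obnd_cbnd (r := pi)); last exact: measurable_funTS.
rewrite -ge0_integral_setU//.
- rewrite /angles -(@itv_bndbnd_setU _ _ (BLeft 0) (BLeft pi) (BLeft (2 * pi)))//.
  + by rewrite bnd_simp ltW.
  + by rewrite bnd_simp; lra.
- exact: measurable_funTS.
- apply/disj_setPS => x /= []; rewrite !in_itv/= => /andP[_ h] /andP[h' _].
  by have := lt_le_trans h h'; rewrite ltxx.
Qed.

(** * Line coordinates on phase space and polar coordinates in the plane *)

Section line_and_polar_coordinates.
Context (R : realType).
Notation mu := (@lebesgue_measure R).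
Notation T1 := (measurableTypeR R).
Local Open Scope ereal_scope.

Lemma measurable_pt : measurable_fun setT
  (fun y : T1 * T1 * T1 => pt y.1.1 y.1.2 y.2 : T1 * T1).
Proof. by rewrite /pt; mfun. Qed.

(** At a fixed angle the pair of signed distance and abscissa is a rotation of the plane. The angle,
    last coordinate of [z], becomes the first of [y], so that a line is the pair [y.1]. *)
Lemma leb3_lines (F : T1 * T1 * T1 -> \bar R) : measurable_fun setT F ->
  (forall z, 0 <= F z) ->
  \int[@leb3 R]_z F z = \int[@leb3 R]_y F (pt y.1.1 y.1.2 y.2, y.1.1).
Proof.
move=> mF F0.
have mG : measurable_fun setT
    (fun y : T1 * T1 * T1 => F (pt y.1.1 y.1.2 y.2, y.1.1)).
  apply: (measurableT_comp mF); apply: measurable_fun_pair; first exact: measurable_pt.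
  exact: measurableT_comp.
rewrite (leb3_tonelli1 mG (fun=> F0 _)) (leb3_tonelli2 mF F0).
rewrite leb2_tonelli1; last 2 first.
- exact: (measurable_fun_fubini_tonelli_F _ mG (fun=> F0 _)).
- by move=> z; apply: integral_ge0.
apply: eq_integral => theta _.
have mFt : measurable_fun setT (fun x : T1 * T1 => F (x, theta)) by mfun.
rewrite -(leb2_rotation theta mFt (fun=> F0 _)) leb2_tonelli1//.
rewrite (_ : (fun z : T1 * T1 => F _) = (fun z => F (pt theta z.1 z.2, theta)))//.
by apply: (measurableT_comp mG (g := fun z : T1 * T1 => ((theta, z.1), z.2) : T1 * T1 * T1)); mfun.
Qed.

Let smul1 (s : T1) : R := (\1_`]0%R, +oo[ s * s)%R.

Let msmul1 : measurable_fun setT smul1.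
Proof. by apply: measurable_funM => //; exact: measurable_indic. Qed.

Let smul1_ge0 s : (0 <= smul1 s)%R.
Proof.
rewrite /smul1 indicE mem_setE in_itv/= andbT; case: ltP => [s0|_].
  by rewrite mul1r ltW.
by rewrite mul0r.
Qed.

Let polar_kernel (F : T1 * T1 -> \bar R) : measurable_fun setT F -> (forall z, 0 <= F z) ->
  let K (z : T1 * T1) := F (z.2 * cos z.1, z.2 * sin z.1)%R * (smul1 z.2)%:E in
  measurable_fun setT K /\ forall z, 0 <= K z.
Proof.
move=> mF F0; split; last by move=> z; rewrite mule_ge0// lee_fin.
by apply: emeasurable_funM; [mfun|apply/measurable_EFinP; exact: measurableT_comp].
Qed.

(** Polar coordinates on the upper half-plane from one-dimensional changes of variables only:
    [x = y t] at fixed [y], then [t] is the cotangent of the angle, then at fixed angle the ordinate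
    is rescaled to the distance. *)
Let polar_half (F : T1 * T1 -> \bar R) : measurable_fun setT F ->
  (forall z, 0 <= F z) ->
  \int[@leb2 R]_z (F z * (\1_`]0%R, +oo[ z.2)%:E) =
  \int[mu]_(theta in `]0%R, pi[)
     \int[mu]_s (F (s * cos theta, s * sin theta)%R * (smul1 s)%:E).
Proof.
move=> mF F0.
have i0 (s : R) : 0 <= (\1_`]0%R, +oo[ s)%:E :> \bar R by rewrite lee_fin indicE.
have mi : measurable_fun setT (fun z : T1 * T1 => (\1_`]0%R, +oo[ z.2 : R)).
  by apply: measurableT_comp => //; exact: measurable_indic.
rewrite leb2_tonelli2; last 2 first.
- apply: emeasurable_funM => //; exact/measurable_EFinP.
- by move=> z; rewrite mule_ge0.
pose H (z : T1 * T1) := F (z.2 * z.1, z.2)%R * (smul1 z.2)%:E.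
have mH : measurable_fun setT H.
  apply: emeasurable_funM; last by apply/measurable_EFinP; exact: measurableT_comp.
  by mfun.
have H0 z : 0 <= H z by rewrite mule_ge0// lee_fin.
transitivity (\int[mu]_y \int[mu]_x H (x, y)).
  apply: eq_integral => y _; rewrite /H/= /smul1 indicE mem_setE in_itv/= andbT.
  have [y0|y0] := ltP 0%R y; last first.
    by rewrite mul0r !integral0_eq// => x _; rewrite mule0.
  rewrite mul1r -(leb_scale (c := y) (F := fun x => F (x, y) * 1%:E)); last 3 first.
  - by rewrite gt_eqF.
  - apply: emeasurable_funM => //.
    exact: (measurableT_comp mF (pair2_measurable _)).
  - by move=> x; rewrite mule1.
  by apply: eq_integral => x _; rewrite mule1 gtr0_norm.
rewrite -(leb2_tonelli2 mH H0) (leb2_tonelli1 mH H0).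
pose K (z : T1 * T1) := F (z.2 * cos z.1, z.2 * sin z.1)%R * (smul1 z.2)%:E.
have [mK K0] : measurable_fun setT K /\ forall z, 0 <= K z := polar_kernel mF F0.
pose p (t : R) : R := (pi / 2 - atan t)%R.
pose p' (t : R) : R := (- (1 + t ^+ 2)^-1)%R.
have dpt (t : R) : is_derive t 1%R p (p' t).
  have h := is_deriveB (is_derive_cst (pi / 2 : R)%R t 1%R) (is_derive1_atan t).
  by apply: (is_derive_eq h); rewrite sub0r.
have q0 (t : R) : (0 < 1 + t ^+ 2)%R by rewrite ltr_pwDl// sqr_ge0.
have cp' : continuous p'.
  move=> t; apply: cvgN; apply: cvgV; first by rewrite gt_eqF.
  by apply: cvgD; [exact: cvg_cst|exact: exprn_continuous].
have cp : continuous p.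
  move=> t; have [+ _] := dpt t; move/derivable1_diffP.
  exact: differentiable_continuous.
have im : [set p t | t in [set: R]] = `]0%R, pi[%classic.
  apply/seteqP; split => th /=; rewrite in_itv/=.
    by move=> [t _ <-]; rewrite /p; have := atan_gtNpi2 t; have := atan_ltpi2 t; lra.
  move=> /andP[th0 thpi]; exists (tan (pi / 2 - th))%R => //.
  by rewrite /p tanK ?subKr// in_itv/=; apply/andP; split; lra.
rewrite -im.
have := @cov_open_ge0 R p p' setT openT (continuous_measurable_fun cp)
  (continuous_measurable_fun cp') (fun t _ => dpt t) (fun t _ => cp' t).
move=> /(_ _ _ (fun th => \int[mu]_s K (th, s))) <-; last 4 first.
- by move=> t _; rewrite oppr_eq0 invr_eq0 gt_eqF.
- by move=> x y _ _ /addrI/oppr_inj/(can_inj (@atanK R)).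
- exact: (measurable_fun_fubini_tonelli_F K).
- by move=> x; exact: integral_ge0.
apply: eq_integral => t _.
rewrite /p' normrN ger0_norm; last by rewrite invr_ge0 ltW.
(* The ratio of the distance to the ordinate at the angle [p t]; one factor [r] comes from the
   Jacobian [s], one from rescaling, and together they cancel [1 + t ^+ 2]. *)
set r := (Num.sqrt (1 + t ^+ 2))%R.
have r0 : (0 < r)%R by rewrite sqrtr_gt0.
have r2 : (r * r = 1 + t ^+ 2)%R by rewrite -expr2 sqr_sqrtr// ltW.
have sp : sin (p t) = r^-1%R.
  rewrite /p sinB sin_pihalf cos_pihalf mul1r mul0r subr0 cos_atan//.
have cpt : cos (p t) = (t / r)%R.
  rewrite /p cosB sin_pihalf cos_pihalf mul1r mul0r add0r.
  have := atanK t; rewrite /tan cos_atan -/r invrK => Ht.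
  by apply: (canRL (mulfK _)) Ht; rewrite gt_eqF.
have mr : measurable_fun setT (fun s : T1 => (r * s)%R) by mfun.
rewrite -(leb_scale (c := r) (F := fun s => K (p t, s))); last 3 first.
- by rewrite gt_eqF.
- exact: (measurableT_comp mK (pair1_measurable _)).
- by [].
rewrite muleC -ge0_integralZl//; last 3 first.
- apply: emeasurable_funM => //.
  exact: (measurableT_comp (measurableT_comp mK (pair1_measurable (p t))) mr).
- by move=> s _; rewrite mule_ge0// lee_fin.
- by rewrite lee_fin invr_ge0 ltW.
apply: eq_integral => s _.
rewrite /K /H/= sp cpt.
have -> : (r * s * (t / r) = s * t)%R by field; rewrite gt_eqF.
have -> : (r * s * r^-1 = s)%R by field; rewrite gt_eqF.
rewrite (gtr0_norm r0) muleCA !muleA -!muleA; congr (_ * _).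
rewrite -!EFinM /smul1 !indicE !mem_setE !in_itv/= !andbT pmulr_rgt0//.
rewrite -r2; congr EFin; field; by rewrite gt_eqF.
Qed.

(** The lower half-plane is the upper one for [F] reflected through the origin, with the angle moved
    by [pi]; the horizontal axis is a null set. *)
Lemma leb2_polar (F : T1 * T1 -> \bar R) : measurable_fun setT F ->
  (forall z, 0 <= F z) ->
  \int[@leb2 R]_z F z = \int[mu]_(theta in @angles R)
     \int[mu]_s (F (s * cos theta, s * sin theta)%R * (\1_`]0%R, +oo[ s * s)%:E).
Proof.
move=> mF F0.
pose K (z : T1 * T1) := F (z.2 * cos z.1, z.2 * sin z.1)%R * (smul1 z.2)%:E.
have [mK K0] : measurable_fun setT K /\ forall z, 0 <= K z := polar_kernel mF F0.
pose G th := \int[mu]_s K (th, s).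
have mG : measurable_fun setT G by exact: (measurable_fun_fubini_tonelli_F K).
have G0 th : 0 <= G th by exact: integral_ge0.
have mFN : measurable_fun setT (fun z : T1 * T1 => F (- z.1, - z.2)%R) by mfun.
have mi (A : set R) : measurable A ->
    measurable_fun setT (fun z : T1 * T1 => (\1_A z.2 : R)%:E).
  by move=> mA; apply/measurable_EFinP; apply: measurableT_comp => //; exact: measurable_indic.
have i0 (A : set R) (s : R) : 0 <= (\1_A s)%:E :> \bar R by rewrite lee_fin indicE.
rewrite -[RHS]/(\int[mu]_(theta in @angles R) G theta) (integral_angles_split mG G0).
have hp := polar_half mF F0.
have hm := polar_half mFN (fun=> F0 _).
rewrite -[X in _ = X + _]hp.
have -> : \int[mu]_(th in `]pi, (2 * pi)%R[) G th =
    \int[@leb2 R]_z (F z * (\1_`]-oo, 0%R[ z.2)%:E).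
  transitivity (\int[@leb2 R]_z (F (- z.1, - z.2)%R * (\1_`]-oo, 0%R[ (- z.2)%R)%:E)); last first.
    rewrite (leb2_opp (F := fun z => F z * (\1_`]-oo, 0%R[ z.2)%:E))//.
    + by apply: emeasurable_funM => //; exact: mi.
    + by move=> z; rewrite mule_ge0.
  transitivity (\int[@leb2 R]_z (F (- z.1, - z.2)%R * (\1_`]0%R, +oo[ z.2)%:E)); last first.
    apply: eq_integral => z _; congr (_ * (_)%:E); rewrite !indicE !mem_setE !in_itv/= andbT.
    by rewrite oppr_lt0.
  rewrite hm integral_mkcond [RHS]integral_mkcond.
  rewrite -[LHS](leb_translate pi); last 2 first.
  + by apply/(measurable_restrictT _ _).1 => //; exact: measurable_funTS.
  + by move=> x; rewrite patchE; case: ifP.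
  apply: eq_integral => th _; rewrite !patchE !mem_setE !in_itv/=.
  rewrite (_ : (pi < th + pi < 2 * pi)%R = (0 < th < pi)%R); last first.
    by apply/idP/idP => /andP[? ?]; apply/andP; split; lra.
  case: ifP => // _; apply: eq_integral => s _; rewrite /K/=.
  by rewrite cosDpi sinDpi !mulrN.
rewrite -ge0_integralD//; last 4 first.
- by move=> z _; rewrite mule_ge0.
- by apply: emeasurable_funM => //; exact: mi.
- by move=> z _; rewrite mule_ge0.
- by apply: emeasurable_funM => //; exact: mi.
have mS : measurable_fun setT (fun z : T1 * T1 =>
    F z * (\1_`]0%R, +oo[ z.2)%:E + F z * (\1_`]-oo, 0%R[ z.2)%:E).
  by apply: emeasurable_funD; apply: emeasurable_funM => //; exact: mi.
have S0 z : 0 <= F z * (\1_`]0%R, +oo[ z.2)%:E + F z * (\1_`]-oo, 0%R[ z.2)%:E.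
  by rewrite adde_ge0// mule_ge0.
rewrite (leb2_tonelli2 mF F0) (leb2_tonelli2 mS S0).
have e0 : ae_eq mu setT (fun y => \int[mu]_x F (x, y)) (fun y => \int[mu]_x
    (F (x, y) * (\1_`]0%R, +oo[ y)%:E + F (x, y) * (\1_`]-oo, 0%R[ y)%:E)).
  exists [set 0%R]; split; [exact: measurable_set1|exact: lebesgue_measure_set1|].
  move=> y /= /not_implyP[_ h]; apply: contrapT => /eqP y0; apply: h.
  apply: eq_integral => x _; rewrite !indicE !mem_setE !in_itv/= andbT.
  by have [ylt0|y0'|y0'] := ltgtP y 0%R; rewrite ?mule1 ?mule0 ?adde0 ?add0e//; move: y0; rewrite y0' eqxx.
apply: ge0_ae_eq_integral => //.
- exact: (measurable_fun_fubini_tonelli_G F).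
- exact: (measurable_fun_fubini_tonelli_G _ mS S0).
- by move=> y _; apply: integral_ge0.
- by move=> y _; apply: integral_ge0 => x _; rewrite adde_ge0// mule_ge0.
Qed.

End line_and_polar_coordinates.

(** * Open sets of a product are measurable for the product sigma-algebra *)

Section countable_measurable_base.

(** The sets [V i] need not be open: a countable network made of members of [M] suffices to write
    every open set as a countable union, and it passes to products. *)
Definition mbase (T : topologicalType) (M : set (set T)) :=
  exists V : nat -> set T, (forall i, M (V i)) /\
    forall x U, nbhs x U -> exists i, V i x /\ V i `<=` U.

Lemma mbase_real (R : realType) : mbase (@measurable _ (measurableTypeR R) : set (set R)).
Proof.
exists (fun n => if @unpickle (rat * rat)%type n is Some q then
  `]ratr q.1, ratr q.2[%classic else set0); split.
  by move=> i; case: (unpickle i) => [q|]; [exact: measurable_itv|exact: measurable0].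
move=> x U /nbhs_ballP[e /= e0 eU].
have [q1] : exists q : rat, ratr q \in `](x - e), x[%R.
  by apply: rat_in_itvoo; rewrite ltrBlDr ltrDl.
have [q2] : exists q : rat, ratr q \in `]x, (x + e)[%R.
  by apply: rat_in_itvoo; rewrite ltrDl.
rewrite !in_itv/= => /andP[t2 e2] /andP[e1 t1].
have [N HN] : exists N, unpickle N = Some (q1, q2).
  by exists (pickle (q1, q2)); exact: pickleK.
exists N; rewrite HN /=; split; first by rewrite in_itv/= t1 t2.
move=> y /=; rewrite in_itv/= => /andP[y1 y2]; apply: eU; rewrite /ball/= ltr_norml.
by apply/andP; split; lra.
Qed.

Lemma mbase_prod (T1 T2 : topologicalType) (M1 : set (set T1)) (M2 : set (set T2))
    (M : set (set (T1 * T2))) :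
  (forall A B, M1 A -> M2 B -> M (A `*` B)) ->
  mbase M1 -> mbase M2 -> mbase M.
Proof.
move=> MX [V [MV bV]] [W [MW bW]].
exists (fun n => if @unpickle (nat * nat)%type n is Some q then V q.1 `*` W q.2
  else V 0%N `*` W 0%N); split.
  by move=> i; case: (unpickle i) => [q|]; exact: MX.
move=> [x y] U [[A B] /= [nA nB] ABU].
have [i [Vx VA]] := bV _ _ nA; have [j [Wy WB]] := bW _ _ nB.
have [N HN] : exists N, unpickle N = Some (i, j).
  by exists (pickle (i, j)); exact: pickleK.
exists N; rewrite HN; split => // z [/= z1 z2]; apply: ABU; split.
  exact: VA.
exact: WB.
Qed.

Lemma mbase_open (T : topologicalType) (M : set (set T)) (U : set T) :
  mbase M -> M set0 -> (forall F : nat -> set T, (forall i, M (F i)) -> M (\bigcup_i F i)) ->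
  open U -> M U.
Proof.
move=> [V [MV bV]] M0 Mcup oU.
rewrite (_ : U = \bigcup_i (if `[< V i `<=` U >] then V i else set0)).
  by apply: Mcup => i; case: ifP.
apply/seteqP; split => x.
  move=> Ux; have [i [Vx VU]] := bV x U (open_nbhs_nbhs (conj oU Ux)).
  by exists i => //; case: asboolP.
by move=> [i _]; case: asboolP => // VU /VU.
Qed.

End countable_measurable_base.

Section open_measurable_product.
Context (R : realType).
Notation T1 := (measurableTypeR R).

Lemma mbase_real2 : mbase (@measurable _ (T1 * T1)%type : set (set (R * R))).
Proof.
by apply: (mbase_prod _ (@mbase_real R) (@mbase_real R)) => A B; exact: measurableX.
Qed.

Lemma open_measurable2 (U : set (R * R)) : open U -> measurable (U : set (T1 * T1)).
Proof.
move=> oU.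
apply: (mbase_open (M := @measurable _ (T1 * T1)%type : set (set (R * R))) mbase_real2 _ _ oU).
  exact: measurable0.
by move=> F mF; exact: bigcupT_measurable.
Qed.

Lemma open_measurable3 (U : set (R * R * R)) : open U -> measurable (U : set (T1 * T1 * T1)).
Proof.
move=> oU.
apply: (mbase_open (M := @measurable _ (T1 * T1 * T1)%type : set (set (R * R * R))) _ _ _ oU).
- by apply: (mbase_prod _ mbase_real2 (@mbase_real R)) => A B; exact: measurableX.
- exact: measurable0.
- by move=> F mF; exact: bigcupT_measurable.
Qed.

Lemma closed_measurable2 (U : set (R * R)) : closed U -> measurable (U : set (T1 * T1)).
Proof.
by move=> cU; rewrite -[U]setCK; apply: measurableC; apply: open_measurable2; rewrite openC.
Qed.

Lemma continuous_measurable3 (f : R * R * R -> R) : continuous f ->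
  measurable_fun setT (f : T1 * T1 * T1 -> R).
Proof.
move=> cf; apply: (measurability (@RGenOpens.G R)); first exact: RGenOpens.measurableE.
move=> _ [_ [x [y ->]] <-]; rewrite setTI; apply: open_measurable3.
by move/continuousP: cf; apply; exact: interval_open.
Qed.

End open_measurable_product.

(** What is kept of the domain: convexity in coordinates and a bound [d], so that constants can be
    named in terms of [d] alone. *)
Definition cbody (R : realType) (Omega : set (R * R)) (d : R) :=
  [/\ open Omega,
      (forall x y t, Omega x -> Omega y -> 0 <= t <= 1 ->
        Omega ((1 - t) * x.1 + t * y.1, (1 - t) * x.2 + t * y.2)),
      0 < d & forall x, Omega x -> `|x.1| <= d /\ `|x.2| <= d].

(** Half-side [2 * eta] leaves a margin [eta] around the inner square of half-side [eta]; the margin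
    gives transversality at the boundary to the rays that hit the inner square. *)
Definition contains_square (R : realType) (Omega : set (R * R)) (xc : R * R) (eta : R) :=
  forall y, `|y.1 - xc.1| <= 2 * eta -> `|y.2 - xc.2| <= 2 * eta -> Omega y.

(** * Algebra of the coordinates attached to a direction *)

Section line_coordinates_algebra.
Context (R : realType).
Implicit Types (theta p s r : R) (x : R * R).

Definition cs theta x : R := x.1 * cos theta + x.2 * sin theta.
Definition cp theta x : R := x.2 * cos theta - x.1 * sin theta.

Lemma cs_pt theta p s : cs theta (pt theta p s) = s.
Proof.
rewrite /cs /pt/= -[RHS]mulr1 -(cos2Dsin2 theta); ring.
Qed.

Lemma cp_pt theta p s : cp theta (pt theta p s) = p.
Proof.
rewrite /cp /pt/= -[RHS]mulr1 -(cos2Dsin2 theta); ring.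
Qed.

Lemma pt_cs_cp theta x : pt theta (cp theta x) (cs theta x) = x.
Proof.
rewrite [RHS]surjective_pairing -[x.1 in RHS]mulr1 -[x.2 in RHS]mulr1 -(cos2Dsin2 theta).
by rewrite /pt /cs /cp; congr pair; ring.
Qed.

Lemma pt_opp theta p s : pt (theta + pi) (- p) (- s) = pt theta p s.
Proof. by rewrite /pt cosDpi sinDpi; congr pair; ring. Qed.

Lemma pt_add theta p s r : pt theta p (s + r) =
  ((pt theta p s).1 + r * cos theta, (pt theta p s).2 + r * sin theta).
Proof. by rewrite /pt/=; congr pair; ring. Qed.

Lemma cs_bound theta x d : `|x.1| <= d -> `|x.2| <= d -> `|cs theta x| <= 2 * d.
Proof.
move=> x1 x2; rewrite /cs (le_trans (ler_normD _ _))// !normrM mulrDl mul1r.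
have c1 := cos_max theta; have s1 := sin_max theta.
by rewrite lerD// -[d]mulr1 ler_pM.
Qed.

Lemma cp_bound theta x d : `|x.1| <= d -> `|x.2| <= d -> `|cp theta x| <= 2 * d.
Proof.
move=> x1 x2; rewrite /cp (le_trans (ler_normB _ _))// !normrM mulrDl mul1r.
have c1 := cos_max theta; have s1 := sin_max theta.
by rewrite lerD// -[d]mulr1 ler_pM.
Qed.

End line_coordinates_algebra.

(** * Chords of the convex body *)

Section chords.
Context (R : realType) (Omega : set (R * R)) (d : R) (OB : cbody Omega d).
Notation T1 := (measurableTypeR R).
Implicit Types (theta p s r : R) (x y : R * R).

Lemma body_open x : Omega x ->
  exists2 r, 0 < r & forall y, `|y.1 - x.1| < r -> `|y.2 - x.2| < r -> Omega y.
Proof.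
case: OB => oO _ _ _ Ox.
have /nbhs_ballP[r /= r0 rO] := open_nbhs_nbhs (conj oO Ox).
exists r => // y y1 y2; apply: rO; split => /=; by rewrite /ball/= distrC.
Qed.

Lemma body_measurable : measurable (Omega : set (T1 * T1)).
Proof. by case: OB => oO _ _ _; exact: open_measurable2. Qed.

Lemma frontierP x : frontier Omega x <->
  ~ Omega x /\ forall e, 0 < e ->
    exists y, [/\ Omega y, `|y.1 - x.1| < e & `|y.2 - x.2| < e].
Proof.
case: OB => oO _ _ _; rewrite /frontier (interior_id _).1//; split.
  move=> [cx nx]; split => // e e0.
  have [y [Oy [/= y1 y2]]] := cx _ (nbhsx_ballx x e e0).
  by exists y; split => //; rewrite distrC.
move=> [nx cx]; split => // B /nbhs_ballP[e /= e0 eB].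
have [y [Oy y1 y2]] := cx _ e0.
by exists y; split => //; apply: eB; split; rewrite /ball/= distrC.
Qed.

(** [x] is only in the closure. Replace it by a nearby [z] of the body and move [y] to [y'] so that
    the point at parameter [t] is unchanged; the move of [y] is [(1 - t) / t] times that of [x],
    hence small enough to stay in the open body. *)
Lemma body_segment x y t : Omega y ->
  (forall e, 0 < e -> exists z, [/\ Omega z, `|z.1 - x.1| < e & `|z.2 - x.2| < e]) ->
  0 < t <= 1 -> Omega ((1 - t) * x.1 + t * y.1, (1 - t) * x.2 + t * y.2).
Proof.
move=> Oy cx /andP[t0 t1]; case: OB => _ cO _ _.
have [r r0 rO] := body_open Oy.
have [z [Oz z1 z2]] := cx _ (mulr_gt0 r0 t0).
pose y' := (y.1 + (1 - t) / t * (x.1 - z.1), y.2 + (1 - t) / t * (x.2 - z.2)).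
have Oy' : Omega y'.
  have aux u : `|u| < r * t -> `|(1 - t) / t * u| < r.
    move=> ur; rewrite normrM ger0_norm; last by rewrite divr_ge0 ?subr_ge0// ltW.
    rewrite mulrAC ltr_pdivrMr// (le_lt_trans _ ur)// ler_piMl//.
    by rewrite gerBl ltW.
  by apply: rO; rewrite /y'/= addrC addKr; apply: aux; rewrite distrC.
have := cO _ _ t Oz Oy' _; rewrite (ltW t0) t1 => /(_ isT).
congr (Omega _); rewrite /y'/=.
by congr pair; field; rewrite gt_eqF.
Qed.

Definition chord theta p := [set s | Omega (pt theta p s)].
Definition meets theta p := chord theta p !=set0.
(** Abscissa at which the line enters the body, with default value 0 when the line misses it. *)
Definition si theta p : R := inf (chord theta p).
Definition so theta p : R := sup (chord theta p).

Lemma chord_bound theta p s : chord theta p s -> `|s| <= 2 * d /\ `|p| <= 2 * d.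
Proof.
case: OB => _ _ _ bO /bO[b1 b2]; split.
  by rewrite -(cs_pt theta p s); exact: cs_bound.
by rewrite -(cp_pt theta p s); exact: cp_bound.
Qed.

Lemma chord_open theta p s : chord theta p s ->
  exists2 e, 0 < e & forall r, `|r - s| < e -> chord theta p r.
Proof.
move=> /body_open[e e0 eO]; exists e => // r rs; apply: eO => /=.
  rewrite (_ : _ - _ = (r - s) * cos theta); last by ring.
  rewrite normrM (le_lt_trans _ rs)// ler_piMr// ler_norml cos_geN1 cos_le1//.
rewrite (_ : _ - _ = (r - s) * sin theta); last by ring.
by rewrite normrM (le_lt_trans _ rs)// ler_piMr// ler_norml sin_geN1 sin_le1.
Qed.

Lemma chord_convex theta p r s u : chord theta p r -> chord theta p s ->
  r <= u <= s -> chord theta p u.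
Proof.
move=> cr csn /andP[ru us].
have [rs|rs] := ltP r s; last by rewrite (_ : u = r)//; lra.
case: OB => _ cO _ _.
have := cO _ _ ((u - r) / (s - r)) cr csn _.
have sr : 0 < s - r by rewrite subr_gt0.
rewrite divr_ge0 ?subr_ge0// ?ler_pdivrMr// ?mul1r; last by rewrite (le_trans ru).
move=> H; have := H _; rewrite lerB// => /(_ isT).
rewrite /chord/=; congr (Omega _); rewrite /pt/=.
by congr pair; field; rewrite gt_eqF.
Qed.

Lemma chord_has_lbound theta p : has_lbound (chord theta p).
Proof. by exists (- (2 * d)) => s /chord_bound[]; rewrite ler_norml => /andP[]. Qed.

Lemma chord_has_ubound theta p : has_ubound (chord theta p).
Proof. by exists (2 * d) => s /chord_bound[]; rewrite ler_norml => /andP[]. Qed.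

Lemma chordP theta p s : meets theta p -> (chord theta p s <-> si theta p < s < so theta p).
Proof.
move=> mt; split.
  move=> cs_; have [e e0 H] := chord_open cs_; apply/andP; split.
    have : chord theta p (s - e / 2) by apply: H; rewrite ltr_norml; apply/andP; split; lra.
    by move=> /(ge_inf (chord_has_lbound theta p)); rewrite -/(si _ _); lra.
  have : chord theta p (s + e / 2) by apply: H; rewrite ltr_norml; apply/andP; split; lra.
  by move=> /(ub_le_sup (chord_has_ubound theta p)); rewrite -/(so _ _); lra.
move=> /andP[s1 s2].
have [r rc rs] := inf_lt mt s1; have [u uc us] := sup_gt mt s2.
by apply: (chord_convex rc uc); rewrite !ltW.
Qed.

Lemma si_lt_so theta p : meets theta p -> si theta p < so theta p.
Proof. by move=> mt; have [s /(chordP _ mt)/andP[? ?]] := mt; lra. Qed.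

Lemma si_bound theta p : `|si theta p| <= 2 * d.
Proof.
have [_ _ d0 _] := OB.
have [mt|/set0P/negP/negPn/eqP e0] := pselect (meets theta p); last first.
  by rewrite /si e0 inf0 normr0 mulr_ge0 ?ltW.
rewrite ler_norml; apply/andP; split.
  by apply: lb_le_inf => // s /chord_bound[]; rewrite ler_norml => /andP[].
have [s cs_] := mt; apply: le_trans (ge_inf (chord_has_lbound theta p) cs_) _.
by have [] := chord_bound cs_; rewrite ler_norml => /andP[].
Qed.

Lemma pt_si_frontier theta p : meets theta p -> frontier Omega (pt theta p (si theta p)).
Proof.
move=> mt; apply/frontierP; split.
  by move=> /(chordP _ mt); rewrite ltxx.
move=> e e0; have h := si_lt_so mt.
pose r := Num.min (e / 2) ((so theta p - si theta p) / 2).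
have r0 : 0 < r by rewrite lt_min !divr_gt0// subr_gt0.
have re : r < e.
  by apply: (@le_lt_trans _ _ (e / 2)); [rewrite ge_min lexx|lra].
have rso : r <= (so theta p - si theta p) / 2 by rewrite ge_min lexx orbT.
exists (pt theta p (si theta p + r)); rewrite pt_add/=; split.
- by rewrite -pt_add; apply/(chordP _ mt); apply/andP; split; lra.
- rewrite addrC addKr normrM gtr0_norm// (le_lt_trans _ re)// ler_piMr//; first exact: ltW.
  by rewrite ler_norml cos_geN1 cos_le1.
- rewrite addrC addKr normrM gtr0_norm// (le_lt_trans _ re)// ler_piMr//; first exact: ltW.
  by rewrite ler_norml sin_geN1 sin_le1.
Qed.

Lemma chord_opp theta p : chord (theta + pi) (- p) = -%R @` chord theta p.
Proof.
apply/seteqP; split => s /=.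
  by move=> h; exists (- s); rewrite ?opprK// /chord/= -pt_opp opprK.
by move=> [r h <-]; rewrite /chord/= pt_opp.
Qed.

Lemma meets_opp theta p : meets (theta + pi) (- p) <-> meets theta p.
Proof.
rewrite /meets chord_opp; split; first by move=> [_ [s h _]]; exists s.
by move=> [s h]; exists (- s), s.
Qed.

(** Reversing the direction turns exits into entries. Statements about exits are deduced from those
    about entries through this identity. *)
Lemma so_si theta p : so theta p = - si (theta + pi) (- p).
Proof.
rewrite /si chord_opp /so /inf opprK; congr sup.
apply/seteqP; split => s /=; first by move=> h; exists (- s); rewrite ?opprK//; exists s.
by move=> [_ [r h <-] <-]; rewrite opprK.
Qed.

Lemma pt_so_frontier theta p : meets theta p -> frontier Omega (pt theta p (so theta p)).
Proof.
move=> mt; have := pt_si_frontier ((meets_opp theta p).2 mt).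
by rewrite so_si -[pt theta p _]pt_opp opprK.
Qed.

Lemma measurable_chord (s : R) :
  measurable [set z : T1 * T1 | chord z.1 z.2 s].
Proof.
have h : measurable_fun setT (fun z : T1 * T1 => (z, s) : T1 * T1 * T1) by mfun.
have := measurableT_comp (@measurable_pt R) h measurableT body_measurable.
by rewrite setTI.
Qed.

(** Chords are open, so rational abscissas detect an entry before [c]; measurability in the line
    then follows by countable unions. *)
Let chord_rat theta p c : (exists2 s, chord theta p s & s < c) <->
  exists q : rat, ratr q < c /\ chord theta p (ratr q).
Proof.
split; last by move=> [q [? ?]]; exists (ratr q).
move=> [s cs_ sc]; have [e e0 H] := chord_open cs_.
have [q] : exists q : rat, ratr q \in `](s - e), s[%R.
  by apply: rat_in_itvoo; rewrite ltrBlDr ltrDl.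
rewrite in_itv/= => /andP[q1 q2]; exists q; split; first exact: lt_trans sc.
by apply: H; rewrite ltr_norml; apply/andP; split; lra.
Qed.

Lemma measurable_meets : measurable [set z : T1 * T1 | meets z.1 z.2].
Proof.
rewrite (_ : [set z | _] = \bigcup_(q : rat) [set z : T1 * T1 | chord z.1 z.2 (ratr q)]).
  by apply: bigcupT_measurable_rat => q; exact: measurable_chord.
apply/seteqP; split => z /=; last by move=> [q _ h]; exists (ratr q).
move=> [s cs_]; have [q [_ h]] := (chord_rat z.1 z.2 (s + 1)).1 (ex_intro2 _ _ s cs_ (ltr_pwDr ltr01 (lexx _))).
by exists q.
Qed.

Lemma measurable_si : measurable_fun setT (fun z : T1 * T1 => si z.1 z.2).
Proof.
apply: (measurability (@RGenInftyO.G R)); first exact: RGenInftyO.measurableE.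
move=> _ [_ [c ->] <-]; rewrite setTI.
(* The second set accounts for the default value 0 of [si] on lines that miss the body. *)
rewrite (_ : _ @^-1` _ = (\bigcup_(q : rat) [set z : T1 * T1 | ratr q < c /\ chord z.1 z.2 (ratr q)])
   `|` (~` [set z : T1 * T1 | meets z.1 z.2] `&` [set z : T1 * T1 | 0 < c])); last first.
  apply/seteqP; split => z /=; rewrite in_itv/=.
    move=> h; have [mt|mt] := pselect (meets z.1 z.2).
      by left; have [s cs_ sc] := inf_lt mt h; have [q h'] := (chord_rat z.1 z.2 c).1 (ex_intro2 _ _ s cs_ sc); exists q.
    right; split => //; move: h; rewrite /si.
    by have /set0P/negP/negPn/eqP -> := mt; rewrite inf0.
  move=> [[q _ [qc cq]]|[mt c0]].
    by apply: le_lt_trans qc; exact: (ge_inf (chord_has_lbound z.1 z.2)).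
  by have /set0P/negP/negPn/eqP e0 := mt; rewrite /si e0 inf0.
apply: measurableU.
  apply: bigcupT_measurable_rat => q.
  have [qc|qc] := ltP (ratr q : R) c.
    by rewrite (_ : [set z | _] = [set z : T1 * T1 | chord z.1 z.2 (ratr q)]);
      [exact: measurable_chord|apply/seteqP; split => z /= => [[]|]].
  by rewrite (_ : [set z | _] = set0); [exact: measurable0|apply/seteqP; split => z //= -[]].
apply: measurableI; first by apply: measurableC; exact: measurable_meets.
have [c0|c0] := ltP 0 c; last first.
  by rewrite (_ : [set z | _] = set0); [exact: measurable0|apply/seteqP; split => z].
by rewrite (_ : [set z | _] = setT); [exact: measurableT|apply/seteqP; split => z].
Qed.

Lemma measurable_so : measurable_fun setT (fun z : T1 * T1 => so z.1 z.2).
Proof.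
rewrite (_ : (fun z => _) = (fun z : T1 * T1 => - si (z.1 + pi) (- z.2))).
  apply: measurable_funN.
  have h : measurable_fun setT (fun z : T1 * T1 => (z.1 + pi, - z.2) : T1 * T1) by mfun.
  exact: (measurableT_comp measurable_si h).
by apply/funext => z; rewrite so_si.
Qed.

Lemma chord_si_so theta p s : chord theta p s -> meets theta p /\ si theta p < s < so theta p.
Proof.
move=> h; have mt : meets theta p by exists s.
by split => //; apply/(chordP _ mt).
Qed.

End chords.

Lemma continuous_coordinates (R : realType) (f : R -> R * R) : continuous f ->
  continuous (fun t => (f t).1) /\ continuous (fun t => (f t).2).
Proof.
by move=> cf; split => t; [apply: (cvg_comp f fst (cf t)); exact: cvg_fst|
  apply: (cvg_comp f snd (cf t)); exact: cvg_snd].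
Qed.

(** * The boundary curve, its supporting lines and its incoming directions *)

Section boundary_curve.
Context (R : realType) (Omega : set (R * R)) (d : R) (OB : cbody Omega d)
        (b : boundary_data Omega).
Notation T1 := (measurableTypeR R).
Notation mu := (@lebesgue_measure R).
Notation c := (curve b).
Notation dc := (derive1 (curve b)).
Notation n := (fun t => normal b (curve b t)).
Implicit Types (t u theta p s : R) (x y v w : R * R).

Lemma is_derive_linear_curve (k1 k2 t : R) :
  is_derive t 1 (fun u => (c u).1 * k1 + (c u).2 * k2) ((dc t).1 * k1 + (dc t).2 * k2).
Proof.
pose l (x : R * R) : R := x.1 * k1 + x.2 * k2.
have cl : continuous l.
  by move=> x; apply: cvgD; apply: cvgM; (exact: cvg_cst || exact: cvg_fst || exact: cvg_snd).
have [dcv _] := curve_C1 b.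
have h : h^-1 *: (l (c (h *: (1 : R) + t)) - l (c t)) @[h --> (0 : R)^'] --> l (dc t).
  have := dcv t; rewrite /derivable => /cvg_ex[/= a ha].
  have ea : dc t = a by rewrite derive1E /derive; apply: cvg_lim.
  rewrite ea; have := cvg_comp _ _ ha (cl a); apply: cvg_trans.
  by apply: near_eq_cvg; near=> h; rewrite /l /= /GRing.scale/=; ring.
apply: DeriveDef; first exact: (cvgP (l (dc t))).
exact: (cvg_lim (@norm_hausdorff _ _) h).
Unshelve. all: by end_near. Qed.

Lemma continuous_linear_dcurve (k1 k2 : R) :
  continuous (fun u => (dc u).1 * k1 + (dc u).2 * k2).
Proof.
move=> t; have [_ cdc] := curve_C1 b.
have cl : continuous (fun x : R * R => x.1 * k1 + x.2 * k2).
  by move=> x; apply: cvgD; apply: cvgM; (exact: cvg_cst || exact: cvg_fst || exact: cvg_snd).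
by apply: (@continuous_comp _ _ _ dc (fun x : R * R => x.1 * k1 + x.2 * k2)); [exact: cdc|exact: cl].
Qed.

Lemma continuous_linear_curve (k1 k2 : R) :
  continuous (fun u => (c u).1 * k1 + (c u).2 * k2).
Proof.
move=> t; have [+ _] := is_derive_linear_curve k1 k2 t.
by move/derivable1_diffP; exact: differentiable_continuous.
Qed.

Lemma derive_pos_local (f : R -> R) t (df : R) : is_derive t 1 f df -> 0 < df ->
  exists2 e, 0 < e & forall k, 0 < k < e -> f t < f (t + k) /\ f (t - k) < f t.
Proof.
move=> [dft Dft] df0.
have h : h^-1 *: (f (h *: (1 : R) + t) - f t) @[h --> (0 : R)^'] --> df.
  by rewrite -Dft; exact: dft.
have /cvgrPdist_lt/(_ _ df0) := h.
move=> /nbhs_ballP[e /= e0 he]; exists e => // k /andP[k0 ke].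
have pos (r : R) : r != 0 -> `|r| < e -> 0 < r^-1 * (f (t + r) - f t).
  move=> r0 re; have := he r _ r0; rewrite /ball/= sub0r normrN => /(_ re).
  rewrite /GRing.scale/= mulr1 [r + t]addrC ltr_norml => /andP[_]; lra.
split.
  by have := pos k; rewrite gt_eqF// gtr0_norm// => /(_ isT ke); rewrite pmulr_rgt0 ?invr_gt0// subr_gt0.
have := pos (- k); rewrite oppr_eq0 gt_eqF// normrN gtr0_norm// => /(_ isT ke).
by rewrite invrN mulNr oppr_gt0 pmulr_rlt0 ?invr_gt0// subr_lt0.
Qed.

(** The determinant [k] of the frame satisfies [k * k = 1], and [e2] is [k] times [e1] turned by a
    right angle. *)
Lemma orthonormal_decomposition (e1 e2 v : R * R) : dot e1 e1 = 1 -> dot e2 e2 = 1 ->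
  dot e1 e2 = 0 -> v = (dot v e1 * e1.1 + dot v e2 * e2.1, dot v e1 * e1.2 + dot v e2 * e2.2).
Proof.
rewrite /dot => h1 h2 h3; set k := e1.1 * e2.2 - e1.2 * e2.1.
have k1 : e2.1 = - (k * e1.2).
  rewrite /k mulrBl opprB.
  transitivity (e2.1 * (e1.1 * e1.1 + e1.2 * e1.2) - e1.1 * (e1.1 * e2.1 + e1.2 * e2.2)); last by ring.
  by rewrite h1 h3; ring.
have k2 : e2.2 = k * e1.1.
  rewrite /k mulrBl.
  transitivity (e2.2 * (e1.1 * e1.1 + e1.2 * e1.2) - e1.2 * (e1.1 * e2.1 + e1.2 * e2.2)); last by ring.
  by rewrite h1 h3; ring.
have kk : k * k = 1.
  transitivity (k * k * (e1.1 * e1.1 + e1.2 * e1.2)); first by rewrite h1 mulr1.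
  by move: h2; rewrite k1 k2 => <-; ring.
clearbody k; rewrite k1 k2 [LHS]surjective_pairing; congr pair.
  transitivity (v.1 * (e1.1 * e1.1 + (k * k) * (e1.2 * e1.2)) + v.2 * (e1.1 * e1.2 * (1 - k * k))); last by ring.
  by rewrite kk mul1r h1; ring.
transitivity (v.2 * (e1.2 * e1.2 + (k * k) * (e1.1 * e1.1)) + v.1 * (e1.1 * e1.2 * (1 - k * k))); last by ring.
by rewrite kk mul1r [e1.2 * e1.2 + _]addrC h1; ring.
Qed.

Lemma curve_decomposition t v : v =
  (dot v (n t) * (n t).1 + dot v (dc t) * (dc t).1,
   dot v (n t) * (n t).2 + dot v (dc t) * (dc t).2).
Proof.
apply: orthonormal_decomposition.
- exact: normal_unit.
- exact: curve_unit_speed.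
- exact: normal_orth.
Qed.

Lemma curve_frontier t : frontier Omega (c t).
Proof.
have L0 := len_gt0 b.
have per (k : nat) u : c (u + k%:R * len b) = c u.
  elim: k u => [|k IH] u; first by rewrite mul0r addr0.
  by rewrite -natr1 mulrDl mul1r addrA curve_periodic IH.
have perz (k : int) u : c (u + k%:~R * len b) = c u.
  case: k => k; first exact: per.
  by rewrite -(per k.+1) NegzE mulrNz mulNr subrK.
pose k := Num.floor (t / len b); have /andP[k1 k2] := floor_itv (t / len b).
rewrite -(perz (- k)) -(curve_range b); exists (t + (- k)%:~R * len b) => //.
rewrite /= in_itv/= mulrNz mulNr subr_ge0 ltrBlDr -{2}[len b]mul1r -mulrDl.
rewrite -ler_pdivlMr// k1 -ltr_pdivrMr//.
by move: k2; rewrite -/k intrD addrC.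
Qed.

Lemma curve_notin t : ~ Omega (c t).
Proof. by have /(frontierP OB)[] := curve_frontier t. Qed.

Lemma curve_approx t e : 0 < e ->
  exists y, [/\ Omega y, `|y.1 - (c t).1| < e & `|y.2 - (c t).2| < e].
Proof. by move=> e0; have /(frontierP OB)[_] := curve_frontier t; exact. Qed.

Lemma inner_normal t : exists2 e, 0 < e &
  Omega ((c t).1 - e * (n t).1, (c t).2 - e * (n t).2).
Proof.
have H := normal_outward b t.
have [e [e0 [He _]]] : exists e, 0 < e /\ (Omega (c t - e *: n t) /\ ~ Omega (c t + e *: n t)).
  near (0 : R)^'+ => e; exists e; split; first by near: e; exact: nbhs_right_gt.
  by near: e.
by exists e.
Unshelve. all: by end_near. Qed.

Lemma curve_shift_dot t u e : dot (c u) e = dot (c t) e + dot (c u - c t) e.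
Proof. by rewrite /dot /=; ring. Qed.

Lemma is_derive_curve_dot t (k1 k2 : R) :
  is_derive t 1 (fun u => k1 * dot (c u) (n t) + k2 * dot (c u) (dc t)) k2.
Proof.
have := is_derive_linear_curve (k1 * (n t).1 + k2 * (dc t).1) (k1 * (n t).2 + k2 * (dc t).2) t.
set f := (X in is_derive _ _ X _); set g := (X in _ -> is_derive _ _ X _).
have -> : f = g by apply/funext => u; rewrite /f /g /dot; ring.
move=> h; apply: (is_derive_eq h).
transitivity (k1 * dot (n t) (dc t) + k2 * dot (dc t) (dc t)).
  by rewrite /dot; ring.
by rewrite normal_orth curve_unit_speed mulr0 mulr1 add0r.
Qed.

Lemma common_radius (e1 e2 : R) : 0 < e1 -> 0 < e2 -> exists k, [/\ 0 < k, 0 < k < e1 & 0 < k < e2].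
Proof.
move=> e10 e20; have m0 : 0 < Num.min e1 e2 by rewrite lt_min e10.
have k0 : 0 < Num.min e1 e2 / 2 by rewrite divr_gt0.
have k1 : Num.min e1 e2 / 2 < Num.min e1 e2 by rewrite ltr_pdivrMr// ltr_pMr// ltr1n.
by exists (Num.min e1 e2 / 2); split; rewrite ?k0// (lt_le_trans k1)// ge_min lexx ?orbT.
Qed.

Lemma normal_coordinates t y :
  y.1 = (c t).1 + (dot (y - c t) (n t) * (n t).1 + dot (y - c t) (dc t) * (dc t).1) /\
  y.2 = (c t).2 + (dot (y - c t) (n t) * (n t).2 + dot (y - c t) (dc t) * (dc t).2).
Proof.
have yE := curve_decomposition t (y - c t).
by split; [move/(congr1 fst): yE|move/(congr1 snd): yE] => /= <-; ring.
Qed.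

(** Otherwise the curve point would lie between this point and an inner point of the normal line,
    hence in the body by convexity. *)
Lemma no_outward_normal t g : 0 < g -> ~ Omega ((c t).1 + g * (n t).1, (c t).2 + g * (n t).2).
Proof.
move=> g0 Og; have [e e0 Oe] := inner_normal t.
have [_ cO _ _] := OB.
have eg : 0 < e + g by rewrite addr_gt0.
have := cO _ _ (e / (e + g)) Oe Og.
rewrite divr_ge0 ?(ltW e0) ?(ltW eg)// ler_pdivrMr// mul1r lerDl (ltW g0) => /(_ isT).
set z := (X in Omega X -> _); have -> : z = c t; last exact: curve_notin.
by rewrite [RHS]surjective_pairing /z/=; congr pair; field; rewrite gt_eqF.
Qed.

(* Otherwise a chord from [y] to a nearby point of the curve, on the other side
   of the normal line, would cross the outer half of that line. *)
Lemma supporting_line t y : Omega y -> dot (y - c t) (n t) < 0.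
Proof.
move=> Oy0; rewrite ltNge; apply/negP => y0.
(* A small move along the outward normal makes the inequality strict. *)
have [y' [Oy']] : exists y', Omega y' /\ 0 < dot (y' - c t) (n t).
  have [r r0 rO] := body_open OB Oy0.
  have nu := normal_unit b t.
  have [n1 n2] : `|(n t).1| <= 1 /\ `|(n t).2| <= 1.
    by split; [exact: norm_unit_coordinate nu|apply: (norm_unit_coordinate (v := (n t).1)); rewrite addrC].
  exists (y.1 + r / 2 * (n t).1, y.2 + r / 2 * (n t).2); split.
    have r2 : `|r / 2| < r by rewrite gtr0_norm ?divr_gt0//; lra.
    apply: rO; rewrite /= addrC addKr normrM (le_lt_trans _ r2)// ler_piMr//.
  rewrite (_ : dot _ _ = dot (y - c t) (n t) + r / 2 * dot (n t) (n t)); last by rewrite /dot/=; ring.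
  by rewrite normal_unit mulr1 ltr_wpDl// divr_gt0.
set al := dot _ _ => al0; pose be := dot (y' - c t) (dc t).
have [y1 y2] := normal_coordinates t y'; rewrite -/al -/be in y1 y2.
(* The segment from [c u] to [y'] meets the normal line at parameter [- bb / (be - bb)], at the
   height that appears in the last premise. For [u] near [t], on the side opposite to [be], that
   height is positive to first order. *)
have main u : let bb := dot (c u - c t) (dc t) in let a := dot (c u - c t) (n t) in
    be != bb -> 0 < - bb / (be - bb) <= 1 -> 0 < (- bb * al + be * a) / (be - bb) -> False.
  move=> bb a bebb l01 g0; apply: (no_outward_normal g0 (t := t)).
  have := body_segment OB Oy' (curve_approx u) l01.
  congr (Omega _).
  have [c1 c2] := normal_coordinates t (c u); rewrite -/a -/bb in c1 c2.
  rewrite y1 y2 c1 c2; congr pair; field; by rewrite subr_eq0.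
have d1 := is_derive_curve_dot t 0 1; have d2 := is_derive_curve_dot t (- be) al.
have [e1 e10 H1] := derive_pos_local d1 ltr01.
have [e2 e20 H2] := derive_pos_local d2 al0.
have [k [k0 ke1 ke2]] := common_radius e10 e20.
have [h1 h1'] := H1 _ ke1; have [h2 h2'] := H2 _ ke2.
have [be0|be0|be0] := ltgtP be 0.
- apply: (main (t + k)) => /=; move: h1 h2;
    rewrite !(curve_shift_dot t (t + k)); set a := dot (_ - _) (n t); set bb := dot (_ - _) (dc t).
  + by move=> h1 h2; rewrite lt_eqF//; lra.
  + move=> h1 h2; rewrite -mulrNN -invrN opprK ler_pdivrMr ?mul1r; last by lra.
    by rewrite divr_gt0; lra.
  + move=> h1 h2; rewrite -mulrNN -invrN divr_gt0//; lra.
- apply: (main (t - k)) => /=; move: h1' h2';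
    rewrite !(curve_shift_dot t (t - k)); set a := dot (_ - _) (n t); set bb := dot (_ - _) (dc t).
  + by move=> h1' h2'; rewrite gt_eqF//; lra.
  + move=> h1' h2'; rewrite ler_pdivrMr ?mul1r; last by lra.
    by rewrite divr_gt0; lra.
  + move=> h1' h2'; rewrite divr_gt0//; lra.
- apply: (no_outward_normal al0 (t := t)); move: Oy'; congr (Omega _).
  by rewrite [LHS]surjective_pairing y1 y2 be0 !mul0r !addr0.
Qed.

(** When [w] is not normal, its ray crosses the segment from the inner normal point to a curve point
    close to [c t], on the side towards which [w] leans. The sign conditions for this crossing hold
    to first order, because the curve leaves [c t] tangentially. *)
Lemma entering_direction t w : dot w (n t) < 0 ->
  exists2 s, 0 < s & Omega ((c t).1 + s * w.1, (c t).2 + s * w.2).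
Proof.
move=> wn; have [e e0 Oe] := inner_normal t.
have wE := curve_decomposition t w.
set nu := dot w (n t) in wE wn; set ta := dot w (dc t) in wE.
have w1 := congr1 fst wE; have w2 := congr1 snd wE; move: w1 w2 => /= w1 w2.
have [ta0|ta0] := eqVneq ta 0.
  exists (- e / nu); first by rewrite -mulrNN -invrN opprK divr_gt0// oppr_gt0.
  move: Oe; congr (Omega _); rewrite w1 w2 ta0.
  by congr pair; field; rewrite lt_eqF.
have main u : let bb := dot (c u - c t) (dc t) in let a := dot (c u - c t) (n t) in
    let q := a - nu / ta * bb in
    0 < q -> 0 < bb / ta -> exists2 s, 0 < s & Omega ((c t).1 + s * w.1, (c t).2 + s * w.2).
  move=> bb a q q0 bt; exists (e * (bb / ta) / (e + q)).
    by apply: divr_gt0; [exact: mulr_gt0|exact: addr_gt0].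
  have eq0 : 0 < e + q by rewrite addr_gt0.
  have l01 : 0 < e / (e + q) <= 1.
    by rewrite divr_gt0//= ler_pdivrMr// mul1r lerDl ltW.
  have l01' : 0 < q / (e + q) <= 1.
    by rewrite divr_gt0//= ler_pdivrMr// mul1r lerDr ltW.
  have := body_segment OB Oe (curve_approx u) l01'.
  congr (Omega _).
  have [c1 c2] := normal_coordinates t (c u); rewrite -/a -/bb in c1 c2.
  have eq0' : e + q != 0 by rewrite gt_eqF.
  rewrite c1 c2 w1 w2 /=; rewrite /q in eq0' *.
  by congr pair; field; rewrite ta0/=; move: eq0'; apply: contraNN => /eqP h;
    apply/eqP; apply: (mulIf ta0); rewrite mul0r -[RHS]h; field.
have d1 := is_derive_curve_dot t 0 1; have [e1 e10 H1] := derive_pos_local d1 ltr01.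
have [ta1|ta1|ta1] := ltgtP ta 0; last by rewrite ta1 eqxx in ta0.
- have d2 := is_derive_curve_dot t (- 1) (nu / ta).
  have nt0 : 0 < nu / ta by rewrite -mulrNN -invrN divr_gt0// oppr_gt0.
  have [e2 e20 H2] := derive_pos_local d2 nt0.
  have [k [k0 ke1 ke2]] := common_radius e10 e20.
  have [_ h1] := H1 _ ke1; have [_ h2] := H2 _ ke2.
  apply: (main (t - k)) => /=; move: h1 h2;
    rewrite !(curve_shift_dot t (t - k)); set a := dot (_ - _) (n t); set bb := dot (_ - _) (dc t).
  + move=> h1 h2; lra.
  + move=> h1 h2; rewrite -mulrNN -invrN divr_gt0//; lra.
- have d2 := is_derive_curve_dot t 1 (- (nu / ta)).
  have nt0 : 0 < - (nu / ta) by rewrite -mulNr divr_gt0// oppr_gt0.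
  have [e2 e20 H2] := derive_pos_local d2 nt0.
  have [k [k0 ke1 ke2]] := common_radius e10 e20.
  have [h1 _] := H1 _ ke1; have [h2 _] := H2 _ ke2.
  apply: (main (t + k)) => /=; move: h1 h2;
    rewrite !(curve_shift_dot t (t + k)); set a := dot (_ - _) (n t); set bb := dot (_ - _) (dc t).
  + move=> h1 h2; lra.
  + move=> h1 h2; rewrite divr_gt0//; lra.
Qed.

End boundary_curve.

(** * Boundary points as ends of chords, and the flux as a Jacobian *)

Section boundary_lines.
Context (R : realType) (Omega : set (R * R)) (d : R) (OB : cbody Omega d)
        (b : boundary_data Omega).
Notation T1 := (measurableTypeR R).
Notation mu := (@lebesgue_measure R).
Notation c := (curve b).
Notation dc := (derive1 (curve b)).
Notation n := (fun t => normal b (curve b t)).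
Notation fl t theta := (flux b (t, theta)).
Notation meets := (meets Omega).
Notation chord := (chord Omega).
Notation si := (si Omega).
Notation so := (so Omega).
Implicit Types (t u theta p s : R) (x y v w : R * R).

Lemma fluxE t theta : fl t theta = dot (dir theta) (n t).
Proof. by []. Qed.

Lemma flux_opp t theta : fl t (theta + pi) = - fl t theta.
Proof. by rewrite !fluxE /dot /dir/= cosDpi sinDpi; ring. Qed.

Lemma flux_neg_enter t theta : fl t theta < 0 <->
  exists2 s, 0 < s & Omega ((c t).1 + s * cos theta, (c t).2 + s * sin theta).
Proof.
split; first by rewrite fluxE => /(entering_direction OB).
move=> [s s0 /(supporting_line OB b t)].
rewrite fluxE (_ : dot _ _ = s * dot (dir theta) (n t)); last by rewrite /dot/=; ring.
by rewrite pmulr_rlt0.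
Qed.

Lemma pt_curve t theta s : pt theta (cp theta (c t)) (cs theta (c t) + s) =
  ((c t).1 + s * cos theta, (c t).2 + s * sin theta).
Proof. by rewrite pt_add pt_cs_cp. Qed.

(** An incoming direction enters the body at once, and [c t] itself is outside, so the chord starts
    exactly there. This identifies incoming boundary points with entry points of lines. *)
Lemma flux_neg_si t theta : fl t theta < 0 <->
  meets theta (cp theta (c t)) /\ si theta (cp theta (c t)) = cs theta (c t).
Proof.
split.
  move=> /flux_neg_enter[r r0 Or].
  have ch : chord theta (cp theta (c t)) (cs theta (c t) + r) by rewrite /chord/= pt_curve.
  have [mt /andP[h1 h2]] := chord_si_so OB ch; split => //.
  have nc : ~ chord theta (cp theta (c t)) (cs theta (c t)).
    by rewrite /chord/= pt_cs_cp; exact: (curve_notin OB).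
  have le1 : cs theta (c t) <= si theta (cp theta (c t)).
    rewrite leNgt; apply/negP => h; apply: nc; apply/(chordP OB _ mt).
    by rewrite h/=; lra.
  apply/eqP; rewrite eq_le le1 andbT leNgt; apply/negP => h.
  have : chord theta (cp theta (c t)) (si theta (cp theta (c t))); last first.
    by move=> /(chordP OB _ mt); rewrite ltxx.
  set s0 := si _ _ in h *.
  have l01 : 0 < (s0 - cs theta (c t)) / r <= 1.
    by rewrite divr_gt0 ?subr_gt0//= ler_pdivrMr// mul1r; lra.
  have := body_segment OB Or (curve_approx OB b t) l01.
  rewrite /chord/= (_ : s0 = cs theta (c t) + (s0 - cs theta (c t))); last by ring.
  rewrite pt_curve; congr (Omega _) => /=.
  by congr pair; field; rewrite gt_eqF.
move=> [mt e]; apply/flux_neg_enter.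
have h := si_lt_so OB mt; exists ((so theta (cp theta (c t)) - si theta (cp theta (c t))) / 2).
  by rewrite divr_gt0// subr_gt0.
have : chord theta (cp theta (c t)) (cs theta (c t) + (so theta (cp theta (c t)) - si theta (cp theta (c t))) / 2).
  by apply/(chordP OB _ mt); rewrite -e; apply/andP; split; lra.
by rewrite /chord/= pt_curve.
Qed.

Lemma curve_param x : frontier Omega x -> exists2 t, 0 <= t < len b & c t = x.
Proof. by rewrite -(curve_range b) => -[t /= tb <-]; exists t. Qed.

Lemma curve_injP t u : 0 <= t < len b -> 0 <= u < len b -> c t = c u -> t = u.
Proof. by move=> t0 u0; apply: (curve_inj (b := b)); rewrite inE/= in_itv. Qed.

(* Inverse of the boundary parametrization ([0] off the boundary). *)
Definition tb x : R := xget 0 [set t | 0 <= t < len b /\ c t = x].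

Lemma tbP x : frontier Omega x -> 0 <= tb x < len b /\ c (tb x) = x.
Proof.
move=> /curve_param[t t0 tx]; rewrite /tb; case: xgetP => [y _ [? ?] //|].
by move=> /(_ t); case.
Qed.

Lemma tb_curve t : 0 <= t < len b -> tb (c t) = t.
Proof.
by move=> t0; have [h1 h2] := tbP (curve_frontier b t); exact: curve_injP.
Qed.

Lemma tb_range x : 0 <= tb x < len b.
Proof.
have [/tbP[]//|nx] := pselect (frontier Omega x).
rewrite /tb; case: xgetP => [y _ [? ?] //|_]; rewrite lexx; exact: len_gt0.
Qed.

Lemma curve_continuous : continuous c.
Proof.
move=> t; have [dcv _] := curve_C1 b.
by have /derivable1_diffP := dcv t; exact: differentiable_continuous.
Qed.

Lemma frontier_measurable : measurable (frontier Omega : set (T1 * T1)).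
Proof.
have [oO _ _ _] := OB; rewrite /frontier (interior_id _).1//.
apply: measurableD; last exact: (body_measurable OB).
exact: (closed_measurable2 (@closed_closure _ Omega)).
Qed.

Lemma measurable_tb : measurable_fun setT (tb : T1 * T1 -> R).
Proof.
apply: (measurability (@RGenOInfty.G R)); first exact: RGenOInfty.measurableE.
move=> _ [_ [a ->] <-]; rewrite setTI.
rewrite (_ : _ @^-1` _ = ~` [set x | tb x <= a]); last first.
  by apply/seteqP; split => x /=; rewrite in_itv/= andbT ltNge => /negP.
apply: measurableC.
have mfr := frontier_measurable.
have [a0|a0] := ltP a 0.
  rewrite (_ : [set x | _] = set0); first exact: measurable0.
  by apply/seteqP; split => x //=; have /andP[h _] := tb_range x; move=> h'; lra.
have [al|al] := leP (len b) a.
  rewrite (_ : [set x | _] = setT); first exact: measurableT.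
  by apply/seteqP; split => x //= _; have /andP[_ h] := tb_range x; lra.
rewrite (_ : [set x | _] = ~` frontier Omega `|` c @` `[0, a]); last first.
  apply/seteqP; split => x /=.
    move=> tx; have [fx|nf] := pselect (frontier Omega x); [right|by left].
    have [/andP[h1 h2] h3] := tbP fx.
    by exists (tb x) => //; rewrite in_itv/= h1.
  move=> [nf|[t]].
    rewrite /tb; case: xgetP => [y _ [_ h]|//].
    by case: nf; rewrite -h; exact: curve_frontier.
  by rewrite in_itv/= => /andP[t0 ta] <-; rewrite tb_curve// t0; lra.
apply: measurableU; first exact: measurableC.
apply: closed_measurable2; apply: compact_closed; first exact: norm_hausdorff.
apply: continuous_compact; last exact: segment_compact.
by apply: continuous_subspaceT; exact: curve_continuous.
Qed.

Definition tin theta p : R := tb (pt theta p (si theta p)).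
Definition tout theta p : R := tb (pt theta p (so theta p)).

Lemma tin_range theta p : 0 <= tin theta p < len b.
Proof. exact: tb_range. Qed.

Lemma curve_tin theta p : meets theta p -> c (tin theta p) = pt theta p (si theta p).
Proof. by move=> /(pt_si_frontier OB)/tbP[]. Qed.

Lemma curve_tout theta p : meets theta p -> c (tout theta p) = pt theta p (so theta p).
Proof. by move=> /(pt_so_frontier OB)/tbP[]. Qed.

Lemma tout_tin theta p : tout theta p = tin (theta + pi) (- p).
Proof. by rewrite /tout /tin so_si -[pt theta p _]pt_opp opprK. Qed.

Lemma flux_tin theta p : meets theta p -> fl (tin theta p) theta < 0.
Proof.
by move=> mt; apply/flux_neg_si; rewrite curve_tin// cs_pt cp_pt.
Qed.

Lemma tin_curve t theta : 0 <= t < len b -> fl t theta < 0 ->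
  meets theta (cp theta (c t)) /\ tin theta (cp theta (c t)) = t.
Proof.
move=> t0 /flux_neg_si[mt e]; split => //.
by rewrite /tin e pt_cs_cp tb_curve.
Qed.

Lemma cp_opp t theta : cp (theta + pi) (c t) = - cp theta (c t).
Proof. by rewrite /cp cosDpi sinDpi; ring. Qed.

Lemma cs_opp t theta : cs (theta + pi) (c t) = - cs theta (c t).
Proof. by rewrite /cs cosDpi sinDpi; ring. Qed.

Lemma tout_curve t theta : 0 <= t < len b -> 0 < fl t theta ->
  [/\ meets theta (cp theta (c t)), tout theta (cp theta (c t)) = t &
      so theta (cp theta (c t)) = cs theta (c t)].
Proof.
move=> t0; rewrite -oppr_lt0 -flux_opp => h.
have [mt e] := tin_curve t0 h; have [_ es] := (flux_neg_si t (theta + pi)).1 h.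
move: mt e es; rewrite !cp_opp cs_opp => mt e es.
by split; [exact/meets_opp|rewrite tout_tin|rewrite so_si es opprK].
Qed.

Lemma measurable_line_tb (f : T1 * T1 -> R) : measurable_fun setT f ->
  measurable_fun setT (fun z : T1 * T1 => tb (pt z.1 z.2 (f z))).
Proof.
move=> mf.
have h : measurable_fun setT (fun z : T1 * T1 => (z, f z) : T1 * T1 * T1) by mfun.
exact: (measurableT_comp measurable_tb (measurableT_comp (@measurable_pt R) h)).
Qed.

Lemma measurable_tin : measurable_fun setT (fun z : T1 * T1 => tin z.1 z.2).
Proof. by apply: measurable_line_tb; exact: (measurable_si OB). Qed.

Lemma measurable_tout : measurable_fun setT (fun z : T1 * T1 => tout z.1 z.2).
Proof. by apply: measurable_line_tb; exact: (measurable_so OB). Qed.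

Lemma measurable_curve : measurable_fun setT (c : T1 -> T1 * T1).
Proof.
have [c1 c2] := continuous_coordinates curve_continuous.
by apply/measurable_fun_pairP; split; exact: continuous_measurable_fun.
Qed.

(** [normal] comes with no regularity in the boundary parameter, so the sign of the flux is read off
    the body: it is negative exactly when some rational step along the direction lands inside. *)
Lemma measurable_flux_neg : measurable [set z : T1 * T1 | flux b z < 0].
Proof.
rewrite (_ : [set z | _] = \bigcup_(q : rat) [set z : T1 * T1 | 0 < ratr q :> R /\
   Omega ((c z.1).1 + ratr q * cos z.2, (c z.1).2 + ratr q * sin z.2)]); last first.
  apply/seteqP; split => -[t theta] /=.
    move=> /flux_neg_enter[s s0].
    rewrite -pt_curve => /(chord_open OB)[e e0 H].
    have [q] : exists q : rat, ratr q \in `]s, (s + e)[%R.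
      by apply: rat_in_itvoo; rewrite ltrDl.
    rewrite in_itv/= => /andP[q1 q2]; exists q => //=; split; first exact: lt_trans q1.
    rewrite -pt_curve; apply: H.
    rewrite (_ : _ - _ = ratr q - s); last by ring.
    by rewrite ltr_norml; apply/andP; split; lra.
  by move=> [q _ [q0 h]]; apply/flux_neg_enter; exists (ratr q).
apply: bigcupT_measurable_rat => q.
have [q0|q0] := ltP 0 (ratr q : R); last first.
  by rewrite (_ : [set z | _] = set0); [exact: measurable0|apply/seteqP; split => z //= -[]].
have h : measurable_fun setT (fun z : T1 * T1 =>
  ((c z.1).1 + ratr q * cos z.2, (c z.1).2 + ratr q * sin z.2) : T1 * T1).
  have mc : measurable_fun setT (fun z : T1 * T1 => c z.1 : T1 * T1).
    exact: (measurableT_comp measurable_curve).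
  apply: measurable_fun_pair; apply: measurable_funD.
  - exact: (measurableT_comp measurable_fst mc).
  - by apply: measurable_funM => //; exact: (measurableT_comp (@measurable_cos R)).
  - exact: (measurableT_comp measurable_snd mc).
  - by apply: measurable_funM => //; exact: (measurableT_comp (@measurable_sin R)).
have := h measurableT _ (body_measurable OB); rewrite setTI => H.
by rewrite (_ : [set z | _] = (fun z : T1 * T1 =>
  ((c z.1).1 + ratr q * cos z.2, (c z.1).2 + ratr q * sin z.2)) @^-1` Omega)//; apply/seteqP; split => z /= => [[]|].
Qed.

Lemma measurable_flux_pos : measurable [set z : T1 * T1 | 0 < flux b z].
Proof.
have h : measurable_fun setT (fun z : T1 * T1 => (z.1, z.2 + pi) : T1 * T1) by mfun.
have := h measurableT _ measurable_flux_neg; rewrite setTI.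
rewrite (_ : _ @^-1` _ = [set z : T1 * T1 | 0 < flux b z])//.
by apply/seteqP; split => -[t theta] /=; rewrite flux_opp oppr_lt0.
Qed.

(** The derivative along the curve of the signed distance [cp theta], that is the Jacobian from the
    boundary parameter to the lines of direction [theta]. *)
Definition dcp theta t : R := (dc t).1 * (- sin theta) + (dc t).2 * cos theta.

(** Normal and tangent form an orthonormal frame, so the component of the direction on the normal
    equals, up to sign, the component of its quarter turn on the tangent. *)
Lemma normr_flux t theta : `|fl t theta| = `|dcp theta t|.
Proof.
have h := curve_decomposition b t (dir theta).
have h1 := normal_unit b t; have h2 := curve_unit_speed b t; have h3 := normal_orth b t.
apply/eqP; rewrite -(@eqrXn2 _ 2)// !real_normK ?num_real//; apply/eqP.
have d1 := orthonormal_decomposition (1, 0) h1 h2 h3.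
have d2 := orthonormal_decomposition (0, 1) h1 h2 h3.
move: (congr1 fst d1) (congr1 snd d1) (congr1 snd d2); rewrite /dot/= => e1 e2 e3.
rewrite fluxE /dcp /dot /dir/=.
set n1 := (n t).1 in e1 e2 e3 *; set n2 := (n t).2 in e1 e2 e3 *.
set t1 := (dc t).1 in e1 e2 e3 *; set t2 := (dc t).2 in e1 e2 e3 *.
have E1 : n1 ^+ 2 = 1 - t1 ^+ 2.
  by apply: (canRL (addrK _)); rewrite [RHS]e1; ring.
have E2 : n1 * n2 = - (t1 * t2).
  by apply/eqP; rewrite -addr_eq0; apply/eqP; rewrite [RHS]e2; ring.
have E3 : n2 ^+ 2 = 1 - t2 ^+ 2.
  by apply: (canRL (addrK _)); rewrite [RHS]e3; ring.
have U : t1 ^+ 2 = 1 - t2 ^+ 2.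
  by move: h2; rewrite /dot -/t1 -/t2 => <-; ring.
transitivity (cos theta ^+ 2 * n1 ^+ 2 + 2 * cos theta * sin theta * (n1 * n2) + sin theta ^+ 2 * n2 ^+ 2).
  by ring.
rewrite E1 E2 E3.
transitivity ((t1 * (- sin theta) + t2 * cos theta) ^+ 2 +
  (cos theta ^+ 2 + sin theta ^+ 2) * (1 - t2 ^+ 2 - t1 ^+ 2)); first by ring.
by rewrite U subrr mulr0 addr0.
Qed.

Lemma measurable_dcp : measurable_fun setT (fun z : T1 * T1 => dcp z.2 z.1).
Proof.
have [_ /continuous_coordinates[d1 d2]] := curve_C1 b.
have m1 := continuous_measurable_fun d1; have m2 := continuous_measurable_fun d2.
apply: measurable_funD; apply: measurable_funM.
- exact: (measurableT_comp m1).
- by apply: measurable_funN; exact: (measurableT_comp (@measurable_sin R)).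
- exact: (measurableT_comp m2).
- exact: (measurableT_comp (@measurable_cos R)).
Qed.

Lemma measurable_flux : measurable_fun setT (flux b : T1 * T1 -> R).
Proof.
rewrite (_ : flux b = fun z => `|dcp z.2 z.1| *
   (\1_[set z | 0 < flux b z] z - \1_[set z | flux b z < 0] z)).
  apply: measurable_funM.
    by apply: measurableT_comp => //; exact: measurable_dcp.
  apply: measurable_funB; apply: measurable_indic.
    exact: measurable_flux_pos.
  exact: measurable_flux_neg.
apply/funext => -[t theta]; rewrite /= -normr_flux.
have [h|h|h] := ltgtP (fl t theta) 0.
- rewrite indicN ?indicT//=; last by apply/negP; rewrite -leNgt ltW.
  by rewrite ltr0_norm// sub0r mulrN1 opprK.
- rewrite indicT ?indicN//=; last by apply/negP; rewrite -leNgt ltW.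
  by rewrite gtr0_norm// subr0 mulr1.
- by rewrite h normr0 mul0r.
Qed.

Lemma flux_bound z : `|flux b z| <= 1.
Proof.
case: z => t theta; have h1 := normal_unit b t; have h2 := cos2Dsin2 theta.
rewrite -(@ler_pXn2r _ 2)// ?nnegrE// expr1n real_normK ?num_real// fluxE.
rewrite -subr_ge0 (_ : 1 - _ = (cos theta * (n t).2 - sin theta * (n t).1) ^+ 2) ?sqr_ge0//.
rewrite -[X in X - _ = _]mulr1 -{1}h1 -h2 /dot /dir/=; ring.
Qed.

Local Open Scope ereal_scope.

(** On the open arc of incoming parameters the map [t -> cp theta (c t)] is injective, since [tin]
    inverts it, and its Jacobian is the flux. Opening the arc at 0 loses only the line through
    [c 0]. *)
Lemma enter_lines theta (F : T1 -> \bar R) : measurable_fun setT F -> (forall t, 0 <= F t) ->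
  \int[mu]_t (F t * (\1_`[0%R, len b[ t * \1_[set t | (fl t theta < 0)%R] t * `|fl t theta|)%:E) =
  \int[mu]_p (F (tin theta p) * (\1_[set p | meets theta p] p)%:E).
Proof.
move=> mF F0.
pose T := [set t : R | (0 < t < len b)%R /\ (fl t theta < 0)%R].
have oT : open T.
  rewrite (_ : T = `]0%R, len b[%classic `&` [set t | (fl t theta < 0)%R]); last first.
    by apply/seteqP; split => t /=; rewrite in_itv.
  apply: openI; first exact: interval_open.
  rewrite openE => t /= /flux_neg_enter[s s0 Os].
  have [oO _ _ _] := OB.
  have cf : continuous (fun u => ((c u).1 + s * cos theta, (c u).2 + s * sin theta)%R : R * R).
    move=> u.
    have [c1 c2] := continuous_coordinates curve_continuous.
    have h1 : ((c u).1 + s * cos theta)%R @[u --> u] --> ((c u).1 + s * cos theta)%R.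
      by apply: cvgD; [exact: c1|exact: cvg_cst].
    have h2 : ((c u).2 + s * sin theta)%R @[u --> u] --> ((c u).2 + s * sin theta)%R.
      by apply: cvgD; [exact: c2|exact: cvg_cst].
    exact: (cvg_pair h1 h2).
  have h0 : nbhs t [set u : R | Omega ((c u).1 + s * cos theta, (c u).2 + s * sin theta)%R].
    exact: (cf t _ (open_nbhs_nbhs (conj oO Os))).
  rewrite /interior; apply: (@filterS _ _ (nbhs_filter t) _ _ _ h0) => u /= h.
  by apply/flux_neg_enter; exists s.
pose pp (t : R) : R := ((c t).1 * (- sin theta) + (c t).2 * cos theta)%R.
have ppE t : pp t = cp theta (c t) by rewrite /pp /cp; ring.
have mpp : measurable_fun setT pp.
  by apply: continuous_measurable_fun; exact: continuous_linear_curve.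
have mdp : measurable_fun setT (dcp theta).
  by apply: continuous_measurable_fun; exact: continuous_linear_dcurve.
have inj (t u : R) : T t -> T u -> pp t = pp u -> t = u.
  move=> [/andP[t0 tl] tf] [/andP[u0 ul] uf]; rewrite !ppE => e.
  have t0' : (0 <= t < len b)%R by rewrite ltW.
  have u0' : (0 <= u < len b)%R by rewrite ltW.
  by have [_ <-] := tin_curve t0' tf; have [_ <-] := tin_curve u0' uf; rewrite e.
pose F' (p : T1) := F (tin theta p) * (\1_[set p | meets theta p] p)%:E.
have mmt : measurable [set p : T1 | meets theta p].
  have := (@pair1_measurable _ _ T1 T1 theta) measurableT _ (measurable_meets OB).
  by rewrite setTI.
have mF' : measurable_fun setT F'.
  apply: emeasurable_funM; last by apply/measurable_EFinP; exact: measurable_indic.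
  exact: (measurableT_comp mF (measurableT_comp measurable_tin (pair1_measurable theta))).
have F'0 p : 0 <= F' p by rewrite mule_ge0// lee_fin indicE.
have dp t : T t -> is_derive t 1%R pp (dcp theta t).
  by move=> _; exact: is_derive_linear_curve.
have cdp t : T t -> {for t, continuous (dcp theta)}.
  by move=> _; exact: continuous_linear_dcurve.
have dp0 t : T t -> dcp theta t != 0%R.
  by move=> [_ tf]; rewrite -normr_eq0 -normr_flux normr_eq0 lt_eqF.
have := cov_open_ge0 oT mpp mdp dp cdp dp0 inj mF' F'0.
have mT : measurable (T : set T1) by exact: open_measurable.
have [mpT _] := cov_open oT mpp mdp dp cdp dp0 inj.
have -> : \int[mu]_(x in [set pp t | t in T]) F' x = \int[mu]_x F' x.
  rewrite integral_mkcond; apply: ge0_ae_eq_integral => //.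
  - by apply/(measurable_restrictT _ _).1 => //; exact: measurable_funTS.
  - by move=> x _; rewrite patchE; case: ifP.
  exists [set pp 0%R]; split; [exact: measurable_set1|exact: lebesgue_measure_set1|].
  move=> p /= /not_implyP[_ h]; apply: contrapT => pp0; apply: h; rewrite patchE.
  case: ifPn => // /negP pT; rewrite /F' indicE.
  have [mt|nmt] := pselect (meets theta p); last first.
    by rewrite memNset ?mule0.
  case: pT; rewrite inE; exists (tin theta p); last first.
    by rewrite ppE curve_tin// cp_pt.
  have /andP[t0 tl] := tin_range theta p; split; last exact: flux_tin.
  rewrite tl andbT lt_def t0 andbT; apply/eqP => e0; apply: pp0.
  by rewrite -e0 ppE curve_tin// cp_pt.
move=> <-; rewrite [RHS]integral_mkcond.
have mfl : measurable_fun setT (fun t : T1 => fl t theta).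
  exact: (measurableT_comp measurable_flux (pair2_measurable theta)).
have mfn : measurable [set t : T1 | (fl t theta < 0)%R].
  have := (@pair2_measurable _ _ T1 T1 theta) measurableT _ measurable_flux_neg.
  by rewrite setTI.
have k0 t : (0 <= \1_`[0%R, len b[ t * \1_[set t | (fl t theta < 0)%R] t * `|fl t theta|)%R.
  by rewrite !mulr_ge0// indicE.
apply: ge0_ae_eq_integral => //.
- apply: emeasurable_funM => //; apply/measurable_EFinP.
  apply: measurable_funM; last exact: measurableT_comp.
  by apply: measurable_funM; exact: measurable_indic.
- apply/(measurable_restrictT _ _).1 => //; apply: measurable_funTS.
  apply: emeasurable_funM.
    exact: (measurableT_comp mF').
  by apply/measurable_EFinP; exact: measurableT_comp.
- by move=> t _; rewrite mule_ge0// lee_fin.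
- by move=> t _; rewrite patchE; case: ifP => // _; rewrite mule_ge0// lee_fin.
exists [set 0%R]; split; [exact: measurable_set1|exact: lebesgue_measure_set1|].
move=> t /= /not_implyP[_ h]; apply: contrapT => /eqP t0; apply: h; rewrite patchE.
case: ifPn => [|/negP nT].
  rewrite inE => -[/andP[t0' tl] tf].
  have t0'' : (0 <= t < len b)%R by rewrite ltW.
  have [mt e] := tin_curve t0'' tf.
  by rewrite /F' ppE e !indicE !mem_set//= ?mul1r ?mule1 ?normr_flux//.
rewrite !indicE; have [tl|ntl] := boolP (t \in `[0%R, len b[%classic); last by rewrite !mul0r mule0.
have [tf|ntf] := pselect (fl t theta < 0)%R; last by rewrite memNset// mulr0 mul0r mule0.
case: nT; rewrite inE; split => //; move: tl; rewrite inE/= in_itv/= => /andP[t0' ->].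
by rewrite andbT lt_def t0.
Qed.

Lemma exit_lines theta (F : T1 -> \bar R) : measurable_fun setT F -> (forall t, 0 <= F t) ->
  \int[mu]_t (F t * (\1_`[0%R, len b[ t * \1_[set t | (0 < fl t theta)%R] t * `|fl t theta|)%:E) =
  \int[mu]_p (F (tout theta p) * (\1_[set p | meets theta p] p)%:E).
Proof.
move=> mF F0; have := enter_lines (theta + pi) mF F0.
under eq_integral do rewrite flux_opp normrN.
rewrite (_ : [set t | (fl t (theta + pi) < 0)%R] = [set t | (0 < fl t theta)%R]); last first.
  by apply/seteqP; split => t /=; rewrite flux_opp oppr_lt0.
move=> ->.
have mmt : measurable [set p : T1 | meets (theta + pi) p].
  have := (@pair1_measurable _ _ T1 T1 (theta + pi)%R) measurableT _ (measurable_meets OB).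
  by rewrite setTI.
rewrite -[LHS]leb_opp.
- apply: eq_integral => p _; rewrite tout_tin !indicE; congr (_ * ((nat_of_bool _)%:R)%:E).
  by have [h1 h2] := meets_opp Omega theta p; apply/idP/idP; rewrite !inE; (exact: h1 || exact: h2).
- apply: emeasurable_funM; last by apply/measurable_EFinP; exact: measurable_indic.
  exact: (measurableT_comp mF (measurableT_comp measurable_tin (pair1_measurable _))).
- by move=> p; rewrite mule_ge0// lee_fin indicE.
Qed.

End boundary_lines.


(** * Absolutely continuous functions on a segment *)

Section line_absolute_continuity.
Context (R : realType).
Notation mu := (@lebesgue_measure R).
Notation T1 := (measurableTypeR R).
Implicit Types (f g : T1 -> R) (a b s r q : R).

Lemma itv_finite a b : (mu `[a, b] < +oo)%E.
Proof. by rewrite lebesgue_measure_itv/=; case: ifP => _; rewrite ?ltry// -EFinB ltry. Qed.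

Lemma ico_finite a b : (mu `[a, b[ < +oo)%E.
Proof. by rewrite lebesgue_measure_itv/=; case: ifP => _; rewrite ?ltry// -EFinB ltry. Qed.

Lemma fine_mu_itv a b : a <= b -> fine (mu `[a, b]) = b - a.
Proof.
rewrite le_eqVlt => /predU1P[->|ab]; first by rewrite set_itv1 lebesgue_measure_set1 subrr.
by rewrite lebesgue_measure_itv/= lte_fin ab.
Qed.

Definition lac a b f f' :=
  [/\ bmo `[a, b] f, bmo `[a, b] f' &
      forall s, a <= s <= b -> f s = f a + \int[mu]_(r in `[a, s]) f' r].

Lemma Rint_itv_split a s r f : a <= r <= s -> bmo `[a, s] f ->
  \int[mu]_(q in `[a, s]) f q = \int[mu]_(q in `[a, r]) f q + \int[mu]_(q in `[r, s]) f q.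
Proof.
move=> /andP[ar rs] bf.
have i1 : mu.-integrable `[a, s] (EFin \o f).
  by apply: bmo_integrable => //; exact: itv_finite.
have := Rintegral_itvB (x := r) i1; rewrite !bnd_simp => /(_ ar rs) E.
rewrite -[X in _ = _ + X]Rintegral_itv_obnd_cbnd; first by rewrite -E; ring.
apply: integrableS i1 => //.
by apply: subset_itvr; rewrite bnd_simp.
Qed.

(* Both sides are integrals over the square, split along its diagonal. *)
Lemma Rint_primitive_mul a s f g : a <= s -> bmo `[a, s] f -> bmo `[a, s] g ->
  \int[mu]_(r in `[a, s]) (f r * (\int[mu]_(q in `[a, r]) g q) +
                           (\int[mu]_(q in `[a, r]) f q) * g r) =
  (\int[mu]_(r in `[a, s]) f r) * (\int[mu]_(r in `[a, s]) g r).
Proof.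
move=> as_ bf bg; pose D : set T1 := `[a, s]%classic.
have mD : measurable D by exact: measurable_itv.
have fD : (mu D < +oo)%E by exact: itv_finite.
have le_meas : measurable [set z : T1 * T1 | z.2 <= z.1].
  have := @measurable_fun_ler _ _ R setT (fun z : T1 * T1 => z.2) (fun z => z.1)
    measurable_snd measurable_fst measurableT [set true] _.
  by rewrite setTI; apply.
have bmo1 (h : T1 -> R) : bmo D h -> bmo (D `*` D) (fun z : T1 * T1 => h z.1).
  by move=> bh; apply: (bmo_comp bh) => // z [].
have bmo2 (h : T1 -> R) : bmo D h -> bmo (D `*` D) (fun z : T1 * T1 => h z.2).
  by move=> bh; apply: (bmo_comp bh) => // z [].
pose lw (r q : T1) : R := \1_[set z : T1 * T1 | z.2 <= z.1] (r, q).
have blw : bmo (D `*` D) (fun z : T1 * T1 => lw z.1 z.2).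
  rewrite (_ : (fun z => _) = fun z : T1 * T1 => \1_[set z : T1 * T1 | z.2 <= z.1] z).
    exact: bmo_indic.
  by apply/funext => -[].
have prim (h : T1 -> R) (r : R) : D r ->
    \int[mu]_(q in `[a, r]) h q = \int[mu]_(q in D) (lw r q * h q).
  rewrite /D/= in_itv/= => /andP[ar rs].
  rewrite (_ : `[a, r]%classic = D `&` [set q | q <= r]); last first.
    apply/seteqP; split => q; rewrite /D/= !in_itv/=; first by move=> /andP[-> qr]; rewrite (le_trans qr).
    by move=> [/andP[-> _]].
  rewrite Rint_restrictI; apply: eq_Rintegral => q _; congr (_ * _).
have bprim (h : T1 -> R) : bmo D h -> bmo D (fun r => \int[mu]_(q in D) (lw r q * h q)).
  move=> bh; apply: (bmo_Rint mD fD (f := fun r q => lw r q * h q)).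
  by apply: bmoM => //; exact: bmo2.
transitivity (\int[mu]_(r in D) (f r * (\int[mu]_(q in D) (lw r q * g q)) +
                           (\int[mu]_(q in D) (lw r q * f q)) * g r)).
  by apply: eq_Rintegral => r /set_mem rD; rewrite (prim g _ rD) (prim f _ rD).
rewrite (RintD mD fD); [|exact: bmoM (bprim _ _)|exact: bmoM (bprim _ _) _].
have fgb : bmo (D `*` D) (fun z : T1 * T1 => lw z.1 z.2 * f z.2 * g z.1).
  by apply: bmoM; [apply: bmoM => //; exact: bmo2|exact: bmo1].
have pair1 (F : T1 -> T1 -> R) r : D r -> bmo (D `*` D) (fun z => F z.1 z.2) -> bmo D (F r).
  move=> Dr bF; by apply: (bmo_comp bF (pair1_measurable r)) => q Dq.
have E2 : \int[mu]_(r in D) ((\int[mu]_(q in D) (lw r q * f q)) * g r) =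
    \int[mu]_(q in D) (f q * \int[mu]_(r in D) (lw r q * g r)).
  transitivity (\int[mu]_(r in D) \int[mu]_(q in D) (lw r q * f q * g r)).
    apply: eq_Rintegral => r /set_mem rD; rewrite mulrC -(RintZ mD fD).
      by apply: eq_Rintegral => q _; ring.
    by apply: bmoM bf; exact: (pair1 lw).
  rewrite (Rint_swap mD mD fD fD (f := fun r q => lw r q * f q * g r))//.
  apply: eq_Rintegral => q /set_mem qD; rewrite -(RintZ mD fD).
    by apply: eq_Rintegral => r _; ring.
  apply: bmoM bg; by apply: (bmo_comp blw (pair2_measurable q)) => r Dr.
rewrite E2 -(RintD mD fD); last 2 first.
- exact: bmoM (bprim _ _).
- apply: bmoM => //.
  apply: (bmo_Rint mD fD (f := fun q r => lw r q * g r)).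
  apply: bmoM; last exact: bmo2.
  apply: (bmo_comp (g := fun z : T1 * T1 => (z.2, z.1)) blw).
    exact: measurable_fun_pair.
  by move=> z [].
transitivity (\int[mu]_(r in D) ((\int[mu]_(q in D) g q) * f r)); last first.
  by rewrite (RintZ mD fD)// mulrC.
apply: eq_Rintegral => r /set_mem rD; rewrite -mulrDr mulrC; congr (_ * _).
rewrite -prim//.
move: rD; rewrite /D/= in_itv/= => ars.
have -> : \int[mu]_(q in D) (lw q r * g q) = \int[mu]_(q in `[r, s]) g q.
  have /andP[ar rs] := ars.
  rewrite (_ : `[r, s]%classic = D `&` [set q | r <= q]); last first.
    apply/seteqP; split => q; rewrite /D/= !in_itv/=; first by move=> /andP[rq ->]; rewrite (le_trans ar).
    by move=> [/andP[_ ->] ->].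
  rewrite Rint_restrictI; apply: eq_Rintegral => q _; congr (_ * _).
by rewrite -(Rint_itv_split ars).
Qed.

(** Expanding both factors around their values at [a] leaves the product of two primitives, which is
    [Rint_primitive_mul]. *)
Lemma lac_mul a b f f' g g' : lac a b f f' -> lac a b g g' ->
  lac a b (fun s => f s * g s) (fun s => f' s * g s + f s * g' s).
Proof.
move=> [bf bf' fE] [bg bg' gE]; split.
- exact: bmoM.
- by apply: bmoD; apply: bmoM.
move=> s /andP[as_ sb].
have sub : `[a, s] `<=` `[a, b] by apply: subset_itvl; rewrite bnd_simp.
have {}bf : bmo (`[a, s] : set T1) f by apply: bmoS bf.
have {}bg : bmo (`[a, s] : set T1) g by apply: bmoS bg.
have {}bf' : bmo (`[a, s] : set T1) f' by apply: bmoS bf'.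
have {}bg' : bmo (`[a, s] : set T1) g' by apply: bmoS bg'.
have mD : measurable (`[a, s] : set T1) by exact: measurable_itv.
have fD := itv_finite a s.
have P := Rint_primitive_mul as_ bf' bg'.
have E : \int[mu]_(r in `[a, s]) (f' r * g r + f r * g' r) =
   g a * \int[mu]_(r in `[a, s]) f' r + f a * \int[mu]_(r in `[a, s]) g' r +
   (\int[mu]_(r in `[a, s]) f' r) * (\int[mu]_(r in `[a, s]) g' r).
  rewrite -P -!(RintZ mD fD)// -(RintD mD fD); [|exact: bmoZ|exact: bmoZ].
  rewrite [RHS]addrC.
  have eqr r : `[a, s]%classic r ->
     f' r * g r + f r * g' r - (g a * f' r + f a * g' r) =
     f' r * (\int[mu]_(q in `[a, r]) g' q) + (\int[mu]_(q in `[a, r]) f' q) * g' r.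
    move=> /=; rewrite in_itv/= => /andP[ar rs].
    by rewrite (fE r) ?ar ?(le_trans rs)// (gE r) ?ar ?(le_trans rs)//; ring.
  have -> : \int[mu]_(r in `[a, s]) (f' r * (\int[mu]_(q in `[a, r]) g' q) +
      (\int[mu]_(q in `[a, r]) f' q) * g' r) =
    \int[mu]_(r in `[a, s]) (f' r * g r + f r * g' r - (g a * f' r + f a * g' r)).
    by apply/esym/eq_Rintegral => r /set_mem; exact: eqr.
  rewrite (RintB mD fD) ?subrK//; first by apply: bmoD; exact: bmoM.
  by apply: bmoD; exact: bmoZ.
rewrite E (fE s) ?as_// (gE s) ?as_//; ring.
Qed.

Lemma lac_primitive a b c f : bmo `[a, b] f -> a <= b ->
  lac a b (fun s => c + \int[mu]_(r in `[a, s]) f r) f.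
Proof.
move=> bf ab.
split => //; last by move=> s /andP[as_ sb]; rewrite set_itv1 Rintegral_set1 addr0.
have [M fM] := bf.2.
apply: (bmo_bd (M := `|c| + M * (b - a))).
  apply: measurable_funD => //.
  pose F (s r : T1) : R := \1_[set z : T1 * T1 | a <= z.2 <= z.1] (s, r) * f r.
  have mset : measurable [set z : T1 * T1 | a <= z.2 <= z.1].
    rewrite (_ : [set z | _] = [set z : T1 * T1 | a <= z.2] `&` [set z : T1 * T1 | z.2 <= z.1]).
      apply: measurableI.
        have := @measurable_fun_ler _ _ R setT (fun z : T1 * T1 => a) (fun z => z.2)
          (measurable_cst _) measurable_snd measurableT [set true] _.
        by rewrite setTI; apply.
      have := @measurable_fun_ler _ _ R setT (fun z : T1 * T1 => z.2) (fun z => z.1)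
        measurable_snd measurable_fst measurableT [set true] _.
      by rewrite setTI; apply.
    by apply/seteqP; split => z /= => [/andP[]|[-> ->]].
  have mF : measurable_fun setT (fun z : T1 * T1 => F z.1 z.2).
    rewrite /F; apply: measurable_funM.
      rewrite (_ : (fun z => _) = fun z : T1 * T1 => \1_[set z : T1 * T1 | a <= z.2 <= z.1] z).
        exact: measurable_indic.
      by apply/funext => -[].
    exact: (measurableT_comp bf.1).
  have := Rint_param_meas mu (@measurableT _ T1) mF.
  congr (measurable_fun _ _); apply/funext => s.
  rewrite /F [RHS]Rint_restrict; apply: eq_Rintegral => r _; congr (_ * _).
move=> s /=; rewrite in_itv/= => /andP[as_ sb].
rewrite (le_trans (ler_normD _ _))// lerD2l.
have := @Rint_bound _ T1 R mu `[a, s]%classic (measurable_itv _) (itv_finite _ _) f M.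
have sub : `[a, s] `<=` `[a, b] by apply: subset_itvl; rewrite bnd_simp.
move=> /(_ (bmoS sub bf)) H; apply: le_trans (H _) _; first by move=> x /sub; exact: fM.
rewrite fine_mu_itv// ler_wpM2l//; last by lra.
by apply: le_trans (normr_ge0 _) (fM a _); rewrite /= in_itv/= lexx ab.
Qed.

Lemma lac_C1 a b f f' : a <= b -> measurable_fun setT f -> measurable_fun setT f' ->
  (forall t, a <= t <= b -> is_derive t 1 f (f' t)) ->
  (forall t, a <= t <= b -> {for t, continuous f'}) -> lac a b f f'.
Proof.
move=> ab mf mf' df cf'.
have bounded (h : R -> R) : (forall t, a <= t <= b -> {for t, continuous h}) ->
    exists M, forall t, `[a, b]%classic t -> `|h t| <= M.
  move=> ch; have cw : {within `[a, b], continuous (fun t => `|h t|)}.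
    apply: continuous_in_subspaceT => t; rewrite inE/= in_itv/= => tab.
    by apply: (continuous_comp (ch t tab)); exact: norm_continuous.
  have [c _ hc] := EVT_max ab cw; exists `|h c| => t; exact: hc.
have cf t : a <= t <= b -> {for t, continuous f}.
  by move=> /df[+ _]; move/derivable1_diffP; exact: differentiable_continuous.
split; [by split => //; exact: bounded|by split => //; exact: bounded|].
move=> s /andP[as_ sb].
have df_s t : a <= t <= s -> is_derive t 1 f (f' t).
  by move=> /andP[t1 t2]; apply: df; rewrite t1 (le_trans t2).
have cf_s t : a <= t <= s -> {for t, continuous f'}.
  by move=> /andP[t1 t2]; apply: cf'; rewrite t1 (le_trans t2).
by rewrite /Rintegral (FTC_segment as_ df_s cf_s)/= addrC subrK.
Qed.

Lemma lac_ext a b f f' g g' : bmo `[a, b] f -> bmo `[a, b] f' ->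
  (forall s, a <= s <= b -> f s = g s) -> (forall s, a <= s <= b -> f' s = g' s) ->
  lac a b g g' -> lac a b f f'.
Proof.
move=> bf bf' fg fg' [_ _ gE]; split => // s sab; move: (sab) => /andP[as_ sb].
rewrite !fg ?lexx ?(le_trans as_)// gE//; congr (_ + _).
apply: eq_Rintegral => r /set_mem/=; rewrite in_itv/= => /andP[ar rs].
by rewrite fg'// ar (le_trans rs).
Qed.

Lemma lac_exp a b c k : a <= b ->
  lac a b (fun s => expR (k * (s - c))) (fun s => k * expR (k * (s - c))).
Proof.
move=> ab.
have dE (t : R) : is_derive t 1 (fun s : R => expR (k * (s - c))) (k * expR (k * (t - c))).
  have d1 : is_derive t 1 (fun s : R => k * (s - c)) k.
    have h := is_deriveZ k (is_deriveB (is_derive_id t 1) (is_derive_cst c t 1)).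
    by apply: (is_derive_eq h); rewrite subr0 /GRing.scale/= mulr1.
  have := @is_derive1_comp R expR (fun s : R => k * (s - c)) t _ _ (is_derive_expR _) d1.
  by move=> h; apply: (is_derive_eq h); rewrite mulrC.
have cE : continuous (fun s : R => expR (k * (s - c))).
  move=> t; have [+ _] := dE t; move/derivable1_diffP; exact: differentiable_continuous.
have cE' : continuous (fun s : R => k * expR (k * (s - c))).
  by move=> t; apply: cvgM; [exact: cvg_cst|exact: cE].
exact: (lac_C1 ab (continuous_measurable_fun cE) (continuous_measurable_fun cE')
  (fun t _ => dE t) (fun t _ => cE' t)).
Qed.

Lemma Rint_exp a b e : a <= b -> 0 < e ->
  \int[mu]_(r in `[a, b]) (e^-1 * expR (e^-1 * (r - a))) = expR (e^-1 * (b - a)) - 1.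
Proof.
move=> ab e0; have [_ _ /(_ b)] := lac_exp a e^-1 ab.
rewrite ab lexx => /(_ isT) ->; rewrite subrr mulr0 expR0; ring.
Qed.

End line_absolute_continuity.

Lemma Rint_eq0 d (T : measurableType d) (R : realType) (m : {measure set T -> \bar R})
    (D : set T) (f : T -> R) :
  (forall x, D x -> f x = 0) -> \int[m]_(x in D) f x = 0.
Proof. by move=> H; rewrite /Rintegral integral0_eq// => x Dx; rewrite H. Qed.

(** * Integrals over phase space and over the boundary as integrals over lines *)

Section integrals_over_lines.
Context (R : realType) (Omega : set (R * R)) (d : R) (OB : cbody Omega d)
        (b : boundary_data Omega).
Notation T1 := (measurableTypeR R).
Notation mu := (@lebesgue_measure R).
Notation c := (curve b).
Notation meets := (meets Omega).
Notation chord := (chord Omega).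
Notation si := (si Omega).
Notation so := (so Omega).
Implicit Types (t u theta p s r : R) (x y : R * R).

Definition lines : set (T1 * T1) := [set y | angles y.1 /\ meets y.1 y.2].

Definition body_closure : set (R * R) := Omega `|` frontier Omega.
Definition clph : set (T1 * T1 * T1) := [set z | body_closure z.1].
Definition Gamma_plus : set (T1 * T1) := [set z | Gamma b z /\ 0 < flux b z].

Lemma angles_measurable : measurable (@angles R : set T1).
Proof. exact: measurable_itv. Qed.

Lemma angles_finite : (mu (@angles R) < +oo)%E.
Proof. exact: ico_finite. Qed.

Lemma lines_measurable : measurable lines.
Proof.
apply: measurableI; last exact: measurable_meets OB.
have := @measurable_fst _ _ T1 T1 measurableT _ angles_measurable.
by rewrite setTI.
Qed.

Definition lines_box : set (T1 * T1) := @angles R `*` `[- (2 * d), 2 * d]%classic.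

Lemma lines_sub_box : lines `<=` lines_box.
Proof.
move=> [theta p] [/= ath [s /(chord_bound OB)[_]]]; rewrite ler_norml => h.
by split => //=; rewrite in_itv.
Qed.

Lemma leb2_rect_finite (A B : set T1) : measurable A -> measurable B ->
  (mu A < +oo)%E -> (mu B < +oo)%E -> (@leb2 R (A `*` B) < +oo)%E.
Proof.
by move=> mA mB A0 B0; rewrite [ltLHS]product_measure1E// lte_mul_pinfty// ge0_fin_numE.
Qed.

Lemma leb3_rect_finite (A : set (T1 * T1)) (B : set T1) : measurable A -> measurable B ->
  (@leb2 R A < +oo)%E -> (mu B < +oo)%E -> (@leb3 R (A `*` B) < +oo)%E.
Proof.
move=> mA mB A0 B0; rewrite [ltLHS](@product_measure1E _ _ _ _ R (@leb2 R) mu)//.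
by rewrite lte_mul_pinfty// ge0_fin_numE.
Qed.

Lemma lines_finite : (@leb2 R lines < +oo)%E.
Proof.
have mI : measurable (`[- (2 * d), 2 * d]%classic : set T1) by exact: measurable_itv.
apply: (@le_lt_trans _ _ (@leb2 R lines_box)).
  apply: le_measure; rewrite ?inE; [exact: lines_measurable| |exact: lines_sub_box].
  by apply: measurableX => //; exact: angles_measurable.
by apply: leb2_rect_finite => //; [exact: angles_measurable|exact: angles_finite|exact: itv_finite].
Qed.

Lemma body_box : Omega `<=` `[- d, d]%classic `*` `[- d, d]%classic.
Proof.
by case: OB => _ _ _ bO x /bO[]; rewrite !ler_norml => h1 h2; split => /=; rewrite in_itv.
Qed.

Lemma body_finite : (@leb2 R Omega < +oo)%E.
Proof.
have mI : measurable (`[- d, d]%classic : set T1) by exact: measurable_itv.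
apply: (@le_lt_trans _ _ (@leb2 R (`[- d, d]%classic `*` `[- d, d]%classic))).
  by apply: le_measure; rewrite ?inE; [exact: body_measurable OB|exact: measurableX|exact: body_box].
by apply: leb2_rect_finite => //; exact: itv_finite.
Qed.

Lemma phase_measurable : measurable (phase Omega : set (T1 * T1 * T1)).
Proof. by apply: measurableX; [exact: body_measurable OB|exact: angles_measurable]. Qed.

Lemma phase_finite : (@leb3 R (phase Omega) < +oo)%E.
Proof.
apply: leb3_rect_finite; [exact: body_measurable OB|exact: angles_measurable|exact: body_finite|].
exact: angles_finite.
Qed.

Lemma bmo_flux D : bmo D (flux b : T1 * T1 -> R).
Proof.
by apply: (bmo_bd (M := 1)); [exact: measurable_flux OB b|move=> z _; exact: flux_bound].
Qed.

Lemma Gamma_measurable : measurable (Gamma b : set (T1 * T1)).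
Proof. by apply: measurableX; [exact: measurable_itv|exact: angles_measurable]. Qed.

Lemma Gamma_finite : (@leb2 R (Gamma b) < +oo)%E.
Proof.
by apply: leb2_rect_finite => //; [exact: angles_measurable|exact: ico_finite|exact: angles_finite].
Qed.

Lemma Gamma_minus_measurable : measurable (Gamma_minus b : set (T1 * T1)).
Proof. by apply: measurableI; [exact: Gamma_measurable|exact: measurable_flux_neg OB b]. Qed.

Lemma Gamma_plus_measurable : measurable (Gamma_plus : set (T1 * T1)).
Proof. by apply: measurableI; [exact: Gamma_measurable|exact: measurable_flux_pos OB b]. Qed.

Lemma finite_sub (A B : set (T1 * T1)) : measurable A -> measurable B -> A `<=` B ->
  (@leb2 R B < +oo)%E -> (@leb2 R A < +oo)%E.
Proof. by move=> mA mB AB; apply: le_lt_trans; apply: le_measure; rewrite ?inE. Qed.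

Lemma Gamma_minus_finite : (@leb2 R (Gamma_minus b) < +oo)%E.
Proof.
apply: (finite_sub Gamma_minus_measurable Gamma_measurable _ Gamma_finite).
by move=> z [].
Qed.

(** A bounded box around all chords makes Fubini available. The closed chord replaces the open one
    at the cost of two points on each line, so that later primitives start at the entry point. *)
Lemma Rint_phase_lines (F : T1 * T1 * T1 -> R) : bmo (phase Omega) F ->
  \int[@leb3 R]_(z in phase Omega) F z =
  \int[@leb2 R]_(y in lines) \int[mu]_(s in `[si y.1 y.2, so y.1 y.2])
    F (pt y.1 y.2 s, y.1).
Proof.
move=> bF.
have mI : measurable (`[- (2 * d), 2 * d]%classic : set T1) by exact: measurable_itv.
have mbox : measurable lines_box by apply: measurableX => //; exact: angles_measurable.
have fbox : (@leb2 R lines_box < +oo)%E.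
  by apply: leb2_rect_finite => //; [exact: angles_measurable|exact: angles_finite|exact: itv_finite].
pose psi (y : T1 * T1 * T1) : T1 * T1 * T1 := (pt y.1.1 y.1.2 y.2, y.1.1).
have mpsi : measurable_fun setT psi.
  by rewrite /psi /pt; mfun.
pose G (y : T1 * T1 * T1) := \1_(phase Omega) (psi y) * F (psi y).
have bphF : bmo setT (fun z => \1_(phase Omega) z * F z).
  have [mF [M FM]] := bF.
  apply: (bmo_bd (M := `|M|)).
    by apply: measurable_funM => //; apply: measurable_indic; exact: phase_measurable.
  move=> z _; have [h|h] := pselect (phase Omega z).
    by rewrite indicT// mul1r (le_trans (FM _ h))// ler_norm.
  by rewrite indicN// mul0r normr0.
have bG : bmo setT G by apply: (bmo_comp bphF).
have -> : \int[@leb3 R]_(z in phase Omega) F z = \int[@leb3 R]_y (G y * 1).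
  rewrite Rint_restrict; transitivity (\int[@leb3 R]_z (\1_(phase Omega) z * F z * 1)).
    by apply: eq_Rintegral => z _; rewrite mulr1.
  rewrite (@Rint_transfer _ _ _ _ R (@leb3 R) (@leb3 R) psi (fun=> 1) (fun=> 1))//; last exact: bphF.1.
  move=> H mH H0; transitivity (\int[@leb3 R]_z H z)%E.
    by apply: eq_integral => z _; rewrite mule1.
  by rewrite leb3_lines//; apply: eq_integral => z _; rewrite mule1.
have GE (y : T1 * T1) : \int[mu]_(s in `[- (2 * d), 2 * d]) G (y, s) =
    \1_lines y * \int[mu]_(s in `[si y.1 y.2, so y.1 y.2]) F (pt y.1 y.2 s, y.1).
  have [ly|ly] := pselect (lines y); last first.
    rewrite indicN// mul0r; apply: Rint_eq0 => s _; rewrite /G indicN ?mul0r// => -[/= Oy ay]; apply: ly.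
    by split => //; exists s.
  rewrite indicT// mul1r; have [ay mt] := ly.
  have sub : `]si y.1 y.2, so y.1 y.2[ `<=` `[- (2 * d), 2 * d].
    move=> s; rewrite /= in_itv/= => /(chordP OB _ mt)/(chord_bound OB)[].
    by rewrite ler_norml in_itv.
  have bFl : bmo (`]si y.1 y.2, so y.1 y.2[ : set T1) (fun s => F (pt y.1 y.2 s, y.1)).
    apply: (bmo_comp bF); first by rewrite /pt; mfun.
    move=> s; rewrite /= in_itv/= => h; split => //=.
    by rewrite -/(chord y.1 y.2 s); apply/(chordP OB).
  transitivity (\int[mu]_(s in `]si y.1 y.2, so y.1 y.2[) F (pt y.1 y.2 s, y.1)).
    rewrite -{1}(setIidr sub) Rint_restrictI; apply: eq_Rintegral => s _.
    rewrite /G; congr (_ * _); rewrite !indicE; congr (nat_of_bool _)%:R.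
    apply/idP/idP; rewrite !inE/= in_itv/=.
      by move=> [/= h _]; apply/(chordP OB).
    by move=> h; split => //=; rewrite -/(chord y.1 y.2 s); apply/(chordP OB).
  have mFl : measurable_fun setT (fun s : T1 => (F (pt y.1 y.2 s, y.1))%:E).
    by apply/measurable_EFinP; apply: (measurableT_comp bF.1); rewrite /pt; mfun.
  rewrite /Rintegral integral_itv_obnd_cbnd; last exact: measurable_funTS.
  by rewrite integral_itv_bndo_bndc//; exact: measurable_funTS.
transitivity (\int[@leb3 R]_(y in lines_box `*` `[- (2 * d), 2 * d]) G y).
  rewrite [RHS]Rint_restrict; apply: eq_Rintegral => y _; rewrite mulr1.
  have [h|h] := pselect (phase Omega (psi y)); last first.
    by rewrite /G indicN// mul0r mulr0.
  rewrite [X in X * _]indicT ?mul1r//; case: h => /= h1 h2.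
  have [] := chord_bound OB (h1 : chord y.1.1 y.1.2 y.2).
  by rewrite !ler_norml => h3 h4; split; [split => //=|]; rewrite /= in_itv.
have := Rint_prod mbox mI fbox (itv_finite _ _) (f := fun y s => G (y, s)).
have -> : (fun z : T1 * T1 * T1 => G (z.1, z.2)) = G by apply/funext => -[].
move=> H; rewrite [RHS]Rint_restrict.
transitivity (\int[@leb3 R]_(z in lines_box `*` `[- (2 * d), 2 * d]) G (z.1, z.2)).
  by apply: eq_Rintegral => -[].
rewrite /leb3 H; last exact: bmoS bG.
under eq_Rintegral do rewrite GE.
rewrite [LHS]Rint_restrict; apply: eq_Rintegral => y _.
have [h|h] := pselect (lines y); last by rewrite (indicN R h) !mul0r mulr0.
by rewrite (indicT R h) (indicT R (lines_sub_box h)) !mul1r.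
Qed.

(** Common form of the incoming and outgoing cases: [tx] will be [tin] or [tout] and [A] the
    corresponding sign of the flux. *)
Lemma Rint_Gamma_lines (A : set (T1 * T1)) (tx : R -> R -> R) (F : T1 * T1 -> R) :
  measurable A -> measurable_fun setT (fun y : T1 * T1 => tx y.1 y.2) ->
  (forall theta (H : T1 -> \bar R), measurable_fun setT H -> (forall t, 0 <= H t)%E ->
    (\int[mu]_t (H t * (\1_`[0%R, len b[ t * \1_[set t | A (t, theta)] t *
       `|flux b (t, theta)|)%:E) =
     \int[mu]_p (H (tx theta p) * (\1_[set p | meets theta p] p)%:E))%E) ->
  measurable_fun setT F ->
  \int[@leb2 R]_(z in Gamma b `&` A) (F z * `|flux b z|) =
  \int[@leb2 R]_(y in lines) F (tx y.1 y.2, y.1).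
Proof.
move=> mA mtx cov mF.
pose psi (y : T1 * T1) : T1 * T1 := (tx y.1 y.2, y.1).
have mpsi : measurable_fun setT psi by rewrite /psi; mfun.
have mfl := measurable_flux OB b.
pose k1 (z : T1 * T1) : R := \1_(Gamma b `&` A) z * `|flux b z|.
pose k2 (y : T1 * T1) : R := \1_lines y.
have mk1 : measurable_fun setT k1.
  apply: measurable_funM; last exact: measurableT_comp.
  by apply: measurable_indic; apply: measurableI => //; exact: Gamma_measurable.
have mk2 : measurable_fun setT k2 by apply: measurable_indic; exact: lines_measurable.
have k10 z : 0 <= k1 z by rewrite mulr_ge0// indicE.
have k20 y : 0 <= k2 y by rewrite /k2 indicE.
transitivity (\int[@leb2 R]_z (F z * k1 z)).
  by rewrite Rint_restrict; apply: eq_Rintegral => z _; rewrite /k1; ring.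
rewrite (@Rint_transfer _ _ _ _ R (@leb2 R) (@leb2 R) psi k1 k2)//.
  by rewrite [RHS]Rint_restrict; apply: eq_Rintegral => y _; rewrite mulrC.
move=> H mH H0.
have mHk1 : measurable_fun setT (fun z => H z * (k1 z)%:E)%E.
  by apply: emeasurable_funM => //; exact/measurable_EFinP.
have mHk2 : measurable_fun setT (fun y => H (psi y) * (k2 y)%:E)%E.
  by apply: emeasurable_funM; [exact: measurableT_comp|exact/measurable_EFinP].
have K1 z : (0 <= H z * (k1 z)%:E)%E by rewrite mule_ge0// lee_fin.
have K2 y : (0 <= H (psi y) * (k2 y)%:E)%E by rewrite mule_ge0// lee_fin.
rewrite (leb2_tonelli2 mHk1 K1) (leb2_tonelli1 mHk2 K2).
apply: eq_integral => theta _.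
have [ath|nath] := pselect (angles theta); last first.
  rewrite !integral0_eq// => t _.
    by rewrite /k2 indicN ?mule0// => -[].
  by rewrite /k1 indicN ?mul0r ?mule0// => -[[]].
have mHt : measurable_fun setT (fun t : T1 => H (t, theta)).
  exact: (measurableT_comp mH (pair2_measurable theta)).
have := cov theta _ mHt (fun=> H0 _).
have -> : (\int[mu]_t (H (t, theta) * (\1_`[0%R, len b[ t *
    \1_[set t | A (t, theta)] t * `|flux b (t, theta)|)%R%:E) =
   \int[mu]_t (H (t, theta) * (k1 (t, theta))%:E))%E.
  apply: eq_integral => t _; congr (_ * (_ * _)%:E)%E; rewrite !indicE -natrM mulnb.
  congr (nat_of_bool _)%:R; apply/idP/idP; rewrite !inE.
    by move=> /andP[]; rewrite !inE.
  by move=> [[h1 h2] h3]; apply/andP; split; rewrite inE.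
move=> ->; apply: eq_integral => p _; congr (_ * (_)%:E)%E.
rewrite /k2 !indicE; congr (nat_of_bool _)%:R; apply/idP/idP; rewrite !inE/=.
  by move=> h; split.
by case.
Qed.

Lemma Rint_Gamma_minus (F : T1 * T1 -> R) : measurable_fun setT F ->
  \int[@leb2 R]_(z in Gamma_minus b) (F z * `|flux b z|) =
  \int[@leb2 R]_(y in lines) F (tin b y.1 y.2, y.1).
Proof.
apply: Rint_Gamma_lines; first exact: measurable_flux_neg OB b.
  exact: measurable_tin OB b.
by move=> theta H; exact: (enter_lines OB b theta).
Qed.

Lemma Rint_Gamma_plus (F : T1 * T1 -> R) : measurable_fun setT F ->
  \int[@leb2 R]_(z in Gamma_plus) (F z * `|flux b z|) =
  \int[@leb2 R]_(y in lines) F (tout b y.1 y.2, y.1).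
Proof.
apply: Rint_Gamma_lines; first exact: measurable_flux_pos OB b.
  exact: measurable_tout OB b.
by move=> theta H; exact: (exit_lines OB b theta).
Qed.

(** The relation [w . grad f = f'] along characteristics. It is imposed on every line that meets the
    body, not on almost every one. *)
Definition llac (f f' : T1 * T1 * T1 -> R) := forall theta p, meets theta p ->
  lac (si theta p) (so theta p) (fun s => f (pt theta p s, theta))
    (fun s => f' (pt theta p s, theta)).

Lemma llac_mul f f' g g' : llac f f' -> llac g g' ->
  llac (fun z => f z * g z) (fun z => f' z * g z + f z * g' z).
Proof. by move=> lf lg theta p mt; exact: lac_mul (lf _ _ mt) (lg _ _ mt). Qed.

Lemma body_closure_curve t : body_closure (c t).
Proof. by right; exact: curve_frontier. Qed.

Lemma bmo_curve (F : T1 * T1 * T1 -> R) D : bmo clph F ->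
  bmo D (fun z : T1 * T1 => F (c z.1, z.2)).
Proof.
move=> bF; apply: (bmo_comp bF) => [|z _]; last exact: body_closure_curve.
have mc := measurable_curve b.
by apply: measurable_fun_pair; [exact: (measurableT_comp mc)|mfun].
Qed.

(** On each chord the integral of [f'] is the exit value minus the entry value; over all lines these
    become the outgoing and incoming fluxes. *)
Lemma green f f' : bmo clph f -> bmo (phase Omega) f' -> llac f f' ->
  \int[@leb3 R]_(z in phase Omega) f' z =
  \int[@leb2 R]_(z in Gamma_plus) (f (c z.1, z.2) * `|flux b z|) -
  \int[@leb2 R]_(z in Gamma_minus b) (f (c z.1, z.2) * `|flux b z|).
Proof.
move=> bf bf' lf; have bc := bmo_curve setT bf.
rewrite Rint_phase_lines// Rint_Gamma_plus; last exact: bc.1.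
rewrite Rint_Gamma_minus; last exact: bc.1.
have mtin := measurable_tin OB b; have mtout := measurable_tout OB b.
rewrite -(RintB lines_measurable lines_finite); last 2 first.
- by apply: (bmo_comp bc) => //; mfun.
- by apply: (bmo_comp bc) => //; mfun.
apply: eq_Rintegral => -[theta p] /set_mem[/= ath mt].
have [_ _ /(_ (so theta p))] := lf _ _ mt.
rewrite lexx (ltW (si_lt_so OB mt)) => /(_ isT).
by rewrite (curve_tin OB)// (curve_tout OB)// => ->; ring.
Qed.

End integrals_over_lines.

Lemma measurable_le_set d (T : measurableType d) (R : realType) (f g : T -> R) :
  measurable_fun setT f -> measurable_fun setT g -> measurable [set z | f z <= g z].
Proof.
move=> mf mg; have := measurable_fun_ler mf mg measurableT (Y := [set true]) _.
by rewrite setTI; apply.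
Qed.

Lemma measurable_lt_set d (T : measurableType d) (R : realType) (f g : T -> R) :
  measurable_fun setT f -> measurable_fun setT g -> measurable [set z | f z < g z].
Proof.
move=> mf mg; have := measurable_fun_ltr mf mg measurableT (Y := [set true]) _.
by rewrite setTI; apply.
Qed.

(** * Mild solutions of the transport equation with given source and incoming datum *)

Section mild_solution.
Context (R : realType) (Omega : set (R * R)) (d : R) (OB : cbody Omega d)
        (b : boundary_data Omega) (e : R) (e0 : 0 < e).
Notation T1 := (measurableTypeR R).
Notation T3 := (T1 * T1 * T1)%type.
Notation mu := (@lebesgue_measure R).
Notation c := (curve b).
Notation meets := (meets Omega).
Notation chord := (chord Omega).
Notation si := (si Omega).
Notation so := (so Omega).
Implicit Types (t u theta p s r : R) (x y : R * R) (S : T3 -> R).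

(* Solution of [e U' + U = S] along a line, equal to [S] at the entry point. *)
Definition line_sol S theta p s : R := expR (- e^-1 * (s - si theta p)) *
  (S (pt theta p (si theta p), theta) + \int[mu]_(r in `[si theta p, s])
     (e^-1 * expR (e^-1 * (r - si theta p)) * S (pt theta p r, theta))).

Let bexp a a' k r0 : bmo (`[a, a']%classic : set T1) (fun r => expR (k * (r - r0))).
Proof.
have [aa|aa] := leP a a'; first by have [] := lac_exp r0 k aa.
split; first by mfun.
by exists 0 => x; rewrite /= in_itv/= => /andP[h1 h2]; lra.
Qed.

Let bS S theta p D : bmo setT S -> bmo D (fun r : T1 => S (pt theta p r, theta)).
Proof. by move=> bS; apply: (bmo_comp bS) => //; rewrite /pt; mfun. Qed.

Let bkern S theta p a a' : bmo setT S -> bmo (`[a, a']%classic : set T1)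
  (fun r => e^-1 * expR (e^-1 * (r - si theta p)) * S (pt theta p r, theta)).
Proof. by move=> bmS; apply: bmoM; [apply: bmoZ; exact: bexp|exact: bS]. Qed.

Lemma lac_line_sol S theta p : bmo setT S -> meets theta p ->
  lac (si theta p) (so theta p) (line_sol S theta p)
    (fun s => e^-1 * (S (pt theta p s, theta) - line_sol S theta p s)).
Proof.
move=> bmS mt; have h := ltW (si_lt_so OB mt).
have L1 := lac_exp (si theta p) (- e^-1) h.
have L2 := lac_primitive (S (pt theta p (si theta p), theta)) (bkern theta p (si theta p) (so theta p) bmS) h.
have L := lac_mul L1 L2; have [bL bL' _] := L.
have bLS : bmo (`[si theta p, so theta p]%classic : set T1) (line_sol S theta p) by exact: bL.
apply: (lac_ext _ _ _ _ L) => //.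
  by apply: bmoZ; apply: bmoB => //; exact: bS.
move=> s _; rewrite /line_sol.
have E : expR (- e^-1 * (s - si theta p)) * expR (e^-1 * (s - si theta p)) = 1.
  by rewrite -expRD mulNr addNr expR0.
rewrite (_ : expR (- e^-1 * _) * (e^-1 * expR _ * _) = e^-1 * S (pt theta p s, theta) *
   (expR (- e^-1 * (s - si theta p)) * expR (e^-1 * (s - si theta p)))); last by ring.
by rewrite E; ring.
Qed.

Lemma line_sol_si S theta p : line_sol S theta p (si theta p) = S (pt theta p (si theta p), theta).
Proof. by rewrite /line_sol subrr mulr0 expR0 mul1r set_itv1 Rintegral_set1 addr0. Qed.

Lemma line_sol_lin S S' k theta p s : bmo setT S -> bmo setT S' ->
  line_sol (fun z => S z + k * S' z) theta p s =
  line_sol S theta p s + k * line_sol S' theta p s.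
Proof.
move=> b1 b2; rewrite /line_sol.
have mI : measurable (`[si theta p, s]%classic : set T1) by exact: measurable_itv.
have fI := itv_finite (si theta p) s.
have B1 := bkern theta p (si theta p) s b1; have B2 := bkern theta p (si theta p) s b2.
have -> : \int[mu]_(r in `[si theta p, s])
     (e^-1 * expR (e^-1 * (r - si theta p)) * (S (pt theta p r, theta) + k * S' (pt theta p r, theta))) =
  \int[mu]_(r in `[si theta p, s]) (e^-1 * expR (e^-1 * (r - si theta p)) * S (pt theta p r, theta)) +
  k * \int[mu]_(r in `[si theta p, s]) (e^-1 * expR (e^-1 * (r - si theta p)) * S' (pt theta p r, theta)).
  rewrite -(RintZ mI fI)// -(RintD mI fI)//; last exact: bmoZ.
  by apply: eq_Rintegral => r _; ring.
by ring.
Qed.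

Lemma line_sol_cst k theta p s : si theta p <= s -> line_sol (fun=> k) theta p s = k.
Proof.
move=> h; rewrite /line_sol.
have mI : measurable (`[si theta p, s]%classic : set T1) by exact: measurable_itv.
have fI := itv_finite (si theta p) s.
have -> : \int[mu]_(r in `[si theta p, s]) (e^-1 * expR (e^-1 * (r - si theta p)) * k) =
   k * (expR (e^-1 * (s - si theta p)) - 1).
  rewrite -Rint_exp// -(RintZ mI fI); last by apply: bmoZ; exact: bexp.
  by apply: eq_Rintegral => r _; ring.
rewrite (_ : _ * _ = k * (expR (- e^-1 * (s - si theta p)) * expR (e^-1 * (s - si theta p)))); last by ring.
by rewrite -expRD mulNr addNr expR0 mulr1.
Qed.

Lemma line_solE S theta p s : bmo setT S -> line_sol S theta p s =
  expR (- e^-1 * (s - si theta p)) * S (pt theta p (si theta p), theta) +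
  \int[mu]_(r in `[si theta p, s]) (e^-1 * expR (- e^-1 * (s - r)) * S (pt theta p r, theta)).
Proof.
move=> bmS; rewrite /line_sol mulrDr; congr (_ + _).
rewrite -RintZ; [|exact: measurable_itv|exact: itv_finite|exact: bkern].
apply: eq_Rintegral => r _.
rewrite (_ : - e^-1 * (s - r) = - e^-1 * (s - si theta p) + e^-1 * (r - si theta p)); last by ring.
by rewrite expRD; ring.
Qed.

Lemma line_sol_ge0 S theta p s : (forall z, 0 <= S z) -> 0 <= line_sol S theta p s.
Proof.
move=> S0; apply: mulr_ge0; first exact: expR_ge0.
apply: addr_ge0 => //; apply: Rintegral_ge0 => r _.
by rewrite !mulr_ge0 ?expR_ge0// invr_ge0 ltW.
Qed.

(** Maximum principle: the solution operator is linear, positive and fixes constants, so it is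
    applied to [M + S] and [M - S]. *)
Lemma line_sol_bound S theta p s M : bmo setT S -> (forall z, `|S z| <= M) ->
  si theta p <= s -> `|line_sol S theta p s| <= M.
Proof.
move=> bmS SM h; rewrite ler_norml; apply/andP; split.
  have := @line_sol_ge0 (fun z => M + 1 * S z) theta p s.
  rewrite line_sol_lin//; last exact: bmo_cst.
  rewrite line_sol_cst// mul1r; move=> H; rewrite -subr_ge0 opprK addrC; apply: H => z.
  by have := SM z; rewrite ler_norml mul1r => /andP[h1 _]; rewrite -lerBlDl sub0r.
have := @line_sol_ge0 (fun z => M + (-1) * S z) theta p s.
rewrite line_sol_lin//; last exact: bmo_cst.
rewrite line_sol_cst// mulN1r; move=> H; rewrite -subr_ge0; apply: H => z.
by have := SM z; rewrite ler_norml mulN1r subr_ge0 => /andP[_ h1].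
Qed.

Lemma measurable_line_sol S : bmo setT S ->
  measurable_fun setT (fun y : T3 => line_sol S y.1.1 y.1.2 y.2).
Proof.
move=> bmS.
have msi : measurable_fun setT (fun y : T3 => si y.1.1 y.1.2).
  exact: (measurableT_comp (measurable_si OB) measurable_fst).
have mSi : measurable_fun setT (fun y : T3 => S (pt y.1.1 y.1.2 (si y.1.1 y.1.2), y.1.1)).
  by apply: (measurableT_comp bmS.1); rewrite /pt; mfun.
rewrite /line_sol; apply: measurable_funM; first by mfun.
apply: measurable_funD => //.
pose g (y : T3) (r : T1) := \1_[set z : T3 * T1 | si z.1.1.1 z.1.1.2 <= z.2 /\ z.2 <= z.1.2] (y, r) *
  (e^-1 * expR (e^-1 * (r - si y.1.1 y.1.2)) * S (pt y.1.1 y.1.2 r, y.1.1)).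
have mg : measurable_fun setT (fun z : T3 * T1 => g z.1 z.2).
  have msi' : measurable_fun setT (fun y : T3 * T1 => si y.1.1.1 y.1.1.2).
    exact: (measurableT_comp msi measurable_fst).
  apply: measurable_funM.
    rewrite (_ : (fun z => _) = fun z : T3 * T1 => \1_[set z : T3 * T1 | si z.1.1.1 z.1.1.2 <= z.2 /\ z.2 <= z.1.2] z); last first.
      by apply/funext => -[].
    by apply: measurable_indic; apply: measurableI; apply: measurable_le_set => //; mfun.
  apply: measurable_funM; first by mfun.
  by apply: (measurableT_comp bmS.1); rewrite /pt; mfun.
have := Rint_param_meas mu (@measurableT _ T1) mg.
rewrite (_ : (fun y : T3 => _) = fun y : T3 => \int[mu]_(r in `[si y.1.1 y.1.2, y.2])
   (e^-1 * expR (e^-1 * (r - si y.1.1 y.1.2)) * S (pt y.1.1 y.1.2 r, y.1.1)))//.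
apply/funext => v; rewrite [RHS]Rint_restrict; apply: eq_Rintegral => r _.
rewrite /g; congr (_ * _); rewrite !indicE; congr (nat_of_bool _)%:R.
by apply/idP/idP; rewrite !inE/= in_itv/= => h; apply/andP.
Qed.

Definition lseg : set T3 := [set z | meets z.2 (cp z.2 z.1) /\
  (si z.2 (cp z.2 z.1) <= cs z.2 z.1 /\ cs z.2 z.1 <= so z.2 (cp z.2 z.1))].

(** One function [S] carries the source and the incoming datum, the latter as its values at entry
    points. The value is 0 off the closed chords, in particular for tangential directions at the
    boundary. *)
Definition mild S (z : T3) : R := \1_lseg z * line_sol S z.2 (cp z.2 z.1) (cs z.2 z.1).

Let mcp : measurable_fun setT (fun z : T3 => (z.2, cp z.2 z.1) : T1 * T1).
Proof. by rewrite /cp; mfun. Qed.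

Lemma lseg_measurable : measurable lseg.
Proof.
have msi := measurableT_comp (measurable_si OB) mcp.
have mso := measurableT_comp (measurable_so OB) mcp.
apply: measurableI.
  by have := mcp measurableT (measurable_meets OB); rewrite setTI.
by apply: measurableI; apply: measurable_le_set => //; rewrite /cs; mfun.
Qed.

Lemma mild_abs S M : bmo setT S -> 0 <= M -> (forall z, `|S z| <= M) ->
  forall z, `|mild S z| <= M.
Proof.
move=> bmS M0 SM z; rewrite /mild; have [lz|lz] := pselect (lseg z); last first.
  by rewrite indicN// mul0r normr0.
rewrite indicT// mul1r; apply: line_sol_bound => //; by case: lz => _ [].
Qed.

Lemma bmo_mild S : bmo setT S -> bmo setT (mild S).
Proof.
move=> bmS; have [M SM] := bmS.2.
apply: (bmo_bd (M := `|M|)); last first.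
  by move=> z _; apply: mild_abs => // z'; apply: le_trans (SM _ I) (ler_norm _).
apply: measurable_funM; first by apply: measurable_indic; exact: lseg_measurable.
apply: (measurableT_comp (measurable_line_sol bmS) (g := fun z : T3 => ((z.2, cp z.2 z.1), cs z.2 z.1) : T3)).
by rewrite /cp /cs; mfun.
Qed.

Lemma mild_lin S S' k z : bmo setT S -> bmo setT S' ->
  mild (fun z => S z + k * S' z) z = mild S z + k * mild S' z.
Proof. by move=> b1 b2; rewrite /mild line_sol_lin//; ring. Qed.

Lemma mild_cst k z : lseg z -> mild (fun=> k) z = k.
Proof. by move=> lz; rewrite /mild indicT// mul1r line_sol_cst//; case: lz => _ []. Qed.

Lemma mild_ge0 S z : (forall z, 0 <= S z) -> 0 <= mild S z.
Proof. by move=> S0; rewrite mulr_ge0 ?line_sol_ge0// indicE. Qed.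

Lemma line_closure theta p s : meets theta p -> si theta p <= s <= so theta p ->
  body_closure Omega (pt theta p s).
Proof.
move=> mt /andP[]; rewrite le_eqVlt => /predU1P[<- _|s1].
  by right; exact: (pt_si_frontier OB).
rewrite le_eqVlt => /predU1P[->|s2]; first by right; exact: (pt_so_frontier OB).
by left; rewrite -/(chord theta p s); apply/(chordP OB _ mt); rewrite s1.
Qed.

Lemma mild_ext S S' : (forall z, body_closure Omega z.1 -> S z = S' z) -> mild S = mild S'.
Proof.
move=> SS'; apply/funext => z; rewrite /mild; have [lz|nz] := pselect (lseg z); last by rewrite (indicN R nz) !mul0r.
congr (_ * _); have [mt [h1 h2]] := lz; rewrite /line_sol; congr (_ * (_ + _)).
  by rewrite SS'//; apply: line_closure => //; rewrite lexx (le_trans h1 h2).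
apply: eq_Rintegral => r /set_mem/=; rewrite in_itv/= => /andP[r1 r2].
by rewrite SS'//; apply: line_closure => //; rewrite r1 (le_trans r2 h2).
Qed.

Lemma lseg_pt theta p s : meets theta p -> si theta p <= s <= so theta p ->
  lseg (pt theta p s, theta).
Proof. by move=> mt /andP[h1 h2]; rewrite /lseg/= cp_pt cs_pt. Qed.

Lemma mild_pt S theta p s : meets theta p -> si theta p <= s <= so theta p ->
  mild S (pt theta p s, theta) = line_sol S theta p s.
Proof. by move=> mt h; rewrite /mild (indicT _ (lseg_pt mt h)) mul1r/= cp_pt cs_pt. Qed.

Lemma lseg_body x theta : Omega x -> lseg (x, theta).
Proof.
move=> Ox; have [|mt /andP[h1 h2]] := @chord_si_so _ _ _ OB theta (cp theta x) (cs theta x).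
  by rewrite /chord/= pt_cs_cp.
by split => //=; rewrite !ltW.
Qed.

Lemma lseg_enter t theta : 0 <= t < len b -> flux b (t, theta) < 0 -> lseg (c t, theta).
Proof.
move=> tl /(flux_neg_si OB)[mt h]; split => //=; rewrite h lexx; split => //.
by rewrite -h ltW// (si_lt_so OB).
Qed.

Lemma lseg_exit t theta : 0 <= t < len b -> 0 < flux b (t, theta) -> lseg (c t, theta).
Proof.
move=> tl /(tout_curve OB tl)[mt _ h]; split => //=; rewrite h lexx; split => //.
by rewrite -h ltW// (si_lt_so OB).
Qed.

Lemma mild_enter S t theta : 0 <= t < len b -> flux b (t, theta) < 0 ->
  mild S (c t, theta) = S (c t, theta).
Proof.
move=> tl fl; have lz := lseg_enter tl fl; rewrite /mild indicT// mul1r/=.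
by have [_ h] := (flux_neg_si OB b t theta).1 fl; rewrite -h line_sol_si/= h pt_cs_cp.
Qed.

Lemma llac_mild S : bmo setT S -> llac Omega (mild S) (fun z => e^-1 * (S z - mild S z)).
Proof.
move=> bmS theta p mt.
have bm : bmo (`[si theta p, so theta p]%classic : set T1) (fun s => mild S (pt theta p s, theta)).
  by apply: (bS theta p); exact: bmo_mild.
apply: lac_ext (lac_line_sol bmS mt) => //.
- by apply: bmoZ; apply: bmoB => //; exact: bS.
- by move=> s h; rewrite mild_pt.
- by move=> s h; rewrite mild_pt.
Qed.

(** Green for the identity [e U' = S - U]; at incoming points [mild S] equals [S]. *)
Lemma mild_balance S : bmo setT S ->
  \int[@leb3 R]_(z in phase Omega) mild S z +
    e * \int[@leb2 R]_(z in Gamma_plus b) (mild S (c z.1, z.2) * `|flux b z|) =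
  \int[@leb3 R]_(z in phase Omega) S z +
    e * \int[@leb2 R]_(z in Gamma_minus b) (S (c z.1, z.2) * `|flux b z|).
Proof.
move=> bmS; have bm := bmo_mild bmS.
have sub3 (D : set T3) (f : T3 -> R) : bmo setT f -> bmo D f by exact: bmoS.
have pm := phase_measurable OB; have pf := phase_finite OB.
have := green OB b (sub3 _ _ bm) (sub3 (phase Omega) _ (bmoZ e^-1 (bmoB bmS bm))) (llac_mild bmS).
rewrite (RintZ pm pf); last exact/sub3/bmoB.
rewrite (RintB pm pf); [|exact: sub3|exact: sub3].
have -> : \int[@leb2 R]_(z in Gamma_minus b) (mild S (c z.1, z.2) * `|flux b z|) =
   \int[@leb2 R]_(z in Gamma_minus b) (S (c z.1, z.2) * `|flux b z|).
  apply: eq_Rintegral => -[t theta] /set_mem[[/= tl _] fl]; by rewrite mild_enter.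
move=> H; apply/eqP; rewrite -subr_eq0; apply/eqP.
have ene : e != 0 by rewrite gt_eqF.
move: H; set a1 := \int[@leb3 R]_(z in phase Omega) S z.
set a2 := \int[@leb3 R]_(z in phase Omega) mild S z.
move=> /(congr1 ( *%R e)); rewrite (mulVKf ene) mulrBr => E; lra.
Qed.

End mild_solution.

(** * Total flux through a boundary point *)

Section half_circle_mass.
Context (R : realType).
Notation mu := (@lebesgue_measure R).
Notation T1 := (measurableTypeR R).

Lemma unit_vector_angle (k1 k2 : R) : k1 ^+ 2 + k2 ^+ 2 = 1 ->
  exists phi, k1 = cos phi /\ k2 = sin phi.
Proof.
move=> h; have k1b : k1 \in `[(-1), 1]%R.
  rewrite in_itv/= -ler_norml -(@ler_pXn2r _ 2)// ?nnegrE// expr1n real_normK ?num_real//.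
  by rewrite -h lerDl sqr_ge0.
have k1b' : -1 <= k1 <= 1 by move: k1b; rewrite in_itv.
have E : Num.sqrt (1 - k1 ^+ 2) = `|k2| by rewrite -h addrC addKr sqrtr_sqr.
have [k20|k20] := leP 0 k2.
  by exists (acos k1); rewrite acosK// sin_acos// E ger0_norm.
by exists (- acos k1); rewrite cosN sinN acosK// sin_acos// E ltr0_norm// opprK.
Qed.

Definition half_circle (k1 k2 : R) (theta : T1) : R := Num.max (cos theta * k1 + sin theta * k2) 0.

Lemma measurable_maxr0 d (T : measurableType d) (f : T -> R) : measurable_fun setT f ->
  measurable_fun setT (fun x => Num.max (f x) 0).
Proof. by move=> mf; apply: measurable_maxr. Qed.

Lemma measurable_half_circle k1 k2 : measurable_fun setT (half_circle k1 k2).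
Proof. by rewrite /half_circle; apply: measurable_maxr0; mfun. Qed.

Local Open Scope ereal_scope.

(* Integrate [max (x . k) 0] over the unit disk in polar coordinates, before and
   after rotating [k] to the second axis. *)
Lemma half_circle_mass (k1 k2 : R) : (k1 ^+ 2 + k2 ^+ 2 = 1)%R ->
  (\int[mu]_(theta in @angles R) half_circle k1 k2 theta = 2)%R.
Proof.
move=> hk.
pose F (k1 k2 : R) (x : T1 * T1) : \bar R :=
  (\1_[set x : T1 * T1 | (x.1 * x.1 + x.2 * x.2 < 1)%R] x * Num.max (x.1 * k1 + x.2 * k2) 0)%R%:E.
have mF l1 l2 : measurable_fun setT (F l1 l2).
  apply/measurable_EFinP; apply: measurable_funM.
    by apply: measurable_indic; apply: measurable_lt_set; mfun.
  by apply: measurable_maxr0; mfun.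
have F0 l1 l2 x : 0 <= F l1 l2 x.
  by rewrite lee_fin mulr_ge0// ?indicE// le_max lexx orbT.
have polarF l1 l2 : \int[@leb2 R]_x F l1 l2 x =
    (\int[mu]_(theta in @angles R) (half_circle l1 l2 theta)%:E) * (3^-1)%:E.
  rewrite leb2_polar// -ge0_integralZr//; last 3 first.
  - exact: angles_measurable.
  - by apply: measurable_funTS; apply/measurable_EFinP; exact: measurable_half_circle.
  - by move=> th _; rewrite lee_fin le_max lexx orbT.
  apply: eq_integral => theta _.
  (* The radial factor: one power of [s] from the homogeneous integrand, one from the polar
     Jacobian. *)
  have -> : (3^-1)%:E = \int[mu]_(s in `[0%R, 1%R]) (s ^+ 2)%:E.
    have d3 (s : R) : (0 <= s <= 1)%R -> is_derive s 1%R (fun s => 3^-1 * s ^+ 3)%R (s ^+ 2)%R.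
      move=> _; have h := is_deriveZ (3^-1)%R (is_deriveX 3 (is_derive_id s 1%R)).
      by apply: (is_derive_eq h); rewrite /GRing.scale/=; field.
    have c3 (s : R) : (0 <= s <= 1)%R -> {for s, continuous (fun s : R => s ^+ 2)%R}.
      by move=> _; exact: exprn_continuous.
    by rewrite (FTC_segment ler01 d3 c3); congr EFin; rewrite expr1n expr0n/= mulr1 mulr0 subr0.
  rewrite -ge0_integralZl//; last 3 first.
  - by apply: measurable_funTS; apply/measurable_EFinP; exact: measurable_funX.
  - by move=> s _; rewrite lee_fin sqr_ge0.
  - by rewrite lee_fin le_max lexx orbT.
  rewrite [RHS]integral_mkcond; apply: ge0_ae_eq_integral => //.
  - apply: emeasurable_funM.
      apply: (measurableT_comp (mF l1 l2) (g := fun s : T1 => (s * cos theta, s * sin theta)%R : T1 * T1)).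
      by mfun.
    apply/measurable_EFinP; apply: measurable_funM => //; exact: measurable_indic.
  - apply/(measurable_restrictT _ _).1 => //; apply: measurable_funTS.
    apply: emeasurable_funM => //; apply/measurable_EFinP; exact: measurable_funX.
  - move=> s _; rewrite mule_ge0// lee_fin indicE mem_setE in_itv/= andbT.
    by have [s0|] := ltP 0%R s; rewrite ?mul1r ?mul0r// ltW.
  - move=> s _; rewrite patchE; case: ifP => // _; rewrite mule_ge0// lee_fin ?sqr_ge0//.
    by rewrite le_max lexx orbT.
  exists [set 1%R]; split; [exact: measurable_set1|exact: lebesgue_measure_set1|].
  move=> s /= /not_implyP[_ h]; apply: contrapT => s1; apply: h.
  have Es : (s * cos theta * (s * cos theta) + s * sin theta * (s * sin theta) = s ^+ 2)%R.
    by rewrite -[RHS]mulr1 -(cos2Dsin2 theta); ring.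
  rewrite patchE mem_setE in_itv/= /F.
  have [s0|s0] := ltP 0%R s; last first.
    rewrite [X in _ * (X * _)%:E]indicN ?mul0r ?mule0; last by rewrite /= in_itv/= andbT; apply/negP; rewrite -leNgt.
    case: ifP => // /andP[h1 _].
    by rewrite (_ : s = 0)%R ?expr0n ?mule0//; apply/eqP; rewrite eq_le s0.
  rewrite [X in _ * (X * _)%:E]indicT ?mul1r; last by rewrite /= in_itv/= s0.
  rewrite (ltW s0)/=; have [sle|sgt] := leP s 1%R; last first.
    rewrite indicN ?mul0r ?mul0e//=; rewrite Es.
    by apply/negP; rewrite -leNgt exprn_ege1// ltW.
  have slt : (s < 1)%R by rewrite lt_neqAle sle andbT; apply/eqP.
  rewrite indicT/=; last by rewrite Es expr_lt1// ltW.
  rewrite mul1r -!EFinM; congr EFin.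
  rewrite /half_circle (_ : s * cos theta * l1 + _ = s * (cos theta * l1 + sin theta * l2))%R; last by ring.
  by rewrite -[X in Num.max _ X](mulr0 s) -maxr_pMr ?ltW//; ring.
have [phi [E1 E2]] := unit_vector_angle hk.
have rot : \int[@leb2 R]_x F k1 k2 x = \int[@leb2 R]_x F 0%R 1%R x.
  rewrite -(leb2_rotation phi (mF k1 k2) (F0 k1 k2)); apply: eq_integral => z _.
  rewrite /F/= E1 E2; congr EFin; congr (_ * Num.max _ _)%R.
    have nz : ((z.2 * cos phi - z.1 * sin phi) * (z.2 * cos phi - z.1 * sin phi) +
        (z.2 * sin phi + z.1 * cos phi) * (z.2 * sin phi + z.1 * cos phi) =
        z.1 * z.1 + z.2 * z.2)%R.
      rewrite -[RHS]mulr1 -(cos2Dsin2 phi); ring.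
    by rewrite !indicE; congr ((nat_of_bool _)%:R)%R; apply/idP/idP; rewrite !inE/= nz.
  by rewrite mulr0 add0r -(cos2Dsin2 phi); ring.
have sin_mass : \int[mu]_(theta in @angles R) (half_circle 0 1 theta)%:E = 2%:E.
  have pi0 := @pi_gt0 R.
  have mh : measurable_fun setT (fun x : T1 => (half_circle 0 1 x)%:E).
    by apply/measurable_EFinP; exact: measurable_half_circle.
  rewrite integral_angles_split//; last by move=> x; rewrite lee_fin le_max lexx orbT.
  have msin : measurable_fun setT (fun x : T1 => (sin x)%:E).
    by apply/measurable_EFinP; exact: measurable_sin.
  have -> : \int[mu]_(x in `]0%R, pi[) (half_circle 0 1 x)%:E = \int[mu]_(x in `[0%R, pi]) (sin x)%:E.
    transitivity (\int[mu]_(x in `]0%R, pi[) (sin x)%:E).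
      apply: eq_integral => x; rewrite inE/= in_itv/= => xpi; congr EFin.
      by rewrite /half_circle mulr0 add0r mulr1 max_l// ltW// sin_gt0_pi.
    rewrite integral_itv_obnd_cbnd; last exact: measurable_funTS.
    by rewrite integral_itv_bndo_bndc//; exact: measurable_funTS.
  have dc (x : R) : (0 <= x <= pi)%R -> is_derive x 1%R (fun x => - cos x)%R (sin x).
    by move=> _; have h := is_deriveN (is_derive_cos x); apply: (is_derive_eq h); rewrite opprK.
  have cc (x : R) : (0 <= x <= pi)%R -> {for x, continuous (@sin R)}.
    by move=> _; exact: continuous_sin.
  rewrite (FTC_segment (ltW pi0) dc cc) cospi cos0 opprK integral0_eq ?adde0//.
  move=> x; rewrite /= in_itv/= => /andP[x1 x2]; congr EFin.
  rewrite /half_circle mulr0 add0r mulr1 max_r// -[x](subrK pi) sinDpi oppr_le0 ltW//.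
  by apply: sin_gt0_pi; apply/andP; split; lra.
move: rot; rewrite !polarF sin_mass => /(congr1 (fun z => z * 3%:E)).
rewrite -!muleA -!EFinM (mulVf (_ : 3 != 0)%R)// mulr1 mule1 => h.
by rewrite /Rintegral h.
Qed.

End half_circle_mass.

(** * Velocity averages, outgoing averages and the invariant integral *)

Section boundary_average.
Context (R : realType) (Omega : set (R * R)) (d : R) (OB : cbody Omega d)
        (b : boundary_data Omega) (e : R) (e0 : 0 < e).
Notation T1 := (measurableTypeR R).
Notation T2 := (T1 * T1)%type.
Notation T3 := (T1 * T1 * T1)%type.
Notation mu := (@lebesgue_measure R).
Notation c := (curve b).
Notation mild := (mild Omega e).
Implicit Types (t theta : R) (x : R * R) (F S : T3 -> R) (V : T2 -> R).

Lemma outward_flux_mass t :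
  \int[mu]_(theta in @angles R) Num.max (flux b (t, theta)) 0 = 2.
Proof.
rewrite -(@half_circle_mass R (normal b (c t)).1 (normal b (c t)).2)//.
by have := normal_unit b t; rewrite /dot !expr2.
Qed.

Lemma inward_flux_mass t :
  \int[mu]_(theta in @angles R) Num.max (- flux b (t, theta)) 0 = 2.
Proof.
rewrite -(@half_circle_mass R (- (normal b (c t)).1) (- (normal b (c t)).2))//.
  apply: eq_Rintegral => theta _; rewrite /half_circle fluxE /dot/=; congr Num.max; ring.
by have := normal_unit b t; rewrite /dot !sqrrN !expr2.
Qed.

(* Averaging over the velocity variable inside the body, and over the outgoing
   directions on its boundary. *)
Definition wt x theta : R := (2 * pi)^-1 * \1_Omega x +
  2^-1 * (\1_(frontier Omega) x * Num.max (flux b (tb b x, theta)) 0).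

Definition avg F (x : T2) : R := \int[mu]_(theta in @angles R) (wt x theta * F (x, theta)).

Lemma frontier_notin x : frontier Omega x -> ~ Omega x.
Proof. by move=> /(frontierP OB)[]. Qed.

Lemma wt_body x theta : Omega x -> wt x theta = (2 * pi)^-1.
Proof.
move=> Ox; rewrite /wt indicT// indicN; first by rewrite mul0r mulr0 addr0 mulr1.
by move=> /frontier_notin.
Qed.

Lemma wt_frontier x theta : frontier Omega x ->
  wt x theta = 2^-1 * Num.max (flux b (tb b x, theta)) 0.
Proof.
by move=> fx; rewrite /wt indicN ?indicT// ?mulr0 ?add0r ?mul1r//; exact: frontier_notin.
Qed.

Lemma wt_curve t theta : 0 <= t < len b ->
  wt (c t) theta = 2^-1 * Num.max (flux b (t, theta)) 0.
Proof. by move=> tl; rewrite wt_frontier ?tb_curve//; exact: curve_frontier. Qed.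

Lemma wt_out x theta : ~ body_closure Omega x -> wt x theta = 0.
Proof.
move=> nx; rewrite /wt !indicN ?mul0r ?mulr0 ?addr0// => h; apply: nx; by [left|right].
Qed.

Let i2pi_ge0 : 0 <= (2 * pi : R)^-1.
Proof. by rewrite invr_ge0 mulr_ge0// pi_ge0. Qed.

Lemma wt_ge0 x theta : 0 <= wt x theta.
Proof.
by rewrite addr_ge0// !mulr_ge0// ?indicE ?invr_ge0// le_max lexx orbT.
Qed.

Lemma wt_le1 x theta : wt x theta <= 1.
Proof.
have [Ox|nx] := pselect (Omega x).
  rewrite wt_body// invf_le1 ?mulr_gt0 ?pi_gt0//.
  by have := @pi_ge2 R; lra.
have [fx|nf] := pselect (frontier Omega x); last by rewrite wt_out// => -[].
rewrite wt_frontier//; have := flux_bound b (tb b x, theta); rewrite ler_norml => /andP[_ h].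
have : Num.max (flux b (tb b x, theta)) 0 <= 1 by rewrite ge_max h ler01.
by lra.
Qed.

Lemma measurable_wt : measurable_fun setT (fun z : T3 => wt z.1 z.2).
Proof.
have mtb := measurable_tb OB b; have mfl := measurable_flux OB b.
have mi (A : set T2) : measurable A -> measurable_fun setT (fun z : T3 => \1_A z.1 : R).
  by move=> mA; apply: (measurableT_comp (measurable_indic mA)); mfun.
rewrite /wt; apply: measurable_funD; apply: measurable_funM => //.
  by apply: mi; exact: body_measurable OB.
apply: measurable_funM; first by apply: mi; exact: frontier_measurable OB.
apply: measurable_maxr0.
apply: (measurableT_comp mfl (g := fun z : T3 => (tb b z.1, z.2) : T2)).
by apply: measurable_fun_pair; [exact: (measurableT_comp mtb)|mfun].
Qed.

Lemma bmo_wt : bmo setT (fun z : T3 => wt z.1 z.2).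
Proof.
apply: (bmo_bd (M := 1) measurable_wt) => z _.
by rewrite ger0_norm ?wt_ge0// wt_le1.
Qed.

Let am : measurable (@angles R : set T1) := @angles_measurable R.
Let af : (mu (@angles R : set T1) < +oo)%E := @angles_finite R.

Lemma bmo_section F x D : bmo setT F -> bmo D (fun theta : T1 => F (x, theta)).
Proof. by move=> bF; apply: (bmo_comp bF (pair1_measurable x)). Qed.

Lemma bmo_wtF F x : bmo setT F -> bmo (@angles R) (fun theta => wt x theta * F (x, theta)).
Proof. by move=> bF; apply: bmoM; [exact: (bmo_section x _ bmo_wt)|exact: bmo_section]. Qed.

Lemma bmo_avg F : bmo setT F -> bmo setT (avg F).
Proof.
move=> bF; apply: (bmo_Rint am af (D1 := setT) (f := fun x theta => wt x theta * F (x, theta))).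
rewrite (_ : (fun z => _) = fun z : T3 => wt z.1 z.2 * F z); last by apply/funext => -[].
by apply: bmoM; [apply: bmoS bmo_wt|apply: bmoS bF].
Qed.

Lemma avg_lin F F' k x : bmo setT F -> bmo setT F' ->
  avg (fun z => F z + k * F' z) x = avg F x + k * avg F' x.
Proof.
move=> bF bF'; rewrite /avg -(RintZ am af); last exact: bmo_wtF.
rewrite -(RintD am af); [|exact: bmo_wtF|by apply: bmoZ; exact: bmo_wtF].
by apply: eq_Rintegral => theta _; ring.
Qed.

Lemma avg_ge0 F x : (forall z, 0 <= F z) -> 0 <= avg F x.
Proof. by move=> F0; apply: Rintegral_ge0 => theta _; rewrite mulr_ge0 ?wt_ge0. Qed.

Lemma avg_out F x : ~ body_closure Omega x -> avg F x = 0.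
Proof. by move=> nx; apply: Rint_eq0 => theta _; rewrite wt_out// mul0r. Qed.

Lemma fine_mu_angles : fine (mu (@angles R)) = 2 * pi.
Proof.
by rewrite /angles lebesgue_measure_itv/= lte_fin mulr_gt0 ?pi_gt0//= oppr0 addr0.
Qed.

Lemma wt_mass x : body_closure Omega x -> \int[mu]_(theta in @angles R) wt x theta = 1.
Proof.
move=> [Ox|fx].
  transitivity (\int[mu]_(theta in @angles R) ((2 * pi)^-1)).
    by apply: eq_Rintegral => theta _; rewrite wt_body.
  by rewrite Rintegral_cst// fine_mu_angles mulVf// mulf_neq0// gt_eqF// pi_gt0.
transitivity (\int[mu]_(theta in @angles R) (2^-1 * Num.max (flux b (tb b x, theta)) 0)).
  by apply: eq_Rintegral => theta _; rewrite wt_frontier.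
rewrite (RintZ am af) ?outward_flux_mass ?mulVf//.
apply: (bmo_bd (M := 1)).
  apply: measurable_maxr0; exact: (measurableT_comp (measurable_flux OB b) (pair1_measurable _)).
move=> theta _; rewrite ger0_norm; last by rewrite le_max lexx orbT.
by have := flux_bound b (tb b x, theta); rewrite ler_norml ge_max ler01 andbT => /andP[].
Qed.

Lemma avg_section_cst F k x : body_closure Omega x ->
  (forall theta, wt x theta != 0 -> F (x, theta) = k) -> avg F x = k.
Proof.
move=> cx Fk; transitivity (\int[mu]_(theta in @angles R) (k * wt x theta)).
  apply: eq_Rintegral => theta _; have [->|w0] := eqVneq (wt x theta) 0.
    by rewrite mul0r mulr0.
  by rewrite Fk// mulrC.
rewrite (RintZ am af) ?wt_mass ?mulr1//.
exact: (bmo_section x _ bmo_wt).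
Qed.

(** On the boundary the weight charges outgoing directions only, and these lie on closed chords.
    Averages of mild solutions therefore never see the default value of [mild]. *)
Lemma lseg_wt x theta : wt x theta != 0 -> lseg Omega (x, theta).
Proof.
have [Ox|nx] := pselect (Omega x); first by move=> _; exact: (lseg_body OB).
have [fx|nf] := pselect (frontier Omega x); last by rewrite wt_out ?eqxx// => -[].
have [tl E] := tbP b fx; rewrite wt_frontier// => h.
rewrite -[X in lseg _ (X, _)]E; apply: (lseg_exit OB) => //.
by rewrite ltNge; apply: contra h => h; rewrite max_r// mulr0.
Qed.

Lemma avg_mild_cst k x : body_closure Omega x -> avg (mild (fun=> k)) x = k.
Proof.
by move=> cx; apply: avg_section_cst => // theta h; rewrite mild_cst//; exact: lseg_wt.
Qed.

Lemma avg_abs F M x : bmo setT F -> 0 <= M -> (forall theta, `|F (x, theta)| <= M) -> `|avg F x| <= M.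
Proof.
move=> bF M0 FM; have [cx|ncx] := pselect (body_closure Omega x); last first.
  by rewrite avg_out// normr0.
apply: le_trans (Rint_abs am af (bmo_wtF x bF)) _.
rewrite -[leRHS]mulr1 -(wt_mass cx) -(RintZ am af); last exact: (bmo_section x _ bmo_wt).
apply: (Rint_le am af); first by apply: bmo_norm; exact: bmo_wtF.
  by apply: bmoZ; exact: (bmo_section x _ bmo_wt).
by move=> theta _; rewrite normrM ger0_norm ?wt_ge0// mulrC ler_wpM2r ?wt_ge0.
Qed.

(** Origin of the weights: an interior point carries directions of total measure [2 * pi], a
    boundary point carries total flux 2, and Green gives boundary fluxes a factor [e]. *)
Definition invariant_integral V : R := (2 * pi) * \int[@leb2 R]_(x in Omega) V x +
  (2 * e) * \int[mu]_(t in `[0, len b[) V (c t).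

Let bm := body_measurable OB.
Let bf := body_finite OB.
Let lm : measurable (`[0, len b[%classic : set T1) := measurable_itv _.
Let lf : (mu (`[0%R, len b[%classic : set T1) < +oo)%E := ico_finite _ _.

Lemma Rint_phase_prod F : bmo setT F ->
  \int[@leb3 R]_(z in phase Omega) F z =
  \int[@leb2 R]_(x in Omega) \int[mu]_(theta in @angles R) F (x, theta).
Proof.
move=> bF; have := Rint_prod bm am bf af (f := fun x theta => F (x, theta)).
have -> : (fun z : T3 => F (z.1, z.2)) = F by apply/funext => -[].
move=> <-; last exact: bmoS bF.
by rewrite /leb3; apply: eq_Rintegral => -[].
Qed.

Lemma Rint_Gamma_prod (F : T2 -> R) : bmo setT F ->
  \int[@leb2 R]_(z in Gamma b) F z =
  \int[mu]_(t in `[0, len b[) \int[mu]_(theta in @angles R) F (t, theta).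
Proof.
move=> bF; have := Rint_prod lm am lf af (f := fun x theta : T1 => F (x, theta)).
have -> : (fun z : T2 => F (z.1, z.2)) = F by apply/funext => -[].
move=> <-; last exact: bmoS bF.
by rewrite /leb2; apply: eq_Rintegral => -[].
Qed.

Lemma Rint_avg_body F : bmo setT F ->
  (2 * pi) * \int[@leb2 R]_(x in Omega) avg F x = \int[@leb3 R]_(z in phase Omega) F z.
Proof.
move=> bF; rewrite Rint_phase_prod// -(RintZ bm bf); last exact: bmoS (bmo_avg bF).
apply: eq_Rintegral => x /set_mem Ox; rewrite /avg -(RintZ am af); last exact: bmo_wtF.
apply: eq_Rintegral => theta _; rewrite wt_body// mulrA divff ?mul1r//.
by rewrite mulf_neq0// gt_eqF// pi_gt0.
Qed.

Lemma Rint_avg_curve F : bmo setT F ->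
  2 * \int[mu]_(t in `[0, len b[) avg F (c t) =
  \int[@leb2 R]_(z in Gamma_plus b) (F (c z.1, z.2) * `|flux b z|).
Proof.
move=> bF.
have bG : bmo setT (fun z : T2 => F (c z.1, z.2) * Num.max (flux b z) 0).
  apply: bmoM; first by apply: (bmo_curve b); apply: bmoS bF.
  apply: (bmo_bd (M := 1)); first by apply: measurable_maxr0; exact: measurable_flux OB b.
  move=> z _; rewrite ger0_norm; last by rewrite le_max lexx orbT.
  by have := flux_bound b z; rewrite ler_norml ge_max ler01 andbT => /andP[].
transitivity (\int[@leb2 R]_(z in Gamma b) (F (c z.1, z.2) * Num.max (flux b z) 0)).
  rewrite Rint_Gamma_prod// -(RintZ lm lf); last first.
    by apply: (bmo_comp (bmo_avg bF)) => //; exact: measurable_curve.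
  apply: eq_Rintegral => t /set_mem/=; rewrite in_itv/= => tl.
  rewrite /avg -(RintZ am af); last exact: bmo_wtF.
  by apply: eq_Rintegral => theta _; rewrite wt_curve//; field.
rewrite [LHS]Rint_restrict [RHS]Rint_restrict; apply: eq_Rintegral => z _.
have [gz|gz] := pselect (Gamma b z); last by rewrite !indicN ?mul0r// => -[].
have [f0|f0] := ltP 0 (flux b z); last first.
  rewrite [X in _ = X * _]indicN ?mul0r ?max_r ?mulr0// => -[_]; first by rewrite ltNge f0.
by rewrite !indicT// gtr0_norm.
Qed.

Lemma invariant_integral_avg F : bmo setT F ->
  invariant_integral (avg F) = \int[@leb3 R]_(z in phase Omega) F z +
    e * \int[@leb2 R]_(z in Gamma_plus b) (F (c z.1, z.2) * `|flux b z|).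
Proof.
move=> bF; rewrite /invariant_integral Rint_avg_body//; congr (_ + _).
by rewrite -Rint_avg_curve//; ring.
Qed.

Lemma Rint_Gamma_minus_fst V : bmo setT V ->
  \int[@leb2 R]_(z in Gamma_minus b) (V (c z.1) * `|flux b z|) =
  2 * \int[mu]_(t in `[0, len b[) V (c t).
Proof.
move=> bV.
have bVc : bmo setT (fun t : T1 => V (c t)) by apply: (bmo_comp bV) => //; exact: measurable_curve.
have bfl : bmo setT (fun z : T2 => Num.max (- flux b z) 0).
  apply: (bmo_bd (M := 1)).
    by apply: measurable_maxr0; apply: measurable_funN; exact: measurable_flux OB b.
  move=> z _; rewrite ger0_norm; last by rewrite le_max lexx orbT.
  by have := flux_bound b z; rewrite ler_norml ge_max ler01 andbT lerNl => /andP[].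
transitivity (\int[@leb2 R]_(z in Gamma b) (V (c z.1) * Num.max (- flux b z) 0)).
  rewrite [LHS]Rint_restrict [RHS]Rint_restrict; apply: eq_Rintegral => z _.
  have [gz|gz] := pselect (Gamma b z); last by rewrite !indicN ?mul0r// => -[].
  have [f0|f0] := ltP (flux b z) 0; last first.
    rewrite [X in X * _]indicN ?mul0r ?[Num.max _ _]max_r ?mulr0 ?oppr_le0// => -[_].
    by rewrite ltNge f0.
  by rewrite !indicT// max_l ?oppr_ge0 ?ltW// ltr0_norm.
rewrite Rint_Gamma_prod; last first.
  by apply: bmoM => //; apply: (bmo_comp bVc) => //; exact: measurable_fst.
rewrite -(RintZ lm lf); last exact: bmoS bVc.
apply: eq_Rintegral => t _.
transitivity (\int[mu]_(theta in @angles R) (V (c t) * Num.max (- flux b (t, theta)) 0)); first by [].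
have bt : bmo (@angles R : set T1) (fun theta : T1 => Num.max (- flux b (t, theta)) 0).
  exact: (bmo_comp bfl (pair1_measurable t)).
by rewrite (RintZ am af _ bt) inward_flux_mass mulrC.
Qed.

(** The backward collision process: the mean of [V] at the first collision, or at the boundary point
    reached before it, when a ray is followed backwards from [x] in a direction of law [wt x]. *)
Definition transition V : T2 -> R := avg (mild (fun z => V z.1)).

Lemma bmo_fst V : bmo setT V -> bmo setT (fun z : T3 => V z.1).
Proof. by move=> bV; apply: (bmo_comp bV measurable_fst). Qed.

Lemma invariant_integral_mild S : bmo setT S ->
  invariant_integral (avg (mild S)) = \int[@leb3 R]_(z in phase Omega) S z +
    e * \int[@leb2 R]_(z in Gamma_minus b) (S (c z.1, z.2) * `|flux b z|).
Proof.
move=> bS; rewrite -(mild_balance OB b e0)// invariant_integral_avg//.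
exact: (bmo_mild OB e0).
Qed.

Lemma invariant_integral_transition V : bmo setT V ->
  invariant_integral (transition V) = invariant_integral V.
Proof.
move=> bV; rewrite invariant_integral_mild; last exact: bmo_fst.
rewrite Rint_Gamma_minus_fst// Rint_phase_prod; last exact: bmo_fst.
rewrite /invariant_integral mulrA [e * 2]mulrC; congr (_ + _).
rewrite -(RintZ bm bf); last exact: bmoS bV.
apply: eq_Rintegral => x _; transitivity (\int[mu]_(theta in @angles R) V x); first by [].
by rewrite Rintegral_cst// fine_mu_angles mulrC.
Qed.

End boundary_average.

(** * Polar coordinates along backward rays *)

Section polar_at_a_point.
Context (R : realType).
Notation T1 := (measurableTypeR R).
Notation T2 := (T1 * T1)%type.
Notation mu := (@lebesgue_measure R).
Implicit Types (x y : R * R) (theta r : R).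

Definition ray x theta r : R * R := (x.1 - r * cos theta, x.2 - r * sin theta).

Lemma Rint_reflect (a s : R) (f : T1 -> R) : measurable_fun setT f ->
  \int[mu]_(r in `[a, s]) f r = \int[mu]_(r in `[0, s - a]) f (s - r).
Proof.
move=> mf; rewrite [LHS]Rint_restrict [RHS]Rint_restrict.
pose g (r : T1) : R := \1_(`[a, s] : set T1) r * f r.
have mg : measurable_fun setT g.
  by apply: measurable_funM => //; apply: measurable_indic; exact: measurable_itv.
have E (r : T1) : (\1_(`[a, s] : set T1) (s - r) : R) = \1_(`[0, s - a] : set T1) r.
  rewrite !indicE; congr (nat_of_bool _)%:R.
  by apply/idP/idP; rewrite !inE/= !in_itv/= => /andP[h1 h2]; apply/andP; split; lra.
have := @Rint_transfer _ _ T1 T1 R mu mu (fun r : T1 => s - r) (fun=> 1) (fun=> 1) _ _ _ g mg.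
rewrite /g => H; transitivity (\int[mu]_r (\1_(`[a, s] : set T1) r * f r * 1)).
  by apply: eq_Rintegral => r _; rewrite mulr1.
rewrite H//.
  by apply: eq_Rintegral => r _; rewrite mulr1 E.
move=> F mF F0; under eq_integral do rewrite mule1; under [RHS]eq_integral do rewrite mule1.
rewrite -(leb_affine s (c := -1) (F := F))//.
by apply: eq_integral => r _; rewrite normrN1 mule1 mulN1r addrC.
Qed.

Lemma measurable_ray x : measurable_fun setT (fun z : T2 => ray x z.1 z.2 : T2).
Proof. by rewrite /ray; mfun. Qed.

(** The support lies in a square of half-side [L] around [x], hence within distance [2 * L]. Rays
    run backwards to match the mild formula. *)
Lemma Rint_polar x (L : R) (F : T2 -> R) : 0 <= L -> bmo setT F ->
  (forall y, F y != 0 -> `|y.1 - x.1| <= L /\ `|y.2 - x.2| <= L) ->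
  \int[@leb2 R]_y F y =
  \int[mu]_(theta in @angles R) \int[mu]_(r in `[0, 2 * L]) (r * F (ray x theta r)).
Proof.
move=> L0 bF FL.
pose psi (z : T2) : T2 := ray x z.1 z.2.
pose k2 (z : T2) : R := \1_(@angles R) z.1 * (\1_`]0%R, +oo[ z.2 * z.2).
have mk2 : measurable_fun setT k2.
  apply: measurable_funM.
    by apply: (measurableT_comp (measurable_indic _)); [exact: angles_measurable|mfun].
  apply: measurable_funM; last by mfun.
  by apply: (measurableT_comp (measurable_indic _)); [exact: measurable_itv|mfun].
have k20 z : 0 <= k2 z.
  apply: mulr_ge0; first by rewrite indicE.
  have [s0|s0] := ltP 0 z.2; first by rewrite mulr_ge0 ?indicE// ltW.
  by rewrite indicN ?mul0r//= in_itv/= andbT; apply/negP; rewrite -leNgt.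
have tr (H : T2 -> \bar R) : measurable_fun setT H -> (forall z, 0 <= H z)%E ->
    (\int[@leb2 R]_y (H y * 1%:E) = \int[@leb2 R]_z (H (psi z) * (k2 z)%:E))%E.
  move=> mH H0; under eq_integral do rewrite mule1.
  have mHk : measurable_fun setT (fun z => H (psi z) * (k2 z)%:E)%E.
    apply: emeasurable_funM; first exact: (measurableT_comp mH (measurable_ray x)).
    exact/measurable_EFinP.
  have Hk0 z : (0 <= H (psi z) * (k2 z)%:E)%E by rewrite mule_ge0// lee_fin.
  rewrite (leb2_tonelli1 mHk Hk0) -(leb2_translate x mH H0).
  have mHx : measurable_fun setT (fun y : T2 => H (y + x)).
    by apply: (measurableT_comp mH); apply: measurable_fun_pair; apply: measurable_funD => //; mfun.
  have mHo : measurable_fun setT (fun y : T2 => H ((- y.1, - y.2) + x)).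
    by apply: (measurableT_comp mHx (g := fun z : T2 => (- z.1, - z.2) : T2)); mfun.
  rewrite -(leb2_opp mHx (fun=> H0 _)) (leb2_polar mHo (fun=> H0 _)).
  rewrite integral_mkcond; apply: eq_integral => theta _; rewrite patchE.
  case: ifPn => [/set_mem ath|nath].
    apply: eq_integral => r _; rewrite /k2/= (indicT _ ath) mul1r; congr (H _ * _)%E.
    by rewrite /psi /ray/=; congr pair; rewrite /= addrC.
  rewrite integral0_eq// => r _; rewrite /k2/= indicN ?mul0r ?mule0//.
  by move=> /mem_set; rewrite (negPf nath).
transitivity (\int[@leb2 R]_y (F y * 1)); first by apply: eq_Rintegral => y _; rewrite mulr1.
rewrite (Rint_transfer (k1 := fun=> 1) _ k20 tr bF.1)//.
have mI : measurable (`[0, 2 * L]%classic : set T1) by exact: measurable_itv.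
have := Rint_prod (@angles_measurable R) mI (@angles_finite R) (itv_finite 0 (2 * L))
  (f := fun theta r : T1 => r * F (ray x theta r)).
rewrite /leb2 => <-; last first.
  apply: bmoM.
    apply: (bmo_bd (M := 2 * L)); first by mfun.
    by move=> z [_ /=]; rewrite in_itv/= => /andP[h1 h2]; rewrite ger0_norm.
  by apply: (bmo_comp bF) => //; exact: measurable_ray.
rewrite [RHS]Rint_restrict; apply: eq_Rintegral => z _.
rewrite /k2 /psi; have [->|Fz] := eqVneq (F (ray x z.1 z.2)) 0.
  by rewrite !mul0r !mulr0.
have [ath|nath] := pselect (@angles R z.1); last first.
  by rewrite [X in _ * (X * _) = _]indicN// mul0r mulr0 indicN ?mul0r// => -[].
rewrite [X in _ * (X * _) = _]indicT// mul1r.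
have [r0|r0] := ltP 0 z.2; last first.
  rewrite [X in _ * (X * _)]indicN ?mul0r ?mulr0; last by rewrite /= in_itv/= andbT; apply/negP; rewrite -leNgt.
  have [z20|z20] := eqVneq z.2 0; first by rewrite z20 mul0r mulr0.
  rewrite indicN ?mul0r// => -[_ /=]; rewrite in_itv/= => /andP[h _].
  by move: z20; rewrite eq_le r0 h.
rewrite [X in _ * (X * _)]indicT; last by rewrite /= in_itv/= r0.
rewrite indicT; first by rewrite !mul1r mulrC.
split => //=; rewrite in_itv/= (ltW r0)/=.
have [/= h1 h2] := FL _ Fz.
have {}h1 : (z.2 * cos z.1) ^+ 2 <= L ^+ 2.
  by rewrite -[X in X <= _]real_normK ?num_real// ler_pXn2r ?nnegrE//; move: h1; rewrite addrAC subrr add0r normrN.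
have {}h2 : (z.2 * sin z.1) ^+ 2 <= L ^+ 2.
  by rewrite -[X in X <= _]real_normK ?num_real// ler_pXn2r ?nnegrE//; move: h2; rewrite addrAC subrr add0r normrN.
rewrite -(@ler_pXn2r _ 2)// ?nnegrE ?mulr_ge0 ?(ltW r0)//.
have : z.2 ^+ 2 = (z.2 * cos z.1) ^+ 2 + (z.2 * sin z.1) ^+ 2.
  by rewrite -[LHS]mulr1 -(cos2Dsin2 z.1); ring.
have := sqr_ge0 L; rewrite exprMn; lra.
Qed.

End polar_at_a_point.

(** * Minorization of the transition operator on a square *)

Section backward_rays.
Context (R : realType) (Omega : set (R * R)) (d : R) (OB : cbody Omega d)
        (b : boundary_data Omega) (e : R) (e0 : 0 < e).
Notation T1 := (measurableTypeR R).
Notation T2 := (T1 * T1)%type.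
Notation T3 := (T1 * T1 * T1)%type.
Notation mu := (@lebesgue_measure R).
Notation c := (curve b).
Notation mild := (mild Omega e).
Notation wt := (wt b).
Notation avg := (avg b).
Implicit Types (t theta r : R) (x y : R * R) (F S : T3 -> R) (V : T2 -> R).

Definition exit_time x theta : R := cs theta x - si Omega theta (cp theta x).

Lemma pt_ray x theta r : pt theta (cp theta x) (cs theta x - r) = ray x theta r.
Proof. by rewrite pt_add pt_cs_cp /ray; congr pair; ring. Qed.

Lemma exit_time_ge0 x theta : lseg Omega (x, theta) -> 0 <= exit_time x theta.
Proof. by move=> [_ [h _]]; rewrite subr_ge0. Qed.

Lemma mild_ray S x theta : bmo setT S -> lseg Omega (x, theta) ->
  mild S (x, theta) = expR (- e^-1 * exit_time x theta) * S (ray x theta (exit_time x theta), theta) +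
  \int[mu]_(r in `[0, exit_time x theta]) (e^-1 * expR (- e^-1 * r) * S (ray x theta r, theta)).
Proof.
move=> bS lz; rewrite /mild indicT// mul1r line_solE//= -/(exit_time x theta).
rewrite -pt_ray subKr; congr (_ + _).
rewrite Rint_reflect; last first.
  apply: measurable_funM; first by mfun.
  by apply: (measurableT_comp bS.1); rewrite /pt; mfun.
by apply: eq_Rintegral => r _; rewrite subKr pt_ray.
Qed.

Lemma ray_body_exit_time x theta r : lseg Omega (x, theta) -> 0 <= r ->
  Omega (ray x theta r) -> r < exit_time x theta.
Proof.
move=> [/= mt _] r0; rewrite -pt_ray => Or.
have /(chordP OB _ mt)/andP[h _] : chord Omega theta (cp theta x) (cs theta x - r) by [].
by rewrite /exit_time; lra.
Qed.

Lemma closure_bound x : body_closure Omega x -> `|x.1| <= d /\ `|x.2| <= d.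
Proof.
have [_ _ _ bO] := OB; move=> [/bO//|/(frontierP OB)[_ h]].
have aux (u : R) : (forall k, 0 < k -> `|u| <= d + k) -> `|u| <= d.
  by move=> hu; apply/ler_addgt0Pr => k k0; exact: hu.
split; apply: aux => k k0; have [y [/bO[y1 y2] h1 h2]] := h _ k0.
  have := ler_normD (x.1 - y.1) y.1; rewrite subrK; move: h1; rewrite distrC; lra.
have := ler_normD (x.2 - y.2) y.2; rewrite subrK; move: h2; rewrite distrC; lra.
Qed.

Lemma ray_length x theta r : body_closure Omega x -> body_closure Omega (ray x theta r) ->
  0 <= r -> r <= 4 * d.
Proof.
move=> /closure_bound[x1 x2] /closure_bound[/= y1 y2] r0.
have d0 : 0 < d by case: OB.
have h1 : (r * cos theta) ^+ 2 <= (2 * d) ^+ 2.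
  rewrite -[X in X <= _]real_normK ?num_real// ler_pXn2r ?nnegrE ?mulr_ge0 ?(ltW d0)//.
  by have := ler_normB x.1 (x.1 - r * cos theta); rewrite subKr; lra.
have h2 : (r * sin theta) ^+ 2 <= (2 * d) ^+ 2.
  rewrite -[X in X <= _]real_normK ?num_real// ler_pXn2r ?nnegrE ?mulr_ge0 ?(ltW d0)//.
  by have := ler_normB x.2 (x.2 - r * sin theta); rewrite subKr; lra.
rewrite -(@ler_pXn2r _ 2)// ?nnegrE ?mulr_ge0 ?(ltW d0)//.
have : r ^+ 2 = (r * cos theta) ^+ 2 + (r * sin theta) ^+ 2.
  by rewrite -[LHS]mulr1 -(cos2Dsin2 theta); ring.
by have := sqr_ge0 d; move: h1 h2; rewrite !(exprMn _ _ d); lra.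
Qed.

Context (xc : R * R) (eta : R) (eta0 : 0 < eta).
Context (HQ : contains_square Omega xc eta).

Definition inner_square : set T2 := [set y | `|y.1 - xc.1| <= eta /\ `|y.2 - xc.2| <= eta].
Let Q := inner_square.

Lemma inner_square_body : Q `<=` Omega.
Proof. by move=> y [h1 h2]; have e2 := eta0; apply: HQ; [apply: le_trans h1 _|apply: le_trans h2 _]; lra. Qed.

Lemma inner_square_measurable : measurable Q.
Proof.
by apply: measurableI; apply: measurable_le_set; mfun;
   apply: (measurableT_comp (@normr_measurable R setT)) => //; mfun.
Qed.

(** A lower bound for [wt] on directions whose backward ray hits the square: [1 / (2 * pi)] at
    interior points, and at the boundary half of the lower bound [eta / (4 * d)] on the flux. *)
Definition hit_weight : R := Num.min (2 * pi)^-1 (eta / (8 * d)).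

Lemma hit_weight_gt0 : 0 < hit_weight.
Proof.
have d0 : 0 < d by case: OB.
by rewrite lt_min invr_gt0 mulr_gt0 ?pi_gt0//= divr_gt0// mulr_gt0.
Qed.

(* If a backward ray from a boundary point meets the inner square then its
   direction is transversal to the boundary. *)
Lemma ray_hit x theta r : body_closure Omega x -> 0 <= r -> Q (ray x theta r) ->
  [/\ hit_weight <= wt x theta, lseg Omega (x, theta), r <= 4 * d & r < exit_time x theta].
Proof.
move=> cx r0 Qr; have Or := inner_square_body Qr.
have r4 : r <= 4 * d by apply: (ray_length cx _ r0 (theta := theta)); left.
have d0 : 0 < d by case: OB.
have W : hit_weight <= wt x theta.
  have [Ox|fx] := cx; first by rewrite (wt_body OB)// ge_min lexx.
  have [tl E] := tbP b fx; rewrite (wt_frontier OB)//; set t := tb b x in tl E *.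
  apply: (@le_trans _ _ (eta / (8 * d))); first by rewrite ge_min lexx orbT.
  have nn := normal_unit b t.
  have [n1 n2] : `|(normal b (c t)).1| <= 1 /\ `|(normal b (c t)).2| <= 1.
    by split; [exact: norm_unit_coordinate nn|apply: (norm_unit_coordinate (v := (normal b (c t)).1)); rewrite addrC].
  have [q1 q2] := Qr.
  (* The hit point pushed outwards by [eta] stays in the larger square, and the supporting line at
     [c t] then gives [eta < r * flux]. *)
  have Oy : Omega ((ray x theta r).1 + eta * (normal b (c t)).1,
                   (ray x theta r).2 + eta * (normal b (c t)).2).
    have en (u : R) : `|u| <= 1 -> `|eta * u| <= eta.
      by move=> h; rewrite normrM gtr0_norm// ler_piMr// ltW.
    apply: HQ; [rewrite [(_, _).1]/= addrAC|rewrite [(_, _).2]/= addrAC];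
      apply: le_trans (ler_normD _ _) _; [have := en _ n1|have := en _ n2]; lra.
  have := supporting_line OB b t Oy.
  rewrite (_ : dot _ _ = eta * dot (normal b (c t)) (normal b (c t)) - r * flux b (t, theta)); last first.
    by rewrite /flux /dot /dir /ray /= E; ring.
  rewrite nn mulr1 subr_lt0 => h.
  have e2 : 0 < eta by exact: eta0.
  have rp : 0 < r by rewrite lt_def r0 andbT; apply/eqP => r00; move: h; rewrite r00 mul0r; lra.
  have fp : 0 < flux b (t, theta) by rewrite -(pmulr_rgt0 _ rp); lra.
  rewrite (max_l (ltW fp)) ler_pdivrMr ?mulr_gt0//.
  have : r * flux b (t, theta) <= 4 * d * flux b (t, theta) by rewrite ler_wpM2r// ltW.
  by rewrite (_ : _ * (8 * d) = 4 * d * flux b (t, theta)); [lra|field].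
have lz : lseg Omega (x, theta).
  by apply: (lseg_wt OB (b := b)); rewrite gt_eqF// (lt_le_trans hit_weight_gt0).
by split => //; exact: ray_body_exit_time.
Qed.

Lemma Rint_Q_polar x V : body_closure Omega x -> bmo setT V ->
  \int[@leb2 R]_(y in Q) V y = \int[mu]_(theta in @angles R) \int[mu]_(r in `[0, 4 * d])
    (r * (\1_Q (ray x theta r) * V (ray x theta r))).
Proof.
move=> cx bV; have d0 : 0 < d by case: OB.
rewrite Rint_restrict (Rint_polar (x := x) (L := 2 * d)).
- by rewrite mulrA (_ : 2 * 2 = 4)//; ring.
- by rewrite mulr_ge0// ltW.
- by apply: bmoM => //; apply: bmo_indic; exact: inner_square_measurable.
move=> y; have [Qy _|nQ] := pselect (Q y); last by rewrite indicN// mul0r eqxx.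
have [x1 x2] := closure_bound cx.
have [y1 y2] := closure_bound (or_introl (inner_square_body Qy)).
by split; apply: le_trans (ler_normB _ _) _; lra.
Qed.

(** The ratio of the kernel [exp(- r / e) / e] to the polar weight [r], both taken at the largest
    distance [4 * d], times the least angular weight. *)
Definition doeblin : R := hit_weight * (e^-1 * expR (- e^-1 * (4 * d)) / (4 * d)).

Lemma doeblin_gt0 : 0 < doeblin.
Proof.
have d0 : 0 < d by case: OB.
by rewrite mulr_gt0 ?hit_weight_gt0// divr_gt0 ?mulr_gt0 ?expR_gt0// invr_gt0.
Qed.

(** The integral over the square, in polar coordinates at [x], is compared with the mild formula
    direction by direction. Directions that miss the square contribute 0 to the left side; on the
    others the angular weight is at least [hit_weight]. *)
Lemma transition_minorization V x : bmo setT V -> (forall y, 0 <= V y) ->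
  body_closure Omega x -> doeblin * \int[@leb2 R]_(y in Q) V y <= transition b e V x.
Proof.
move=> bV V0 cx; have d0 : 0 < d by case: OB.
have bQV : bmo setT (fun y => \1_Q y * V y).
  by apply: bmoM => //; apply: bmo_indic; exact: inner_square_measurable.
have am := @angles_measurable R; have af := @angles_finite R.
have brad D : D `<=` `[0, 4 * d]%classic -> forall theta, bmo D (fun r : T1 => r * (\1_Q (ray x theta r) * V (ray x theta r))).
  move=> sD theta; apply: bmoM.
    apply: (bmo_bd (M := 4 * d)) => // r /sD/=; rewrite in_itv/= => /andP[h1 h2].
    by rewrite ger0_norm.
  by apply: (bmo_comp bQV) => //; exact: (measurableT_comp (measurable_ray x) (pair1_measurable theta)).
have mI (a a' : R) : measurable (`[a, a']%classic : set T1) by exact: measurable_itv.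
have bang : bmo (@angles R) (fun theta => \int[mu]_(r in `[0, 4 * d]) (r * (\1_Q (ray x theta r) * V (ray x theta r)))).
  apply: (bmo_Rint (mI 0 (4 * d)) (itv_finite 0 (4 * d)) (f := fun theta r => r * (\1_Q (ray x theta r) * V (ray x theta r)))) => //.
  apply: bmoM.
    apply: (bmo_bd (M := 4 * d)); first by mfun.
    by move=> z [_ /=]; rewrite in_itv/= => /andP[h1 h2]; rewrite ger0_norm.
  by apply: (bmo_comp bQV) => //; exact: measurable_ray.
rewrite (Rint_Q_polar cx bV) -(RintZ am af)//.
have bS := bmo_fst bV; have bm := bmo_mild OB e0 bS.
apply: (Rint_le am af); [exact: bmoZ|exact: (bmo_wtF OB b x bm)|].
move=> theta _.
have [[r [r0 Qr]]|nh] := pselect (exists r, 0 <= r /\ Q (ray x theta r)); last first.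
  rewrite Rint_eq0 ?mulr0; first by rewrite mulr_ge0 ?wt_ge0// mild_ge0.
  move=> r; rewrite /= in_itv/= => /andP[r0 _]; rewrite indicN ?mul0r ?mulr0//.
  by move=> Qr; apply: nh; exists r.
have [W lz _ _] := ray_hit cx r0 Qr.
rewrite /doeblin -mulrA; apply: ler_pM.
- by rewrite ltW// hit_weight_gt0.
- apply: mulr_ge0; first by rewrite divr_ge0 ?mulr_ge0 ?expR_ge0 ?invr_ge0// ltW.
  apply: Rintegral_ge0 => r'; rewrite /= in_itv/= => /andP[h _].
  by rewrite !mulr_ge0// indicE.
- exact: W.
rewrite mild_ray//; apply: ler_wpDl; first by rewrite mulr_ge0 ?expR_ge0.
have Pt (r' : R) : 0 <= r' ->
  e^-1 * expR (- e^-1 * (4 * d)) / (4 * d) * (r' * (\1_Q (ray x theta r') * V (ray x theta r'))) <=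
  \1_(`[0, exit_time x theta]%classic) r' * (e^-1 * expR (- e^-1 * r') * V (ray x theta r')).
  move=> r'0; have [Q'|nQ'] := pselect (Q (ray x theta r')); last first.
    rewrite (indicN R nQ') mul0r !mulr0 mulr_ge0 ?indicE// !mulr_ge0 ?expR_ge0// invr_ge0 ltW//.
  have [_ _ h4 hx] := ray_hit cx r'0 Q'.
  rewrite (indicT R Q') indicT ?mul1r; last by rewrite /= in_itv/= r'0 ltW.
  rewrite mulrA ler_wpM2r//.
  rewrite (_ : _ * r' = e^-1 * (expR (- e^-1 * (4 * d)) * (r' / (4 * d)))); last by ring.
  rewrite ler_wpM2l ?invr_ge0 ?(ltW e0)//.
  apply: (@le_trans _ _ (expR (- e^-1 * (4 * d)) * 1)).
    by rewrite ler_wpM2l ?expR_ge0// ler_pdivrMr ?mulr_gt0// mul1r.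
  by rewrite mulr1 ler_expR ler_wnM2l// oppr_le0 invr_ge0 ltW.
have e4 := itv_finite 0 (4 * d).
rewrite -(RintZ (mI 0 (4 * d)) e4); last exact: brad.
have tau4 : exit_time x theta <= 4 * d.
  apply: (ray_length cx (theta := theta)); last exact: exit_time_ge0.
  by right; rewrite -pt_ray subKr; apply: (pt_si_frontier OB); case: lz.
have -> : \int[mu]_(r in `[0, exit_time x theta]) (e^-1 * expR (- e^-1 * r) * V (ray x theta r)) =
  \int[mu]_(r in `[0, 4 * d]) (\1_(`[0, exit_time x theta]%classic : set T1) r *
     (e^-1 * expR (- e^-1 * r) * V (ray x theta r))).
  rewrite -Rint_restrictI setIidr// => r'/=; rewrite !in_itv/= => /andP[-> h]/=.
  exact: le_trans h tau4.
apply: (Rint_le (mI 0 (4 * d)) e4); first by apply: bmoZ; exact: brad.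
  apply: bmoM; first by apply: bmo_indic; exact: mI.
  apply: bmoM.
    apply: bmoZ; apply: (bmo_bd (M := 1)); first by mfun.
    move=> r'; rewrite /= in_itv/= => /andP[h _]; rewrite ger0_norm ?expR_ge0//.
    by rewrite -expR0 ler_expR mulNr oppr_le0 mulr_ge0// invr_ge0 ltW.
  by apply: (bmo_comp bV) => //; exact: (measurableT_comp (measurable_ray x) (pair1_measurable theta)).
by move=> r'; rewrite /= in_itv/= => /andP[h _]; exact: Pt.
Qed.

End backward_rays.

Lemma norm_split_le (R : realType) (v s k w a : R) :
  `|v - (s + w)| <= a -> `|w - k| <= a -> `|v - (s + k)| <= 2 * a.
Proof.
move=> h1 h2; have := ler_normD (v - (s + w)) (w - k).
by rewrite (_ : v - (s + w) + (w - k) = v - (s + k)); [lra|ring].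
Qed.

(** * Contraction and existence of a fixed point *)

Section existence.
Context (R : realType) (Omega : set (R * R)) (d : R) (OB : cbody Omega d)
        (b : boundary_data Omega) (e : R) (e0 : 0 < e).
Context (xc : R * R) (eta : R) (eta0 : 0 < eta).
Context (HQ : contains_square Omega xc eta).
Notation T1 := (measurableTypeR R).
Notation T2 := (T1 * T1)%type.
Notation T3 := (T1 * T1 * T1)%type.
Notation mu := (@lebesgue_measure R).
Notation c := (curve b).
Notation mild := (mild Omega e).
Notation avg := (avg b).
Notation K := (transition b e).
Notation Pi := (invariant_integral b e).
Notation Q := (inner_square xc eta).
Implicit Types (V W : T2 -> R) (S : T3 -> R).

Lemma bmo_transition V : bmo setT V -> bmo setT (K V).
Proof. by move=> bV; apply: bmo_avg OB b _ _; apply: bmo_mild OB _ e0 _ _; exact: bmo_fst. Qed.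

Lemma transition_lin V W k x : bmo setT V -> bmo setT W ->
  K (fun y => V y + k * W y) x = K V x + k * K W x.
Proof.
move=> bV bW; rewrite /transition -(avg_lin OB); [|by apply: (bmo_mild OB e0); exact: bmo_fst..].
congr (avg _ x); apply/funext => z.
by rewrite -mild_lin//; exact: bmo_fst.
Qed.

Lemma transition_cst k x : body_closure Omega x -> K (fun=> k) x = k.
Proof. by move=> cx; rewrite /transition (avg_mild_cst OB). Qed.

Lemma transition_abs V M x : bmo setT V -> 0 <= M -> (forall y, `|V y| <= M) -> `|K V x| <= M.
Proof.
move=> bV M0 VM; apply: (avg_abs OB) => //.
  by apply: (bmo_mild OB e0); exact: bmo_fst.
by move=> theta; apply: (mild_abs Omega e0 (bmo_fst bV) M0) => z; exact: VM.
Qed.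

Lemma invariant_integral_ge0 V : (forall x, body_closure Omega x -> 0 <= V x) -> 0 <= Pi V.
Proof.
move=> V0; rewrite addr_ge0// mulr_ge0 ?mulr_ge0 ?pi_ge0 ?(ltW e0)//; apply: Rintegral_ge0.
  by move=> x Ox; apply: V0; left.
by move=> t _; apply: V0; right; exact: curve_frontier.
Qed.

Let bm := body_measurable OB.
Let bf := body_finite OB.
Let lm : measurable (`[0, len b[%classic : set T1) := measurable_itv _.
Let lf : (mu (`[0%R, len b[%classic : set T1) < +oo)%E := ico_finite _ _.

Lemma invariant_integral_lin V W k : bmo setT V -> bmo setT W ->
  Pi (fun x => V x + k * W x) = Pi V + k * Pi W.
Proof.
move=> bV bW.
have bc (U : T2 -> R) D : bmo setT U -> bmo D (fun t : T1 => U (c t)).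
  by move=> bU; apply: (bmo_comp bU) => //; exact: measurable_curve.
have bs (U : T2 -> R) D : bmo setT U -> bmo D U by exact: bmoS.
have E1 := RintD bm bf (bs V Omega bV) (bmoZ k (bs W Omega bW)).
have E2 := RintD lm lf (bc V _ bV) (bmoZ k (bc W _ bW)).
rewrite (RintZ bm bf _ (bs W Omega bW)) in E1; rewrite (RintZ lm lf _ (bc W _ bW)) in E2.
by rewrite /invariant_integral E1 E2; ring.
Qed.

Lemma invariant_integral_gt0 k : 0 < k -> 0 < Pi (fun=> k).
Proof.
move=> k0; rewrite /invariant_integral ltr_wpDl//.
  by rewrite mulr_ge0 ?mulr_ge0 ?pi_ge0//; apply: Rintegral_ge0 => *; exact: ltW.
have El : fine (mu `[0, len b[) = len b.
  by rewrite lebesgue_measure_itv/= lte_fin len_gt0/= oppr0 addr0.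
by rewrite (Rintegral_cst mu lm) El !mulr_gt0// len_gt0.
Qed.

Lemma zero_mean_lower_bound V k : bmo setT V -> Pi V = 0 ->
  (forall x, body_closure Omega x -> k <= V x) -> k <= 0.
Proof.
move=> bV PV Vk; rewrite leNgt; apply/negP => k0.
have := @invariant_integral_ge0 (fun x => V x + (-1) * k).
rewrite invariant_integral_lin//; last exact: bmo_cst.
rewrite PV add0r => H.
have : Pi (fun=> k) <= 0.
  rewrite -oppr_ge0 -mulN1r; apply: H => x cx; rewrite mulN1r subr_ge0; exact: Vk.
by rewrite leNgt invariant_integral_gt0.
Qed.

Lemma zero_mean_upper_bound V k : bmo setT V -> Pi V = 0 ->
  (forall x, body_closure Omega x -> V x <= k) -> 0 <= k.
Proof.
move=> bV PV Vk; rewrite -oppr_le0.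
apply: (@zero_mean_lower_bound (fun x => 0 + (-1) * V x)).
- by apply: bmoD; [exact: bmo_cst|exact: bmoZ].
- rewrite invariant_integral_lin//; last exact: bmo_cst.
  rewrite PV mulr0 addr0 /invariant_integral !Rint_eq0 ?mulr0 ?addr0//.
- by move=> x cx; have := Vk x cx; lra.
Qed.

Let Qm := inner_square_measurable xc eta.

Lemma inner_square_finite : (@leb2 R Q < +oo)%E.
Proof.
by apply: finite_sub Qm bm _ bf; exact: (inner_square_body eta0 HQ).
Qed.

Definition contraction_rate : R := doeblin d e eta * fine (@leb2 R Q).

Lemma contraction_rate_gt0 : 0 < contraction_rate.
Proof.
have e2 := eta0; rewrite mulr_gt0 ?(doeblin_gt0 OB)//.
rewrite (_ : Q = `[xc.1 - eta, xc.1 + eta]%classic `*` `[xc.2 - eta, xc.2 + eta]%classic); last first.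
  apply/seteqP; split => y; rewrite /inner_square/= !in_itv/= !ler_norml.
    by move=> [/andP[? ?] /andP[? ?]]; split; apply/andP; split; lra.
  by move=> [/andP[? ?] /andP[? ?]]; split; apply/andP; split; lra.
rewrite [X in fine X](product_measure1E mu mu)//.
have h : xc.1 - eta <= xc.1 + eta by lra.
have h' : xc.2 - eta <= xc.2 + eta by lra.
rewrite fineM ?ge0_fin_numE//; [|exact: itv_finite|exact: itv_finite].
by rewrite !fine_mu_itv// mulr_gt0//; lra.
Qed.

Lemma contraction_rate_le1 : contraction_rate <= 1.
Proof.
have cx : body_closure Omega xc.
  by left; apply: HQ; rewrite subrr normr0 mulr_ge0// ltW.
have := transition_minorization OB b e0 eta0 HQ (bmo_cst setT (1 : R)) _ cx.
rewrite transition_cst// Rintegral_cst ?mul1r//; apply => _; exact: ler01.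
Qed.

(** Minorization applied to [V - lo] and to [hi - V] shortens the range at both ends, by amounts
    whose sum is the rate times [hi - lo]. Outside the closure [transition] is 0, and 0 belongs to
    the new range because the invariant mean is 0. *)
Lemma transition_contraction V lo hi : bmo setT V -> Pi V = 0 ->
  (forall x, lo <= V x <= hi) -> exists lo' hi',
  (forall x, lo' <= K V x <= hi') /\ hi' - lo' = (1 - contraction_rate) * (hi - lo).
Proof.
move=> bV PV Vb; set I := \int[@leb2 R]_(y in Q) V y; set q := fine (@leb2 R Q).
pose de := doeblin d e eta.
have bVQ : bmo Q V by exact: bmoS bV.
have Qf := inner_square_finite.
have up x : body_closure Omega x -> lo + de * (I - lo * q) <= K V x.
  move=> cx.
  have := transition_minorization OB b e0 eta0 HQ (V := fun y => V y + (-1) * lo) _ _ cx.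
  rewrite transition_lin//; last exact: bmo_cst.
  rewrite transition_cst// (RintD Qm Qf)//; last exact: bmo_cst.
  rewrite Rintegral_cst// -/I -/q -/de.
  move=> /(_ (bmoD bV (bmo_cst _ _))) H.
  have : forall y, 0 <= V y + (-1) * lo by move=> y; have /andP[? ?] := Vb y; lra.
  by move=> /H; rewrite !mulN1r mulNr; lra.
have dn x : body_closure Omega x -> K V x <= hi - de * (hi * q - I).
  move=> cx.
  have := transition_minorization OB b e0 eta0 HQ (V := fun y => hi + (-1) * V y) _ _ cx.
  rewrite transition_lin//; last exact: bmo_cst.
  rewrite transition_cst// (RintD Qm Qf)//; [|exact: bmo_cst|exact: bmoZ].
  rewrite Rintegral_cst// (RintZ Qm Qf)// -/I -/q -/de.
  move=> /(_ (bmoD (bmo_cst _ _) (bmoZ _ bV))) H.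
  have : forall y, 0 <= hi + (-1) * V y by move=> y; have /andP[? ?] := Vb y; lra.
  by move=> /H; rewrite !mulN1r; lra.
exists (lo + de * (I - lo * q)), (hi - de * (hi * q - I)); split; last first.
  by rewrite /contraction_rate -/de -/q; ring.
have PK : Pi (K V) = 0 by rewrite (invariant_integral_transition OB).
have bK := bmo_transition bV.
move=> x; have [cx|ncx] := pselect (body_closure Omega x); first by rewrite up ?dn.
rewrite /transition avg_out//; apply/andP; split.
  exact: zero_mean_lower_bound bK PK up.
exact: zero_mean_upper_bound bK PK dn.
Qed.

Let q : R := 1 - contraction_rate.

Let q01 : 0 <= q < 1.
Proof.
have h1 := contraction_rate_gt0; have h2 := contraction_rate_le1.
by rewrite /q; apply/andP; split; lra.
Qed.

Lemma iter_transition V M : bmo setT V -> Pi V = 0 -> (forall x, `|V x| <= M) ->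
  forall n, bmo setT (iter n K V) /\ forall x, `|iter n K V x| <= 2 * M * q ^+ n.
Proof.
move=> bV PV VM n.
suff: exists lo hi, [/\ bmo setT (iter n K V), Pi (iter n K V) = 0,
    (forall x, lo <= iter n K V x <= hi) & hi - lo = q ^+ n * (2 * M)].
  move=> [lo [hi [bn Pn Vn E]]]; split => // x.
  have lo0 : lo <= 0 by apply: zero_mean_lower_bound bn Pn _ => y _; have /andP[] := Vn y.
  have hi0 : 0 <= hi by apply: zero_mean_upper_bound bn Pn _ => y _; have /andP[] := Vn y.
  rewrite mulrC -E ler_norml; have /andP[? ?] := Vn x; apply/andP; split; lra.
elim: n => [|n [lo [hi [bn Pn Vn E]]]].
  exists (- M), M; split => //; last by rewrite expr0; ring.
  by move=> x; rewrite /= -ler_norml.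
have [lo' [hi' [h1 h2]]] := transition_contraction bn Pn Vn.
exists lo', hi'; split => //.
- exact: bmo_transition.
- by rewrite /= (invariant_integral_transition OB).
- by rewrite h2 E exprS mulrA.
Qed.

(** Neumann series, summed pointwise with a uniform geometric bound, so that the equation holds at
    every point, including each boundary point. *)
Lemma transition_fixpoint s : bmo setT s -> Pi s = 0 ->
  exists2 V, bmo setT V & forall x, V x = s x + K V x.
Proof.
move=> bs Ps; have [M' sM'] := bs.2; pose M := `|M'|.
have sM x : `|s x| <= M by apply: le_trans (sM' x I) (ler_norm _).
have it := iter_transition bs Ps sM.
have /andP[q0 q1] := q01.
pose W n x := \sum_(k < n) iter k K s x.
have bW n : bmo setT (W n).
  elim: n => [|n IH].
    rewrite (_ : W 0%N = fun=> 0); first exact: bmo_cst.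
    by apply/funext => x; rewrite /W big_ord0.
  rewrite (_ : W n.+1 = fun x => W n x + iter n K s x).
    by apply: bmoD => //; exact: (it n).1.
  by apply/funext => x; rewrite /W big_ord_recr.
have WS n x : W n.+1 x = s x + K (W n) x.
  rewrite /W big_ord_recl/=; congr (_ + _); rewrite -/(W n).
  elim: n => [|n IH].
    rewrite big_ord0 (_ : W 0%N = fun=> 0); last by apply/funext => y; rewrite /W big_ord0.
    apply/esym/eqP; rewrite -normr_le0.
    by apply: transition_abs => [||y]; [exact: bmo_cst|exact: lexx|rewrite normr0].
  rewrite big_ord_recr/= IH.
  rewrite (_ : W n.+1 = fun y => W n y + 1 * iter n K s y); last first.
    by apply/funext => y; rewrite /W big_ord_recr mul1r.
  by rewrite transition_lin ?mul1r//; exact: (it n).1.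
pose C := 2 * M / (1 - q).
have q1' : 0 < 1 - q by lra.
have M0 : 0 <= M by rewrite normr_ge0.
have C0 : 0 <= C by rewrite divr_ge0 ?mulr_ge0// ltW.
(* The geometric sum is written as a telescoping difference, which makes the induction on [m]
   immediate. *)
have Wd n m x : `|W (n + m)%N x - W n x| <= C * (q ^+ n - q ^+ (n + m)).
  elim: m => [|m IH]; first by rewrite addn0 !subrr normr0 mulr0.
  rewrite addnS /W big_ord_recr/= -/(W (n + m)%N x) addrAC.
  apply: le_trans (ler_normD _ _) _.
  have := (it (n + m)%N).2 x.
  have -> : 2 * M * q ^+ (n + m) = C * (q ^+ (n + m) - q ^+ (n + m).+1).
    by rewrite /C exprS; field; rewrite gt_eqF.
  by move: IH; rewrite !mulrBr; lra.
have cvgW x : cvgn (fun n => W n x).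
  rewrite (_ : (fun n => W n x) = series (fun n => iter n K s x)); last first.
    by apply/funext => n; rewrite /W /series/= big_mkord.
  apply: normed_cvg; apply: (series_le_cvg (v_ := geometric (2 * M) q)).
  - by move=> n; exact: normr_ge0.
  - by move=> n; rewrite /geometric/= !mulr_ge0 ?exprn_ge0.
  - by move=> n; exact: (it n).2.
  - by apply: is_cvg_geometric_series; rewrite ger0_norm.
have Wlim n x : `|limn (fun n => W n x) - W n x| <= C * q ^+ n.
  apply/ler_addgt0Pr => k k0.
  have /cvgrPdist_lt/(_ k k0)[N _ HN] := cvgW x.
  have := HN (n + N)%N (leq_addl _ _); have := Wd n N x.
  set l := limn _; set w := W n x; set w' := W (n + N)%N x => h1 h2.
  have : C * (q ^+ n - q ^+ (n + N)) <= C * q ^+ n.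
    by rewrite ler_wpM2l// gerBl exprn_ge0.
  have := ler_normD (l - w') (w' - w); rewrite addrA subrK; move: h1 h2; lra.
pose V x := limn (fun n => W n x).
have bV : bmo setT V.
  apply: (bmo_bd (M := C)).
    by apply: (measurable_fun_cvg (h := W)) => [m|x _]; [exact: (bW m).1|exact: cvgW].
  by move=> x _; have := Wlim 0%N x; rewrite {2}/W big_ord0 subr0 expr0 mulr1.
exists V => // x; apply/eqP; rewrite -subr_eq0 -normr_le0.
have H n : `|V x - (s x + K V x)| <= 2 * C * q ^+ n.
  have h1 := Wlim n.+1 x; rewrite -/(V x) in h1.
  have h2 : `|K (fun y => W n y + (-1) * V y) x| <= C * q ^+ n.
    apply: transition_abs; first by apply: bmoD => //; exact: bmoZ.
      by rewrite mulr_ge0// exprn_ge0.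
    by move=> y; rewrite mulN1r distrC; exact: Wlim.
  rewrite transition_lin// mulN1r in h2.
  rewrite WS in h1.
  have h3 : C * q ^+ n.+1 <= C * q ^+ n.
    by rewrite ler_wpM2l// exprS ler_piMl ?exprn_ge0// ltW.
  rewrite -mulrA; exact: norm_split_le (le_trans h1 h3) h2.
apply/ler_addgt0Pr => k k0; rewrite add0r.
have [n hn] : exists n, 2 * C * q ^+ n < k.
  have cq : (fun n => 2 * C * q ^+ n) @ \oo --> (2 * C * 0 : R).
    by apply: cvgM; [exact: cvg_cst|apply: cvg_expr; rewrite ger0_norm].
  have := cq; rewrite mulr0 => /cvgrPdist_lt/(_ k k0)[N _ HN].
  exists N; have := HN N (leqnn _); rewrite /= sub0r normrN ger0_norm//.
  by apply: mulr_ge0; [exact: mulr_ge0|exact: exprn_ge0].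
exact: le_trans (H n) (ltW hn).
Qed.

(** The hypothesis says that [avg (mild S)] has zero invariant mean. Constants are fixed on the
    closure, so subtracting [k] normalizes the solution; the indicator keeps the equation true off
    the closure, where [avg] is 0. *)
Lemma mild_fixpoint S : bmo setT S ->
  \int[@leb3 R]_(z in phase Omega) S z +
    e * \int[@leb2 R]_(z in Gamma_minus b) (S (c z.1, z.2) * `|flux b z|) = 0 ->
  exists V, [/\ bmo setT V, \int[@leb2 R]_(x in Omega) V x = 0 &
    forall x, V x = avg (mild (fun z => V z.1 + S z)) x].
Proof.
move=> bS S0; have bmS := bmo_mild OB e0 bS.
have [] := @transition_fixpoint (avg (mild S)).
- exact: bmo_avg OB b _ bmS.
- by rewrite (invariant_integral_mild OB).
move=> V bV VE.
have Om : 0 < fine (@leb2 R Omega).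
  have h := contraction_rate_gt0; have dg := doeblin_gt0 OB e0 eta0.
  apply: (@lt_le_trans _ _ (fine (@leb2 R Q))).
    by move: h; rewrite /contraction_rate pmulr_rgt0.
  apply: fine_le; rewrite ?ge0_fin_numE//; first exact: inner_square_finite.
  by apply: le_measure; rewrite ?inE//; exact: (inner_square_body eta0 HQ).
pose k := \int[@leb2 R]_(x in Omega) V x / fine (@leb2 R Omega).
have cm : measurable (body_closure Omega : set T2).
  by apply: measurableU => //; exact: (frontier_measurable OB).
exists (fun x => \1_(body_closure Omega) x * (V x - k)); split.
- by apply: bmoM; [exact: bmo_indic|apply: bmoB => //; exact: bmo_cst].
- transitivity (\int[@leb2 R]_(x in Omega) (V x - k)).
    by apply: eq_Rintegral => x /set_mem Ox; rewrite indicT ?mul1r//; left.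
  rewrite (RintB bm bf); [|exact: bmoS bV|exact: bmo_cst].
  by rewrite Rintegral_cst// /k divfK ?subrr// gt_eqF.
move=> x; have [cx|ncx] := pselect (body_closure Omega x); last first.
  by rewrite avg_out// indicN// mul0r.
rewrite indicT// mul1r (mild_ext OB e (S' := fun z => V z.1 - k + S z)); last first.
  by move=> z cz; rewrite indicT// mul1r.
have bV1 : bmo setT (fun z : T3 => V z.1) by exact: bmo_fst.
have bk : bmo setT (fun z : T3 => k) by exact: bmo_cst.
rewrite (_ : (fun z : T3 => V z.1 - k + S z) = fun z => (V z.1 + (-1) * k) + 1 * S z); last first.
  by apply/funext => z; ring.
rewrite (_ : mild _ = fun z => (mild (fun z => V z.1) z + (-1) * mild (fun=> k) z) + 1 * mild S z); last first.
  apply/funext => z; rewrite mild_lin//; last by apply: bmoD => //; exact: bmoZ.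
  by rewrite mild_lin.
have B1 := bmo_mild OB e0 bV1; have B2 := bmo_mild OB e0 bk.
rewrite (avg_lin OB)//; last by apply: bmoD => //; exact: bmoZ.
rewrite (avg_lin OB)// (avg_mild_cst OB)// VE /transition.
set a1 := avg _ x; set a2 := avg _ x; clearbody a1 a2 k; ring.
Qed.

End existence.

(** * The energy inequality *)

Section energy.
Context (R : realType) (Omega : set (R * R)) (d : R) (OB : cbody Omega d)
        (b : boundary_data Omega) (e : R) (e0 : 0 < e).
Notation T1 := (measurableTypeR R).
Notation T2 := (T1 * T1)%type.
Notation T3 := (T1 * T1 * T1)%type.
Notation mu := (@lebesgue_measure R).
Notation c := (curve b).
Notation mild := (mild Omega e).
Notation avg := (avg b).
Implicit Types (V W : T2 -> R) (S F : T3 -> R).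

Let bm := body_measurable OB.
Let bf := body_finite OB.
Let am : measurable (@angles R : set T1) := @angles_measurable R.
Let af : (mu (@angles R : set T1) < +oo)%E := @angles_finite R.
Let pm := phase_measurable OB.
Let pf := phase_finite OB.
Let gm := Gamma_minus_measurable OB b.
Let gf := Gamma_minus_finite OB b.
Let lm : measurable (`[0, len b[%classic : set T1) := measurable_itv _.
Let lf : (mu (`[0%R, len b[%classic : set T1) < +oo)%E := ico_finite _ _.

(** Jensen: on the closure the weight has mass 1, and the average of [(F - v) ^+ 2] is
    nonnegative. *)
Lemma avg_square_le F x : bmo setT F -> body_closure Omega x ->
  avg F x ^+ 2 <= avg (fun z => F z ^+ 2) x.
Proof.
move=> bF cx; set v := avg F x.
have bF2 := bmoX 2 bF; have b1 : bmo setT (fun _ : T3 => 1 : R) by exact: bmo_cst.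
have : 0 <= avg (fun z => (F z ^+ 2 + (- (2 * v)) * F z) + v ^+ 2 * 1) x.
  apply: avg_ge0 => z.
  by rewrite (_ : _ + _ = (F z - v) ^+ 2) ?sqr_ge0//; ring.
rewrite (avg_lin OB)//; last by apply: bmoD => //; exact: bmoZ.
rewrite (avg_lin OB)// -/v (avg_section_cst OB (F := fun=> 1) (k := 1) cx)//.
rewrite mulr1; lra.
Qed.

Lemma Rint_zero_mul dd (T : measurableType dd) (m : {measure set T -> \bar R}) (D : set T)
    (f g : T -> R) : measurable D -> (m D < +oo)%E -> bmo D f -> bmo D g ->
  \int[m]_(x in D) `|f x| = 0 -> \int[m]_(x in D) (f x * g x) = 0.
Proof.
move=> mD fD bf' bg f0; have [M gM] := bg.2.
apply/eqP; rewrite -normr_le0; apply: le_trans (Rint_abs mD fD (bmoM bf' bg)) _.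
rewrite -[leRHS](mulr0 M) -f0 -(RintZ mD fD); last exact: bmo_norm.
apply: (Rint_le mD fD); [by apply: bmo_norm; exact: bmoM|by apply: bmoZ; exact: bmo_norm|].
by move=> x Dx; rewrite normrM mulrC ler_wpM2r// gM.
Qed.

(** Green for [U ^+ 2]. Inside, [V (V - U)] integrates to 0 because [V] is the velocity average of
    [U]; at the boundary, Jensen makes the outgoing term dominate the part [V ^+ 2] of the incoming
    one. The relation between [V] and [avg U] is assumed in integral form so that the inequality
    also applies to weak solutions. *)
Lemma energy V S : bmo setT V -> bmo setT S ->
  let U := mild (fun z => V z.1 + S z) in
  \int[@leb2 R]_(x in Omega) `|V x - avg U x| = 0 ->
  \int[mu]_(t in `[0, len b[) `|V (c t) - avg U (c t)| = 0 ->
  \int[@leb3 R]_(z in phase Omega) (V z.1 - U z) ^+ 2 <=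
  \int[@leb3 R]_(z in phase Omega) (S z * U z) +
  e * \int[@leb2 R]_(z in Gamma_minus b) (V (c z.1) * S (c z.1, z.2) * `|flux b z|) +
  e / 2 * \int[@leb2 R]_(z in Gamma_minus b) (S (c z.1, z.2) ^+ 2 * `|flux b z|).
Proof.
move=> bV bS U EV EB.
have bS' : bmo setT (fun z => V z.1 + S z) by apply: bmoD => //; exact: bmo_fst.
have bU : bmo setT U by exact: bmo_mild OB _ e0 _ bS'.
have bV3 : bmo setT (fun z : T3 => V z.1) by exact: bmo_fst.
have bA := bmo_avg OB b bU.
have s2 (f : T2 -> R) D : bmo setT f -> bmo D f by exact: bmoS.
have s3 (f : T3 -> R) D : bmo setT f -> bmo D f by exact: bmoS.
have sc (f : T2 -> R) : bmo setT f -> bmo `[0, len b[ (fun t : T1 => f (c t)).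
  by move=> bf'; apply: (bmo_comp bf') => //; exact: measurable_curve.
have sg (f : T3 -> R) D : bmo setT f -> bmo D (fun z : T2 => f (c z.1, z.2)).
  by move=> bf'; apply: (bmo_curve b); exact: s3.
have bfl : bmo setT (fun z : T2 => `|flux b z|).
  by apply: bmo_norm; exact: bmo_flux OB b _.
have hA : \int[@leb3 R]_(z in phase Omega) (V z.1 * (V z.1 - U z)) = 0.
  rewrite (Rint_phase_prod OB); last by apply: bmoM => //; exact: bmoB.
  transitivity (\int[@leb2 R]_(x in Omega) ((V x - avg U x) * (V x * (2 * pi)))).
    apply: eq_Rintegral => x /set_mem Ox.
    have bUx : bmo (@angles R) (fun theta : T1 => U (x, theta)) by exact: bmo_section.
    transitivity (\int[mu]_(theta in @angles R) (V x * (V x - U (x, theta)))); first by [].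
    rewrite (RintZ am af); last by apply: bmoB => //; exact: bmo_cst.
    rewrite (RintB am af)//; last exact: bmo_cst.
    rewrite Rintegral_cst//= fine_mu_angles.
    have -> : \int[mu]_(theta in @angles R) U (x, theta) = 2 * pi * avg U x.
      rewrite /avg -(RintZ am af); last exact: (bmo_wtF OB).
      apply: eq_Rintegral => theta _; rewrite (wt_body OB)// mulrA divff ?mul1r//.
      by rewrite mulf_neq0// gt_eqF// pi_gt0.
    ring.
  apply: Rint_zero_mul => //; first by apply: s2; exact: bmoB.
  by apply: s2; apply: bmoM => //; exact: bmo_cst.
have hB : 2 * \int[mu]_(t in `[0, len b[) V (c t) ^+ 2 <=
    \int[@leb2 R]_(z in Gamma_plus b) (U (c z.1, z.2) ^+ 2 * `|flux b z|).
  have bU2 := bmoX 2 bU.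
  have := Rint_avg_curve OB b bU2; rewrite /= => <-; rewrite ler_pM2l//.
  have z0 : \int[mu]_(t in `[0, len b[) ((V (c t) - avg U (c t)) * (V (c t) + avg U (c t))) = 0.
    apply: Rint_zero_mul => //; [exact: (sc (fun x => V x - avg U x) (bmoB bV bA))|].
    exact: (sc (fun x => V x + avg U x) (bmoD bV bA)).
  have -> : \int[mu]_(t in `[0, len b[) V (c t) ^+ 2 = \int[mu]_(t in `[0, len b[) (avg U (c t) ^+ 2).
    apply/eqP; rewrite -subr_eq0; apply/eqP; rewrite -[RHS]z0.
    rewrite -(RintB lm lf); [|exact: (sc (fun x => V x ^+ 2) (bmoX 2 bV))|exact: (sc (fun x => avg U x ^+ 2) (bmoX 2 bA))].
    by apply: eq_Rintegral => t _; ring.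
  apply: (Rint_le lm lf).
  - exact: (sc (fun x => avg U x ^+ 2) (bmoX 2 bA)).
  - exact: (sc (avg (fun z => U z ^+ 2)) (bmo_avg OB b bU2)).
  by move=> t _; apply: avg_square_le => //; right; exact: curve_frontier.
have LU := llac_mild OB e0 bS'; have LUU := llac_mul LU LU.
have bUU : bmo setT (fun z => U z * U z) by exact: bmoM.
have bdU : bmo setT (fun z => e^-1 * ((V z.1 + S z) - U z)) by apply: bmoZ; exact: bmoB.
have := green OB b (s3 _ _ bUU) (s3 _ (phase Omega) (bmoD (bmoM bdU bU) (bmoM bU bdU))) LUU.
have bVU : bmo setT (fun z => V z.1 - U z) by exact: bmoB.
have bSU : bmo setT (fun z => S z * U z) by exact: bmoM.
have -> : \int[@leb3 R]_(z in phase Omega) (e^-1 * ((V z.1 + S z) - U z) * U z + U z * (e^-1 * ((V z.1 + S z) - U z))) =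
   2 * e^-1 * (\int[@leb3 R]_(z in phase Omega) (S z * U z) - \int[@leb3 R]_(z in phase Omega) (V z.1 - U z) ^+ 2).
  rewrite -[X in X - _]addr0 -hA -(RintD pm pf); [|exact: s3|by apply: s3; exact: bmoM].
  rewrite -(RintB pm pf); last 2 first.
  - by apply: s3; apply: bmoD => //; exact: bmoM.
  - by apply: s3; exact: bmoX.
  rewrite -(RintZ pm pf); last first.
    apply: s3; apply: bmoB; last exact: bmoX.
    by apply: bmoD => //; exact: bmoM.
  by apply: eq_Rintegral => z _; ring.
have -> : \int[@leb2 R]_(z in Gamma_minus b) (U (c z.1, z.2) * U (c z.1, z.2) * `|flux b z|) =
  2 * \int[mu]_(t in `[0, len b[) V (c t) ^+ 2 +
  2 * \int[@leb2 R]_(z in Gamma_minus b) (V (c z.1) * S (c z.1, z.2) * `|flux b z|) +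
  \int[@leb2 R]_(z in Gamma_minus b) (S (c z.1, z.2) ^+ 2 * `|flux b z|).
  have B1 : bmo (Gamma_minus b) (fun z => V (c z.1) ^+ 2 * `|flux b z|).
    by apply: bmoM; [exact: (sg (fun z => V z.1 ^+ 2) _ (bmoX 2 bV3))|exact: s2].
  have B2 : bmo (Gamma_minus b) (fun z => V (c z.1) * S (c z.1, z.2) * `|flux b z|).
    by apply: bmoM; [exact: (sg (fun z => V z.1 * S z) _ (bmoM bV3 bS))|exact: s2].
  have B3 : bmo (Gamma_minus b) (fun z => S (c z.1, z.2) ^+ 2 * `|flux b z|).
    by apply: bmoM; [exact: (sg (fun z => S z ^+ 2) _ (bmoX 2 bS))|exact: s2].
  rewrite -(@Rint_Gamma_minus_fst _ _ _ OB b (fun x => V x ^+ 2)); last exact: bmoX.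
  rewrite -(RintZ gm gf)// -(RintD gm gf)//; last exact: bmoZ.
  rewrite -(RintD gm gf)//; last by apply: bmoD => //; exact: bmoZ.
  apply: eq_Rintegral => -[t theta] /set_mem[[/= tl _] fl].
  have Ein : U (c t, theta) = V (c t) + S (c t, theta).
    by rewrite /U (mild_enter OB)//; move: tl; rewrite in_itv.
  by rewrite Ein; ring.
have -> : \int[@leb2 R]_(z in Gamma_plus b) (U (c z.1, z.2) * U (c z.1, z.2) * `|flux b z|) =
  \int[@leb2 R]_(z in Gamma_plus b) (U (c z.1, z.2) ^+ 2 * `|flux b z|).
  by apply: eq_Rintegral => z _; ring.
move: hB; set I1 := Rintegral _ _ _; set I2 := Rintegral _ _ _.
set I3 := Rintegral _ _ _; set I4 := Rintegral _ _ _; set I5 := Rintegral _ _ _; set I6 := Rintegral _ _ _.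
move=> hB E; have {}E : I3 - I4 = e / 2 * (I2 - (2 * I1 + 2 * I5 + I6)).
  by rewrite -E; field; rewrite gt_eqF.
have : 0 <= e / 2 * (I2 - 2 * I1) by rewrite mulr_ge0 ?divr_ge0 ?(ltW e0)// subr_ge0.
rewrite (_ : e * I5 = e / 2 * (2 * I5)); last by field.
by move: E; rewrite !mulrBr !mulrDr; lra.
Qed.

End energy.

(** * Oscillation of the averages over a convex piece of the body *)

Section oscillation.
Context (R : realType) (Omega : set (R * R)) (d : R) (OB : cbody Omega d)
        (b : boundary_data Omega) (e : R) (e0 : 0 < e).
Notation T1 := (measurableTypeR R).
Notation T2 := (T1 * T1)%type.
Notation T3 := (T1 * T1 * T1)%type.
Notation mu := (@lebesgue_measure R).
Notation mild := (mild Omega e).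
Implicit Types (V : T2 -> R) (S F : T3 -> R).

Let am : measurable (@angles R : set T1) := @angles_measurable R.
Let af : (mu (@angles R : set T1) < +oo)%E := @angles_finite R.

Lemma ray0 (x : R * R) theta : ray x theta 0 = x.
Proof. by rewrite /ray !mul0r !subr0 -surjective_pairing. Qed.

(* Along a characteristic, [e U' = S - U]. *)
Lemma mild_difference S y theta s : bmo setT S -> Omega y -> 0 <= s -> Omega (ray y theta s) ->
  mild S (y, theta) - mild S (ray y theta s, theta) =
  e^-1 * \int[mu]_(q in `[0, s]) (S (ray y theta q, theta) - mild S (ray y theta q, theta)).
Proof.
move=> bS Oy s0 Os; set p := cp theta y; set s2 := cs theta y.
have ch2 : chord Omega theta p s2 by rewrite /chord/= pt_cs_cp.
have ch1 : chord Omega theta p (s2 - s) by rewrite /chord/= pt_ray.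
have [mt /andP[h1 h2]] := chord_si_so OB ch2.
have [_ /andP[h3 h4]] := chord_si_so OB ch1.
have [_ bf' fE] := llac_mild OB e0 bS mt.
have sub : `[si Omega theta p, s2] `<=` `[si Omega theta p, so Omega theta p].
  by apply: subset_itvl; rewrite bnd_simp ltW.
have E2 := fE s2; have E1 := fE (s2 - s).
rewrite !ltW// in E2; rewrite !ltW// in E1; move/(_ isT): E2 => E2; move/(_ isT): E1 => E1.
rewrite pt_cs_cp in E2; rewrite pt_ray in E1; rewrite E1 E2.
rewrite (Rint_itv_split (r := s2 - s) _ (bmoS sub bf')); last by rewrite (ltW h3)/=; lra.
rewrite [X in X - _](_ : _ = (mild S (pt theta p (si Omega theta p), theta) +
  \int[mu]_(r in `[si Omega theta p, (s2 - s)]) (e^-1 * (S (pt theta p r, theta) - mild S (pt theta p r, theta)))) +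
  \int[mu]_(r in `[s2 - s, s2]) (e^-1 * (S (pt theta p r, theta) - mild S (pt theta p r, theta)))); last by rewrite addrA.
rewrite addrAC subrr add0r.
have bD : bmo setT (fun z => S z - mild S z) by apply: bmoB => //; exact: bmo_mild OB _ e0 _ bS.
have mpt : measurable_fun setT (fun r : T1 => (pt theta p r, theta) : T3) by rewrite /pt; mfun.
rewrite Rint_reflect; last by apply: measurable_funM => //; exact: (measurableT_comp bD.1 mpt).
rewrite subKr -RintZ; [|exact: measurable_itv|exact: itv_finite|]; last first.
  apply: (bmo_comp bD) => //; rewrite /ray; mfun.
by apply: eq_Rintegral => q _; rewrite -pt_ray.
Qed.

Lemma Rint_translate (w : R * R) (f : T2 -> R) : measurable_fun setT f ->
  \int[@leb2 R]_x f (x.1 - w.1, x.2 - w.2) = \int[@leb2 R]_x f x.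
Proof.
move=> mf.
transitivity (\int[@leb2 R]_x (f x * 1)); last by apply: eq_Rintegral => x _; rewrite mulr1.
rewrite (Rint_transfer (m2 := @leb2 R) (psi := fun x : T2 => (x.1 - w.1, x.2 - w.2) : T2)
  (k1 := fun=> 1) (k2 := fun=> 1) _ _ _ mf)//.
  by apply: eq_Rintegral => x _; rewrite mulr1.
move=> F mF F0; transitivity (\int[@leb2 R]_x F x)%E; first by apply: eq_integral => x _; rewrite mule1.
rewrite -(leb2_translate (- w) mF F0); apply: eq_integral => x _; rewrite mule1.
by congr F.
Qed.

Context (D : set T2) (mD : measurable D) (DO : D `<=` Omega).

Let fD : (@leb2 R D < +oo)%E.
Proof. by apply: finite_sub mD (body_measurable OB) DO (body_finite OB). Qed.

Definition ray_integral L F (y : T2) theta : R :=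
  \int[mu]_(q in `[0, L]) (\1_D (ray y theta q) * F (ray y theta q, theta)).

Let measurable_ray3 : measurable_fun setT (fun z : T2 * T2 => ray z.1 z.2.1 z.2.2 : T2).
Proof. by rewrite /ray; mfun. Qed.

Let bint F : bmo setT F -> bmo setT (fun z : T2 * T2 => \1_D (ray z.1 z.2.1 z.2.2) * F (ray z.1 z.2.1 z.2.2, z.2.1)).
Proof.
move=> bF; apply: bmoM; first by apply: (bmo_comp (g := fun z : T2 * T2 => ray z.1 z.2.1 z.2.2) (@bmo_indic _ T2 R setT D mD) measurable_ray3).
by apply: (bmo_comp bF) => //; apply: measurable_fun_pair; [exact: measurable_ray3|mfun].
Qed.

Let mI (L : R) : measurable (`[0, L]%classic : set T1) := measurable_itv _.

Lemma bmo_ray_integral L F : bmo setT F -> bmo setT (fun z : T3 => ray_integral L F z.1 z.2).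
Proof.
move=> bF; apply: (bmo_Rint (mI L) (itv_finite 0 L) (D1 := setT)
  (f := fun (z : T3) q => \1_D (ray z.1 z.2 q) * F (ray z.1 z.2 q, z.2))).
apply: (bmo_comp (bint bF) (g := fun z : T3 * T1 => (z.1.1, (z.1.2, z.2)) : T2 * T2)) => //.
by mfun.
Qed.

(** For a fixed direction and length, moving along the ray is a translation of the plane, which
    preserves area; points brought into [D] from outside it are simply left out. *)
Lemma Rint_ray_integral_le L F : 0 <= L -> bmo setT F -> (forall z, 0 <= F z) ->
  \int[@leb2 R]_(y in D) \int[mu]_(theta in @angles R) ray_integral L F y theta <=
  L * \int[@leb2 R]_(y in D) \int[mu]_(theta in @angles R) F (y, theta).
Proof.
move=> L0 bF F0.
have mAL : measurable (@angles R `*` `[0, L]%classic : set T2) by apply: measurableX => //; exact: mI.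
have fAL : (@leb2 R (@angles R `*` (`[0%R, L]%classic : set T1)) < +oo)%E.
  by apply: leb2_rect_finite => //; exact: itv_finite.
pose H (y : T2) (w : T2) := \1_D (ray y w.1 w.2) * F (ray y w.1 w.2, w.1).
have bH : bmo setT (fun z : T2 * T2 => H z.1 z.2) by exact: bint.
have sec1 y DD : bmo DD (H y) by apply: (bmo_comp bH (pair1_measurable y)).
have sec2 w DD : bmo DD (fun y => H y w) by apply: (bmo_comp bH (pair2_measurable w)).
have bF2 DD : bmo DD (fun w : T2 => \int[@leb2 R]_(y in D) H y w).
  apply: (bmo_Rint mD fD (D1 := DD) (f := fun w y => H y w)).
  apply: (bmo_comp bH (g := fun z : T2 * T2 => (z.2, z.1) : T2 * T2)) => //; mfun.
have FD theta DD : bmo DD (fun y : T2 => F (y, theta)) by apply: (bmo_comp bF (pair2_measurable theta)).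
have FDi DD : bmo DD (fun theta : T1 => \int[@leb2 R]_(y in D) F (y, theta)).
  apply: (bmo_Rint mD fD (D1 := DD) (f := fun theta y => F (y, theta))).
  apply: (bmo_comp bF (g := fun z : T1 * T2 => (z.2, z.1) : T3)) => //; mfun.
have E1 : \int[@leb2 R]_(y in D) \int[mu]_(theta in @angles R) ray_integral L F y theta =
    \int[@leb2 R]_(y in D) \int[@leb2 R]_(w in @angles R `*` `[0, L]%classic) H y w.
  apply: eq_Rintegral => y _; rewrite /ray_integral.
  have := Rint_prod am (mI L) af (itv_finite 0 L) (f := fun theta q : T1 => H y (theta, q)).
  rewrite /H/= => <-; first by rewrite /leb2; apply: eq_Rintegral => -[].
  rewrite (_ : (fun z => _) = H y); first exact: sec1.
  by apply/funext => -[].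
rewrite E1 (Rint_swap mD mAL fD fAL); last first.
  by apply: bmoS bH.
pose G (theta : T1) := \int[@leb2 R]_(y in D) F (y, theta).
apply: (@le_trans _ _ (\int[@leb2 R]_(w in @angles R `*` `[0, L]%classic) G w.1)).
  apply: (Rint_le mAL fAL) => //; first by apply: (bmo_comp (FDi setT) measurable_fst).
  move=> [theta q] _; rewrite /H/= Rint_restrict.
  pose w := (q * cos theta, q * sin theta) : R * R.
  have mDf : measurable_fun setT (fun y : T2 => \1_D (y.1 + w.1, y.2 + w.2) * (\1_D y * F (y, theta))).
    apply: measurable_funM.
      apply: (measurableT_comp (measurable_indic mD) (g := fun y : T2 => (y.1 + w.1, y.2 + w.2) : T2)).
      by mfun.
    by apply: measurable_funM; [exact: measurable_indic|exact: (FD theta setT).1].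
  have := Rint_translate w mDf => /= E.
  rewrite (_ : Rintegral _ _ _ = \int[@leb2 R]_y (\1_D (y.1 + w.1, y.2 + w.2) * (\1_D y * F (y, theta)))); last first.
    by rewrite -E; apply: eq_Rintegral => -[y1 y2] _; rewrite /w/= !subrK.
  rewrite (_ : Rintegral _ _ _ = \int[@leb2 R]_(y in D) (\1_D (y.1 + w.1, y.2 + w.2) * F (y, theta))); last first.
    by rewrite [RHS]Rint_restrict; apply: eq_Rintegral => y _; ring.
  apply: (Rint_le mD fD) => //.
    apply: bmoM => //; apply: (bmo_comp (g := fun y : T2 => (y.1 + w.1, y.2 + w.2) : T2) (@bmo_indic _ T2 R setT D mD)) => //.
    by mfun.
  move=> y _; rewrite indicE; case: (_ \in D); rewrite ?mul1r ?mul0r//; exact: F0.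
have -> : \int[@leb2 R]_(w in @angles R `*` `[0, L]%classic) G w.1 =
    \int[mu]_(theta in @angles R) \int[mu]_(q in `[0, L]) G theta.
  have := Rint_prod am (mI L) af (itv_finite 0 L) (f := fun theta q : T1 => G theta).
  by move=> <-; [rewrite /leb2|apply: (bmo_comp (FDi setT) measurable_fst)].
have -> : \int[mu]_(theta in @angles R) \int[mu]_(q in `[0, L]) G theta = L * \int[mu]_(theta in @angles R) G theta.
  rewrite -(RintZ am af) //; apply: eq_Rintegral => theta _.
  by rewrite (Rintegral_cst mu (mI L)) fine_mu_itv// subr0 mulrC.
rewrite ler_wpM2l// le_eqVlt; apply/orP; left; apply/eqP.
rewrite (Rint_swap mD am fD af (f := fun y theta => F (y, theta)))//.
rewrite (_ : (fun z => _) = F); first exact: bmoS bF.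
by apply/funext => -[].
Qed.

Context (r : R) (r0 : 0 <= r).
Context (Dr : forall y z, D y -> D z -> `|y.1 - z.1| <= 2 * r /\ `|y.2 - z.2| <= 2 * r).
Context (Dconvex : forall y theta s q, D y -> D (ray y theta s) -> 0 <= q <= s -> D (ray y theta q)).

(* Two points of [D] are joined by a characteristic, along which the solution
   differs from the averages by [a] and varies at the rate [g / e]. *)
Lemma oscillation V S : bmo setT V -> bmo setT S ->
  let U := mild (fun z => V z.1 + S z) in
  let a (z : T3) := `|V z.1 - U z| in
  let g (z : T3) := `|V z.1 + S z - U z| in
  is_true (\int[@leb2 R]_(y in D) \int[@leb2 R]_(z in D) `|V y - V z| <=
  32 * r ^+ 2 * \int[@leb2 R]_(y in D) \int[mu]_(theta in @angles R) a (y, theta) +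
  64 * r ^+ 3 * e^-1 * \int[@leb2 R]_(y in D) \int[mu]_(theta in @angles R) g (y, theta)).
Proof.
move=> bV bS U a g.
have bV3 : bmo setT (fun z : T3 => V z.1) by exact: bmo_fst.
have bS' : bmo setT (fun z => V z.1 + S z) by exact: bmoD.
have bU : bmo setT U by exact: bmo_mild OB _ e0 _ bS'.
have ba : bmo setT a by apply: bmo_norm; exact: bmoB.
have bg : bmo setT g by apply: bmo_norm; exact: bmoB.
(* Points of [D] differ by at most [2 * r] in each coordinate, so polar coordinates at one of them
   reach all others within distance [L]. *)
pose L := 2 * (2 * r).
have L0 : 0 <= L by rewrite !mulr_ge0.
have ei0 : 0 <= e^-1 by rewrite invr_ge0 ltW.
have g0 z : 0 <= g z by exact: normr_ge0.
have a0 z : 0 <= a z by exact: normr_ge0.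
pose RIa := ray_integral L a; pose RIg := ray_integral L g.
have bRa : bmo setT (fun z : T3 => RIa z.1 z.2) by exact: bmo_ray_integral.
have bRg : bmo setT (fun z : T3 => RIg z.1 z.2) by exact: bmo_ray_integral.
have RIg0 y theta : 0 <= RIg y theta.
  by apply: Rintegral_ge0 => q _; rewrite mulr_ge0// indicE.
have key y theta s : D y -> D (ray y theta s) -> 0 <= s <= L ->
    `|V y - V (ray y theta s)| <= a (y, theta) + a (ray y theta s, theta) + e^-1 * RIg y theta.
  move=> Dy Ds /andP[s0 sL]; set z := ray y theta s.
  have := mild_difference bS' (DO Dy) s0 (DO Ds); rewrite -/z -/U => E.
  have h : `|U (y, theta) - U (z, theta)| <= e^-1 * RIg y theta.
    rewrite E normrM (ger0_norm ei0) ler_wpM2l//.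
    have mIs := mI s; have fIs := itv_finite 0 s.
    have bq DD : bmo DD (fun q : T1 => V (ray y theta q) + S (ray y theta q, theta) - U (ray y theta q, theta)).
      apply: (bmo_comp (bmoB bS' bU) (g := fun q : T1 => (ray y theta q, theta) : T3)) => //.
      by rewrite /ray; mfun.
    apply: le_trans (Rint_abs mIs fIs (bq _)) _.
    have sub : `[0, s] `<=` `[0, L] by apply: subset_itvl; rewrite bnd_simp.
    rewrite (_ : Rintegral _ _ _ = \int[mu]_(q in `[0, L]) (\1_(`[0, s]%classic : set T1) q *
       `|V (ray y theta q) + S (ray y theta q, theta) - U (ray y theta q, theta)|)); last first.
      by rewrite -Rint_restrictI setIidr.
    rewrite /RIg /ray_integral; apply: (Rint_le (mI L) (itv_finite 0 L)).
    - by apply: bmoM; [apply: bmo_indic; exact: mI|apply: bmo_norm; exact: bq].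
    - apply: (bmo_comp (bint bg) (g := fun q : T1 => (y, (theta, q)) : T2 * T2)) => //; mfun.
    move=> q _; have [qs|nqs] := pselect ((`[0, s]%classic : set T1) q); last first.
      by rewrite indicN// mul0r mulr_ge0// indicE.
    rewrite indicT// mul1r indicT ?mul1r//.
    by apply: (Dconvex Dy Ds); move: qs; rewrite /= in_itv.
  rewrite /a/= in h *.
  have -> : V y - V z = (V y - U (y, theta)) - (V z - U (z, theta)) + (U (y, theta) - U (z, theta)) by ring.
  apply: le_trans (ler_normD _ _) (lerD _ h); exact: ler_normB.
have mDD : measurable_fun setT (\1_D : T2 -> R) by exact: measurable_indic.
have bray y DD theta : bmo DD (fun s : T1 => \1_D (ray y theta s) * a (ray y theta s, theta)).
  apply: (bmo_comp (bint ba) (g := fun q : T1 => (y, (theta, q)) : T2 * T2)) => //; mfun.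
(* Polar coordinates at [y]: each [z] of [D] is [ray y theta s], and the weight [s] is at most
   [L]. *)
have inner y : D y -> \int[@leb2 R]_(z in D) `|V y - V z| <=
   \int[mu]_(theta in @angles R) (L ^+ 2 * a (y, theta) + L * RIa y theta + L ^+ 2 * e^-1 * RIg y theta).
  move=> Dy; rewrite Rint_restrict.
  have bFy : bmo setT (fun z : T2 => \1_D z * `|V y - V z|).
    by apply: bmoM; [exact: bmo_indic|apply: bmo_norm; apply: bmoB => //; exact: bmo_cst].
  have r20 : 0 <= 2 * r by rewrite mulr_ge0.
  rewrite (Rint_polar (x := y) r20 bFy); last first.
    move=> z; have [Dz _|nD] := pselect (D z); last by rewrite indicN// mul0r eqxx.
    exact: Dr.
  rewrite -/L.
  have bsF DD (theta : T1) : DD `<=` `[0, L] -> bmo DD (fun s : T1 => s * (\1_D (ray y theta s) * `|V y - V (ray y theta s)|)).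
    move=> sD; apply: bmoM.
      apply: (bmo_bd (M := L)); first by mfun.
      by move=> s /sD/=; rewrite in_itv/= => /andP[h1 h2]; rewrite ger0_norm.
    by apply: (bmo_comp bFy (g := fun s : T1 => ray y theta s)) => //; rewrite /ray; mfun.
  apply: (Rint_le am af).
  - apply: (bmo_Rint (mI L) (itv_finite 0 L) (f := fun theta s => s * (\1_D (ray y theta s) * `|V y - V (ray y theta s)|))).
    apply: bmoM.
      apply: (bmo_bd (M := L)); first by mfun.
      by move=> s [_ /=]; rewrite in_itv/= => /andP[h1 h2]; rewrite ger0_norm.
    by apply: (bmo_comp bFy (g := fun z : T2 => ray y z.1 z.2)) => //; rewrite /ray; mfun.
  - have sec F0 DD : bmo setT F0 -> bmo DD (fun theta : T1 => F0 (y, theta)).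
      by move=> bF0; exact: (bmo_comp bF0 (pair1_measurable y)).
    apply: bmoD; last by apply: bmoZ; exact: (sec (fun z : T3 => RIg z.1 z.2)).
    apply: bmoD; first by apply: bmoZ; exact: sec.
    by apply: bmoZ; exact: (sec (fun z : T3 => RIa z.1 z.2)).
  move=> theta _.
  have mIL := mI L; have fIL := itv_finite 0 L.
  have -> : L ^+ 2 * a (y, theta) + L * RIa y theta + L ^+ 2 * e^-1 * RIg y theta =
    \int[mu]_(s in `[0, L]) (L * (a (y, theta) + e^-1 * RIg y theta) + L * (\1_D (ray y theta s) * a (ray y theta s, theta))).
    rewrite (RintD mIL fIL); [|exact: bmo_cst|by apply: bmoZ; exact: bray].
    rewrite (Rintegral_cst mu mIL) fine_mu_itv// subr0 (RintZ mIL fIL)//.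
    by rewrite -/(ray_integral L a y theta) -/RIa; ring.
  apply: (Rint_le mIL fIL).
  - exact: bsF.
  - by apply: bmoD; [exact: bmo_cst|apply: bmoZ; exact: bray].
  move=> s; rewrite /= in_itv/= => sL; have /andP[s0 sl] := sL.
  have [Ds|nD] := pselect (D (ray y theta s)); last first.
    rewrite indicN// !mul0r !mulr0 addr0 mulr_ge0// addr_ge0// mulr_ge0//.
  rewrite (indicT R Ds) !mul1r -mulrDr.
  apply: ler_pM => //; apply: le_trans (key _ _ _ Dy Ds sL) _.
  by rewrite addrAC.
pose IA (y : T2) := \int[mu]_(theta in @angles R) a (y, theta).
pose IRA (y : T2) := \int[mu]_(theta in @angles R) RIa y theta.
pose IRG (y : T2) := \int[mu]_(theta in @angles R) RIg y theta.
have bI (F : T3 -> R) DD : bmo setT F -> bmo DD (fun y : T2 => \int[mu]_(theta in @angles R) F (y, theta)).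
  move=> bF; apply: (bmo_Rint am af (D1 := DD) (f := fun y theta => F (y, theta))).
  by rewrite (_ : (fun z => _) = F); [exact: bmoS bF|apply/funext => -[]].
have bIA DD : bmo DD IA by exact: bI.
have bIRA DD : bmo DD IRA by exact: (bI (fun z : T3 => RIa z.1 z.2)).
have bIRG DD : bmo DD IRG by exact: (bI (fun z : T3 => RIg z.1 z.2)).
apply: (@le_trans _ _ (\int[@leb2 R]_(y in D) (L ^+ 2 * IA y + L * IRA y + L ^+ 2 * e^-1 * IRG y))).
  apply: (Rint_le mD fD).
  - apply: (bmo_Rint mD fD (f := fun y z => `|V y - V z|)).
    apply: bmo_norm; apply: bmoB.
      by apply: (bmo_comp bV measurable_fst).
    by apply: (bmo_comp bV measurable_snd).
  - exact: bmoD (bmoD (bmoZ _ (bIA D)) (bmoZ _ (bIRA D))) (bmoZ _ (bIRG D)).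
  move=> y Dy; apply: le_trans (inner y Dy) _.
  have sec F0 DD : bmo setT F0 -> bmo DD (fun theta : T1 => F0 (y, theta)).
    by move=> bF0; exact: (bmo_comp bF0 (pair1_measurable y)).
  have b1 := sec _ (@angles R) ba.
  have b2 : bmo (@angles R) (RIa y) by exact: (sec (fun z : T3 => RIa z.1 z.2)).
  have b3 : bmo (@angles R) (RIg y) by exact: (sec (fun z : T3 => RIg z.1 z.2)).
  rewrite (RintD am af); [|by apply: bmoD; exact: bmoZ|exact: bmoZ].
  rewrite (RintD am af); [|exact: bmoZ|exact: bmoZ].
  by rewrite !(RintZ am af).
rewrite (RintD mD fD (bmoD (bmoZ _ (bIA D)) (bmoZ _ (bIRA D))) (bmoZ _ (bIRG D))).
rewrite (RintD mD fD (bmoZ _ (bIA D)) (bmoZ _ (bIRA D))).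
rewrite (RintZ mD fD _ (bIA D)) (RintZ mD fD _ (bIRA D)) (RintZ mD fD _ (bIRG D)).
have h1 := Rint_ray_integral_le L0 ba a0; have h2 := Rint_ray_integral_le L0 bg g0.
have fin (A A2 G2 G : R) : A2 <= L * A -> G2 <= L * G ->
    L ^+ 2 * A + L * A2 + L ^+ 2 * e^-1 * G2 <= 32 * r ^+ 2 * A + 64 * r ^+ 3 * e^-1 * G.
  move=> k1 k2; have -> : 32 * r ^+ 2 * A + 64 * r ^+ 3 * e^-1 * G =
      L ^+ 2 * A + L * (L * A) + L ^+ 2 * e^-1 * (L * G) by rewrite /L; ring.
  apply: lerD; [apply: lerD => //; exact: ler_wpM2l|].
  by apply: ler_wpM2l => //; rewrite mulr_ge0// sqr_ge0.
exact: fin h1 h2.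
Qed.

End oscillation.

(** * Local averages from the whole domain down to scale [e] *)

Section local_averages.
Context (R : realType) (Omega : set (R * R)) (d : R) (OB : cbody Omega d)
        (b : boundary_data Omega) (e : R) (e0 : 0 < e).
Context (xc : R * R) (eta : R) (eta0 : 0 < eta).
Context (HQ : contains_square Omega xc eta).
Notation T1 := (measurableTypeR R).
Notation T2 := (T1 * T1)%type.
Notation T3 := (T1 * T1 * T1)%type.
Notation mu := (@lebesgue_measure R).
Notation mild := (mild Omega e).
Implicit Types (V : T2 -> R) (S F : T3 -> R).

Definition square (x : R * R) (r : R) : set T2 := [set y | `|y.1 - x.1| <= r /\ `|y.2 - x.2| <= r].
Definition local_body x r : set T2 := Omega `&` square x r.

Let d0 : 0 < d. Proof. by case: OB. Qed.

Lemma squareE x r : square x r =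
  `[x.1 - r, x.1 + r]%classic `*` `[x.2 - r, x.2 + r]%classic.
Proof.
apply/seteqP; split => y; rewrite /square/= !in_itv/= !ler_norml.
  by move=> [/andP[? ?] /andP[? ?]]; split; apply/andP; split; lra.
by move=> [/andP[? ?] /andP[? ?]]; split; apply/andP; split; lra.
Qed.

Lemma square_measurable x r : measurable (square x r).
Proof. by rewrite squareE; apply: measurableX; exact: measurable_itv. Qed.

Lemma local_body_measurable x r : measurable (local_body x r).
Proof. by apply: measurableI; [exact: body_measurable OB|exact: square_measurable]. Qed.

Lemma leb2_rect (a a' k k' : R) : a <= a' -> k <= k' ->
  @leb2 R (`[a, a']%classic `*` `[k, k']%classic) = ((a' - a) * (k' - k))%:E.
Proof.
have mE (u v : R) : u <= v -> mu `[u, v] = (v - u)%:E.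
  by move=> uv; rewrite -fine_mu_itv// fineK// ge0_fin_numE// itv_finite.
move=> aa kk; transitivity (mu `[a, a'] * mu `[k, k'])%E; last by rewrite !mE.
by apply: product_measure1E; exact: measurable_itv.
Qed.

Lemma local_body_finite x r : (@leb2 R (local_body x r) < +oo)%E.
Proof.
apply: finite_sub (local_body_measurable x r) (body_measurable OB) _ (body_finite OB).
by move=> y [].
Qed.

Lemma local_body_mass_le x r : 0 <= r -> fine (@leb2 R (local_body x r)) <= (2 * r) ^+ 2.
Proof.
move=> r0; rewrite -lee_fin fineK ?ge0_fin_numE ?local_body_finite//.
have -> : (2 * r) ^+ 2 = ((x.1 + r) - (x.1 - r)) * ((x.2 + r) - (x.2 - r)) by ring.
rewrite -leb2_rect; [|lra|lra]; rewrite -squareE.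
apply: le_measure; rewrite ?inE; [exact: local_body_measurable|exact: square_measurable|].
by move=> y [].
Qed.

Lemma closure_approx x : body_closure Omega x ->
  forall k, 0 < k -> exists z, [/\ Omega z, `|z.1 - x.1| < k & `|z.2 - x.2| < k].
Proof.
move=> [Ox k k0|/(frontierP OB)[_]//].
by exists x; rewrite !subrr normr0.
Qed.

(** The homothety of centre [x] and ratio [t = r / (2 * d)] sends the body into the square of
    half-side [r] at [x], and into the body by convexity. The image of a square of half-side [eta]
    has area [(2 * t * eta) ^+ 2], which is the left side. *)
Lemma local_body_mass_ge x r : body_closure Omega x -> 0 < r <= 2 * d ->
  (eta / d) ^+ 2 * r ^+ 2 <= fine (@leb2 R (local_body x r)).
Proof.
move=> cx /andP[r0 rd]; have e2 := eta0; have d2 := d0; set t := r / (2 * d).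
have t0 : 0 < t by rewrite divr_gt0// mulr_gt0.
have t1 : t <= 1 by rewrite ler_pdivrMr ?mulr_gt0// mul1r.
have rt : r = t * (2 * d) by rewrite divfK// mulf_neq0// gt_eqF.
rewrite -lee_fin fineK ?ge0_fin_numE ?local_body_finite//.
pose A1 := (1 - t) * x.1 + t * xc.1; pose A2 := (1 - t) * x.2 + t * xc.2.
have te : 0 < t * eta by rewrite mulr_gt0.
have -> : (eta / d) ^+ 2 * r ^+ 2 = ((A1 + t * eta) - (A1 - t * eta)) * ((A2 + t * eta) - (A2 - t * eta)).
  by rewrite rt; field; rewrite gt_eqF.
rewrite -leb2_rect; [|lra|lra].
apply: le_measure; rewrite ?inE; [by apply: measurableX; exact: measurable_itv|exact: local_body_measurable|].
move=> y [/=]; rewrite !in_itv/= => /andP[y1 y2] /andP[y3 y4].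
pose y' := (xc.1 + (y.1 - A1) / t, xc.2 + (y.2 - A2) / t).
have aux (u a : R) : a - t * eta <= u -> u <= a + t * eta -> `|(u - a) / t| <= eta.
  move=> h1 h2; rewrite normrM normfV (gtr0_norm t0) ler_pdivrMr// mulrC ler_norml.
  by apply/andP; split; lra.
have Oy' : Omega y'.
  apply: HQ; rewrite /y'/= addrAC subrr add0r; apply: le_trans (aux _ _ _ _) _; lra.
have E1 : y.1 = (1 - t) * x.1 + t * y'.1.
  by rewrite /y'/= mulrDr mulrCA mulfV ?mulr1 ?gt_eqF// /A1; ring.
have E2 : y.2 = (1 - t) * x.2 + t * y'.2.
  by rewrite /y'/= mulrDr mulrCA mulfV ?mulr1 ?gt_eqF// /A2; ring.
have Oy : Omega y.
  have := body_segment OB Oy' (closure_approx cx) (_ : 0 < t <= 1); rewrite t0 t1 => /(_ isT).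
  by rewrite -E1 -E2 -surjective_pairing.
split => //; have [x1 x2] := closure_bound OB cx.
have [z1 z2] := closure_bound OB (or_introl Oy').
rewrite /square/= E1 E2 rt.
have -> : (1 - t) * x.1 + t * y'.1 - x.1 = t * (y'.1 - x.1) by ring.
have -> : (1 - t) * x.2 + t * y'.2 - x.2 = t * (y'.2 - x.2) by ring.
have nm (u : R) : `|t * u| = t * `|u| by rewrite normrM (gtr0_norm t0).
rewrite !nm !ler_pM2l//; split.
  by have := ler_normB y'.1 x.1; move: x1 z1; lra.
by have := ler_normB y'.2 x.2; move: x2 z2; lra.
Qed.

Lemma local_body_full x : body_closure Omega x -> local_body x (2 * d) = Omega.
Proof.
move=> cx; apply/seteqP; split => [y []//|y Oy]; split => //.
have [x1 x2] := closure_bound OB cx; have [y1 y2] := closure_bound OB (or_introl Oy).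
by split; apply: le_trans (ler_normB _ _) _; lra.
Qed.

Lemma local_body_diam x r y z : local_body x r y -> local_body x r z ->
  `|y.1 - z.1| <= 2 * r /\ `|y.2 - z.2| <= 2 * r.
Proof.
move=> [_ [y1 y2]] [_ [z1 z2]]; split.
  by have := ler_distD x.1 y.1 z.1; rewrite [`|x.1 - _|]distrC; lra.
by have := ler_distD x.2 y.2 z.2; rewrite [`|x.2 - _|]distrC; lra.
Qed.

Lemma local_body_convex x r y theta s q : local_body x r y -> local_body x r (ray y theta s) ->
  0 <= q <= s -> local_body x r (ray y theta q).
Proof.
move=> [Oy [y1 y2]] [Os [s1 s2]] /andP[q0 qs].
have [s0|s0] := leP s 0.
  have -> : q = 0 by apply/eqP; rewrite eq_le q0 (le_trans qs).
  by rewrite ray0.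
split.
  have [_ cO _ _] := OB; have := cO _ _ (q / s) Oy Os.
  rewrite divr_ge0 ?(ltW s0)// ler_pdivrMr// mul1r qs => /(_ isT).
  by congr (Omega _); rewrite /ray/=; congr pair; field; rewrite gt_eqF.
have aux (u v k : R) : `|u - v| <= r -> `|u - s * k - v| <= r -> `|u - q * k - v| <= r.
  move=> h1 h2; rewrite -(ler_pM2l s0) -{1}(gtr0_norm s0) -normrM.
  rewrite (_ : s * (u - q * k - v) = (s - q) * (u - v) + q * (u - s * k - v)); last by ring.
  apply: le_trans (ler_normD _ _) _; rewrite !normrM (ger0_norm q0) ger0_norm ?subr_ge0//.
  rewrite (_ : s * r = (s - q) * r + q * r); last by ring.
  by apply: lerD; apply: ler_wpM2l => //; rewrite subr_ge0.
by split; [exact: aux y1 s1|exact: aux y2 s2].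
Qed.

(** Passage from one scale to the next: for [y] in [D'], [|V y|] exceeds the mean of [|V|] over [D]
    by at most the mean of [|V y - V z|]. The masses are multiplied out to avoid divisions. *)
Lemma mean_step D' D V : measurable D -> measurable D' -> D' `<=` D -> (@leb2 R D < +oo)%E ->
  bmo setT V -> fine (@leb2 R D) * \int[@leb2 R]_(y in D') `|V y| <=
  fine (@leb2 R D') * \int[@leb2 R]_(y in D) `|V y| +
  \int[@leb2 R]_(y in D) \int[@leb2 R]_(z in D) `|V y - V z|.
Proof.
move=> mD mD' sub fD bV.
have fD' : (@leb2 R D' < +oo)%E by exact: finite_sub mD' mD sub fD.
have s2 f DD : bmo setT f -> bmo DD f by exact: bmoS.
have bVV DD : bmo DD (fun z : T2 * T2 => `|V z.1 - V z.2|).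
  apply: bmo_norm; apply: bmoB.
    by apply: (bmo_comp bV measurable_fst).
  by apply: (bmo_comp bV measurable_snd).
have bJ DD : bmo DD (fun y => \int[@leb2 R]_(z in D) `|V y - V z|).
  exact: (bmo_Rint mD fD (D1 := DD) (f := fun y z => `|V y - V z|)).
set A := \int[@leb2 R]_(y in D) `|V y|.
apply: (@le_trans _ _ (\int[@leb2 R]_(y in D') (A + \int[@leb2 R]_(z in D) `|V y - V z|))).
  rewrite -(RintZ mD' fD'); last by apply: s2; exact: bmo_norm.
  apply: (Rint_le mD' fD').
  - by apply: bmoZ; apply: s2; exact: bmo_norm.
  - by apply: bmoD => //; exact: bmo_cst.
  move=> y D'y; rewrite mulrC -(Rintegral_cst (@leb2 R) mD) -(RintD mD fD); last 2 first.
  - by apply: s2; exact: bmo_norm.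
  - apply: bmo_norm; apply: bmoB; [exact: bmo_cst|exact: s2].
  apply: (Rint_le mD fD); [exact: bmo_cst| |].
    apply: bmoD; first by apply: s2; exact: bmo_norm.
    by apply: bmo_norm; apply: bmoB; [exact: bmo_cst|exact: s2].
  by move=> z _; have := ler_normD (V z) (V y - V z); rewrite addrC subrK.
rewrite (RintD mD' fD'); [|exact: bmo_cst|exact: bJ].
rewrite (Rintegral_cst (@leb2 R) mD') mulrC lerD2l//.
rewrite -(setIidr sub) Rint_restrictI.
apply: (Rint_le mD fD); [by apply: bmoM => //; exact: bmo_indic|exact: bJ|].
move=> y _; rewrite indicE; case: (_ \in D'); rewrite ?mul1r ?mul0r//.
by apply: Rintegral_ge0.
Qed.

Lemma mean_zero_L1 V : bmo setT V -> \int[@leb2 R]_(x in Omega) V x = 0 ->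
  fine (@leb2 R Omega) * \int[@leb2 R]_(y in Omega) `|V y| <=
  \int[@leb2 R]_(y in Omega) \int[@leb2 R]_(z in Omega) `|V y - V z|.
Proof.
move=> bV V0; have bm := body_measurable OB; have bf := body_finite OB.
have bVO : bmo Omega V by exact: bmoS bV.
rewrite -(RintZ bm bf); last exact: bmo_norm.
apply: (Rint_le bm bf); first by apply: bmoZ; exact: bmo_norm.
  apply: (bmo_Rint bm bf (f := fun y z => `|V y - V z|)).
  apply: bmo_norm; apply: bmoB.
    by apply: (bmo_comp bV measurable_fst).
  by apply: (bmo_comp bV measurable_snd).
move=> y Oy; have bD : bmo Omega (fun z => V y - V z) by apply: bmoB => //; exact: bmo_cst.
apply: le_trans (Rint_abs bm bf bD).
rewrite (RintB bm bf)//; last exact: bmo_cst.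
by rewrite V0 subr0 (Rintegral_cst (@leb2 R) bm) normrM [X in _ <= _ * X]ger0_norm ?fine_ge0// mulrC.
Qed.

Let am : measurable (@angles R : set T1) := @angles_measurable R.
Let af : (mu (@angles R : set T1) < +oo)%E := @angles_finite R.

(** Cauchy-Schwarz on a set of measure at most [(2 * r) ^+ 2 * (2 * pi)], itself at most
    [36 * r ^+ 2]. *)
Lemma local_L1_le_L2 F x r (al : R) : bmo setT F -> 0 <= r -> 0 <= al ->
  \int[@leb3 R]_(z in phase Omega) F z ^+ 2 <= al ^+ 2 ->
  \int[@leb2 R]_(y in local_body x r) \int[mu]_(theta in @angles R) `|F (y, theta)| <= 6 * r * al.
Proof.
move=> bF r0 al0 Fal; set D := local_body x r.
have mD : measurable D by exact: local_body_measurable.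
have fD : (@leb2 R D < +oo)%E by exact: local_body_finite.
have mDA : measurable (D `*` (@angles R : set T1)) by exact: measurableX.
have DAE : @leb3 R (D `*` (@angles R : set T1)) = (@leb2 R D * mu (@angles R))%E.
  by rewrite [LHS](@product_measure1E _ _ _ _ R (@leb2 R) mu).
have fDA : (@leb3 R (D `*` (@angles R : set T1)) < +oo)%E.
  by rewrite DAE lte_mul_pinfty// ge0_fin_numE.
have bnF := bmo_norm bF.
have -> : \int[@leb2 R]_(y in D) \int[mu]_(theta in @angles R) `|F (y, theta)| =
   \int[@leb3 R]_(z in D `*` (@angles R : set T1)) `|F z|.
  have := Rint_prod mD am fD af (f := fun y theta => `|F (y, theta)|).
  move=> <-; first by rewrite /leb3; apply: eq_Rintegral => -[].
  rewrite (_ : (fun z => _) = fun z => `|F z|); first exact: bmoS bnF.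
  by apply/funext => -[].
have CS := Rint_cauchy_schwarz mDA fDA (bmoS (fun _ _ => I) bF).
have I0 : 0 <= \int[@leb3 R]_(z in D `*` (@angles R : set T1)) `|F z| by exact: Rintegral_ge0.
have sub : D `*` (@angles R : set T1) `<=` phase Omega by move=> z [[Oz _] az].
have pm := phase_measurable OB; have pf := phase_finite OB.
have h1 : \int[@leb3 R]_(z in D `*` (@angles R : set T1)) F z ^+ 2 <= al ^+ 2.
  apply: le_trans Fal; rewrite -(setIidr sub) Rint_restrictI.
  have bF2 : bmo (phase Omega) (fun z => F z ^+ 2) by apply: bmoS (bmoX 2 bF).
  apply: (Rint_le pm pf) => //; first by apply: bmoM => //; exact: bmo_indic.
  by move=> z _; rewrite indicE; case: (_ \in _); rewrite ?mul1r ?mul0r ?sqr_ge0.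
have h2 : fine (@leb3 R (D `*` (@angles R : set T1))) <= 36 * r ^+ 2.
  rewrite DAE fineM ?ge0_fin_numE// fine_mu_angles.
  have := local_body_mass_le x r0; rewrite -/D; set m := fine _ => mr.
  have m0 : 0 <= m by exact: fine_ge0.
  apply: (@le_trans _ _ ((2 * r) ^+ 2 * (2 * 4))).
    have p0 := pi_ge0 R; have p2 := pihalf_lt2 R.
    apply: ler_pM => //; first exact: mulr_ge0.
    rewrite ler_pM2l//; apply: ltW; move: p2; rewrite ltr_pdivrMr// => h; apply: lt_le_trans h _.
    by rewrite -natrM ler_nat.
  rewrite exprMn (_ : _ * _ = 32 * r ^+ 2); last by ring.
  by rewrite ler_wpM2r ?sqr_ge0// ler_nat.
rewrite -(@ler_pXn2r _ 2)// ?nnegrE ?mulr_ge0//; apply: le_trans CS _.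
rewrite (_ : (6 * r * al) ^+ 2 = 36 * r ^+ 2 * al ^+ 2); last by ring.
apply: (ler_pM _ _ h2 h1); first exact: fine_ge0.
by apply: Rintegral_ge0 => z _; exact: sqr_ge0.
Qed.

Section multiscale.
Context (V : T2 -> R) (S : T3 -> R) (bV : bmo setT V) (bS : bmo setT S).
Context (V0 : \int[@leb2 R]_(x in Omega) V x = 0) (al ga : R) (al0 : 0 <= al) (ga0 : 0 <= ga).
Let U := mild (fun z => V z.1 + S z).
Context (Hal : \int[@leb3 R]_(z in phase Omega) (V z.1 - U z) ^+ 2 <= al ^+ 2).
Context (Hga : \int[@leb3 R]_(z in phase Omega) (V z.1 + S z - U z) ^+ 2 <= ga ^+ 2).
Context (x : R * R) (cx : body_closure Omega x).

(** The term in [al] comes with [r ^+ 3] and the term in [ga] with [r ^+ 4 / e]; the condition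
    [e <= r] puts both under the second form. *)
Lemma local_oscillation r : e <= r ->
  \int[@leb2 R]_(y in local_body x r) \int[@leb2 R]_(z in local_body x r) `|V y - V z| <=
  384 * r ^+ 4 * e^-1 * (al + ga).
Proof.
move=> er; have r0 : 0 <= r by apply: le_trans er; exact: ltW.
have mD := local_body_measurable x r.
have DO : local_body x r `<=` Omega by move=> y [].
have bV3 : bmo setT (fun z : T3 => V z.1) by exact: bmo_fst.
have bS' : bmo setT (fun z => V z.1 + S z) by exact: bmoD.
have bU : bmo setT U by exact: bmo_mild OB _ e0 _ bS'.
have := oscillation OB e0 mD DO r0 (@local_body_diam x r) (@local_body_convex x r) bV bS.
rewrite /= -/U; set J := Rintegral _ _ _; move=> h.
have h1 := local_L1_le_L2 x (bmoB bV3 bU) r0 al0 Hal.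
have h2 := local_L1_le_L2 x (bmoB bS' bU) r0 ga0 Hga.
apply: le_trans h _.
have fin (A G : R) : A <= 6 * r * al -> G <= 6 * r * ga ->
    32 * r ^+ 2 * A + 64 * r ^+ 3 * e^-1 * G <= 384 * r ^+ 4 * e^-1 * (al + ga).
  move=> k1 k2; rewrite mulrDr; apply: lerD.
    apply: (@le_trans _ _ (32 * r ^+ 2 * (6 * r * al))); first by rewrite ler_wpM2l// mulr_ge0// sqr_ge0.
    rewrite (_ : 32 * _ * _ = 192 * r ^+ 3 * al * 1); last by ring.
    rewrite (_ : 384 * _ * _ * _ = 192 * r ^+ 3 * al * (2 * (r / e))); last by ring.
    rewrite ler_wpM2l ?mulr_ge0 ?exprn_ge0//.
    have k : 1 <= r / e by rewrite ler_pdivlMr// mul1r.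
    by rewrite (le_trans k)// ler_peMl ?(le_trans ler01 k)// ler1n.
  rewrite (_ : 384 * _ * _ * _ = 64 * r ^+ 3 * e^-1 * (6 * r * ga)); last by ring.
  by rewrite ler_wpM2l// !mulr_ge0 ?exprn_ge0// invr_ge0 ltW.
exact: fin h1 h2.
Qed.

(** The oscillation at scale [r] is of order [r ^+ 4 / e], and dividing by two masses of order
    [r ^+ 2] leaves a cost that does not depend on the scale. It is paid once per scale, whence
    [k.+1]; the factor [q ^- 2] compares the masses of consecutive scales. *)
Lemma local_average_bound (q : R) (k : nat) : 0 < q <= 1 -> e <= 2 * d * q ^+ k ->
  \int[@leb2 R]_(y in local_body x (2 * d * q ^+ k)) `|V y| <=
  (2 * (2 * d * q ^+ k)) ^+ 2 *
  (k.+1%:R * (384 * (d / eta) ^+ 4 * q ^- 2 * e^-1 * (al + ga))).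
Proof.
move=> /andP[q0 q1] ek; set E := 384 * _ * _ * _ * _.
have d2 := d0; have e2 := eta0; have ei : 0 <= e^-1 by rewrite invr_ge0 ltW.
have E0 : 0 <= E.
  have de0 : 0 <= d / eta by exact: divr_ge0 (ltW d2) (ltW e2).
  apply: mulr_ge0 (addr_ge0 al0 ga0); apply: mulr_ge0 ei; apply: mulr_ge0.
    by apply: mulr_ge0 (exprn_ge0 _ de0); exact: ler0n.
  by rewrite invr_ge0; exact: exprn_ge0 (ltW q0).
pose r (j : nat) := 2 * d * q ^+ j.
have r0 j : 0 < r j by rewrite !mulr_gt0// exprn_gt0.
have rd j : 0 < r j <= 2 * d.
  by rewrite r0/= ler_piMr ?mulr_ge0 ?(ltW d2)// exprn_ile1// ltW.
have er j : (j <= k)%N -> e <= r j.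
  move=> jk; apply: le_trans ek _; rewrite ler_pM2l ?mulr_gt0//.
  by rewrite ler_wiXn2l// ltW.
pose m j := fine (@leb2 R (local_body x (r j))).
have mr j : (eta / d) ^+ 2 * r j ^+ 2 <= m j by exact: local_body_mass_ge.
have m0 j : 0 < m j.
  by apply: lt_le_trans (mr j); rewrite mulr_gt0 ?exprn_gt0 ?divr_gt0.
have J j i : (j <= k)%N -> (eta / d) ^+ 2 * (q ^+ 2 * r j ^+ 2) <= m i ->
   \int[@leb2 R]_(y in local_body x (r j)) \int[@leb2 R]_(z in local_body x (r j)) `|V y - V z| <=
   m j * m i * E.
  move=> jk mi; apply: le_trans (local_oscillation (er _ jk)) _.
  have -> : 384 * r j ^+ 4 * e^-1 * (al + ga) =
     ((eta / d) ^+ 2 * r j ^+ 2) * ((eta / d) ^+ 2 * (q ^+ 2 * r j ^+ 2)) * E.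
    by rewrite /E; field; rewrite ?gt_eqF.
  rewrite ler_wpM2r//; apply: (ler_pM _ _ (mr j) mi).
    exact: mulr_ge0 (sqr_ge0 _) (sqr_ge0 _).
  exact: mulr_ge0 (sqr_ge0 _) (mulr_ge0 (sqr_ge0 _) (sqr_ge0 _)).
have step j : (j <= k)%N -> \int[@leb2 R]_(y in local_body x (r j)) `|V y| <= m j * (j.+1%:R * E).
  elim: j => [_|j IH jk].
    rewrite mul1r -(ler_pM2l (m0 0%N)) mulrA.
    (* At the largest scale the local body is the whole body, where [V] has zero mean. *)
    have r00 : r 0%N = 2 * d by rewrite /r expr0 mulr1.
    apply: le_trans (J 0%N 0%N (leq0n _) _); last first.
      apply: le_trans (mr 0%N); rewrite ler_wpM2l ?sqr_ge0// ler_piMl ?sqr_ge0// exprn_ile1// ltW//.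
    by rewrite /m r00 local_body_full//; exact: mean_zero_L1.
  have sub : local_body x (r j.+1) `<=` local_body x (r j).
    move=> y [Oy [y1 y2]]; split => //.
    have : r j.+1 <= r j by rewrite /r exprS mulrCA; apply: ler_piMl q1; exact: ltW (r0 j).
    by move=> h; split; exact: le_trans h.
  have := mean_step (local_body_measurable x (r j)) (local_body_measurable x (r j.+1)) sub
     (local_body_finite x (r j)) bV.
  rewrite -/(m j) -/(m j.+1) => h.
  rewrite -(ler_pM2l (m0 j)); apply: le_trans h _.
  have h1 : m j.+1 * \int[@leb2 R]_(y in local_body x (r j)) `|V y| <= m j.+1 * (m j * (j.+1%:R * E)).
    by apply: ler_wpM2l (ltW (m0 _)) _ _ (IH _); exact: ltnW.
  have h2 := J j j.+1 (ltnW jk).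
  have h3 : (eta / d) ^+ 2 * (q ^+ 2 * r j ^+ 2) <= m j.+1.
    suff -> : (eta / d) ^+ 2 * (q ^+ 2 * r j ^+ 2) = (eta / d) ^+ 2 * r j.+1 ^+ 2 by exact: mr.
    by rewrite /r [q ^+ j.+1]exprS; ring.
  apply: le_trans (lerD h1 (h2 h3)) _.
  by rewrite -[j.+2%:R]natr1 le_eqVlt; apply/orP; left; apply/eqP; ring.
apply: le_trans (step k (leqnn k)) _.
apply: ler_wpM2r; first exact: mulr_ge0 (ler0n _ _) E0.
exact: local_body_mass_le (ltW (r0 k)).
Qed.

End multiscale.
End local_averages.

Lemma Rint_le_sub dd (T : measurableType dd) (R : realType) (m : {measure set T -> \bar R})
    (D' D : set T) (f : T -> R) : measurable D -> measurable D' -> (m D < +oo)%E -> D' `<=` D ->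
  bmo D f -> (forall x, D x -> 0 <= f x) ->
  \int[m]_(x in D') f x <= \int[m]_(x in D) f x.
Proof.
move=> mD mD' fD sub bf f0; rewrite -(setIidr sub) Rint_restrictI.
apply: (Rint_le mD fD) => //; first by apply: bmoM => //; exact: bmo_indic.
by move=> x Dx; rewrite indicE; case: (_ \in _); rewrite ?mul1r ?mul0r ?f0.
Qed.

(* Splitting [0, +oo[ at rho e and L e: near zero the kernel is small in mass, in
   the middle it is dominated by the polar weight r, and beyond L e it decays. *)
Lemma expR_kernel_split (R : realType) (e rho L r w M : R) : 0 < e -> 0 < rho -> rho * L = 4 ->
  0 <= r -> 0 <= w <= M ->
  e^-1 * expR (- e^-1 * r) * w <=
  (r <= rho * e)%R%:R * (M / e) + rho * M * ((2 * e)^-1 * expR (- (2 * e)^-1 * r)) +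
  (rho * e ^+ 2)^-1 * ((r <= L * e)%R%:R * (r * w)).
Proof.
move=> e0 rho0 rL r0 /andP[w0 wM].
have L0 : 0 < L by rewrite -(pmulr_rgt0 _ rho0) rL.
have ei : 0 < e^-1 by rewrite invr_gt0.
have M0 : 0 <= M by exact: le_trans wM.
have A1 : 0 <= (rho * e ^+ 2)^-1 * ((r <= L * e)%R%:R * (r * w)).
  by rewrite mulr_ge0 ?mulr_ge0 ?ler0n// invr_ge0 mulr_ge0 ?sqr_ge0// ltW.
have A2 : 0 <= rho * M * ((2 * e)^-1 * expR (- (2 * e)^-1 * r)).
  by rewrite mulr_ge0 ?mulr_ge0 ?expR_ge0 ?(ltW rho0)// invr_ge0 mulr_ge0// ltW.
have k1 : expR (- e^-1 * r) <= 1.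
  by rewrite -[leRHS]expR0 ler_expR mulNr oppr_le0 mulr_ge0// ltW.
have kw : e^-1 * expR (- e^-1 * r) * w <= e^-1 * w.
  by rewrite ler_wpM2r// ler_piMr// ltW.
have [rr|rr] := leP r (rho * e).
  have h : e^-1 * w <= M / e by rewrite mulrC ler_pM2r.
  rewrite mul1r -addrA; apply: le_trans kw _; apply: le_trans h _.
  by rewrite lerDl addr_ge0.
rewrite mul0r add0r; have [rL'|rL'] := leP r (L * e).
  apply: le_trans kw _; rewrite mul1r; apply: ler_wpDl => //.
  rewrite mulrA ler_wpM2r// mulrC ler_pdivlMr ?mulr_gt0 ?exprn_gt0//.
  by rewrite (_ : e^-1 * (rho * e ^+ 2) = rho * e); [exact: ltW|field; rewrite gt_eqF].
rewrite !mul0r mulr0 addr0.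
(* The exponential is at most [2 / L], which is [rho / 2] because [rho * L = 4]. *)
have tail : expR (- (L / 2)) <= rho / 2.
  rewrite expRN (_ : rho / 2 = (L / 2)^-1); last first.
    by apply: (mulIf (lt0r_neq0 L0)); rewrite mulrAC rL; field; rewrite gt_eqF.
  rewrite lef_pV2 ?posrE ?expR_gt0 ?divr_gt0//.
  by apply: le_trans (expR_ge1Dx _); rewrite lerDr.
have E0 : expR (- e^-1 * r) <= expR (- (L / 2)) * expR (- (2 * e)^-1 * r).
  rewrite -expRD ler_expR.
  have -> : - e^-1 * r = - (2 * e)^-1 * r - (2 * e)^-1 * r by field; rewrite gt_eqF.
  rewrite [leRHS]addrC lerD2l lerN2 [leRHS]mulrC ler_pdivlMr ?mulr_gt0//.
  by rewrite (_ : L / 2 * (2 * e) = L * e); [exact: ltW|field].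
have E1 : expR (- e^-1 * r) <= rho / 2 * expR (- (2 * e)^-1 * r).
  by apply: le_trans E0 _; rewrite ler_wpM2r// expR_ge0.
rewrite (_ : rho * M * _ = e^-1 * (rho / 2 * expR (- (2 * e)^-1 * r)) * M); last by field; rewrite gt_eqF.
apply: ler_pM => //; first by rewrite mulr_ge0 ?expR_ge0// ltW.
by rewrite ler_pM2l.
Qed.

(** * From local averages to a supremum bound *)

Section sup_bound.
Context (R : realType) (Omega : set (R * R)) (d : R) (OB : cbody Omega d)
        (b : boundary_data Omega) (e : R) (e0 : 0 < e).
Context (xc : R * R) (eta : R) (eta0 : 0 < eta).
Context (HQ : contains_square Omega xc eta).
Notation T1 := (measurableTypeR R).
Notation T2 := (T1 * T1)%type.
Notation T3 := (T1 * T1 * T1)%type.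
Notation mu := (@lebesgue_measure R).
Notation mild := (mild Omega e).
Notation wt := (wt b).
Notation avg := (avg b).
Notation K := (transition b e).
Implicit Types (V W : T2 -> R) (S F : T3 -> R).

Let d0 : 0 < d. Proof. by case: OB. Qed.
Let ei0 : 0 < e^-1. Proof. by rewrite invr_gt0. Qed.
Let am : measurable (@angles R : set T1) := @angles_measurable R.
Let af : (mu (@angles R : set T1) < +oo)%E := @angles_finite R.
Let mI (a a' : R) : measurable (`[a, a']%classic : set T1). Proof. exact: measurable_itv. Qed.

Lemma ray_interior x theta r : lseg Omega (x, theta) -> 0 < r < exit_time Omega x theta ->
  Omega (ray x theta r).
Proof.
move=> [/= mt [h1 h2]] /andP[r0 rt]; rewrite -pt_ray -/(chord _ _ _ _).
by apply/(chordP OB _ mt); rewrite /exit_time in rt; apply/andP; split; lra.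
Qed.

Lemma ray_exit x theta : lseg Omega (x, theta) -> ~ Omega (ray x theta (exit_time Omega x theta)).
Proof.
by move=> [/= mt _]; rewrite -pt_ray subKr => /(chordP OB _ mt); rewrite ltxx.
Qed.

Lemma bmo_ray W x theta D : bmo setT W -> bmo D (fun r : T1 => W (ray x theta r)).
Proof.
move=> bW; apply: (bmo_comp bW) => //.
exact: (measurableT_comp (measurable_ray x) (pair1_measurable theta)).
Qed.

Lemma bmo_indicW W : bmo setT W -> bmo setT (fun y => \1_Omega y * W y).
Proof. by move=> bW; apply: bmoM => //; apply: bmo_indic; exact: body_measurable OB. Qed.

Let bexp k a : 0 <= k -> bmo (`[0, a]%classic : set T1) (fun r : T1 => expR (- k * r)).
Proof.
move=> k0; apply: (bmo_bd (M := 1)); first by mfun.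
move=> r /=; rewrite in_itv/= => /andP[r0 _]; rewrite ger0_norm ?expR_ge0//.
by rewrite -[leRHS]expR0 ler_expR mulNr oppr_le0 mulr_ge0.
Qed.

Lemma mild_indicW W x theta : bmo setT W -> lseg Omega (x, theta) ->
  mild (fun z => \1_Omega z.1 * W z.1) (x, theta) =
  \int[mu]_(r in `[0, exit_time Omega x theta])
    (e^-1 * expR (- e^-1 * r) * (\1_Omega (ray x theta r) * W (ray x theta r))).
Proof.
move=> bW lz; rewrite mild_ray//; last exact: (bmo_fst (bmo_indicW bW)).
by rewrite (indicN R (ray_exit lz)) mul0r mulr0 add0r.
Qed.

(** The probability that a backward particle collides before reaching the boundary: the constant 1
    is reproduced by the mild formula, and only the boundary term is removed. *)
Lemma mild_indic_body x theta : lseg Omega (x, theta) ->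
  mild (fun z => \1_Omega z.1) (x, theta) = 1 - expR (- e^-1 * exit_time Omega x theta).
Proof.
move=> lz; have bO : bmo setT (\1_Omega : T2 -> R) by apply: bmo_indic; exact: body_measurable OB.
rewrite mild_ray//; last exact: bmo_fst bO.
have := mild_cst e0 1 lz; rewrite mild_ray//; last exact: bmo_cst.
rewrite (indicN R (ray_exit lz)) mulr0 add0r mulr1 => <-; rewrite [RHS]addrAC subrr add0r.
set tau := exit_time _ _ _; pose f (r : T1) := e^-1 * expR (- e^-1 * r).
have bf : bmo (`[0, tau]%classic : set T1) f by apply: bmoZ; apply: bexp; exact: ltW.
have bg : bmo (`[0, tau]%classic : set T1) (fun r : T1 => f r * \1_Omega (ray x theta r)).
  by apply: bmoM => //; exact: bmo_ray bO.
have op (g : T1 -> R) : bmo (`[0, tau]%classic : set T1) g ->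
    \int[mu]_(r in `[0, tau]) g r = \int[mu]_(r in `]0, tau[) g r.
  move=> bg'; have ig := bmo_integrable (mI 0 tau) (itv_finite 0 tau) bg'.
  rewrite -Rintegral_itv_obnd_cbnd; last first.
    apply: integrableS ig => //; apply: subset_itvr; by rewrite bnd_simp.
  rewrite Rintegral_itv_bndo_bndc//; apply: integrableS ig => //.
  by move=> r /=; rewrite !in_itv/= => /andP[r1 r2]; rewrite !ltW.
rewrite !op//; last by apply: bmoM; [exact: bf|exact: bmo_cst].
apply: eq_Rintegral => r /set_mem/=; rewrite in_itv/= => h.
by rewrite (indicT R (ray_interior lz h)).
Qed.

(** [hit_weight / 2] on the directions that see the inner square. Along one ray the polar integral
    is at most [(4 * d) ^+ 2], so these directions have measure at least the area [4 * eta ^+ 2]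
    divided by it. *)
Definition escape_rate : R := hit_weight d eta * eta ^+ 2 / (8 * d ^+ 2).

Lemma escape_rate_gt0 : 0 < escape_rate.
Proof.
have e2 := eta0.
by rewrite divr_gt0 ?mulr_gt0 ?exprn_gt0 ?(hit_weight_gt0 OB).
Qed.

Let Q := inner_square xc eta.

Lemma inner_square_mass : fine (@leb2 R Q) = 4 * eta ^+ 2.
Proof.
have e2 := eta0.
rewrite /Q (_ : inner_square _ _ = square xc eta)// squareE leb2_rect; [|lra|lra].
by rewrite /=; ring.
Qed.

(** Unlike the minorization constant, this lower bound on the probability of a collision inside the
    body is uniform in [e <= eta]; it is what prevents the supremum from living on the boundary
    alone. *)
Lemma transition_indic_body x : e <= eta -> body_closure Omega x ->
  escape_rate <= K (\1_Omega) x.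
Proof.
move=> ee cx; have e2 := eta0; have d2 := d0.
have bO : bmo setT (\1_Omega : T2 -> R) by apply: bmo_indic; exact: body_measurable OB.
have bQ : bmo setT (\1_Q : T2 -> R) by apply: bmo_indic; exact: (inner_square_measurable xc eta).
pose h (theta r : T1) : R := r * (\1_Q (ray x theta r) * 1).
have bh : bmo (@angles R `*` `[0, 4 * d]%classic) (fun z : T2 => h z.1 z.2).
  apply: bmoM.
    apply: (bmo_bd (M := 4 * d)); first by mfun.
    by move=> z [_ /=]; rewrite in_itv/= => /andP[h1 h2]; rewrite ger0_norm.
  apply: bmoM; last exact: bmo_cst.
  by apply: (bmo_comp bQ) => //; exact: measurable_ray.
have bJ : bmo (@angles R) (fun theta => \int[mu]_(r in `[0, 4 * d]) h theta r).
  exact: (bmo_Rint (mI 0 (4 * d)) (itv_finite 0 (4 * d)) (f := h)).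
have bm := bmo_mild OB e0 (bmo_fst bO).
pose k := hit_weight d eta / (32 * d ^+ 2).
have -> : escape_rate = k * \int[@leb2 R]_(y in Q) 1.
  rewrite Rintegral_cst; last exact: (inner_square_measurable xc eta).
  by rewrite mul1r inner_square_mass /escape_rate /k; field; rewrite gt_eqF.
rewrite (Rint_Q_polar OB eta0 HQ cx (bmo_cst _ 1)) -(RintZ am af)//.
apply: (Rint_le am af); [exact: bmoZ|exact: (bmo_wtF OB b x bm)|].
move=> theta _.
have [[r [r0 Qr]]|nh] := pselect (exists r, 0 <= r /\ Q (ray x theta r)); last first.
  rewrite Rint_eq0 ?mulr0; first by rewrite mulr_ge0 ?wt_ge0// mild_ge0// => z; rewrite indicE.
  move=> r; rewrite /= in_itv/= => /andP[r0 _]; rewrite indicN ?mul0r ?mulr0//.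
  by move=> Qr; apply: nh; exists r.
have [W lz _ rt] := ray_hit OB b eta0 HQ cx r0 Qr.
set J := Rintegral _ _ _.
have J1 : J <= 4 * d * (4 * d).
  apply: le_trans (_ : _ <= 4 * d * fine (mu `[0, 4 * d])) _.
    apply: (Rint_le_cst (mI 0 (4 * d)) (itv_finite 0 (4 * d))).
      apply: bmoM; last by apply: bmoM; [exact: bmo_ray bQ|exact: bmo_cst].
      apply: (bmo_bd (M := 4 * d)) => // r'; rewrite /= in_itv/= => /andP[h1 h2].
      by rewrite ger0_norm.
    move=> r'; rewrite /= in_itv/= => /andP[h1 h2].
    by rewrite mulr1 indicE; case: (_ \in _); rewrite ?mulr1 ?mulr0// mulr_ge0// ltW.
  by rewrite fine_mu_itv ?subr0// mulr_ge0// ltW.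
(* Otherwise the exit point would be within [eta] of the hit point, hence inside the larger
   square. *)
have tau : eta <= exit_time Omega x theta.
  rewrite leNgt; apply/negP => te.
  have sh (u : R) : `|u| <= 1 -> `|(exit_time Omega x theta - r) * u| <= eta.
    move=> u1; rewrite normrM ger0_norm ?subr_ge0 ?(ltW rt)//.
    have t0 : 0 <= exit_time Omega x theta - r by rewrite subr_ge0 ltW.
    apply: le_trans (ler_wpM2l t0 u1) _; move: te r0; lra.
  apply: (ray_exit lz); apply: HQ.
    have [q1 _] := Qr.
    rewrite (_ : _ - xc.1 = ((ray x theta r).1 - xc.1) - (exit_time Omega x theta - r) * cos theta); last by rewrite /ray/=; ring.
    apply: le_trans (ler_normB _ _) _; rewrite mulr_natl mulr2n; apply: lerD q1 _; exact: sh (cos_max theta).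
  have [_ q2] := Qr; rewrite (_ : _ - xc.2 = ((ray x theta r).2 - xc.2) - (exit_time Omega x theta - r) * sin theta); last by rewrite /ray/=; ring.
  apply: le_trans (ler_normB _ _) _; rewrite mulr_natl mulr2n; apply: lerD q2 _; exact: sh (sin_max theta).
rewrite (mild_indic_body lz).
have half : expR (- e^-1 * exit_time Omega x theta) <= 2^-1.
  rewrite mulNr expRN lef_pV2 ?posrE ?expR_gt0//.
  apply: le_trans (expR_ge1Dx _); rewrite -[2]/(1 + 1) lerD2l mulrC ler_pdivlMr// mul1r.
  exact: le_trans tau.
apply: (@le_trans _ _ (hit_weight d eta * 2^-1)).
  apply: le_trans (_ : k * (4 * d * (4 * d)) <= _).
    by rewrite ler_wpM2l// divr_ge0 ?mulr_ge0 ?sqr_ge0// ltW// (hit_weight_gt0 OB).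
  by apply: eq_ler; rewrite /k; field; rewrite gt_eqF.
by apply: ler_pM => //; [exact: ltW (hit_weight_gt0 OB eta0)|lra].
Qed.

(** The near and far parts of the backward kernel each cost at most [rho * M]; the middle part is
    dominated by the polar weight over a square of half-side [L * e]. *)
Lemma transition_local_bound W M x (rho L : R) : bmo setT W -> (forall y, 0 <= W y <= M) ->
  0 < rho -> rho * L = 4 -> body_closure Omega x ->
  K (fun y => \1_Omega y * W y) x <= 2 * rho * M +
  (rho * e ^+ 2)^-1 * \int[@leb2 R]_(y in local_body Omega x (L * e)) W y.
Proof.
move=> bW WM rho0 rL cx; have d2 := d0.
have L0 : 0 < L by rewrite -(pmulr_rgt0 _ rho0) rL.
have M0 : 0 <= M by have /andP[] := WM x; exact: le_trans.
set D := local_body Omega x (L * e).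
have mD : measurable D by exact: (local_body_measurable OB).
have bDW : bmo setT (fun y => \1_D y * W y) by apply: bmoM => //; exact: bmo_indic.
have Le0 : 0 <= L * e by rewrite mulr_ge0// ltW.
pose h (theta r : T1) : R := r * (\1_D (ray x theta r) * W (ray x theta r)).
have bh : bmo (@angles R `*` `[0, 2 * (L * e)]%classic) (fun z : T2 => h z.1 z.2).
  apply: bmoM; last by apply: (bmo_comp bDW) => //; exact: measurable_ray.
  apply: (bmo_bd (M := 2 * (L * e))); first by mfun.
  by move=> z [_ /=]; rewrite in_itv/= => /andP[h1 h2]; rewrite ger0_norm.
have bJ : bmo (@angles R) (fun theta => \int[mu]_(r in `[0, 2 * (L * e)]) h theta r).
  exact: (bmo_Rint (mI 0 (2 * (L * e))) (itv_finite 0 (2 * (L * e))) (f := h)).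
have h0 theta r : 0 <= r -> 0 <= h theta r.
  by move=> r0; rewrite mulr_ge0// mulr_ge0 ?indicE//; case/andP: (WM (ray x theta r)).
have bm := bmo_mild OB e0 (bmo_fst (bmo_indicW bW)).
have bwt : bmo (@angles R) (fun theta => wt x theta) by exact: (bmo_section x _ (bmo_wt OB b)).
have main theta : lseg Omega (x, theta) ->
  mild (fun z => \1_Omega z.1 * W z.1) (x, theta) <=
  2 * rho * M + (rho * e ^+ 2)^-1 * \int[mu]_(r in `[0, 2 * (L * e)]) h theta r.
  move=> lz; rewrite mild_indicW//; set tau := exit_time _ _ _.
  have t0 : 0 <= tau by exact: exit_time_ge0.
  have mt := mI 0 tau; have ft := itv_finite 0 tau.
  pose A (r : T1) : R := \1_(`[0, rho * e]%classic) r * (M * e^-1).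
  pose B (r : T1) : R := (rho * e ^+ 2)^-1 * (\1_(`[0, 2 * (L * e)]%classic) r * h theta r).
  (* Kernel with halved decay, written as the derivative of an exponential so that its integral is
     explicit. *)
  pose C (r : T1) : R := (- (rho * M)) * (- (2 * e)^-1 * expR (- (2 * e)^-1 * (r - 0))).
  have bA : bmo (`[0, tau]%classic : set T1) A by apply: bmoM; [apply: bmo_indic; exact: mI|exact: bmo_cst].
  have br a : bmo (`[0, a]%classic : set T1) (fun r : T1 => r).
    apply: (bmo_bd (M := a)) => // r /=; rewrite in_itv/= => /andP[h1 h2].
    by rewrite ger0_norm.
  have bh1 a : bmo (`[0, a]%classic : set T1) (h theta) by apply: bmoM (br _) (bmo_ray _ _ _ bDW).
  have bB : bmo (`[0, tau]%classic : set T1) B.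
    by apply: bmoZ; apply: bmoM => //; apply: bmo_indic; exact: mI.
  have bC' : bmo (`[0, tau]%classic : set T1) (fun r : T1 => - (2 * e)^-1 * expR (- (2 * e)^-1 * (r - 0))).
    apply: bmoZ; rewrite (_ : (fun r : T1 => _) = fun r : T1 => expR (- (2 * e)^-1 * r)); last first.
      by apply/funext => r; rewrite subr0.
    by apply: bexp; rewrite invr_ge0 mulr_ge0// ltW.
  have bC : bmo (`[0, tau]%classic : set T1) C.
    apply: bmoZ; exact: bC'.
  apply: (@le_trans _ _ (\int[mu]_(r in `[0, tau]) (A r + C r + B r))).
    apply: (Rint_le mt ft).
    - apply: bmoM; last exact: bmo_ray (bmo_indicW bW).
      by apply: bmoZ; apply: bexp; exact: ltW.
    - by apply: bmoD => //; exact: bmoD.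
    move=> r; rewrite /= in_itv/= => /andP[r0 rt].
    set w := \1_Omega _ * _; have /andP[W0 W1] := WM (ray x theta r).
    have w0 : 0 <= w by rewrite mulr_ge0 ?indicE.
    have wM : w <= M by rewrite /w indicE; case: (_ \in _); rewrite ?mul1r ?mul0r.
    have w0M : 0 <= w <= M by rewrite w0.
    apply: le_trans (expR_kernel_split e0 rho0 rL r0 w0M) _; apply: lerD.
      apply: eq_ler; congr (_ + _); last by rewrite /C subr0; ring.
      rewrite /A; have [h1|h1] := leP r (rho * e).
        by rewrite indicT//= in_itv/= r0.
      by rewrite indicN//= in_itv/= r0 leNgt h1.
    rewrite /B ler_wpM2l//; first by rewrite invr_ge0 mulr_ge0 ?sqr_ge0// ltW.
    have [rL'|rL'] := leP r (L * e); last first.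
      by rewrite mul0r mulr_ge0 ?h0// indicE.
    rewrite mul1r indicT ?mul1r; last by rewrite /= in_itv/= r0 (le_trans rL')//; lra.
    apply: ler_wpM2l => //; have [Or|nOr] := pselect (Omega (ray x theta r)); last first.
      by rewrite /w (indicN R nOr) mul0r mulr_ge0 ?indicE.
    have Dr : D (ray x theta r).
      have cs1 (u k : R) : `|u| <= 1 -> `|k - r * u - k| <= L * e.
        move=> u1; rewrite addrAC subrr sub0r normrN normrM (ger0_norm r0); apply: le_trans rL'.
        by rewrite ler_piMr.
      by split => //; split; apply: cs1; [exact: cos_max|exact: sin_max].
    by rewrite /w (indicT R Or) (indicT R Dr).
  rewrite (RintD mt ft) ?(RintD mt ft)//; last exact: bmoD.
  apply: lerD.
    have -> : 2 * rho * M = rho * M + rho * M by ring.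
    apply: lerD.
      rewrite /A -Rint_restrictI; have mr := mI 0 (rho * e).
      apply: le_trans (Rint_le_sub mr (measurableI _ _ mt mr) (itv_finite _ _) _ (bmo_cst _ _) _) _.
      - by move=> r [].
      - by move=> r _; rewrite divr_ge0// ltW.
      rewrite Rintegral_cst// fine_mu_itv ?subr0; last by rewrite mulr_ge0 ?ltW.
      by rewrite (_ : M / e * (rho * e) = rho * M)//; field; rewrite gt_eqF.
    rewrite /C (RintZ mt ft).
      have [_ _ /(_ tau)] := lac_exp 0 (- (2 * e)^-1) t0.
      rewrite t0 lexx => /(_ isT); set I := Rintegral _ _ _; rewrite subr0 subrr mulr0 expR0 => h1.
      have := expR_ge0 (- (2 * e)^-1 * tau); rewrite h1 mulNr -mulrN => h2.
      by rewrite ler_piMr ?mulr_ge0 ?(ltW rho0)//; lra.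
    exact: bC'.
  rewrite /B (RintZ mt ft); last by apply: bmoM => //; apply: bmo_indic; exact: mI.
  rewrite ler_wpM2l//; first by rewrite invr_ge0 mulr_ge0 ?sqr_ge0// ltW.
  rewrite -Rint_restrictI; apply: (Rint_le_sub (mI _ _) _ (itv_finite _ _)); [by apply: measurableI; exact: mI| |exact: bh1|].
    by move=> r [].
  by move=> r; rewrite /= in_itv/= => /andP[r0 _]; exact: h0.
have -> : \int[@leb2 R]_(y in D) W y =
    \int[mu]_(theta in @angles R) \int[mu]_(r in `[0, 2 * (L * e)]) h theta r.
  rewrite Rint_restrict (Rint_polar (x := x) (L := L * e))//.
  move=> y; have [[_ Dy] _//|nD] := pselect (D y); last by rewrite (indicN R nD) mul0r eqxx.
rewrite -[X in X + _]mulr1 -[X in _ * X + _](wt_mass OB b cx) -(RintZ am af)// -(RintZ am af)//.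
rewrite -(RintD am af); [|exact: bmoZ|exact: bmoZ].
apply: (Rint_le am af); [exact: (bmo_wtF OB b x bm)|by apply: bmoD; exact: bmoZ|].
move=> theta _; set J := Rintegral _ _ _.
have J0 : 0 <= (rho * e ^+ 2)^-1 * J.
  rewrite mulr_ge0//; first by rewrite invr_ge0 mulr_ge0 ?sqr_ge0 ?(ltW rho0).
  by apply: Rintegral_ge0 => r; rewrite /= in_itv/= => /andP[r0 _]; exact: h0.
have [w0|w0] := eqVneq (wt x theta) 0; first by rewrite w0 mul0r mulr0 add0r.
have lz := lseg_wt OB w0.
apply: le_trans (_ : wt x theta * (2 * rho * M + (rho * e ^+ 2)^-1 * J) <= _).
  by rewrite ler_wpM2l ?wt_ge0//; exact: main.
rewrite mulrDr mulrC lerD2l ler_piMl//; exact: (wt_le1 OB).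
Qed.

Lemma avg_mild_lin F G k x : bmo setT F -> bmo setT G ->
  avg (mild (fun z => F z + k * G z)) x = avg (mild F) x + k * avg (mild G) x.
Proof.
move=> bF bG; rewrite -(avg_lin OB); [|exact: (bmo_mild OB e0)..].
by congr (avg _ x); apply/funext => z; rewrite mild_lin.
Qed.

Lemma avg_mild_abs F G x : bmo setT F -> bmo setT G -> (forall z, `|F z| <= G z) ->
  `|avg (mild F) x| <= avg (mild G) x.
Proof.
move=> bF bG FG.
have P k : k = 1 \/ k = -1 -> 0 <= avg (mild G) x + k * avg (mild F) x.
  move=> hk; rewrite -avg_mild_lin//; apply: avg_ge0 => z; apply: mild_ge0 => // z'.
  have := FG z'; rewrite ler_norml => /andP[h1 h2].
  by case: hk => ->; lra.
have := P 1 (or_introl erefl); have := P (-1) (or_intror erefl).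
rewrite mul1r mulN1r subr_ge0 => h1 h2; rewrite ler_norml h1 andbT.
by rewrite -subr_ge0 opprK addrC.
Qed.

(** With [M] the supremum of [|V|], the boundary part of the transition costs at most
    [(1 - escape_rate) * M] and the interior part at most [escape_rate / 2 * M] plus a local
    average. The total coefficient of [M] is less than 1, so [M] is absorbed. *)
Lemma sup_bound V S (F X : R) : bmo setT V -> bmo setT S -> (forall z, `|S z| <= F) ->
  (forall x, V x = avg (mild (fun z => V z.1 + S z)) x) -> e <= eta ->
  (forall x, body_closure Omega x ->
     \int[@leb2 R]_(y in local_body Omega x (16 / escape_rate * e)) `|V y| <= X) ->
  forall x, `|V x| <= 2 / escape_rate * (4 / escape_rate * e ^- 2 * X + F)%R.
Proof.
move=> bV bS SF fix_ ee HX.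
have k0 := escape_rate_gt0.
have F0 : 0 <= F by apply: le_trans (SF (xc, 0)).
pose W y := `|V y|; have bW : bmo setT W by exact: bmo_norm.
have [M1 VM1] := bV.2.
pose M := sup (range W).
have WM y : 0 <= W y <= M.
  rewrite normr_ge0/=; apply: ub_le_sup; last by exists y.
  by exists M1 => _ [z _ <-]; exact: VM1.
have bO : bmo setT (\1_Omega : T2 -> R) by apply: bmo_indic; exact: body_measurable OB.
pose X' := 4 / escape_rate * e ^- 2 * X + F.
have step x : body_closure Omega x -> W x <= (1 - escape_rate / 2) * M + X'.
  move=> cx; have Kb := transition_indic_body ee cx.
  have bV3 := bmo_fst bV; have bW3 := bmo_fst bW; have bO3 := bmo_fst bO.
  (* The choice [rho = escape_rate / 4] makes the loss [2 * rho * M] half of the gain. *)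
  have rL : escape_rate / 4 * (16 / escape_rate) = 4 by field; rewrite gt_eqF.
  have := transition_local_bound bW WM (divr_gt0 k0 (ltr0n _ 4)) rL cx.
  set T := K _ x; set I := Rintegral _ _ _ => h.
  have IX : I <= X by exact: HX.
  have h1 : W x <= avg (mild (fun z => W z.1 + F * 1)) x.
    rewrite /W fix_; apply: avg_mild_abs; [exact: bmoD|by apply: bmoD => //; exact: bmo_cst|].
    by move=> z; rewrite mulr1; apply: le_trans (ler_normD _ _) _; rewrite lerD2l.
  (* [|V|] is at most its restriction to the body plus [M] times the indicator of the complement. *)
  have h2 : avg (mild (fun z => W z.1)) x <= T + M * (1 - K \1_Omega x).
    have bU : bmo setT (fun z : T3 => \1_Omega z.1 * W z.1) by exact: bmo_fst (bmo_indicW bW).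
    have bc : bmo setT ((fun=> 1) : T3 -> R) by exact: bmo_cst.
    have := @avg_mild_abs (fun z => W z.1) (fun z => \1_Omega z.1 * W z.1 + M * (1 + (-1) * \1_Omega z.1)) x bW3.
    have b2 : bmo setT (fun z : T3 => 1 + (-1) * \1_Omega z.1 : R) by apply: bmoD => //; exact: bmoZ.
    have b3 : bmo setT (fun z : T3 => \1_Omega z.1 * W z.1 + M * (1 + (-1) * \1_Omega z.1)).
      by apply: bmoD => //; exact: bmoZ.
    move=> /(_ b3) hh; rewrite avg_mild_lin// avg_mild_lin// (avg_mild_cst OB)// in hh.
    rewrite -[1 - _]/(1 + - _) -mulN1r; apply: le_trans (ler_norm _) (hh _) => z.
    have /andP[W0 W1] := WM z.1; rewrite ger0_norm//.
    have [Oz|Oz] := pselect (Omega z.1); first by rewrite (indicT R Oz) mulN1r subrr mulr0 addr0 mul1r.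
    by rewrite (indicN R Oz) mul0r add0r mulr0 addr0 mulr1.
  rewrite avg_mild_lin// ?(avg_mild_cst OB)// in h1; last exact: bmo_cst.
  have M0 : 0 <= M by have /andP[] := WM x; exact: le_trans.
  have h3 : M * (1 - K \1_Omega x) <= M * (1 - escape_rate) by rewrite ler_wpM2l// lerD2l lerN2.
  have c0 : 0 <= (escape_rate / 4 * e ^+ 2)^-1.
    by rewrite invr_ge0 mulr_ge0 ?sqr_ge0// divr_ge0// ltW.
  have h4 := ler_wpM2l c0 IX; rewrite /X'.
  rewrite (_ : 4 / escape_rate * e ^- 2 * X = (escape_rate / 4 * e ^+ 2)^-1 * X); last first.
    by field; rewrite !gt_eqF.
  move: h h1 h2 h3 h4; set Y := _^-1 * I; set Z := _^-1 * X.
  rewrite mulr1 mulrBr mulr1.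
  rewrite (_ : 2 * (escape_rate / 4) * M = M * escape_rate / 2); last by field.
  rewrite (_ : (1 - escape_rate / 2) * M = M - M * escape_rate / 2); last by field.
  by rewrite mulrBr mulr1; lra.
have Oxc : body_closure Omega xc.
  by left; apply: HQ; rewrite subrr normr0 mulr_ge0// ltW.
have Mle : M <= (1 - escape_rate / 2) * M + X'.
  apply: ge_sup; first by exists (W xc), xc.
  move=> _ [x _ <-]; have [cx|nx] := pselect (body_closure Omega x); first exact: step.
  have -> : W x = 0 by rewrite /W fix_ avg_out// normr0.
  by apply: le_trans (step _ Oxc); have /andP[] := WM xc.
move=> x; have /andP[_] := WM x; move/le_trans; apply.
rewrite -/X' mulrAC ler_pdivlMr//; move: Mle; rewrite mulrBl mul1r; lra.
Qed.

End sup_bound.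

Ltac pos := repeat first [ match goal with
 | |- is_true (0 <= _ * _) => apply: mulr_ge0
 | |- is_true (0 <= _ + _) => apply: addr_ge0
 | |- is_true (0 <= _ ^-1) => rewrite invr_ge0
 | |- is_true (0 <= _ ^+ _) => apply: exprn_ge0
 | |- is_true (0 <= _%:R) => exact: ler0n
 | h : is_true (0 <= ?x) |- is_true (0 <= ?x) => exact: h
 | h : is_true (0 < ?x) |- is_true (0 <= ?x) => exact: (ltW h)
 end ].

(** * Closing the estimate: real inequalities *)

Section apriori_real.
Context (R : realType).
Implicit Types (a Z Y D : R).

Lemma absorb a Z Y D : 0 <= a -> 0 <= Z -> 0 <= Y -> 0 <= D ->
  a ^+ 2 <= Z * (a + Y) + D ^+ 2 -> a <= 2 * Z + Y + 2 * D.
Proof.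
move=> a0 Z0 Y0 D0 H; rewrite leNgt; apply/negP => aL.
have ap : 0 < a by apply: le_lt_trans aL; rewrite !addr_ge0 ?mulr_ge0.
have h1 : Z * Y <= Z * a by apply: ler_wpM2l => //; lra.
have h2 : D * D <= D * a by apply: ler_wpM2l => //; lra.
have h3 : a * (2 * Z + Y + 2 * D) < a * a by rewrite ltr_pM2l.
have h4 : 0 <= a * Y by rewrite mulr_ge0.
have h5 : 0 <= D * a by rewrite mulr_ge0.
move: H h1 h2 h3 h4 h5; rewrite !expr2 !mulrDr.
rewrite (_ : a * (2 * Z) = Z * a + Z * a); last by ring.
rewrite (_ : a * (2 * D) = D * a + D * a); last by ring.
lra.
Qed.

(** [M] is linear in [P * al] while [al ^+ 2] is linear in [M]. Solving this quadratic inequality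
    squares [P], and that square is the factor [e ^- 2 / E] of [F1]; the data entering linearly keep
    [P], of order [e^-1 / E] at most. *)
Lemma apriori_real (e E F F1 F2 H1 H2 M al P c cH C1 C2 : R) :
  0 < e <= 1 -> 0 < E <= 1 -> 0 <= F -> 0 <= F1 -> 0 <= F2 -> 0 <= H1 -> 0 <= H2 -> 0 <= al ->
  0 <= P -> 0 <= c -> 0 <= cH -> 0 <= C1 -> 0 <= C2 ->
  M <= C1 * P * (al + F2) + C2 * F -> H1 <= cH * H2 ->
  al ^+ 2 <= (M + F) * F1 + e * (M * H1) + e / 2 * H2 ^+ 2 ->
  P ^+ 2 = c * (e ^- 2 / E) -> P <= c * (e^-1 / E) ->
  M <= (2 * (C1 ^+ 2 * c) + 4 * (C1 * c) + 2 * C2 + 2 + 2 * (C1 ^+ 2 * c * cH)) *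
    (e^-1 / E * F2 + e ^- 2 / E * F1 + F + e^-1 / E * H2).
Proof.
move=> /andP[e0 e1] /andP[E0 E1] F0 F10 F20 H10 H20 al0 P0 c0 cH0 C10 C20 HM HH Hal HP2 HP.
set g := e^-1 / E in HP *; set k := e ^- 2 / E in HP2 *.
have g0 : 0 <= g by rewrite divr_ge0 ?invr_ge0 ?ltW.
have k0 : 0 <= k by rewrite divr_ge0 ?invr_ge0 ?exprn_ge0 ?ltW.
have ek : e * k = g by rewrite /k /g; field; rewrite ?gt_eqF.
pose a := C1 * P * al; pose Y := C1 * P * F2 + C2 * F.
have a0 : 0 <= a by rewrite !mulr_ge0.
have Y0 : 0 <= Y by rewrite addr_ge0 ?mulr_ge0.
have MaY : M <= a + Y by move: HM; rewrite /a /Y mulrDr; lra.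
pose Z := (C1 * P) ^+ 2 * (F1 + e * H1); pose D := C1 * P * H2.
have Z0 : 0 <= Z by apply: mulr_ge0; [exact: sqr_ge0|apply: addr_ge0 => //; apply: mulr_ge0 => //; exact: ltW].
have D0 : 0 <= D by rewrite !mulr_ge0.
have aE : a ^+ 2 <= Z * (a + (Y + F)) + D ^+ 2.
  rewrite /a exprMn.
  apply: (@le_trans _ _ ((C1 * P) ^+ 2 * ((a + (Y + F)) * (F1 + e * H1) + H2 ^+ 2))).
    rewrite ler_wpM2l ?sqr_ge0//; apply: le_trans Hal _.
    have h1 : (M + F) * F1 <= (a + (Y + F)) * F1 by rewrite ler_wpM2r//; lra.
    have h2 : e * (M * H1) <= (a + (Y + F)) * (e * H1).
      rewrite mulrCA; apply: ler_wpM2r (mulr_ge0 (ltW e0) H10) _ _ _; lra.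
    have h3 : e / 2 * H2 ^+ 2 <= H2 ^+ 2 by rewrite ler_piMl ?sqr_ge0//; lra.
    by rewrite mulrDr; lra.
  by apply: eq_ler; rewrite /Z /D /a; ring.
have YF0 : 0 <= Y + F by rewrite addr_ge0.
have := absorb a0 Z0 YF0 D0 aE => ha.
have M1 : M <= 2 * Z + 2 * Y + F + 2 * D by lra.
have hZ : Z <= C1 ^+ 2 * c * (k * F1) + C1 ^+ 2 * c * cH * (g * H2).
  rewrite /Z exprMn HP2 -ek.
  have h : C1 ^+ 2 * c * (e * k) * H1 <= C1 ^+ 2 * c * (e * k) * (cH * H2).
    apply: ler_wpM2l HH; apply: mulr_ge0 (mulr_ge0 (ltW e0) k0).
    exact: mulr_ge0 (sqr_ge0 _) c0.
  rewrite (_ : _ * (F1 + _) = C1 ^+ 2 * c * (k * F1) + C1 ^+ 2 * c * (e * k) * H1); last by ring.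
  rewrite lerD2l; apply: le_trans h _.
  by apply: eq_ler; ring.
have hY : C1 * P * F2 <= C1 * c * (g * F2).
  have := ler_wpM2l (mulr_ge0 C10 F20) HP.
  rewrite (_ : C1 * F2 * P = C1 * P * F2); last by ring.
  by rewrite (_ : C1 * F2 * (c * g) = C1 * c * (g * F2))//; ring.
have hD : D <= C1 * c * (g * H2).
  have := ler_wpM2l (mulr_ge0 C10 H20) HP.
  rewrite (_ : C1 * H2 * P = D); last by rewrite /D; ring.
  by rewrite (_ : C1 * H2 * (c * g) = C1 * c * (g * H2))//; ring.
have x1 : 0 <= g * F2 by rewrite mulr_ge0.
have x2 : 0 <= k * F1 by rewrite mulr_ge0.
have x3 : 0 <= g * H2 by rewrite mulr_ge0.
have y1 : 0 <= C1 ^+ 2 * c by rewrite mulr_ge0 ?sqr_ge0.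
have y2 : 0 <= C1 * c by rewrite mulr_ge0.
have y3 : 0 <= C1 ^+ 2 * c * cH by rewrite mulr_ge0.
move: M1; rewrite /Y => M1.
move: (g * F2) (k * F1) (g * H2) x1 x2 x3 hZ hY hD M1 => u v w x1 x2 x3 hZ hY hD M1.
move: (C1 ^+ 2 * c * cH) y3 hZ => A3 y3 hZ.
move: (C1 ^+ 2 * c) (C1 * c) y1 y2 hZ hY hD M1 => A1 A2 y1 y2 hZ hY hD M1; set K := _ + 2 * A3.
have k1 : 2 * A1 * v <= K * v by apply: ler_wpM2r => //; rewrite /K; lra.
have k2 : 2 * A2 * u <= K * u by apply: ler_wpM2r => //; rewrite /K; lra.
have k3 : (2 * C2 + 1) * F <= K * F by apply: ler_wpM2r => //; rewrite /K; lra.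
have k4 : (2 * A3 + 2 * A2) * w <= K * w by apply: ler_wpM2r => //; rewrite /K; lra.
by rewrite !mulrDr; move: k1 k2 k3 k4; move: K => K; rewrite !mulrDl; lra.
Qed.

End apriori_real.

(** * The uniform bound on the averages *)

Section apriori.
Context (R : realType) (d eta : R) (eta0 : 0 < eta) (d0 : 0 < d).
Notation T1 := (measurableTypeR R).
Notation T2 := (T1 * T1)%type.
Notation T3 := (T1 * T1 * T1)%type.
Notation mu := (@lebesgue_measure R).

Lemma lines_mass (Omega : set (R * R)) (OB : cbody Omega d) :
  fine (@leb2 R (lines Omega)) <= 32 * d.
Proof.
have d2 := d0; have am := @angles_measurable R.
have mI : measurable (`[- (2 * d), 2 * d]%classic : set T1) by exact: measurable_itv.
have le2 : - (2 * d) <= 2 * d by lra.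
have fI : fine (mu `[- (2 * d), 2 * d]%classic) = 2 * d - (- (2 * d)) by exact: fine_mu_itv.
apply: (@le_trans _ _ (fine (@leb2 R (lines_box d)))).
  have mb : measurable (lines_box d) by exact: measurableX.
  have fb : (@leb2 R (lines_box d) < +oo)%E.
    by apply: leb2_rect_finite => //; [exact: angles_finite|exact: itv_finite].
  apply: fine_le; rewrite ?ge0_fin_numE//; first exact: lines_finite OB.
  by apply: le_measure; rewrite ?inE//; [exact: lines_measurable OB|exact: lines_sub_box OB].
rewrite [X in fine X](product_measure1E mu mu)//.
rewrite fineM ?ge0_fin_numE//; [|exact: angles_finite|exact: itv_finite].
rewrite fine_mu_angles fI; have p2 := @pihalf_lt2 R.
have : 2 * pi * (4 * d) <= 8 * (4 * d) by rewrite ler_wpM2r ?mulr_ge0 ?(ltW d2)//; lra.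
by rewrite (_ : 2 * d - - (2 * d) = 4 * d); [lra|ring].
Qed.

(** Weighted by the flux, the incoming boundary is the set of lines, whose measure is bounded in
    terms of [d] alone; Cauchy-Schwarz is applied there. *)
Lemma Gamma_minus_L1_le_L2 (Omega : set (R * R)) (OB : cbody Omega d) (b : boundary_data Omega)
    (S : T3 -> R) : bmo setT S ->
  (\int[@leb2 R]_(z in Gamma_minus b) (`|S (curve b z.1, z.2)| * `|flux b z|)) ^+ 2 <=
  32 * d * \int[@leb2 R]_(z in Gamma_minus b) (S (curve b z.1, z.2) ^+ 2 * `|flux b z|).
Proof.
move=> bS; have bc : bmo setT (fun z : T2 => S (curve b z.1, z.2)).
  by apply: (bmo_curve b); exact: bmoS bS.
rewrite (Rint_Gamma_minus OB b (F := fun z => `|S (curve b z.1, z.2)|)); last exact: (bmo_norm bc).1.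
rewrite (Rint_Gamma_minus OB b (F := fun z => S (curve b z.1, z.2) ^+ 2)); last exact: (bmoX 2 bc).1.
have bl : bmo (lines Omega) (fun y => S (curve b (tin b y.1 y.2), y.1)).
  apply: (bmo_comp bc (g := fun y : T2 => (tin b y.1 y.2, y.1) : T2)) => //.
  by apply: measurable_fun_pair; [exact: measurable_tin OB b|mfun].
have lm := lines_measurable OB; have lf := lines_finite OB.
apply: le_trans (Rint_cauchy_schwarz lm lf bl) _.
apply: ler_wpM2r; last exact: lines_mass.
by apply: Rintegral_ge0 => y _; rewrite sqr_ge0.
Qed.

Context (m : nat) (m0 : (0 < m)%N).

(** [C] and [e1] are chosen before the domain, its boundary parametrization and [e], which makes
    visible that they depend only on [d], [eta] and [m]. *)
Lemma apriori : exists C e1 : R, [/\ 0 < C, 0 < e1, e1 <= 1 &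
  forall (Omega : set (R * R)) (OB : cbody Omega d) (xc : R * R)
    (HQ : contains_square Omega xc eta)
    (b : boundary_data Omega) (e : R), 0 < e < e1 ->
  forall (V : T2 -> R) (S : T3 -> R) (F F1 F2 H2 : R), bmo setT V -> bmo setT S ->
    \int[@leb2 R]_(x in Omega) V x = 0 ->
    (forall x, V x = avg b (mild Omega e (fun z => V z.1 + S z)) x) ->
    (forall z, `|S z| <= F) -> 0 <= F2 -> 0 <= H2 ->
    \int[@leb3 R]_(z in phase Omega) `|S z| <= F1 ->
    \int[@leb3 R]_(z in phase Omega) S z ^+ 2 <= F2 ^+ 2 ->
    \int[@leb2 R]_(z in Gamma_minus b) (S (curve b z.1, z.2) ^+ 2 * `|flux b z|) <= H2 ^+ 2 ->
    forall x, `|V x| <= C * (e^-1 / e `^ m%:R^-1 * F2 + e ^- 2 / e `^ m%:R^-1 * F1 + F +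
                             e^-1 / e `^ m%:R^-1 * H2)].
Proof.
(* With [k = 4 * m] scales and [q ^+ k = la * e], the loss [q ^- 4] is [la * e] to the power
   [- 1 / m]. [L] is the radius asked by [sup_bound], and [la] makes the last scale equal to
   [L * e]. *)
pose ka := escape_rate d eta; pose L := 16 / ka; pose k := (4 * m)%N; pose la := L / (2 * d).
have ka0 : 0 < ka.
  have e2 := eta0; have d2 := d0; rewrite /ka /escape_rate divr_gt0 ?mulr_gt0 ?exprn_gt0//.
  rewrite /hit_weight lt_min invr_gt0 mulr_gt0 ?pi_gt0//= divr_gt0 ?mulr_gt0//.
have L0 : 0 < L by rewrite divr_gt0.
have d2 := d0; have e2 := eta0; have la0 : 0 < la by exact: divr_gt0 L0 (mulr_gt0 (ltr0n _ 2) d2).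
pose C1 := 2 / ka * (4 / ka * (2 * L) ^+ 2 * (k.+1%:R * (384 * (d / eta) ^+ 4) * 3)).
pose C2 := 2 / ka.
pose c := (la `^ m%:R^-1)^-1; pose cH := 32 * d + 1.
exists (2 * (C1 ^+ 2 * c) + 4 * (C1 * c) + 2 * C2 + 2 + 2 * (C1 ^+ 2 * c * cH)).
exists (Num.min 1 (Num.min eta (la^-1))).
have C10 : 0 <= C1.
  by rewrite /C1; pos.
have C20 : 0 <= C2 by rewrite divr_ge0// ltW.
have c0 : 0 < c by rewrite invr_gt0 powR_gt0.
have cH0 : 0 <= cH by rewrite addr_ge0// mulr_ge0// ltW.
have cH1 : 1 <= cH by rewrite lerDr mulr_ge0// ltW.
split.
- have h1 : 0 <= C1 ^+ 2 * c by rewrite mulr_ge0 ?sqr_ge0 ?(ltW c0).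
  have h2 : 0 <= C1 * c by rewrite mulr_ge0 ?(ltW c0).
  have h3 : 0 <= C1 ^+ 2 * c * cH by apply: mulr_ge0 h1 _; exact: le_trans cH1.
  by move: h1 h2 h3; set x1 := C1 ^+ 2 * c * cH; set x2 := C1 ^+ 2 * c; set x3 := C1 * c; lra.
- by rewrite !lt_min ltr01 eta0 invr_gt0.
- by rewrite ge_min lexx.
move=> Omega OB xc HQ b e /andP[e0]; rewrite !lt_min => /and3P[e1 ee ela].
move=> V S F F1 F2 H2 bV bS V0 fixV SF F20 H20 HF1 HF2 HH2.
have Fp : 0 <= F by apply: le_trans (SF (xc, 0)).
pose U := mild Omega e (fun z => V z.1 + S z).
have bV3 := bmo_fst bV; have bS' : bmo setT (fun z => V z.1 + S z) by exact: bmoD.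
have bU : bmo setT U by exact: bmo_mild OB _ e0 _ bS'.
have pm := phase_measurable OB; have pf := phase_finite OB.
have gm := Gamma_minus_measurable OB b; have gf := Gamma_minus_finite OB b.
pose A := \int[@leb3 R]_(z in phase Omega) (V z.1 - U z) ^+ 2.
have A0 : 0 <= A by apply: Rintegral_ge0 => z _; exact: sqr_ge0.
pose al := Num.sqrt A; have al0 : 0 <= al by exact: sqrtr_ge0.
have alE : al ^+ 2 = A by exact: sqr_sqrtr.
(* [V + S - U] is controlled by [V - U] and [S]: the square of this [ga] exceeds
   [2 * al ^+ 2 + 2 * F2 ^+ 2]. *)
pose ga := 2 * al + 2 * F2.
have ga0 : 0 <= ga by rewrite addr_ge0 ?mulr_ge0.
have sub D f : bmo setT f -> bmo D f by exact: bmoS.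
have Hga : \int[@leb3 R]_(z in phase Omega) (V z.1 + S z - U z) ^+ 2 <= ga ^+ 2.
  apply: (@le_trans _ _ (2 * A + 2 * \int[@leb3 R]_(z in phase Omega) S z ^+ 2)).
    rewrite /A -(RintZ pm pf); last by apply: sub; apply: bmoX; exact: bmoB.
    rewrite -(RintZ pm pf); last by apply: sub; exact: bmoX.
    rewrite -(RintD pm pf); last 2 first.
    - by apply: bmoZ; apply: sub; apply: bmoX; exact: bmoB.
    - by apply: bmoZ; apply: sub; exact: bmoX.
    apply: (Rint_le pm pf).
    - by apply: sub; apply: bmoX; exact: bmoB.
    - by apply: bmoD; apply: bmoZ; apply: sub; apply: bmoX => //; exact: bmoB.
    move=> z _; have := sqr_ge0 (V z.1 - U z - S z); rewrite -subr_ge0 => h.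
    rewrite -subr_ge0; apply: le_trans h _.
    by apply: eq_ler; ring.
  have := mulr_ge0 al0 F20; rewrite -alE /ga => h; move: HF2.
  set I := Rintegral _ _ _ => HF2.
  have := sqr_ge0 al; have := sqr_ge0 F2.
  rewrite (_ : (2 * al + 2 * F2) ^+ 2 = 4 * al ^+ 2 + 4 * F2 ^+ 2 + 8 * (al * F2)); last by ring.
  clear - h HF2; lra.
pose q := (la * e) `^ (k%:R^-1).
have k0 : (0 < k)%N by rewrite muln_gt0.
have lae : 0 < la * e by rewrite mulr_gt0.
have lae1 : la * e <= 1 by rewrite mulrC -ler_pdivlMr// div1r ltW.
have q0 : 0 < q by exact: powR_gt0.
have qk : q ^+ k = la * e.
  by rewrite -powR_mulrn ?(ltW q0)// -powRrM mulVf ?pnatr_eq0 -?lt0n// powRr1// ltW.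
have q1 : q <= 1 by rewrite -(@ler_pXn2r _ k)// ?nnegrE ?(ltW q0)// expr1n qk.
have q4 : q ^+ 4 = la `^ m%:R^-1 * e `^ m%:R^-1.
  rewrite -powR_mulrn ?(ltW q0)// -powRrM -powRM ?(ltW la0) ?(ltW e0)//; congr (_ `^ _).
  by rewrite /k natrM; field; rewrite pnatr_eq0 -lt0n.
have r2 : 2 * d * q ^+ k = L * e.
  by rewrite qk /la; field; rewrite gt_eqF.
pose P := q ^- 2 * e^-1.
pose X := (2 * (L * e)) ^+ 2 * (k.+1%:R * (384 * (d / eta) ^+ 4 * q ^- 2 * e^-1 * (al + ga))).
(* The last scale [L * e] is at least [e] because [escape_rate] is at most 16; this uses [eta <= d],
   read off the horizontal ends of the larger square. *)
have eL : e <= 2 * d * q ^+ k.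
  rewrite r2 ler_peMl ?(ltW e0)// /L ler_pdivlMr// mul1r.
  have etad : eta <= d.
    have [_ _ _ bO] := OB.
    have p1 : Omega (xc.1 + 2 * eta, xc.2).
      by apply: HQ; rewrite /= ?subrr ?normr0 ?mulr_ge0 ?(ltW e2)// addrAC subrr add0r ger0_norm// mulr_ge0// ltW.
    have p2 : Omega (xc.1 - 2 * eta, xc.2).
      by apply: HQ; rewrite /= ?subrr ?normr0 ?mulr_ge0 ?(ltW e2)// addrAC subrr add0r normrN ger0_norm// mulr_ge0// ltW.
    move: (bO _ p1) (bO _ p2) => /= [+ _] [+ _]; rewrite !ler_norml => /andP[_ h1] /andP[h2 _]; clear - h1 h2 e2; lra.
  rewrite /ka /escape_rate ler_pdivrMr ?mulr_gt0 ?exprn_gt0//.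
  have h1 : hit_weight d eta <= 1.
    rewrite /hit_weight ge_min; apply/orP; left; rewrite invf_le1 ?mulr_gt0 ?pi_gt0//.
    have := pi_ge2 R; clear - eta0 d0 m0; lra.
  apply: (@le_trans _ _ (1 * d ^+ 2)).
    apply: ler_pM => //; [|exact: sqr_ge0|by rewrite ler_pXn2r ?nnegrE// ltW].
    rewrite /hit_weight le_min invr_ge0 mulr_ge0 ?pi_ge0//= divr_ge0 ?mulr_ge0 ?(ltW e2) ?(ltW d2)//.
  have := sqr_ge0 d; clear - eta0 d0 m0; lra.
have q01 : 0 < q <= 1 by rewrite q0.
have HX x : body_closure Omega x -> \int[@leb2 R]_(y in local_body Omega x (16 / escape_rate d eta * e)) `|V y| <= X.
  move=> cx; rewrite /X -/ka -/L -r2.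
  apply: (local_average_bound OB e0 eta0 HQ bV bS V0 al0 ga0 _ Hga cx q01 eL).
  by rewrite alE.
pose M := 2 / ka * (4 / ka * e ^- 2 * X + F).
have VM : forall x, `|V x| <= M by exact: (sup_bound OB e0 eta0 HQ bV bS SF fixV (ltW ee) HX).
have M0 : 0 <= M by apply: le_trans (VM xc).
have UM z : `|U z| <= M + F.
  apply: (mild_abs Omega e0 bS') => [|z']; first exact: addr_ge0.
  by apply: le_trans (ler_normD _ _) _; apply: lerD.
pose H1 := \int[@leb2 R]_(z in Gamma_minus b) (`|S (curve b z.1, z.2)| * `|flux b z|).
have H10 : 0 <= H1 by apply: Rintegral_ge0 => z _; rewrite mulr_ge0.
have H1H2 : H1 <= cH * H2.
  rewrite -(@ler_pXn2r _ 2)// ?nnegrE ?mulr_ge0//.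
  apply: le_trans (Gamma_minus_L1_le_L2 OB b bS) _.
  rewrite exprMn; apply: ler_pM => //.
  - by rewrite mulr_ge0// ltW.
  - by apply: Rintegral_ge0 => z _; rewrite mulr_ge0// sqr_ge0.
  by rewrite expr2; apply: le_trans (_ : cH * 1 <= _); [rewrite mulr1 lerDl|rewrite ler_wpM2l].
have F10 : 0 <= F1 by apply: le_trans HF1; apply: Rintegral_ge0.
have Hal : al ^+ 2 <= (M + F) * F1 + e * (M * H1) + e / 2 * H2 ^+ 2.
  have z1 : \int[@leb2 R]_(x in Omega) `|V x - avg b U x| = 0.
    by apply: Rint_eq0 => x _; rewrite -fixV subrr normr0.
  have z2 : \int[mu]_(t in `[0, len b[) `|V (curve b t) - avg b U (curve b t)| = 0.
    by apply: Rint_eq0 => x _; rewrite -fixV subrr normr0.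
  have bc (f : T3 -> R) : bmo setT f -> bmo (Gamma_minus b) (fun z : T2 => f (curve b z.1, z.2)).
    by move=> bf; apply: (bmo_curve b); exact: bmoS bf.
  have bfl : bmo (Gamma_minus b) (fun z => `|flux b z|).
    by apply: bmo_norm; exact: bmo_flux OB b _.
  rewrite alE; apply: le_trans (energy OB e0 bV bS z1 z2) _.
  apply: lerD; first apply: lerD.
  - apply: (@le_trans _ _ ((M + F) * \int[@leb3 R]_(z in phase Omega) `|S z|)); last first.
      by rewrite ler_wpM2l// addr_ge0.
    rewrite -(RintZ pm pf); last by apply: sub; exact: bmo_norm.
    apply: (Rint_le pm pf).
    + by apply: sub; exact: bmoM.
    + by apply: bmoZ; apply: sub; exact: bmo_norm.
    move=> z _; apply: le_trans (ler_norm _) _; rewrite normrM mulrC.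
    by rewrite ler_wpM2r.
  - rewrite ler_wpM2l ?(ltW e0)// /H1 -(RintZ gm gf); last first.
      by apply: bmoM => //; apply: (bc (fun z => `|S z|)); exact: bmo_norm.
    apply: (Rint_le gm gf).
    + apply: bmoM => //; apply: bmoM; [exact: (bc (fun z => V z.1))|exact: bc].
    + by apply: bmoZ; apply: bmoM => //; apply: (bc (fun z => `|S z|)); exact: bmo_norm.
    move=> z _; rewrite mulrA ler_wpM2r//; apply: le_trans (ler_norm _) _.
    by rewrite normrM ler_wpM2r.
  by rewrite ler_wpM2l// divr_ge0// ltW.
have E0 : 0 < e `^ m%:R^-1 by exact: powR_gt0.
have E1 : e `^ m%:R^-1 <= 1.
  have e01 : 0 < e <= 1 by rewrite e0 ltW.
  have m01 : 0 <= m%:R^-1 :> R by rewrite invr_ge0 ler0n.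
  by have := ger_powR e01 m01; rewrite powRr0.
have P2 : P ^+ 2 = c * (e ^- 2 / e `^ m%:R^-1).
  rewrite /P /c (_ : (q ^- 2 * e^-1) ^+ 2 = (q ^+ 4)^-1 * e ^- 2); last by field; rewrite !gt_eqF.
  by rewrite q4; field; rewrite !gt_eqF// powR_gt0.
have P1 : P <= c * (e^-1 / e `^ m%:R^-1).
  have -> : c * (e^-1 / e `^ m%:R^-1) = (q ^+ 4)^-1 * e^-1.
    by rewrite q4 /c; field; rewrite !gt_eqF// powR_gt0.
  rewrite /P ler_wpM2r ?invr_ge0 ?(ltW e0)// lef_pV2 ?posrE ?exprn_gt0//.
  by apply: ler_wiXn2l => //; exact: ltW.
have P0 : 0 <= P by rewrite mulr_ge0 ?invr_ge0 ?exprn_ge0 ?ltW.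
have MC : M <= C1 * P * (al + F2) + C2 * F.
  have -> : M = 2 / ka * (4 / ka * (2 * L) ^+ 2 * (k.+1%:R * (384 * (d / eta) ^+ 4))) * P * (al + ga) + C2 * F.
    by rewrite /M /X /C2 /P; field; rewrite !gt_eqF.
  rewrite lerD2r.
  have -> : C1 * P * (al + F2) = 2 / ka * (4 / ka * (2 * L) ^+ 2 * (k.+1%:R * (384 * (d / eta) ^+ 4))) * P * (3 * (al + F2)).
    by rewrite /C1; ring.
  apply: ler_wpM2l; last by rewrite /ga; clear - F20; lra.
  by pos.
move=> x; apply: le_trans (VM x) _.
have e01 : 0 < e <= 1 by rewrite e0 ltW.
have E01 : 0 < e `^ m%:R^-1 <= 1 by rewrite E0.
exact: (apriori_real e01 E01 Fp F10 F20 H10 H20 al0 P0 (ltW c0) cH0 C10 C20 MC H1H2 Hal P2 P1).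
Qed.

End apriori.

(** * Smooth approximations of half-line indicators *)

Section logistic.
Context (R : realType).

(** A smooth step of slope [n ^ 2] in the exponent; the shift by [n] sends its value at [c] itself
    to 0, so that the limit is the indicator of the open half-line. *)
Definition logistic (n : nat) (c y : R) : R := (1 + expR (n%:R - n%:R ^+ 2 * (y - c)))^-1.

Lemma logistic_itv n c y : 0 <= logistic n c y <= 1.
Proof.
have e0 := expR_gt0 (n%:R - n%:R ^+ 2 * (y - c)); rewrite /logistic; set u := expR _ in e0 *.
have h : 0 < 1 + u by rewrite addr_gt0.
by rewrite invr_ge0 (ltW h)/= invf_le1// lerDl ltW.
Qed.

Lemma is_derive_logistic n c (y : R) :
  is_derive y 1 (logistic n c) (n%:R ^+ 2 * (logistic n c y * (1 - logistic n c y))).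
Proof.
set k := n%:R ^+ 2.
have d1 : is_derive y 1 (fun z : R => n%:R - k * (z - c)) (- k).
  have h := is_deriveB (is_derive_cst (n%:R : R) y 1) (is_deriveZ k (is_deriveB (is_derive_id y 1) (is_derive_cst c y 1))).
  by apply: is_derive_eq; rewrite subr0 sub0r [_ *: _]mulr1.
have d2 : is_derive y 1 (fun z : R => expR (n%:R - k * (z - c))) (expR (n%:R - k * (y - c)) * - k).
  have h := @is_derive1_comp _ (@expR R) (fun z : R => n%:R - k * (z - c)) y _ _ (is_derive_expR (n%:R - k * (y - c))) d1.
  by apply: is_derive_eq.
have e0 := expR_gt0 (n%:R - k * (y - c)).
have h0 : 1 + expR (n%:R - k * (y - c)) != 0 by rewrite gt_eqF// addr_gt0.
have d3 := is_deriveD (is_derive_cst (1 : R) y 1) d2.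
have d4 := @is_deriveV R (cst 1 + (fun z : R => expR (n%:R - k * (z - c)))) y _ 1 h0 d3.
apply: is_derive_eq; rewrite /logistic -/k add0r /GRing.scale/=.
rewrite -[(cst 1 + _) y]/(1 + expR (n%:R - k * (y - c))).
by field; exact: h0.
Qed.

Lemma continuous_logistic n c : continuous (logistic n c).
Proof.
move=> y; apply: differentiable_continuous; apply/derivable1_diffP.
by have [] := is_derive_logistic n c y.
Qed.

Lemma measurable_logistic n c : measurable_fun setT (logistic n c : measurableTypeR R -> R).
Proof. by apply: continuous_measurable_fun; exact: continuous_logistic. Qed.

Lemma cvg_logistic c y : (logistic n c y : R) @[n --> \oo] --> (\1_(`]c, +oo[%classic) y : R).
Proof.
apply/cvgrPdist_le => /= a a0.
have expn (n : nat) : expR (- n%:R) <= n.+1%:R^-1 :> R.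
  rewrite expRN lef_pV2 ?posrE ?expR_gt0//; apply: le_trans (expR_ge1Dx _).
  by rewrite -natr1 addrC.
have key n : n.+1%:R^-1 <= a -> y <= c \/ 2 <= n%:R * (y - c) ->
    `|\1_(`]c, +oo[%classic) y - logistic n c y| <= a.
  move=> na h; rewrite /logistic; set u := n%:R - n%:R ^+ 2 * (y - c); have u0 := expR_gt0 u.
  have u1 : 0 < 1 + expR u by rewrite addr_gt0.
  apply: le_trans na; apply: le_trans (expn n).
  have [yc|yc] := ltP c y.
    case: h => [|h]; first by rewrite leNgt yc.
    rewrite indicT; last by rewrite /= in_itv/= yc.
    have -> : 1 - (1 + expR u)^-1 = expR u / (1 + expR u) by field; rewrite gt_eqF.
    rewrite ger0_norm; last by rewrite divr_ge0 ?ltW.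
    apply: (@le_trans _ _ (expR u)); first by rewrite ler_pdivrMr// ler_peMr ?lerDl// ltW.
    rewrite ler_expR /u.
    have := ler_wpM2l (ler0n R n) h; rewrite mulrA expr2; lra.
  rewrite indicN; last by rewrite /= in_itv/= andbT => h'; move: yc; rewrite leNgt h'.
  rewrite sub0r normrN ger0_norm; last by rewrite invr_ge0 ltW.
  rewrite expRN lef_pV2 ?posrE ?expR_gt0//.
  apply: ler_wpDl => //; rewrite ler_expR /u lerDl oppr_ge0.
  by rewrite mulr_ge0_le0 ?sqr_ge0// subr_le0.
have inv_near : \forall n \near \oo, n.+1%:R^-1 <= a.
  near=> n; rewrite invf_ple ?posrE//; apply: (@le_trans _ _ n%:R); last by rewrite ler_nat.
  by near: n; exact: nbhs_infty_ger.
have [yc|yc] := leP y c.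
  by near=> n; apply: key; [near: n|left].
near=> n; apply: key; first by near: n.
by right; rewrite -ler_pdivrMr ?subr_gt0//; near: n; exact: nbhs_infty_ger.
Unshelve. all: by end_near. Qed.

End logistic.

(** * Functions orthogonal to enough test factors vanish *)

Section vanishing_integrals.
Context dd (T : measurableType dd) (R : realType) (m : {measure set T -> \bar R}).
Context (E : set T) (mE : measurable E) (fE : (m E < +oo)%E).

Lemma Rint_lim0 (F : nat -> T -> R) (f : T -> R) (M : R) :
  (forall n, measurable_fun setT (F n)) -> (forall n x, E x -> `|F n x| <= M) ->
  measurable_fun setT f -> (forall x, E x -> F n x @[n --> \oo] --> f x) ->
  (forall n, \int[m]_(x in E) F n x = 0) -> \int[m]_(x in E) f x = 0.
Proof.
move=> mF FM mf Ff F0.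
have [] := @dominated_convergence _ T R m E mE (fun n => EFin \o F n) (EFin \o f) (cst M%:E).
- by move=> n; apply/measurable_EFinP; exact: measurable_funTS.
- by apply/measurable_EFinP; exact: measurable_funTS.
- by apply: aeW => x Ex; apply: cvg_EFin; [exact: nearW|exact: Ff].
- exact: (bmo_integrable mE fE (bmo_cst E M)).
- by apply: aeW => x n Ex; rewrite /= lee_fin FM.
move=> _ _; set s := (X in X @ _ --> _).
have -> : s = cst 0%E.
  apply/funext => n; rewrite /s/= -[LHS]fineK.
    by rewrite -[fine _]/(\int[m]_(x in E) F n x) F0.
  apply: integrable_fin_num => //; apply: (bmo_integrable mE fE).
  by apply: (bmo_bd (M := M)) => // x Ex; exact: FM.
move=> h; have := cvg_lim (@ereal_hausdorff R) h; rewrite lim_cst; last exact: ereal_hausdorff.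
by rewrite /Rintegral => <-.
Qed.

(** The sets for which the integral vanishes form a Dynkin class; a countable disjoint union is a
    dominated limit of finite ones. *)
Lemma vanish_measurable dx (X : measurableType dx) (Z : T -> X) (G : set (set X)) (D : T -> R) :
  measurable_fun setT Z -> @measurable _ X = <<s G >> -> setI_closed G -> bmo E D ->
  \int[m]_(x in E) D x = 0 ->
  (forall A, G A -> \int[m]_(x in E) (D x * \1_A (Z x)) = 0) ->
  forall A, measurable A -> \int[m]_(x in E) (D x * \1_A (Z x)) = 0.
Proof.
move=> mZ GE GI bD D0 DG A; rewrite [in X in X -> _]GE; move: A.
have bI A : measurable A -> bmo E (fun x => D x * \1_A (Z x)).
  move=> mA; apply: bmoM => //.
  by apply: (bmo_comp (@bmo_indic _ X R setT A mA) mZ).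
apply: (dynkin_induction (P := fun A => \int[m]_(x in E) (D x * \1_A (Z x)) = 0) GE GI) => //.
- rewrite -[RHS]D0; apply: eq_Rintegral => x _; rewrite (indicT R (A := setT))// ?mulr1//.
- move=> S mS S0; transitivity (\int[m]_(x in E) D x - \int[m]_(x in E) (D x * \1_S (Z x))); last by rewrite D0 S0 subrr.
  rewrite -(RintB mE fE)//; last exact: bI.
  apply: eq_Rintegral => x _; have [h|h] := pselect (S (Z x)).
    by rewrite (indicT R h) indicN ?mulr0 ?mulr1 ?subrr.
  by rewrite (indicN R h) indicT// mulr0 mulr1 subr0.
move=> F mF tF F0.
pose B n : set X := \bigcup_(k in [set k | (k < n)%N]) F k.
have mB n : measurable (B n) by apply: bigcup_measurable => k _; exact: mF.
have B0 n : \int[m]_(x in E) (D x * \1_(B n) (Z x)) = 0.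
  elim: n => [|n IH].
    by apply: Rint_eq0 => x _; rewrite indicN ?mulr0// => -[].
  transitivity (\int[m]_(x in E) (D x * \1_(B n) (Z x)) + \int[m]_(x in E) (D x * \1_(F n) (Z x))).
    2: by rewrite IH F0 addr0.
  rewrite -(RintD mE fE); [|exact: bI..].
  apply: eq_Rintegral => x _; rewrite -mulrDr; congr (_ * _).
  have [Fn|Fn] := pselect (F n (Z x)).
    rewrite (indicT R Fn) indicT; last by exists n => /=.
    rewrite indicN ?add0r// => -[k /= kn Fk].
    have /trivIsetP/(_ n k I I) := tF; rewrite (gtn_eqF kn) => /(_ isT).
    by move/seteqP => [h _]; exact: (h (Z x)).
  rewrite (indicN R Fn) addr0; have [[k /= kn Fk]|nB] := pselect (B n (Z x)).
    rewrite indicT; last by exists k => //=; exact: ltnW.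
    by rewrite indicT//; exists k.
  rewrite (indicN R nB) indicN// => -[k /=]; rewrite ltnS leq_eqVlt => /predU1P[->//|kn Fk].
  by apply: nB; exists k.
have [M DM] := bD.2.
apply: (Rint_lim0 (F := fun n x => D x * \1_(B n) (Z x)) (M := M)) => //.
- by move=> n; exact: (bI _ (mB n)).1.
- move=> n x Ex; rewrite normrM; apply: le_trans (DM _ Ex).
  by rewrite ler_piMr// norm_indic_le1.
- by apply: (bI _ _).1; exact: bigcup_measurable.
move=> x Ex; apply: cvgM; first exact: cvg_cst.
have [[k _ Fk]|nF] := pselect ((\bigcup_k F k) (Z x)).
  rewrite [X in _ --> X]indicT; last by exists k.
  apply: cvg_near_cst; near=> n; rewrite indicT//; exists k => //=.
  by near: n; exists k.+1.
rewrite (indicN R nF); apply: cvg_near_cst; near=> n; rewrite indicN// => -[k _ Fk].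
by apply: nF; exists k.
Unshelve. all: by end_near. Qed.

Lemma vanish_coordinate (Z : T -> R) (D : T -> R) : measurable_fun setT Z -> bmo E D ->
  \int[m]_(x in E) D x = 0 ->
  (forall n c, \int[m]_(x in E) (D x * logistic n c (Z x)) = 0) ->
  forall A : set (measurableTypeR R), measurable A -> \int[m]_(x in E) (D x * \1_A (Z x)) = 0.
Proof.
move=> mZ bD D0 Dl.
have [M DM] := bD.2.
apply: (vanish_measurable (X := measurableTypeR R) mZ (RGenOInfty.measurableE R)) => //.
  move=> _ _ [a ->] [c ->]; exists (Num.max a c); apply/seteqP; split => y /=.
    by rewrite !in_itv/= !andbT => -[h1 h2]; rewrite gt_max h1.
  by rewrite !in_itv/= !andbT gt_max => /andP[].
move=> _ [c ->].
apply: (Rint_lim0 (F := fun n x => D x * logistic n c (Z x)) (M := M)) => //.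
- by move=> n; apply: measurable_funM; [exact: bD.1|exact: measurableT_comp (measurable_logistic n c) mZ].
- move=> n x Ex; rewrite normrM; apply: le_trans (DM _ Ex); have /andP[h1 h2] := logistic_itv n c (Z x).
  by rewrite ler_piMr// ger0_norm.
- apply: measurable_funM; [exact: bD.1|].
  by apply: (measurableT_comp (measurable_indic (measurable_itv _)) mZ).
by move=> x Ex; apply: cvgM; [exact: cvg_cst|exact: cvg_logistic].
Qed.

(* [None] stands for the constant 1. *)
Definition gate (o : option (nat * R)) (y : R) : R :=
  if o is Some nc then logistic nc.1 nc.2 y else 1.

Lemma bmo_gate o (Z : T -> R) D : measurable_fun setT Z -> bmo D (fun x => gate o (Z x)).
Proof.
case: o => [[n c]|] mZ /=; last exact: bmo_cst.
apply: (bmo_bd (M := 1)); first exact: (measurableT_comp (measurable_logistic n c) mZ).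
by move=> x _; have /andP[h1 h2] := logistic_itv n c (Z x); rewrite ger0_norm.
Qed.

Lemma vanish_gate (Z : T -> R) (D : T -> R) : measurable_fun setT Z -> bmo E D ->
  (forall o, \int[m]_(x in E) (D x * gate o (Z x)) = 0) ->
  forall A : set (measurableTypeR R), measurable A -> \int[m]_(x in E) (D x * \1_A (Z x)) = 0.
Proof.
move=> mZ bD Dg; apply: (vanish_coordinate mZ bD) => [|n c]; last exact: (Dg (Some (n, c))).
by rewrite -[RHS](Dg None); apply: eq_Rintegral => x _; rewrite mulr1.
Qed.

Lemma vanish_pair dx dy (X : measurableType dx) (Y : measurableType dy) (Z : T -> X) (W : T -> Y)
    (D : T -> R) : measurable_fun setT Z -> measurable_fun setT W -> bmo E D ->
  (forall A B, measurable A -> measurable B -> \int[m]_(x in E) (D x * \1_A (Z x) * \1_B (W x)) = 0) ->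
  forall A : set (X * Y), measurable A -> \int[m]_(x in E) (D x * \1_A (Z x, W x)) = 0.
Proof.
move=> mZ mW bD DAB.
pose G := [set A `*` B | A in @measurable _ X & B in @measurable _ Y].
apply: (vanish_measurable (X := (X * Y)%type) (Z := fun x => (Z x, W x)) (G := G)) => //.
- exact: measurable_fun_pair.
- exact: measurable_prod_measurableType.
- move=> _ _ [A mA [B mB <-]] [A' mA' [B' mB' <-]]; exists (A `&` A'); first exact: measurableI.
  by exists (B `&` B'); [exact: measurableI|rewrite setXI].
- rewrite -[RHS](DAB setT setT measurableT measurableT); apply: eq_Rintegral => x _.
  by rewrite !(indicT R (A := setT))// !mulr1.
move=> _ [A mA [B mB <-]]; rewrite -[RHS](DAB A B mA mB); apply: eq_Rintegral => x _.
rewrite -mulrA; congr (_ * _); have [Ax|Ax] := pselect (A (Z x)); last first.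
  by rewrite (indicN R Ax) mul0r indicN// => -[].
have [Bx|Bx] := pselect (B (W x)); last by rewrite (indicN R Bx) mulr0 indicN// => -[].
by rewrite (indicT R Ax) (indicT R Bx) mulr1 indicT.
Qed.

Lemma Rint_norm_eq0 (D : T -> R) : bmo E D ->
  (forall A, measurable A -> \int[m]_(x in E) (D x * \1_A x) = 0) ->
  \int[m]_(x in E) `|D x| = 0.
Proof.
move=> bD DA; pose P := [set x | 0 <= D x].
have mP : measurable P by apply: measurable_le_set => //; exact: bD.1.
have bI A : measurable A -> bmo E (fun x => D x * \1_A x).
  by move=> mA; apply: bmoM => //; exact: bmo_indic.
transitivity (\int[m]_(x in E) (D x * \1_P x) - \int[m]_(x in E) (D x * \1_(~` P) x)).
  2: by rewrite !DA ?subrr//; exact: measurableC.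
rewrite -(RintB mE fE); [|exact: bI|by apply: bI; exact: measurableC].
apply: eq_Rintegral => x _; have [Px|Px] := pselect (P x).
  by rewrite (indicT R Px) indicN ?mulr0 ?mulr1 ?subr0// ger0_norm.
rewrite (indicN R Px) indicT// mulr0 mulr1 sub0r ltr0_norm// ltNge.
exact/negP.
Qed.

End vanishing_integrals.

(** * Orthogonality to products of gates on lines *)

Section vanishing_on_phase_space.
Context (R : realType).
Notation T1 := (measurableTypeR R).
Notation T3 := (T1 * T1 * T1)%type.
Notation mu := (@lebesgue_measure R).
Context (E : set T3) (mE : measurable E) (fE : (@leb3 R E < +oo)%E).
Context (Ea : forall z, E z -> angles z.1.1).

(* On [0, 2 pi[ the half-lines are Boolean combinations of cosine and sine half-lines. *)
Lemma angle_ray c : exists A1 B1 B2 A3 : set T1,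
  [/\ measurable A1, measurable B1, measurable A3 & measurable B2] /\ forall theta, angles theta ->
  \1_(`]c, +oo[%classic) theta =
  \1_A1 (cos theta) * \1_B1 (sin theta) + \1_A3 (cos theta) * \1_B2 (sin theta) :> R.
Proof.
have p0 := pi_gt0 R.
have sp (theta : R) : pi < theta -> theta < 2 * pi -> sin theta < 0 /\ cos theta = - cos (theta - pi).
  move=> h1 h2; have e : theta = theta - pi + pi by rewrite subrK.
  rewrite e sinDpi cosDpi addrK; split => //; rewrite oppr_lt0 sin_gt0_pi//.
  by apply/andP; split; lra.
have s0 (theta : R) : 0 <= theta -> theta <= pi -> 0 <= sin theta by move=> h1 h2; apply: sin_ge0_pi; apply/andP.
have [c0|c0] := ltP c 0.
  exists setT, setT, set0, set0; split => // theta; rewrite /angles/= in_itv/= => /andP[t0 t1].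
  rewrite indicT/=; last by rewrite in_itv/= andbT; lra.
  by rewrite ![in RHS](indicT R (A := setT))// !(indicN R (A := set0))// mulr1 mul0r addr0.
have [c1|c1] := leP (2 * pi) c.
  exists set0, set0, set0, set0; split => // theta; rewrite /angles/= in_itv/= => /andP[t0 t1].
  rewrite indicN/=; last by rewrite in_itv/= andbT; apply/negP; lra.
  by rewrite !(indicN R (A := set0))// mul0r addr0.
(* For [c <= pi]: cosine below [cos c] on the upper half circle, together with the whole lower half.
   For [c > pi]: cosine above [cos c] on the lower half. *)
have [cp|cp] := leP c pi.
  exists `]-oo, cos c[%classic, `[0, +oo[%classic, `]-oo, 0[%classic, setT.
  split; first by split => //; exact: measurable_itv.
  move=> theta; rewrite /angles/= in_itv/= => /andP[t0 t1].
  rewrite (indicT R (A := setT))// mul1r.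
  have [tp|tp] := leP theta pi.
    have st := s0 _ t0 tp.
    rewrite [X in _ * X + _]indicT/=; last by rewrite in_itv/= st.
    rewrite [X in _ + X]indicN/=; last by rewrite in_itv/= ltNge st.
    rewrite mulr1 addr0 !indicE; congr (nat_of_bool _)%:R.
    apply/idP/idP; rewrite !inE/= !in_itv/= ?andbT.
      by move=> h; rewrite ltr_cos// in_itv/= ?t0 ?c0.
    by rewrite ltr_cos// in_itv/= ?t0 ?c0.
  have [st _] := sp _ tp t1.
  rewrite [X in _ * X + _]indicN/=; last by rewrite in_itv/= andbT leNgt st.
  rewrite [X in _ + X]indicT/=; last by rewrite in_itv/= st.
  by rewrite indicT/= ?mulr0 ?add0r// in_itv/= andbT; lra.
exists `]cos c, +oo[%classic, `]-oo, 0[%classic, set0, set0.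
split; first by split => //; exact: measurable_itv.
move=> theta; rewrite /angles/= in_itv/= => /andP[t0 t1].
rewrite !(indicN R (A := set0))// mul0r addr0.
have [tp|tp] := leP theta pi.
  have st := s0 _ t0 tp.
  rewrite indicN/=; last by rewrite in_itv/= andbT; apply/negP; lra.
  by rewrite [X in _ * X]indicN/= ?mulr0// in_itv/= ltNge st.
have [st ct] := sp _ tp t1; have [_ cc] := sp _ cp c1.
rewrite [X in _ * X]indicT/= ?mulr1; last by rewrite in_itv/= st.
rewrite !indicE; congr (nat_of_bool _)%:R.
have e : (cos c < cos theta) = (c < theta).
  rewrite ct cc ltrN2 ltr_cos ?in_itv/=; last 2 first.
  - by apply/andP; split; lra.
  - by apply/andP; split; lra.
  by rewrite ltrD2r.
by apply/idP/idP; rewrite !inE/= !in_itv/= ?andbT e.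
Qed.

(** Gates are exchanged one coordinate at a time for indicators of Borel sets. Indicators in the
    cosine and the sine then combine into indicators in the angle, and boxes generate the product
    sigma-algebra. *)
Lemma vanish_phase (D : T3 -> R) : bmo E D ->
  (forall o1 o2 o3 o4, \int[@leb3 R]_(z in E) (D z *
     gate o1 (cos z.1.1) * gate o2 (sin z.1.1) * gate o3 z.1.2 * gate o4 z.2) = 0) ->
  \int[@leb3 R]_(z in E) `|D z| = 0.
Proof.
move=> bD Dg.
have mth : measurable_fun setT (fun z : T3 => z.1.1) by mfun.
have mp : measurable_fun setT (fun z : T3 => z.1.2) by mfun.
have ms : measurable_fun setT (fun z : T3 => z.2) by mfun.
have mc : measurable_fun setT (fun z : T3 => cos z.1.1 : R) by mfun.
have msn : measurable_fun setT (fun z : T3 => sin z.1.1 : R) by mfun.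
have bg o (Z : T3 -> R) : measurable_fun setT Z -> bmo E (fun z => gate o (Z z)).
  by move=> mZ; exact: bmo_gate.
have bi (A : set T1) (Z : T3 -> R) : measurable A -> measurable_fun setT Z -> bmo E (fun z => \1_A (Z z) : R).
  by move=> mA mZ; apply: (bmo_comp (@bmo_indic _ T1 R setT A mA) mZ).
have h4 o1 o2 o3 (S : set T1) : measurable S -> \int[@leb3 R]_(z in E) (D z *
     gate o1 (cos z.1.1) * gate o2 (sin z.1.1) * gate o3 z.1.2 * \1_S z.2) = 0.
  move: S; apply: (vanish_gate mE fE (Z := fun z : T3 => z.2)) => //.
  by apply: bmoM; [apply: bmoM; [exact: bmoM (bg _ _ mc)|exact: bg]|exact: bg].
have h3 o1 o2 (C S : set T1) : measurable C -> measurable S -> \int[@leb3 R]_(z in E) (D z *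
     gate o1 (cos z.1.1) * gate o2 (sin z.1.1) * \1_S z.2 * \1_C z.1.2) = 0.
  move=> + mS; move: C; apply: (vanish_gate mE fE (Z := fun z : T3 => z.1.2)) => //.
    by apply: bmoM; [apply: bmoM; [exact: bmoM (bg _ _ mc)|exact: bg]|exact: bi].
  by move=> o; rewrite -[RHS](h4 o1 o2 o S mS); apply: eq_Rintegral => z _; rewrite mulrAC.
have h2 o1 (B C S : set T1) : measurable B -> measurable C -> measurable S ->
   \int[@leb3 R]_(z in E) (D z * \1_C z.1.2 * \1_S z.2 * gate o1 (cos z.1.1) * \1_B (sin z.1.1)) = 0.
  move=> + mC mS; move: B; apply: (vanish_gate mE fE (Z := fun z : T3 => sin z.1.1)) => //.
    by apply: bmoM; [apply: bmoM; [apply: bmoM => //; exact: bi|exact: bi]|exact: bg].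
  by move=> o; rewrite -[RHS](h3 o1 o C S mC mS); apply: eq_Rintegral => z _; ring.
have h1 (A B C S : set T1) : measurable A -> measurable B -> measurable C -> measurable S ->
   \int[@leb3 R]_(z in E) (D z * \1_C z.1.2 * \1_S z.2 * \1_B (sin z.1.1) * \1_A (cos z.1.1)) = 0.
  move=> + mB mC mS; move: A; apply: (vanish_gate mE fE (Z := fun z : T3 => cos z.1.1)) => //.
    by apply: bmoM; [apply: bmoM; [apply: bmoM => //; exact: bi|exact: bi]|exact: bi].
  by move=> o; rewrite -[RHS](h2 o B C S mB mC mS); apply: eq_Rintegral => z _; rewrite mulrAC.
have h0 (A C S : set T1) : measurable A -> measurable C -> measurable S ->
   \int[@leb3 R]_(z in E) (D z * \1_C z.1.2 * \1_S z.2 * \1_A z.1.1) = 0.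
  move=> + mC mS; move: A.
  have bDCS : bmo E (fun z => D z * \1_C z.1.2 * \1_S z.2) by apply: bmoM; [apply: bmoM => //; exact: bi|exact: bi].
  apply: (vanish_measurable mE fE (X := T1) mth (RGenOInfty.measurableE R)) => //.
  - move=> _ _ [a ->] [c ->]; exists (Num.max a c); apply/seteqP; split => y /=.
      by rewrite !in_itv/= !andbT => -[k1 k2]; rewrite gt_max k1.
    by rewrite !in_itv/= !andbT gt_max => /andP[].
  - rewrite -[RHS](h1 setT setT C S measurableT measurableT mC mS); apply: eq_Rintegral => z _.
    by rewrite !(indicT R (A := setT))// !mulr1.
  move=> _ [c ->]; have [A1 [B1 [B2 [A3 [[mA1 mB1 mA3 mB2] AE]]]]] := angle_ray c.
  transitivity (\int[@leb3 R]_(z in E) (D z * \1_C z.1.2 * \1_S z.2 * \1_B1 (sin z.1.1) * \1_A1 (cos z.1.1)) +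
    \int[@leb3 R]_(z in E) (D z * \1_C z.1.2 * \1_S z.2 * \1_B2 (sin z.1.1) * \1_A3 (cos z.1.1))).
    2: by rewrite !h1// addr0.
  rewrite -(RintD mE fE).
  - by apply: eq_Rintegral => z /set_mem Ez; rewrite (AE _ (Ea Ez)); ring.
  - by do 2! (apply: bmoM; last exact: bi).
  - by do 2! (apply: bmoM; last exact: bi).
apply: (Rint_norm_eq0 mE fE bD) => A mA.
have key := vanish_pair mE fE (X := (T1 * T1)%type) (Y := T1) (Z := fst) (W := snd) measurable_fst measurable_snd bD.
transitivity (\int[@leb3 R]_(z in E) (D z * \1_A (z.1, z.2))).
  by apply: eq_Rintegral => -[].
apply: key mA => {A} A S mA mS.
have bDS : bmo E (fun z => D z * \1_S z.2) by apply: bmoM => //; exact: bi.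
have key := vanish_pair mE fE (X := T1) (Y := T1) (Z := fun z : T3 => z.1.1) (W := fun z : T3 => z.1.2) mth mp bDS.
transitivity (\int[@leb3 R]_(z in E) (D z * \1_S z.2 * \1_A (z.1.1, z.1.2))).
  by apply: eq_Rintegral => -[[a b] c] _; rewrite mulrAC.
apply: key mA => A' C mA' mC.
by rewrite -[RHS](h0 A' C S mA' mC mS); apply: eq_Rintegral => z _; ring.
Qed.

End vanishing_on_phase_space.

(** * Regularity of test functions from their directional derivatives *)

Section C1_tests.
Context (R : realType).
Notation E2 := (R * R)%type.
Notation E4 := (E2 * E2)%type.
Implicit Types (phi : E4 -> R) (p v y : E4).

Lemma derive_line phi p v (t : R) : derivable phi (t *: v + p) v ->
  is_derive t 1 (fun s : R => phi (s *: v + p)) ('D_v phi (t *: v + p)).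
Proof.
move=> d; pose F (s : R) := phi (s *: v + p).
have E : (fun h : R => h^-1 *: (F (h *: 1 + t) - F t)) =
    (fun h : R => h^-1 *: (phi (h *: v + (t *: v + p)) - phi (t *: v + p))).
  apply/funext => h; rewrite /F; congr (_ *: (phi _ - _)).
  by rewrite [h *: 1]mulr1 scalerDl addrA.
by split; [rewrite /derivable; under eq_fun do rewrite -/(F _); rewrite E|rewrite /derive E].
Qed.

Lemma test_mvt phi p v (h : R) : C1_test phi -> exists t, `|t| <= `|h| /\
  phi (h *: v + p) - phi p = h * 'D_v phi (t *: v + p).
Proof.
move=> /(_ v)[d _].
pose F (s : R) := phi (s *: v + p); pose G (s : R) := 'D_v phi (s *: v + p).
have dF (s : R) : is_derive s 1 F (G s) by exact: derive_line.
have cF : continuous F.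
  by move=> s; apply: differentiable_continuous; apply/derivable1_diffP; have [] := dF s.
have F0 : F 0 = phi p by rewrite /F scale0r add0r.
have [h0|h0] := leP 0 h.
  have [t] := MVT_segment h0 (fun s _ => dF s) (continuous_subspaceT cF).
  rewrite in_itv/= => /andP[t0 t1] E; exists t; split; first by rewrite !ger0_norm// (le_trans t0).
  by rewrite -F0 -/(F h) E subr0 mulrC.
have [t] := MVT_segment (ltW h0) (fun s _ => dF s) (continuous_subspaceT cF).
rewrite in_itv/= => /andP[t0 t1] E; exists t; split.
  by rewrite (ltr0_norm h0) ler0_norm// lerN2.
by rewrite -F0 -/(F h) -opprB E sub0r mulrN opprK mulrC.
Qed.

Definition e1 : E4 := ((1, 0), (0, 0)).
Definition e2 : E4 := ((0, 1), (0, 0)).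
Definition e3 : E4 := ((0, 0), (1, 0)).
Definition e4 : E4 := ((0, 0), (0, 1)).

Lemma test_increment phi p v : C1_test phi -> exists M r, [/\ 0 < r, 0 <= M &
  forall q (s : R), `|p - q| < r -> `|s *: v| < r -> `|phi (s *: v + q) - phi q| <= M * `|s|].
Proof.
move=> tp; have cD : continuous (fun q => 'D_v phi q) by have [] := tp v.
have /cvgrPdist_le/(_ _ ltr01)/nbhs_normP[r r0 H] := cD p.
have r2 : 0 < r / 2 by rewrite divr_gt0.
exists (1 + `|'D_v phi p|), (r / 2); split => // q s pq sv.
have [t [ts ->]] := test_mvt q v s tp; rewrite normrM mulrC ler_wpM2r//.
have : `|'D_v phi p - 'D_v phi (t *: v + q)| <= 1.
  apply: H; rewrite /ball_/= opprD addrCA addrC; apply: le_lt_trans (ler_normB _ _) _.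
  have : `|t *: v| <= `|s *: v| by rewrite !normrZ ler_wpM2r.
  by move: pq sv; lra.
have := ler_normB ('D_v phi p) ('D_v phi p - 'D_v phi (t *: v + q)); rewrite subKr; lra.
Qed.

Lemma prod_normrE (U W : normedModType R) (z : U * W) : `|z| = Num.max `|z.1| `|z.2|.
Proof. by []. Qed.

Lemma norm4 (a1 a2 a3 a4 : R) (y : E4) : y = ((a1, a2), (a3, a4)) ->
  [/\ `|a1 *: e1| <= `|y|, `|a2 *: e2| <= `|y|, `|a3 *: e3| <= `|y| & `|a4 *: e4| <= `|y|] /\
  [/\ `|a1| <= `|y|, `|a2| <= `|y|, `|a3| <= `|y| & `|a4| <= `|y|].
Proof.
move=> ->; rewrite !prod_normrE/= /GRing.scale/= !mulr0 !mulr1 !normr0.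
by split; split; rewrite ?ge_max ?le_max ?lexx ?normr_ge0 ?orbT.
Qed.

Lemma coordinatesE (y p : E4) :
  y + p = y.2.2 *: e4 + (y.2.1 *: e3 + (y.1.2 *: e2 + (y.1.1 *: e1 + p))).
Proof.
case: y p => [[y1 y2] [y3 y4]] [[p1 p2] [p3 p4]].
by congr pair; congr pair; rewrite /= /GRing.scale/=; ring.
Qed.

(** [C1_test] provides directional derivatives, each continuous in the base point. Continuity of
    [phi] is recovered by moving one coordinate at a time, with the mean value theorem bounding each
    move. *)
Lemma continuous_test phi : C1_test phi -> continuous phi.
Proof.
move=> tp p.
have [M1 [r1 [r10 M10 H1]]] := test_increment p e1 tp.
have [M2 [r2 [r20 M20 H2]]] := test_increment p e2 tp.
have [M3 [r3 [r30 M30 H3]]] := test_increment p e3 tp.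
have [M4 [r4 [r40 M40 H4]]] := test_increment p e4 tp.
pose M := M1 + M2 + M3 + M4 + 1; have M0 : 0 < M by rewrite /M; lra.
apply/cvgrPdist_le => a a0.
pose r := Num.min (Num.min r1 r2) (Num.min (Num.min r3 r4) (a / M)).
have rp : 0 < r / 3 by rewrite divr_gt0// !lt_min r10 r20 r30 r40 divr_gt0.
apply: (@nbhs_normP R (E4 : normedModType R) p (fun y => `|phi p - phi y| <= a)).2.
exists (r / 3) => // y; rewrite /ball_/= => py.
have yr : 3 * `|y - p| < r by rewrite distrC; move: py; lra.
have [R1 R2 R3 R4 Ra] : [/\ r <= r1, r <= r2, r <= r3, r <= r4 & r <= a / M].
  by split; rewrite /r !ge_min lexx ?orbT.
set n := `|y - p| in yr; have n0 : 0 <= n by exact: normr_ge0.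
pose d := y - p; have dE : d = ((d.1.1, d.1.2), (d.2.1, d.2.2)) by rewrite -!surjective_pairing.
have [[n1 n2 n3 n4] [m1 m2 m3 m4]] := norm4 dE; rewrite -/n in n1 n2 n3 n4 m1 m2 m3 m4.
pose q1 := d.1.1 *: e1 + p; pose q2 := d.1.2 *: e2 + q1; pose q3 := d.2.1 *: e3 + q2.
have yE : y = d.2.2 *: e4 + q3 by rewrite -coordinatesE subrK.
have p1 : `|p - q1| <= n by rewrite /q1 opprD addrCA subrr addr0 normrN.
have p2 : `|p - q2| <= 2 * n.
  rewrite /q2 opprD addrCA; apply: le_trans (ler_normD _ _) _; rewrite normrN; clear - n1 n2 n3 n4 m1 m2 m3 m4 p1; lra.
have p3 : `|p - q3| <= 3 * n.
  rewrite /q3 opprD addrCA; apply: le_trans (ler_normD _ _) _; rewrite normrN; clear - n1 n2 n3 n4 m1 m2 m3 m4 p2; lra.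
have sm (u ri : R) : u <= 3 * n -> r <= ri -> u < ri.
  by move=> h1 h2; apply: le_lt_trans h1 _; exact: lt_le_trans h2.
have n3' : n <= 3 * n by rewrite ler_peMl// ler1n.
have p2' : 2 * n <= 3 * n by rewrite ler_wpM2r// ler_nat.
have i1 : `|phi q1 - phi p| <= M1 * `|d.1.1|.
  by apply: H1 (sm _ _ _ R1) (sm _ _ (le_trans n1 n3') R1); rewrite subrr normr0 mulr_ge0.
have i2 := H2 _ _ (sm _ _ (le_trans p1 n3') R2) (sm _ _ (le_trans n2 n3') R2).
have i3 := H3 _ _ (sm _ _ (le_trans p2 p2') R3) (sm _ _ (le_trans n3 n3') R3).
have i4 := H4 _ _ (sm _ _ p3 R4) (sm _ _ (le_trans n4 n3') R4).
rewrite -yE in i4; rewrite -/q2 in i2; rewrite -/q3 in i3.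
have b1 := ler_wpM2l M10 m1; have b2 := ler_wpM2l M20 m2.
have b3 := ler_wpM2l M30 m3; have b4 := ler_wpM2l M40 m4.
rewrite distrC (_ : phi y - phi p = (phi y - phi q3) + ((phi q3 - phi q2) + ((phi q2 - phi q1) + (phi q1 - phi p)))); last by ring.
have tri (x1 x2 x3 x4 : R) : `|x1 + (x2 + (x3 + x4))| <= `|x1| + `|x2| + `|x3| + `|x4|.
  rewrite -!addrA; apply: le_trans (ler_normD _ _) _; rewrite lerD2l.
  by apply: le_trans (ler_normD _ _) _; rewrite lerD2l; exact: ler_normD.
apply: le_trans (tri _ _ _ _) _.
have : n <= a / M by apply: le_trans n3' (le_trans (ltW yr) Ra).
rewrite ler_pdivlMr// /M => h.
have : n * (M1 + M2 + M3 + M4 + 1) = M1 * n + M2 * n + M3 * n + M4 * n + n by ring.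
have fin (x1 x2 x3 x4 y1 y2 y3 y4 K1 K2 K3 K4 : R) : x1 <= y1 -> x2 <= y2 -> x3 <= y3 -> x4 <= y4 ->
    y1 <= K1 -> y2 <= K2 -> y3 <= K3 -> y4 <= K4 ->
    x4 + x3 + x2 + x1 <= K1 + K2 + K3 + K4 by clear; move=> *; lra.
move=> E; apply: le_trans (fin _ _ _ _ _ _ _ _ _ _ _ _ i1 i2 i3 i4 b1 b2 b3 b4) _.
by apply: le_trans h; rewrite E lerDl.
Qed.

(** Linearity in the direction is not part of [C1_test]; it follows from a two-step path parallel to
    the axes and the continuity of the two partial derivatives. *)
Lemma derive_sum_directions phi p (a1 a2 : R) : C1_test phi ->
  'D_(((a1, a2), (0, 0)) : E4) phi p = a1 * 'D_e1 phi p + a2 * 'D_e2 phi p.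
Proof.
move=> tp; pose v : E4 := ((a1, a2), (0, 0)).
apply: cvg_lim => //; apply/cvgrPdist_le => a a0.
pose K := `|a1| + `|a2| + 1; have K0 : 0 < K by rewrite ltr_wpDl// addr_ge0.
have aK : 0 < a / K by rewrite divr_gt0.
have c1 : continuous (fun q => 'D_e1 phi q) by have [] := tp e1.
have c2 : continuous (fun q => 'D_e2 phi q) by have [] := tp e2.
have /cvgrPdist_le/(_ _ aK)/nbhs_normP[r1 r10 H1] := c1 p.
have /cvgrPdist_le/(_ _ aK)/nbhs_normP[r2 r20 H2] := c2 p.
pose r := Num.min r1 r2; have r0 : 0 < r / K by rewrite divr_gt0// lt_min r10.
near=> h.
have h0 : h != 0 by near: h; exact: nbhs_dnbhs_neq.
have hr : `|h| < r / K.
  near: h; apply/nbhs_normP.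
  by exists (r / K) => // h /=; rewrite sub0r normrN => ? _.
pose q := (h * a1) *: e1 + p.
have [t1 [T1 E1]] := test_mvt p e1 (h * a1) tp.
have [t2 [T2 E2]] := test_mvt q e2 (h * a2) tp.
rewrite [(phi \o shift p) _]/=; have -> : h *: (((a1, a2), (0, 0)) : E4) + p = (h * a2) *: e2 + q.
  rewrite /q /e1 /e2; case: (p) => [[p1 p2] [p3 p4]].
  by congr pair; congr pair; rewrite /= /GRing.scale/=; ring.
rewrite (_ : phi _ - phi p = (phi ((h * a2) *: e2 + q) - phi q) + (phi q - phi p)); last by ring.
rewrite E2 E1 /GRing.scale/=.
have -> : h^-1 * (h * a2 * 'D_e2 phi (t2 *: e2 + q) + h * a1 * 'D_e1 phi (t1 *: e1 + p)) =
    a2 * 'D_e2 phi (t2 *: e2 + q) + a1 * 'D_e1 phi (t1 *: e1 + p).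
  by field.
have n1 : `|e1| = 1 by rewrite !prod_normrE/= normr0 normr1 /Order.max !(ltxx, ltr01, ltr10).
have n2 : `|e2| = 1 by rewrite !prod_normrE/= normr0 normr1 /Order.max !(ltxx, ltr01, ltr10).
have k0 := ltW K0; have hK : `|h| * K < r by rewrite -ltr_pdivlMr.
have ha : `|h| * `|a1| + `|h| * `|a2| <= `|h| * K.
  by rewrite -mulrDr ler_wpM2l// /K lerDl.
have hr12 : r <= r1 /\ r <= r2 by rewrite /r !ge_min !lexx orbT.
have d1 : `|'D_e1 phi p - 'D_e1 phi (t1 *: e1 + p)| <= a / K.
  apply: H1; rewrite /ball_/= opprD addrCA subrr addr0 normrN normrZ n1 mulr1.
  have := normr_ge0 (h * a2); rewrite !normrM in T1 *; move: T1 hr12 ha hK; clear; move=> ? [? ?] ? ? ?; lra.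
have d2 : `|'D_e2 phi p - 'D_e2 phi (t2 *: e2 + q)| <= a / K.
  apply: H2; rewrite /ball_/= /q opprD opprD addrCA [X in _ + X]addrCA subrr addr0.
  apply: le_lt_trans (ler_normD _ _) _; rewrite !normrN !normrZ n1 n2 !mulr1.
  rewrite !normrM in T2 *; move: T2 hr12 ha hK; clear; move=> ? [? ?] ? ?; lra.
have re (x1 x2 y1 y2 : R) : a1 * x1 + a2 * x2 - (a2 * y2 + a1 * y1) = a1 * (x1 - y1) + a2 * (x2 - y2) by ring.
rewrite re; apply: le_trans (ler_normD _ _) _; rewrite !normrM.
apply: (@le_trans _ _ (`|a1| * (a / K) + `|a2| * (a / K))); first by apply: lerD; apply: ler_wpM2l.
rewrite -mulrDl mulrA ler_pdivrMr// mulrC ler_wpM2l ?(ltW a0)// /K lerDl//.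
Unshelve. all: by end_near. Qed.

Lemma continuous_bounded_box (g : E4 -> R) (d : R) : continuous g ->
  exists M, forall p, `|p.1.1| <= d -> `|p.1.2| <= d -> `|p.2.1| <= 1 -> `|p.2.2| <= 1 -> `|g p| <= M.
Proof.
move=> cg; pose I (a : R) := `[- a, a]%classic.
have cK : compact ((I d `*` I d) `*` (I 1 `*` I 1)).
  by apply: compact_setX; apply: compact_setX; exact: segment_compact.
have := continuous_compact (continuous_subspaceT cg) cK => /compact_bounded[M [_ H]].
exists (M + 1) => p h1 h2 h3 h4; apply: (H (M + 1)); first by rewrite ltrDl.
by exists p => //; split; split; rewrite /I/= in_itv/= -ler_norml.
Qed.

End C1_tests.

(** * Test functions along lines and the weak formulation for mild solutions *)

Section transport_tests.
Context (R : realType) (Omega : set (R * R)) (d : R) (OB : cbody Omega d) (b : boundary_data Omega).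
Notation T1 := (measurableTypeR R).
Notation T2 := (T1 * T1)%type.
Notation T3 := (T1 * T1 * T1)%type.
Notation mu := (@lebesgue_measure R).
Notation c := (curve b).
Implicit Types (phi : (R * R) * (R * R) -> R).

Definition test_val phi (z : T3) : R := phi (z.1, dir z.2).
Definition test_deriv phi (z : T3) : R := 'D_(dir z.2) (fun y => phi (y, dir z.2)) z.1.

Lemma test_derivE phi z : C1_test phi -> test_deriv phi z =
  cos z.2 * 'D_(e1 R) phi (z.1, dir z.2) + sin z.2 * 'D_(e2 R) phi (z.1, dir z.2).
Proof.
move=> tp; rewrite -derive_sum_directions// /test_deriv /derive.
set F := (fun h : R => _); set G := (fun h : R => h^-1 *: ((phi \o shift (z.1, dir z.2)) _ - _)).
suff -> : F = G by [].
apply/funext => h; rewrite /F /G; congr (_ *: (phi _ - _)).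
by congr pair; rewrite /= -[LHS]add0r; congr (_ + _); rewrite scaler0.
Qed.

Lemma continuous_phase_point : continuous (fun z : R * R * R => (z.1, dir z.2)).
Proof.
move=> z; apply: (@cvg_pair _ _ _ _ (nbhs z.1) (nbhs (dir z.2))); first exact: cvg_fst.
apply: (@cvg_pair _ _ _ _ (nbhs (cos z.2)) (nbhs (sin z.2))).
  by apply: (@continuous_comp _ _ _ snd cos z); [exact: cvg_snd|exact: continuous_cos].
by apply: (@continuous_comp _ _ _ snd sin z); [exact: cvg_snd|exact: continuous_sin].
Qed.

Lemma bmo_test_val (g : (R * R) * (R * R) -> R) : continuous g -> bmo (clph Omega) (test_val g).
Proof.
move=> cg; have [M gM] := continuous_bounded_box d cg.
apply: (bmo_bd (M := M)).
  apply: continuous_measurable3 => z; apply: (continuous_comp (f := fun z => (z.1, dir z.2))).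
    exact: continuous_phase_point.
  exact: cg.
move=> z cz; have [h1 h2] := closure_bound OB cz.
by apply: gM => //=; [exact: cos_max|exact: sin_max].
Qed.

Lemma bmo_test_deriv phi : C1_test phi -> bmo (clph Omega) (test_deriv phi).
Proof.
move=> tp; rewrite (_ : test_deriv phi = fun z => cos z.2 * test_val (fun q => 'D_(e1 R) phi q) z +
    sin z.2 * test_val (fun q => 'D_(e2 R) phi q) z); last first.
  by apply/funext => z; rewrite test_derivE.
have bc : bmo (clph Omega) (fun z : T3 => cos z.2 : R).
  by apply: (bmo_bd (M := 1)) => [|z _]; [mfun|exact: cos_max].
have bs : bmo (clph Omega) (fun z : T3 => sin z.2 : R).
  by apply: (bmo_bd (M := 1)) => [|z _]; [mfun|exact: sin_max].
have c1 : continuous (fun q => 'D_(e1 R) phi q) by have [] := tp (e1 R).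
have c2 : continuous (fun q => 'D_(e2 R) phi q) by have [] := tp (e2 R).
have b1 := bmo_test_val c1; have b2 := bmo_test_val c2.
exact: bmoD (bmoM bc b1) (bmoM bs b2).
Qed.

Let line_point theta p : (R * R) * (R * R) := (pt theta p 0, dir theta).
Let line_dir theta : (R * R) * (R * R) := (dir theta, (0, 0)).

Let line_pointE theta p s : (pt theta p s, dir theta) = s *: line_dir theta + line_point theta p.
Proof.
by rewrite /line_dir /line_point /pt /dir; congr pair; congr pair; rewrite /= /GRing.scale/=; ring.
Qed.

Let test_deriv_line phi theta p s : C1_test phi ->
  test_deriv phi (pt theta p s, theta) = 'D_(line_dir theta) phi (s *: line_dir theta + line_point theta p).
Proof. by move=> tp; rewrite test_derivE// -line_pointE /line_dir /dir derive_sum_directions. Qed.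

Lemma is_derive_test_line phi (theta p s : R) : C1_test phi ->
  is_derive s 1 (fun s : R => test_val phi (pt theta p s, theta)) (test_deriv phi (pt theta p s, theta)).
Proof.
move=> tp; rewrite test_deriv_line// /test_val/=.
rewrite (_ : (fun s : R => _) = fun s : R => phi (s *: line_dir theta + line_point theta p)); last first.
  by apply/funext => s'; rewrite line_pointE.
by apply: derive_line; have [] := tp (line_dir theta).
Qed.

Lemma llac_test phi : C1_test phi -> llac Omega (test_val phi) (test_deriv phi).
Proof.
move=> tp theta p mt.
have mpt : measurable_fun setT (fun s : T1 => (pt theta p s, theta) : T3) by rewrite /pt; mfun.
apply: lac_C1.
- exact: ltW (si_lt_so OB mt).
- apply: (measurableT_comp _ mpt); exact: (bmo_test_val (continuous_test tp)).1.
- apply: (measurableT_comp _ mpt); exact: (bmo_test_deriv tp).1.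
- by move=> t _; exact: is_derive_test_line.
have cD : continuous (fun y => 'D_(line_dir theta) phi y) by have [] := tp (line_dir theta).
move=> t _; rewrite (_ : (fun s : T1 => _) =
    fun s : R => 'D_(line_dir theta) phi (s *: line_dir theta + line_point theta p)); last first.
  by apply/funext => s; rewrite test_deriv_line.
apply: (@continuous_comp _ _ _ (fun s : R => s *: line_dir theta + line_point theta p)
  (fun y => 'D_(line_dir theta) phi y) t); last exact: cD.
apply: cvgD; last exact: cvg_cst.
by apply: cvgZl; exact: cvg_id.
Qed.

Lemma Rint_Gamma_flux (f : T2 -> R) : bmo (Gamma b) f ->
  \int[@leb2 R]_(z in Gamma b) (f z * flux b z) =
  \int[@leb2 R]_(z in Gamma_plus b) (f z * `|flux b z|) -
  \int[@leb2 R]_(z in Gamma_minus b) (f z * `|flux b z|).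
Proof.
move=> bf.
have gm := Gamma_measurable b; have gf := Gamma_finite b.
have gmm := Gamma_minus_measurable OB b; have gpm := Gamma_plus_measurable OB b.
have sm : Gamma_minus b `<=` Gamma b by move=> z [].
have sp : Gamma_plus b `<=` Gamma b by move=> z [].
have bfl : bmo (Gamma b) (fun z => `|flux b z|).
  by apply: bmo_norm; exact: bmo_flux OB b _.
have bff : bmo (Gamma b) (fun z => f z * `|flux b z|) by exact: bmoM.
have rE (A : set T2) : A `<=` Gamma b -> \int[@leb2 R]_(z in A) (f z * `|flux b z|) =
    \int[@leb2 R]_(z in Gamma b) (\1_A z * (f z * `|flux b z|)).
  by move=> sA; rewrite -{1}(setIidr sA) Rint_restrictI.
rewrite (rE _ sp) (rE _ sm) -(RintB gm gf); last 2 first.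
- by apply: (bmoM _ bff); exact: bmo_indic.
- by apply: (bmoM _ bff); exact: bmo_indic.
apply: eq_Rintegral => z /set_mem Gz; have [fn|fp|f0] := ltgtP (flux b z) 0.
- rewrite indicN; last by move=> [_ /=]; rewrite ltNge (ltW fn).
  by rewrite indicT// ltr0_norm//; ring.
- rewrite indicT//; rewrite indicN; last by move=> [_ /=]; rewrite ltNge (ltW fp).
  by rewrite gtr0_norm//; ring.
by rewrite f0 normr0 !mulr0 subrr.
Qed.

(** Green for the product of [f] with the test function; applied to a mild solution it is the weak
    formulation with trace. *)
Lemma green_test phi (f f' : T3 -> R) : C1_test phi -> bmo (clph Omega) f -> bmo (phase Omega) f' ->
  llac Omega f f' ->
  \int[@leb3 R]_(z in phase Omega) (f' z * test_val phi z + f z * test_deriv phi z) =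
  \int[@leb2 R]_(z in Gamma b) (f (c z.1, z.2) * test_val phi (c z.1, z.2) * flux b z).
Proof.
move=> tp bf bf' lf.
have sub : phase Omega `<=` clph Omega by move=> z [Oz _]; left.
have bt := bmo_test_val (continuous_test tp).
have bff : bmo (clph Omega) (fun z => f z * test_val phi z) by exact: bmoM.
rewrite Rint_Gamma_flux; last first.
  exact: (bmo_curve b (Gamma b) bff).
rewrite -(green OB b (f := fun z => f z * test_val phi z) bff _ (llac_mul lf (llac_test tp)))//.
apply: bmoD; apply: bmoM => //; [exact: bmoS bt|exact: bmoS bf|].
by apply: bmoS (bmo_test_deriv tp).
Qed.

End transport_tests.

(** * Construction of test functions adapted to lines *)

Section C1_test_constructors.
Context (R : realType).
Notation E4 := ((R * R) * (R * R))%type.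
Implicit Types (phi psi q : E4 -> R) (k K : R -> R) (y : R).

Lemma derive_of_line phi (p v : E4) (l : R) :
  is_derive (0 : R) 1 (fun s : R => phi (s *: v + p)) l -> derivable phi p v /\ 'D_v phi p = l.
Proof.
move=> [dv dE]; split; first exact/derivable1P.
pose F (s : R) := phi (s *: v + p).
have E : (fun h : R => h^-1 *: ((phi \o shift p) (h *: v) - phi p)) =
    (fun h : R => h^-1 *: ((F \o shift (0 : R)) (h *: 1) - F 0)).
  by apply/funext => h; rewrite /F/= [h *: 1]mulr1 !addr0 scale0r add0r.
by rewrite -dE /derive E.
Qed.

Lemma line_of_derive phi (p v : E4) : C1_test phi ->
  is_derive (0 : R) 1 (fun s : R => phi (s *: v + p)) ('D_v phi p).
Proof.
move=> /(_ v)[d _]; have := derive_line (d (0 *: v + p)).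
by rewrite scale0r add0r.
Qed.

Let continuous_mul (f g : E4 -> R) : continuous f -> continuous g -> continuous (fun p => f p * g p).
Proof. by move=> cf cg p; exact: (@cvgM _ _ (nbhs p) _ f g _ _ (cf p) (cg p)). Qed.

Lemma test_linear q : (forall (h : R) v p, q (h *: v + p) = h * q v + q p) -> C1_test q.
Proof.
move=> ql v.
have D p : derivable q p v /\ 'D_v q p = q v.
  apply: derive_of_line; under eq_fun do rewrite ql.
  have h := is_deriveD (is_deriveM (is_derive_id (0 : R) 1) (is_derive_cst (q v) (0 : R) 1)) (is_derive_cst (q p) (0 : R) 1).
  by apply: is_derive_eq; rewrite /GRing.scale/= !mul0r mulr1 add0r addr0.
split => [p|]; first by have [] := D p.
rewrite (_ : (fun p => _) = fun=> q v); first exact: cst_continuous.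
by apply/funext => p; have [] := D p.
Qed.

Lemma test_comp k (k' : R -> R) phi : (forall y, is_derive y 1 k (k' y)) -> continuous k' ->
  C1_test phi -> C1_test (fun p => k (phi p)).
Proof.
move=> dk ck tp v.
have D p : derivable (fun p => k (phi p)) p v /\ 'D_v (fun p => k (phi p)) p = k' (phi p) * 'D_v phi p.
  apply: derive_of_line; have := line_of_derive p v tp.
  have dk0 := dk (phi (0 *: v + p)); move=> h.
  have := @is_derive1_comp _ k (fun s : R => phi (s *: v + p)) 0 _ _ dk0 h.
  by rewrite scale0r add0r.
split => [p|]; first by have [] := D p.
have -> : (fun p => 'D_v (fun p => k (phi p)) p) = fun p => k' (phi p) * 'D_v phi p.
  by apply/funext => p; have [] := D p.
apply: continuous_mul; last by have [] := tp v.
by move=> p A /ck h; exact: (continuous_test tp h).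
Qed.

Lemma test_mul phi psi : C1_test phi -> C1_test psi -> C1_test (fun p => phi p * psi p).
Proof.
move=> tp ts v; have [dp cp] := tp v; have [ds cs] := ts v.
split => [p|]; first exact: derivableM.
have -> : (fun p => 'D_v (fun p => phi p * psi p) p) = fun p => phi p * 'D_v psi p + psi p * 'D_v phi p.
  by apply/funext => p; exact: deriveM (dp p) (ds p).
have c1 := continuous_mul (continuous_test tp) cs; have c2 := continuous_mul (continuous_test ts) cp.
by move=> p; exact: (@cvgD _ _ _ (nbhs p) _ _ _ _ _ (c1 p) (c2 p)).
Qed.

Lemma test_add phi psi : C1_test phi -> C1_test psi -> C1_test (fun p => phi p + psi p).
Proof.
move=> tp ts v; have [dp cp] := tp v; have [ds cs] := ts v.
split => [p|]; first exact: derivableD.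
have -> : (fun p => 'D_v (fun p => phi p + psi p) p) = fun p => 'D_v phi p + 'D_v psi p.
  by apply/funext => p; exact: deriveD (dp p) (ds p).
by move=> p; exact: (@cvgD _ _ _ (nbhs p) _ _ _ _ _ (cp p) (cs p)).
Qed.

Definition gate_deriv (o : option (nat * R)) (y : R) : R :=
  if o is Some nc then nc.1%:R ^+ 2 * (logistic nc.1 nc.2 y * (1 - logistic nc.1 nc.2 y)) else 0.

Lemma is_derive_gate o y : is_derive y 1 (gate o) (gate_deriv o y).
Proof.
case: o => [[n c]|]; first exact: is_derive_logistic.
exact: is_derive_cst.
Qed.

Lemma continuous_gate o : continuous (gate o : R -> R).
Proof. by case: o => [[n c]|]; [exact: continuous_logistic|exact: cst_continuous]. Qed.

Lemma continuous_gate_deriv o : continuous (gate_deriv o).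
Proof.
case: o => [[n c]|]; last exact: cst_continuous.
move=> y; apply: cvgM; first exact: cvg_cst.
have cl := @continuous_logistic R n c y.
by apply: cvgM => //; apply: cvgB => //; exact: cvg_cst.
Qed.

(** The test functions see the abscissa through the derivative of [K], so each gate must be such a
    derivative. For a logistic gate the primitive is a softplus. *)
Lemma gate_primitive o : exists K, forall y, is_derive y 1 K (gate o y).
Proof.
case: o => [[n c]|]; last by exists id => y; exact: is_derive_id.
case: n => [|n].
  exists (fun y => 2^-1 * y) => y.
  have h := is_deriveZ (2^-1 : R) (is_derive_id y 1).
  by apply: is_derive_eq; rewrite /gate/= /logistic expr0n/= mul0r subr0 expR0 [_ *: _]mulr1.
set k : R := n.+1%:R ^+ 2; have k0 : k != 0 by rewrite expf_neq0// pnatr_eq0.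
exists (fun y => k^-1 * ln (1 + expR (k * (y - c) - n.+1%:R))) => y.
have d1 : is_derive y 1 (fun z : R => k * (z - c) - n.+1%:R) k.
  have h := is_deriveB (is_deriveZ k (is_deriveB (is_derive_id y 1) (is_derive_cst c y 1))) (is_derive_cst (n.+1%:R : R) y 1).
  by apply: is_derive_eq; rewrite !subr0 [_ *: _]mulr1.
pose g (z : R) := k * (z - c) - n.+1%:R.
have d2 := @is_derive1_comp _ (@expR R) g y _ _ (is_derive_expR (g y)) d1.
have e0 := expR_gt0 (g y).
have p0 : 0 < 1 + expR (g y) by rewrite addr_gt0.
have d3 : is_derive y 1 (fun z : R => 1 + expR (g z)) (expR (g y) * k).
  have h := is_deriveD (is_derive_cst (1 : R) y 1) d2.
  by apply: is_derive_eq; rewrite add0r.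
have d4 := @is_derive1_comp _ (@ln R) (fun z : R => 1 + expR (g z)) y _ _ (is_derive1_ln p0) d3.
have d5 := is_deriveZ k^-1 d4.
apply: is_derive_eq; rewrite /gate/= /logistic -/k /GRing.scale/=.
rewrite (_ : n.+1%:R - k * (y - c) = - g y); last by rewrite /g; ring.
rewrite expRN; field.
by rewrite ?k0 ?gt_eqF// addrC.
Qed.

(* In the coordinates x = pt theta p s, w = dir theta of a line these functions are
   exp(s / e) k1(cos theta) k2(sin theta) k3(p) K(s), so that the operator
   w . grad - 1 / e only differentiates the factor K. *)
Definition line_test (e : R) (k1 k2 k3 K : R -> R) (z : E4) : R :=
  expR (e^-1 * (z.1.1 * z.2.1 + z.1.2 * z.2.2)) *
  (k1 z.2.1 * k2 z.2.2 * k3 (z.1.2 * z.2.1 + (- z.1.1) * z.2.2)) *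
  K (z.1.1 * z.2.1 + z.1.2 * z.2.2).

Lemma C1_line_test e o1 o2 o3 K (K' : R -> R) : (forall y, is_derive y 1 K (K' y)) -> continuous K' ->
  C1_test (line_test e (gate o1) (gate o2) (gate o3) K).
Proof.
move=> dK cK.
have t11 : C1_test (fun z : E4 => z.1.1) by apply: test_linear => h [[? ?] [? ?]] [[? ?] [? ?]].
have t12 : C1_test (fun z : E4 => z.1.2) by apply: test_linear => h [[? ?] [? ?]] [[? ?] [? ?]].
have t21 : C1_test (fun z : E4 => z.2.1) by apply: test_linear => h [[? ?] [? ?]] [[? ?] [? ?]].
have t22 : C1_test (fun z : E4 => z.2.2) by apply: test_linear => h [[? ?] [? ?]] [[? ?] [? ?]].
have tN : C1_test (fun z : E4 => - z.1.1).
  by apply: test_linear => h [[? ?] [? ?]] [[? ?] [? ?]]; rewrite /= /GRing.scale/=; ring.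
have ts := test_add (test_mul t11 t21) (test_mul t12 t22).
have tq := test_add (test_mul t12 t21) (test_mul tN t22).
have tg o q : C1_test q -> C1_test (fun z => gate o (q z)).
  by move=> tqq; exact: (@test_comp (gate o) (gate_deriv o) q (is_derive_gate o) (@continuous_gate_deriv o) tqq).
have tE : C1_test (fun z : E4 => expR (e^-1 * (z.1.1 * z.2.1 + z.1.2 * z.2.2))).
  apply: (test_comp (k := fun y => expR (e^-1 * y)) (k' := fun y => expR (e^-1 * y) * e^-1) _ _ ts).
    move=> y; have d1 : is_derive y 1 (fun z : R => e^-1 * z) e^-1.
      have h := is_deriveZ e^-1 (is_derive_id y 1).
      by apply: is_derive_eq; rewrite [_ *: _]mulr1.
    exact: (@is_derive1_comp _ (@expR R) (fun z : R => e^-1 * z) y _ _ (is_derive_expR (e^-1 * y)) d1).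
  move=> y; apply: cvgM; last exact: cvg_cst.
  apply: (@continuous_comp _ _ _ (fun z : R => e^-1 * z) (@expR R)); last exact: continuous_expR.
  by apply: cvgM; [exact: cvg_cst|exact: cvg_id].
exact: test_mul (test_mul tE (test_mul (test_mul (tg o1 _ t21) (tg o2 _ t22)) (tg o3 _ tq)))
  (@test_comp K K' _ dK cK ts).
Qed.

Lemma line_test_pt e k1 k2 k3 K theta p s :
  line_test e k1 k2 k3 K (pt theta p s, dir theta) =
  expR (e^-1 * s) * (k1 (cos theta) * k2 (sin theta) * k3 p) * K s.
Proof.
have -> : line_test e k1 k2 k3 K (pt theta p s, dir theta) =
  expR (e^-1 * cs theta (pt theta p s)) *
  (k1 (cos theta) * k2 (sin theta) * k3 (cp theta (pt theta p s))) * K (cs theta (pt theta p s)).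
  by rewrite /line_test /cs /cp/= mulNr.
by rewrite cs_pt cp_pt.
Qed.

End C1_test_constructors.

(** * A weak solution of the homogeneous problem is mild, hence zero *)

Section uniqueness.
Context (R : realType) (Omega : set (R * R)) (d : R) (OB : cbody Omega d)
        (b : boundary_data Omega) (e : R) (e0 : 0 < e).
Notation T1 := (measurableTypeR R).
Notation T2 := (T1 * T1)%type.
Notation T3 := (T1 * T1 * T1)%type.
Notation mu := (@lebesgue_measure R).
Notation c := (curve b).
Notation lines := (lines Omega).
Notation si := (si Omega).
Notation so := (so Omega).
Notation avg := (avg b).

(* [F] gathers a weak solution of the homogeneous problem and its trace. *)
Context (F : T3 -> R) (bF : bmo setT F).
Context (weak : forall phi, C1_test phi ->
  \int[@leb3 R]_(z in phase Omega)
    (e^-1 * (avg F z.1 - F z) * test_val phi z + F z * test_deriv phi z) =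
  \int[@leb2 R]_(z in Gamma b) (F (c z.1, z.2) * test_val phi (c z.1, z.2) * flux b z)).
Context (inflow : \int[@leb2 R]_(z in Gamma_minus b)
  (`|F (c z.1, z.2) - avg F (c z.1)| * `|flux b z|) = 0).

Let am : measurable (@angles R : set T1) := @angles_measurable R.
Let af : (mu (@angles R : set T1) < +oo)%E := @angles_finite R.
Let pm := phase_measurable OB.
Let pf := phase_finite OB.
Let gm := Gamma_measurable b.
Let gf := Gamma_finite b.
Let gmm := Gamma_minus_measurable OB b.
Let gmf := Gamma_minus_finite OB b.
Let lm := lines_measurable OB.
Let lf := lines_finite OB.
Let S0 : T3 -> R := fun=> 0.
Let W := avg F.
Let bW : bmo setT W. Proof. exact: bmo_avg OB b _ bF. Qed.
Let bWS : bmo setT (fun z : T3 => W z.1 + S0 z).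
Proof. by apply: bmoD; [exact: bmo_fst|exact: bmo_cst]. Qed.
Let U := mild Omega e (fun z => W z.1 + S0 z).
Let bU : bmo setT U. Proof. exact: bmo_mild OB _ e0 _ bWS. Qed.
Let D (z : T3) : R := F z - U z.
Let bD : bmo setT D. Proof. exact: bmoB. Qed.
Let sub (A : set T3) (f : T3 -> R) : bmo setT f -> bmo A f. Proof. exact: bmoS. Qed.
Let clo : phase Omega `<=` clph Omega. Proof. by move=> z [Oz _]; left. Qed.

Let bfl : bmo (Gamma b) (fun z => `|flux b z|).
Proof. by apply: bmo_norm; exact: bmo_flux OB b _. Qed.

Let bcurve (f : T3 -> R) A : bmo (clph Omega) f -> bmo A (fun z : T2 => f (c z.1, z.2)).
Proof. by move=> bf; exact: (bmo_curve b A bf). Qed.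

(** [U] is the mild solution driven by the averages of [F] itself, so in the difference the averages
    cancel and only the zero-order term [D / e] remains; the incoming traces agree, which leaves the
    outgoing one. *)
Lemma weak_difference phi : C1_test phi ->
  \int[@leb3 R]_(z in phase Omega) (D z * (test_deriv phi z - e^-1 * test_val phi z)) =
  \int[@leb2 R]_(y in lines)
    (D (pt y.1 y.2 (so y.1 y.2), y.1) * test_val phi (pt y.1 y.2 (so y.1 y.2), y.1)).
Proof.
move=> tp; have bt := bmo_test_val OB (continuous_test tp); have bd := bmo_test_deriv OB tp.
have wU := green_test OB b tp (sub _ bU) (sub _ (bmoZ e^-1 (bmoB bWS bU))) (llac_mild OB e0 bWS).
have bt' := bmoS clo bt; have bd' := bmoS clo bd.
have bW3 : bmo (phase Omega) (fun z : T3 => W z.1) by apply: bmoS (bmo_fst bW).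
have bFp := sub (phase Omega) bF; have bUp := sub (phase Omega) bU.
transitivity (\int[@leb3 R]_(z in phase Omega)
    (e^-1 * (avg F z.1 - F z) * test_val phi z + F z * test_deriv phi z) -
  \int[@leb3 R]_(z in phase Omega)
    (e^-1 * (W z.1 + S0 z - U z) * test_val phi z + U z * test_deriv phi z)).
  rewrite -(RintB pm pf); last 2 first.
  - by apply: bmoD; apply: bmoM => //; apply: bmoZ; exact: bmoB.
  - by apply: bmoD; apply: bmoM => //; apply: bmoZ; exact: sub (bmoB bWS bU).
  by apply: eq_Rintegral => z _; rewrite /D /S0 /W; ring.
rewrite weak// wU -(RintB gm gf); last 2 first.
- apply: bmoM; [apply: bmoM; [exact: bcurve (sub _ bF)|exact: bcurve]|].
  exact: bmo_flux OB b _.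
- apply: bmoM; [apply: bmoM; [exact: bcurve (sub _ bU)|exact: bcurve]|].
  exact: bmo_flux OB b _.
transitivity (\int[@leb2 R]_(z in Gamma b) (D (c z.1, z.2) * test_val phi (c z.1, z.2) * flux b z)).
  by apply: eq_Rintegral => z _; rewrite /D; ring.
have bDc : bmo (Gamma b) (fun z : T2 => D (c z.1, z.2) * test_val phi (c z.1, z.2)).
  by apply: bmoM; [exact: bcurve (sub _ bD)|exact: bcurve].
rewrite (Rint_Gamma_flux OB bDc).
have -> : \int[@leb2 R]_(z in Gamma_minus b) (D (c z.1, z.2) * test_val phi (c z.1, z.2) * `|flux b z|) = 0.
  transitivity (\int[@leb2 R]_(z in Gamma_minus b)
      (((F (c z.1, z.2) - avg F (c z.1)) * `|flux b z|) * test_val phi (c z.1, z.2))).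
    apply: eq_Rintegral => z /set_mem[[z1 z2] /= fz]; rewrite /D /U.
    have z1' : 0 <= z.1 < len b by move: z1; rewrite /= in_itv.
    case: z z1 z2 fz z1' => t theta z1 z2 fz /= z1'.
    by rewrite (mild_enter OB)// /S0 addr0 /W; ring.
  have bfm : bmo (Gamma_minus b) (fun z => `|flux b z|) by apply: bmoS bfl => z [].
  have bFm : bmo (Gamma_minus b) (fun z : T2 => F (c z.1, z.2) - avg F (c z.1)).
    by apply: (bcurve (f := fun z => F z - W z.1)); apply: sub; apply: bmoB => //; exact: bmo_fst.
  apply: (Rint_zero_mul gmm gmf); [exact: bmoM|exact: bcurve|].
  by rewrite -[RHS]inflow; apply: eq_Rintegral => z _; rewrite normrM normr_id.
rewrite subr0 (Rint_Gamma_plus OB b (F := fun z => D (c z.1, z.2) * test_val phi (c z.1, z.2))); last exact: bDc.1.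
by apply: eq_Rintegral => -[theta p] /set_mem[/= ath mt]; rewrite (curve_tout OB).
Qed.

Let x1 theta p s : T3 := (pt theta p s, theta).
Let G (o1 o2 o3 : option (nat * R)) (y : T2) : R :=
  gate o1 (cos y.1) * gate o2 (sin y.1) * gate o3 y.2.

Lemma weak_lines o1 o2 o3 (K K' : R -> R) : (forall y : R, is_derive y 1 K (K' y)) -> continuous K' ->
  \int[@leb2 R]_(y in lines) \int[mu]_(s in `[si y.1 y.2, so y.1 y.2])
    (D (pt y.1 y.2 s, y.1) * (expR (e^-1 * s) * G o1 o2 o3 y * K' s)) =
  \int[@leb2 R]_(y in lines)
    (D (pt y.1 y.2 (so y.1 y.2), y.1) * (expR (e^-1 * so y.1 y.2) * G o1 o2 o3 y * K (so y.1 y.2))).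
Proof.
move=> dK cK; pose phi := line_test e (gate o1) (gate o2) (gate o3) K.
have tp : C1_test phi by exact: C1_line_test dK cK.
have bt := bmoS clo (bmo_test_val OB (continuous_test tp)); have bd := bmoS clo (bmo_test_deriv OB tp).
have vE theta p s : test_val phi (pt theta p s, theta) = expR (e^-1 * s) * G o1 o2 o3 (theta, p) * K s.
  by rewrite -[LHS]/(line_test e (gate o1) (gate o2) (gate o3) K (pt theta p s, dir theta)) line_test_pt.
transitivity (\int[@leb3 R]_(z in phase Omega) (D z * (test_deriv phi z - e^-1 * test_val phi z))).
  rewrite (Rint_phase_lines OB); last first.
    by apply: bmoM; [exact: sub|apply: bmoB => //; exact: bmoZ].
  apply: eq_Rintegral => -[theta p] /set_mem[/= ath mt]; apply: eq_Rintegral => s _.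
  congr (_ * _); rewrite vE.
  have -> : test_deriv phi (pt theta p s, theta) = e^-1 * (expR (e^-1 * s) * G o1 o2 o3 (theta, p) * K s) +
     expR (e^-1 * s) * G o1 o2 o3 (theta, p) * K' s.
    have [_ <-] := is_derive_test_line theta p s tp.
    rewrite (_ : (fun s => _) = fun s => (expR (e^-1 * s) * G o1 o2 o3 (theta, p)) * K s); last first.
      by apply/funext => s'; rewrite vE.
    have d1 : is_derive s 1 (fun z : R => e^-1 * z) e^-1.
      have h := is_deriveZ e^-1 (is_derive_id s 1).
      by apply: is_derive_eq; rewrite [_ *: _]mulr1.
    have d2 := @is_derive1_comp _ (@expR R) (fun z : R => e^-1 * z) s _ _ (is_derive_expR (e^-1 * s)) d1.
    have d3 : is_derive s 1 (fun z : R => G o1 o2 o3 (theta, p) * expR (e^-1 * z))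
        (G o1 o2 o3 (theta, p) * (expR (e^-1 * s) * e^-1)).
      exact: (is_deriveZ (G o1 o2 o3 (theta, p)) d2).
    rewrite (_ : (fun s => _) = (fun z : R => (G o1 o2 o3 (theta, p) * expR (e^-1 * z)) * K z)); last first.
      by apply/funext => z; rewrite [expR _ * _]mulrC.
    have [_ ->] := is_deriveM d3 (dK s).
    rewrite -[_ *: _]/(G o1 o2 o3 (theta, p) * expR (e^-1 * s) * K' s).
    rewrite -[_ *: (G _ _ _ _ * (_ * _))]/(K s * (G o1 o2 o3 (theta, p) * (expR (e^-1 * s) * e^-1))).
    by ring.
  by ring.
rewrite weak_difference//; apply: eq_Rintegral => -[theta p] _ /=.
by rewrite vE.
Qed.

Let mpt : measurable_fun setT (fun z : T3 => (pt z.1.1 z.1.2 z.2, z.1.1) : T3).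
Proof. by rewrite /pt; mfun. Qed.

Let mso : measurable_fun setT (fun y : T2 => so y.1 y.2 : R) := measurable_so OB.
Let msi : measurable_fun setT (fun y : T2 => si y.1 y.2 : R) := measurable_si OB.

Let bG o1 o2 o3 A : bmo A (G o1 o2 o3).
Proof.
have mc : measurable_fun setT (fun y : T2 => cos y.1 : R) by mfun.
have ms : measurable_fun setT (fun y : T2 => sin y.1 : R) by mfun.
by apply: bmoM; [apply: bmoM|]; exact: bmo_gate.
Qed.

Let bK (K : R -> R) (f : T2 -> R) : continuous K -> measurable_fun setT f ->
  (forall y, `|f y| <= 2 * d) -> bmo setT (fun y => K (f y)).
Proof.
move=> cK mf fd; have := continuous_compact (continuous_subspaceT cK) (@segment_compact R (- (2 * d)) (2 * d)).
move=> /compact_bounded[M [_ H]]; apply: (bmo_bd (M := M + 1)).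
  by apply: (measurableT_comp (continuous_measurable_fun cK)).
by move=> y _; apply: (H (M + 1)); [rewrite ltrDl|exists (f y) => //; rewrite /= in_itv/= -ler_norml].
Qed.

Let cexp : continuous (fun s : R => expR (e^-1 * s)).
Proof.
move=> s; apply: (@continuous_comp _ _ _ (fun z : R => e^-1 * z) (@expR R)); last exact: continuous_expR.
by apply: cvgM; [exact: cvg_cst|exact: cvg_id].
Qed.

Let so2 y : `|so y.1 y.2| <= 2 * d. Proof. by rewrite so_si normrN; exact: (si_bound OB). Qed.

Let kap (y : T2) : R := D (pt y.1 y.2 (so y.1 y.2), y.1) * expR (e^-1 * so y.1 y.2).

Let bkap : bmo setT kap.
Proof.
apply: bmoM; last exact: (bK cexp mso so2).
apply: (bmo_comp bD) => //.
by apply: (measurableT_comp mpt (g := fun y : T2 => ((y.1, y.2), so y.1 y.2) : T3)); mfun.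
Qed.

(** A constant [K] kills the interior integral, so the outgoing trace is orthogonal to all gates in
    the line. A dummy variable in [[0, 1]] gives the lines the three coordinates that [vanish_phase]
    expects. *)
Lemma outflow_trace_unique : \int[@leb2 R]_(y in lines) `|kap y| = 0.
Proof.
have m1 : measurable (`[0, 1]%classic : set T1) by exact: measurable_itv.
have f1 : (mu (`[0%R, 1%R]%classic : set T1) < +oo)%E by exact: itv_finite.
have mE : measurable (lines `*` (`[0, 1]%classic : set T1)) by exact: measurableX.
have fE : (@leb3 R (lines `*` (`[0%R, 1%R]%classic : set T1)) < +oo)%E by exact: leb3_rect_finite.
have key o1 o2 o3 : \int[@leb2 R]_(y in lines) (kap y * G o1 o2 o3 y) = 0.
  have c0 : continuous (cst (0 : R) : R -> R) by exact: cst_continuous.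
  have := weak_lines o1 o2 o3 (K := cst 1) (fun y => is_derive_cst (1 : R) y 1) c0.
  rewrite Rint_eq0; last first.
    by move=> y _; rewrite Rint_eq0// => s _; rewrite !mulr0.
  by move=> ->; apply: eq_Rintegral => y _; rewrite /kap/=; ring.
have bk3 A : bmo A (fun z : T3 => kap z.1).
  by apply: (bmo_comp bkap (measurable_fst : measurable_fun setT (fst : T3 -> T2))).
have van : \int[@leb3 R]_(z in lines `*` (`[0, 1]%classic : set T1)) `|kap z.1| = 0.
  apply: (vanish_phase mE fE) => //; first by move=> z [[]].
  move=> o1 o2 o3 o4.
  have bf : bmo (lines `*` (`[0, 1]%classic : set T1))
      (fun z : T3 => (kap z.1 * G o1 o2 o3 z.1) * gate o4 z.2).
    apply: bmoM; first apply: bmoM => //.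
      by apply: (bmo_comp (bG o1 o2 o3 setT)).
    by apply: bmo_gate; mfun.
  transitivity (\int[@leb3 R]_(z in lines `*` (`[0, 1]%classic : set T1))
      ((kap z.1 * G o1 o2 o3 z.1) * gate o4 z.2)).
    by apply: eq_Rintegral => z _; rewrite /G; ring.
  rewrite (Rint_prod lm m1 lf f1 (f := fun y s => (kap y * G o1 o2 o3 y) * gate o4 s))//.
  have bg4 : bmo (`[0, 1]%classic : set T1) (fun s : T1 => gate o4 s : R) by apply: bmo_gate; mfun.
  transitivity (\int[@leb2 R]_(y in lines) ((\int[mu]_(s in `[0, 1]) gate o4 s) * (kap y * G o1 o2 o3 y))).
    by apply: eq_Rintegral => y _; rewrite (RintZ m1 f1)// mulrC.
  rewrite (RintZ lm lf) ?key ?mulr0//; apply: bmoM => //; exact: bmoS bkap.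
rewrite -van (Rint_prod lm m1 lf f1 (f := fun y s => `|kap y|)); last exact: bmo_norm.
by apply: eq_Rintegral => y _; rewrite (Rintegral_cst mu m1) fine_mu_itv// subr0 mulr1.
Qed.

(** With [K] a primitive of a fourth gate, the boundary term vanishes by the preceding lemma, and
    [D] times an exponential is orthogonal to all gates in angle, distance and abscissa. *)
Lemma interior_unique : \int[@leb3 R]_(z in phase Omega) `|D z| = 0.
Proof.
pose I : set T1 := `[- (2 * d), 2 * d]%classic.
have mI : measurable I by exact: measurable_itv.
have fI : (mu I < +oo)%E by exact: itv_finite.
pose E : set T3 := lines `*` I.
have mE : measurable E by exact: measurableX.
have fE : (@leb3 R E < +oo)%E by exact: leb3_rect_finite.
pose seg : set T3 := [set z | si z.1.1 z.1.2 <= z.2 /\ z.2 <= so z.1.1 z.1.2].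
have mseg : measurable seg.
  have m1 := measurableT_comp msi (measurable_fst : measurable_fun setT (fst : T3 -> T2)).
  have m2 := measurableT_comp mso (measurable_fst : measurable_fun setT (fst : T3 -> T2)).
  by apply: measurableI; apply: measurable_le_set => //; mfun.
(* Extension by 0 from the chords to a box, so that the domain is a product. *)
pose H (z : T3) : R := \1_seg z * (D (pt z.1.1 z.1.2 z.2, z.1.1) * expR (e^-1 * z.2)).
have bexp : bmo E (fun z : T3 => expR (e^-1 * z.2) : R).
  apply: (bmo_bd (M := expR (e^-1 * (2 * d)))).
    exact: (measurableT_comp (continuous_measurable_fun cexp) measurable_snd).
  move=> z [_]; rewrite /I/= in_itv/= => /andP[_ h]; rewrite ger0_norm ?expR_ge0//.
  by rewrite ler_expR ler_pM2l// invr_gt0.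
have bDp A : bmo A (fun z : T3 => D (pt z.1.1 z.1.2 z.2, z.1.1)) by apply: (bmo_comp bD mpt).
have bH : bmo E H := bmoM (bmo_indic R E mseg) (bmoM (bDp E) bexp).
have prodE (f : T3 -> R) : bmo E f -> \int[@leb3 R]_(z in E) (\1_seg z * f z) =
    \int[@leb2 R]_(y in lines) \int[mu]_(s in `[si y.1 y.2, so y.1 y.2]) f (y, s).
  move=> bf; have bs : bmo E (fun z => \1_seg z * f z) by apply: bmoM => //; exact: bmo_indic.
  have := Rint_prod lm mI lf fI (f := fun y s => \1_seg (y, s) * f (y, s)).
  have -> : (fun z : T2 * T1 => \1_seg (z.1, z.2) * f (z.1, z.2)) = fun z => \1_seg z * f z.
    by apply/funext => -[].
  move=> /(_ bs) h; apply: etrans h _; apply: eq_Rintegral => -[theta p] /set_mem[/= ath mt].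
  have sI : `[si theta p, so theta p]%classic `<=` I.
    move=> s; rewrite /I/= !in_itv/= => /andP[h1 h2].
    have := si_bound OB theta p; have := so2 (theta, p) => /=.
    by rewrite !ler_norml => /andP[_ k1] /andP[k2 _]; rewrite (le_trans k2)// (le_trans h2).
  rewrite -[in RHS](setIidr sI) Rint_restrictI; apply: eq_Rintegral => s _; congr (_ * _).
  rewrite !indicE; congr (nat_of_bool _)%:R; apply/idP/idP; rewrite !inE/= in_itv/=.
    by move=> [-> ->].
  by move=> /andP[].
have van : \int[@leb3 R]_(z in E) `|H z| = 0.
  apply: (vanish_phase mE fE _ bH) => [z [[]]//|o1 o2 o3 o4].
  have [K dK] := gate_primitive o4.
  have cK : continuous K.
    by move=> s; apply: differentiable_continuous; apply/derivable1_diffP; have [] := dK s.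
  have cg : continuous (gate o4 : R -> R) by exact: continuous_gate.
  have := weak_lines o1 o2 o3 dK cg.
  have -> : \int[@leb2 R]_(y in lines)
      (D (pt y.1 y.2 (so y.1 y.2), y.1) * (expR (e^-1 * so y.1 y.2) * G o1 o2 o3 y * K (so y.1 y.2))) = 0.
    transitivity (\int[@leb2 R]_(y in lines) (kap y * (G o1 o2 o3 y * K (so y.1 y.2)))).
      by apply: eq_Rintegral => y _; rewrite /kap; ring.
    apply: (Rint_zero_mul lm lf _ _ outflow_trace_unique); first exact: bmoS bkap.
    by apply: bmoM => //; apply: bmoS (bK cK mso so2).
  have bf : bmo E (fun z : T3 => D (pt z.1.1 z.1.2 z.2, z.1.1) *
      (expR (e^-1 * z.2) * G o1 o2 o3 z.1 * gate o4 z.2)).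
    apply: (bmoM (bDp E)); apply: bmoM; last by apply: bmo_gate; mfun.
    exact: (bmoM bexp (bmo_comp (bG o1 o2 o3 setT) measurable_fst (fun=> fun=> Logic.I))).
  move=> h; rewrite -[RHS]h -(prodE _ bf); apply: eq_Rintegral => z _.
  by rewrite /H /G; ring.
rewrite (Rint_phase_lines OB); last by apply: sub; exact: bmo_norm.
have bn : bmo E (fun z : T3 => `|D (pt z.1.1 z.1.2 z.2, z.1.1)|) := bmo_norm (bDp E).
rewrite -(prodE _ bn).
transitivity (\int[@leb3 R]_(z in E) (`|H z| * expR (- (e^-1 * z.2)))).
  apply: eq_Rintegral => z _; rewrite /H !normrM [`|\1_seg z|]ger0_norm ?indicE//.
  by rewrite [`|expR _|]ger0_norm ?expR_ge0// -!mulrA -expRD subrr expR0 mulr1.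
apply: (Rint_zero_mul mE fE); first exact: bmo_norm.
  apply: (bmo_bd (M := expR (e^-1 * (2 * d)))).
    apply: (measurableT_comp (@measurable_expR _)); apply: measurable_funN.
    by apply: measurable_funM; mfun.
  move=> z [_]; rewrite /I/= in_itv/= => /andP[h _]; rewrite ger0_norm ?expR_ge0//.
  by rewrite ler_expR -mulrN ler_pM2l ?invr_gt0// lerNl.
by rewrite -[RHS]van; apply: eq_Rintegral => z _; rewrite normr_id.
Qed.

Lemma avg_norm_le H x : bmo setT H -> `|avg H x| <= avg (fun z => `|H z|) x.
Proof.
move=> bH; apply: le_trans (Rint_abs am af (bmo_wtF OB b x bH)) _.
apply: eq_ler; apply: eq_Rintegral => theta _.
by rewrite normrM ger0_norm// wt_ge0.
Qed.

(** [F] now agrees with [U], so the energy inequality without source gives [W = U]. The oscillation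
    bound at scale [2 * d], where the local body is everything, makes [W] constant, and the zero
    mean makes it 0. *)
Lemma weak_solution_unique (xc : R * R) (eta : R) : 0 < eta ->
  contains_square Omega xc eta ->
  \int[@leb3 R]_(z in phase Omega) F z = 0 ->
  \int[@leb3 R]_(z in phase Omega) `|F z| = 0.
Proof.
move=> eta0 HQ mean0.
have bm := body_measurable OB; have bf := body_finite OB.
have bDn : bmo setT (fun z => `|D z|) by exact: bmo_norm.
have avD x : W x - avg U x = avg D x.
  have := avg_lin OB b (-1) x bF bU; rewrite mulN1r => <-; congr (avg _ x).
  by apply/funext => z; rewrite mulN1r.
have z1 : \int[@leb2 R]_(x in Omega) `|W x - avg U x| = 0.
  apply/eqP; rewrite eq_le Rintegral_ge0// andbT.
  have := Rint_avg_body OB b bDn; rewrite interior_unique => /eqP.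
  rewrite mulf_eq0 mulf_eq0 pnatr_eq0 (gt_eqF (pi_gt0 R))/= => /eqP h.
  rewrite -[leRHS]h; apply: (Rint_le bm bf).
  - by apply: bmo_norm; apply: bmoS (bmoB bW (bmo_avg OB b bU)).
  - by apply: bmoS (bmo_avg OB b bDn).
  by move=> x _; rewrite avD; exact: avg_norm_le.
have lmm : measurable (`[0, len b[%classic : set T1) by exact: measurable_itv.
have lff : (mu (`[0%R, len b[%classic : set T1) < +oo)%E. by exact: ico_finite.
have z2 : \int[mu]_(t in `[0, len b[) `|W (c t) - avg U (c t)| = 0.
  apply/eqP; rewrite eq_le Rintegral_ge0// andbT.
  have bcu (f : T2 -> R) : bmo setT f -> bmo (`[0, len b[%classic : set T1) (fun t => f (c t)).
    by move=> bf'; apply: (bmo_comp bf') => //; exact: measurable_curve b.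
  have := Rint_avg_curve OB b bDn.
  rewrite (Rint_Gamma_plus OB b (F := fun z => `|D (c z.1, z.2)|)); last first.
    exact: (bmo_norm (@bcurve D setT (sub _ bD))).1.
  have -> : \int[@leb2 R]_(y in lines) `|D (c (tout b y.1 y.2), y.1)| = 0.
    transitivity (\int[@leb2 R]_(y in lines) (`|kap y| * expR (- (e^-1 * so y.1 y.2)))).
      apply: eq_Rintegral => -[theta p] /set_mem[/= ath mt]; rewrite (curve_tout OB)// /kap/= normrM.
      by rewrite [`|expR _|]ger0_norm ?expR_ge0// -mulrA -expRD subrr expR0 mulr1.
    apply: (Rint_zero_mul lm lf); first by apply: bmo_norm; exact: bmoS bkap.
      have c' : continuous (fun s : R => expR (- (e^-1 * s))).
        move=> s; apply: (@continuous_comp _ _ _ (fun z : R => - (e^-1 * z)) (@expR R)); last exact: continuous_expR.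
        by apply: cvgN; apply: cvgM; [exact: cvg_cst|exact: cvg_id].
      by apply: bmoS (bK c' mso so2).
    by rewrite -[RHS]outflow_trace_unique; apply: eq_Rintegral => y _; rewrite normr_id.
  move=> /eqP; rewrite mulf_eq0 pnatr_eq0/= => /eqP h; rewrite -[leRHS]h.
  apply: (Rint_le lmm lff).
  - exact: (bcu _ (bmo_norm (bmoB bW (bmo_avg OB b bU)))).
  - exact: (bcu _ (bmo_avg OB b bDn)).
  by move=> t _; rewrite avD; exact: avg_norm_le.
have bW3 : bmo setT (fun z : T3 => W z.1) by exact: bmo_fst.
have bWU := bmoB bW3 bU.
have E2 : \int[@leb3 R]_(z in phase Omega) (W z.1 - U z) ^+ 2 <= 0.
  apply: le_trans (energy OB e0 bW (bmo_cst setT 0) z1 z2) _.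
  rewrite !Rint_eq0 ?mulr0 ?addr0// => z _; rewrite ?expr0n/= ?mulr0 ?mul0r//.
have E1 : \int[@leb3 R]_(z in phase Omega) `|W z.1 - U z| = 0.
  apply/eqP; rewrite -sqrf_eq0 eq_le sqr_ge0 andbT.
  apply: le_trans (Rint_cauchy_schwarz pm pf (sub _ bWU)) _.
  by rewrite mulr_ge0_le0// fine_ge0.
have W0 : \int[@leb2 R]_(x in Omega) W x = 0.
  have := Rint_avg_body OB b bF; rewrite mean0 => /eqP.
  by rewrite mulf_eq0 mulf_eq0 pnatr_eq0 (gt_eqF (pi_gt0 R))/= => /eqP.
have Oxc : Omega xc by apply: HQ; rewrite subrr normr0 mulr_ge0// ltW.
have cxc : body_closure Omega xc by left.
have d0 : 0 < d by case: OB.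
have V1 : \int[@leb2 R]_(x in Omega) `|W x| = 0.
  have m0 : 0 < fine (@leb2 R Omega).
    rewrite -(local_body_full OB cxc); have d4 : 0 < 2 * d <= 2 * d by rewrite lexx andbT mulr_gt0.
    apply: lt_le_trans (local_body_mass_ge OB eta0 HQ cxc d4).
    by apply: mulr_gt0; apply: exprn_gt0; [exact: divr_gt0|exact: mulr_gt0].
  apply/eqP; rewrite eq_le Rintegral_ge0// andbT -(ler_pM2l m0) mulr0.
  apply: le_trans (mean_zero_L1 OB bW W0) _.
  have mD := local_body_measurable OB xc (2 * d).
  have DO : local_body Omega xc (2 * d) `<=` Omega by move=> y [].
  have r0 : 0 <= 2 * d by rewrite mulr_ge0// ltW.
  have := oscillation OB e0 mD DO r0 (@local_body_diam R Omega xc (2 * d))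
    (@local_body_convex R Omega d OB xc (2 * d)) bW (bmo_cst setT 0).
  rewrite (local_body_full OB cxc) /= => h; apply: le_trans h _.
  have p0 : \int[@leb2 R]_(y in Omega) \int[mu]_(theta in @angles R) `|W y - U (y, theta)| = 0.
    by rewrite -[RHS]E1 (Rint_phase_prod OB)//; exact: bmo_norm.
  have p1 : \int[@leb2 R]_(y in Omega) \int[mu]_(theta in @angles R) `|W y + 0 - U (y, theta)| = 0.
    by rewrite -[RHS]p0; apply: eq_Rintegral => y _; apply: eq_Rintegral => theta _; rewrite addr0.
  by rewrite [X in _ * X + _]p0 [X in _ + _ * X]p1 !mulr0 addr0.
apply/eqP; rewrite eq_le Rintegral_ge0// andbT.
have nW : \int[@leb3 R]_(z in phase Omega) `|W z.1| = 0.
  rewrite (Rint_phase_prod OB); last exact: bmo_norm.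
  transitivity (\int[@leb2 R]_(x in Omega) (2 * pi * `|W x|)).
    apply: eq_Rintegral => x _; transitivity (\int[mu]_(theta in @angles R) `|W x|); first by [].
    by rewrite (Rintegral_cst mu am) fine_mu_angles mulrC.
  by rewrite (RintZ bm bf) ?V1 ?mulr0//; apply: bmo_norm; exact: bmoS bW.
have b1 := sub (phase Omega) bDn; have b2 := sub (phase Omega) (bmo_norm bWU).
have b3 := sub (phase Omega) (bmo_norm bW3).
apply: (@le_trans _ _ (\int[@leb3 R]_(z in phase Omega) (`|D z| + `|W z.1 - U z| + `|W z.1|))).
  apply: (Rint_le pm pf); [by apply: sub; exact: bmo_norm|by apply: bmoD => //; exact: bmoD|].
  move=> z _; have -> : F z = D z - (W z.1 - U z) + W z.1 by rewrite /D; ring.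
  by apply: le_trans (ler_normD _ _) _; rewrite lerD2r; exact: ler_normB.
rewrite (RintD pm pf) ?(RintD pm pf)//; last exact: bmoD.
by rewrite interior_unique E1 nW !addr0.
Qed.

End uniqueness.

(** * Representatives of essentially bounded functions and comparison of norms *)

Section essentially_bounded.
Context d (T : measurableType d) (R : realType) (m : {measure set T -> \bar R}).
Implicit Types (D : set T) (f g : T -> R).

Lemma ae_imp (P Q : T -> Prop) : (forall x, P x -> Q x) ->
  {ae m, forall x, P x} -> {ae m, forall x, Q x}.
Proof. by move=> PQ; apply: filterS. Qed.

Lemma ae_imp2 (P P' Q : T -> Prop) : (forall x, P x -> P' x -> Q x) ->
  {ae m, forall x, P x} -> {ae m, forall x, P' x} -> {ae m, forall x, Q x}.
Proof. by move=> PQ; apply: filterS2. Qed.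

(** Truncation at the essential supremum gives a representative bounded everywhere. Positive total
    mass selects the essential supremum in the definition of the norm. *)
Lemma Linfty_rep f : (0 < m setT)%E -> f \in Lfun m +oo%E ->
  ('N[m]_+oo [EFin \o f])%E \is a fin_num /\
  exists g, [/\ measurable_fun setT g, forall x, `|g x| <= fine ('N[m]_+oo [EFin \o f])%E &
    {ae m, forall x, f x = g x}].
Proof.
move=> m0; rewrite inE => /andP[]; rewrite !inE /= => mf nf.
have fN : ('N[m]_+oo [EFin \o f])%E \is a fin_num by rewrite ge0_fin_numE// Lnorm_ge0.
split => //; set N := fine _.
have fP : {ae m, forall x, `|f x| <= N}.
  have : ('N[m]_+oo [EFin \o f])%E = ess_sup m (abse \o (EFin \o f)) by rewrite unlock m0.
  move=> h; have := ess_sup_ge m (abse \o (EFin \o f)); rewrite -h; apply: filterS => x.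
  by rewrite -(fineK fN) lee_fin.
have mA : measurable [set x | `|f x| <= N].
  by apply: measurable_le_set; [exact: measurableT_comp|exact: measurable_cst].
exists (fun x => \1_[set x | `|f x| <= N] x * f x); split.
- by apply: measurable_funM => //; exact: measurable_indic.
- move=> x; have [h|h] := pselect (`|f x| <= N); first by rewrite indicT// mul1r.
  by rewrite indicN// mul0r normr0 fine_ge0// Lnorm_ge0.
- by apply: filterS fP => x h; rewrite indicT// mul1r.
Qed.

Lemma bounded_Linfty f M : 0 <= M -> measurable_fun setT f -> (forall x, `|f x| <= M) ->
  f \in Lfun m +oo%E /\ ('N[m]_+oo [EFin \o f] <= M%:E)%E.
Proof.
move=> M0 mf fM.
have nM : ('N[m]_+oo [EFin \o f] <= M%:E)%E.
  rewrite unlock; case: ifP => _; last by rewrite lee_fin.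
  by apply: ess_sup_ler => x; rewrite lee_fin.
split => //; rewrite inE; apply/andP; rewrite !inE /=; split => //.
by rewrite /finite_norm; apply: le_lt_trans nM _; rewrite ltry.
Qed.

Lemma ae_Rintegral D f g : measurable D -> measurable_fun D f -> measurable_fun D g ->
  {ae m, forall x, D x -> f x = g x} -> \int[m]_(x in D) f x = \int[m]_(x in D) g x.
Proof.
move=> mD mf mg fg; rewrite /Rintegral; congr fine; apply: ae_eq_integral => //.
- exact/measurable_EFinP.
- exact/measurable_EFinP.
- by apply: filterS fg => x h /h ->.
Qed.

Lemma Rint_norm_eq0_ae D f : measurable D -> (m D < +oo)%E -> bmo D f ->
  \int[m]_(x in D) `|f x| = 0 -> {ae m, forall x, D x -> f x = 0}.
Proof.
move=> mD fD bf f0; have mf : measurable_fun D (EFin \o f).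
  by apply/measurable_EFinP; apply: measurable_funTS; exact: bf.1.
have /(ae_eq_integral_abs m mD mf) : (\int[m]_(x in D) `|(EFin \o f) x| = 0)%E.
  by have := Rint_fin mD fD (bmo_norm bf); rewrite f0 => <-.
by apply: filterS => x h /h [].
Qed.

Lemma bmo_powR D f p : 0 <= p -> bmo D f -> bmo D (fun x => `|f x| `^ p).
Proof.
move=> p0 [mf [M fM]]; apply: (bmo_bd (M := M `^ p)).
  by apply: (measurableT_comp (measurable_powR p)); exact: measurableT_comp.
move=> x Dx; rewrite ger0_norm ?powR_ge0//; have h := fM _ Dx.
by rewrite ge0_ler_powR// nnegrE//; exact: le_trans h.
Qed.

Lemma Lnorm_patch (p : R) D f g : 0 < p -> measurable D -> (m D < +oo)%E -> bmo D g ->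
  measurable_fun D f -> {ae m, forall x, D x -> f x = g x} ->
  ('N[m]_p%:E [EFin \o (f \_ D)])%E = ((\int[m]_(x in D) `|g x| `^ p) `^ p^-1)%:E.
Proof.
move=> p0 mD fD bg mf fg; rewrite unlock -poweR_EFin.
have bp := bmo_powR (ltW p0) bg; rewrite (Rint_fin mD fD bp); apply: (congr1 (fun z : \bar R => poweR z p^-1)).
transitivity (\int[m]_(x in D) (`|f x| `^ p)%:E)%E.
  rewrite [RHS]integral_mkcond; apply: eq_integral => x _; rewrite /patch /=.
  by case: ifP => _ //; rewrite normr0 powR0// gt_eqF.
apply: ge0_ae_eq_integral => //.
- apply/measurable_EFinP; apply: (measurableT_comp (measurable_powR p)).
  exact: (measurableT_comp (@normr_measurable R setT)).
- by apply/measurable_EFinP; apply: measurable_funTS; exact: bp.1.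
- by apply: filterS fg => x h /h ->.
Qed.

(** Trivial below [k]; above it [a / k] to the power [p - 1] is at least 1. This elementary form of
    Young's inequality gives the comparison of [L^1] with [L^p] after a choice of [k]. *)
Lemma le_add_powR (a k p : R) : 0 <= a -> 0 < k -> 1 <= p -> a <= k + a `^ p * k `^ (1 - p).
Proof.
move=> a0 k0 p1; have [ak|ka] := leP a k; first by rewrite ler_wpDr// mulr_ge0 ?powR_ge0.
have a1 := lt_trans k0 ka.
have -> : a `^ p = a * a `^ (p - 1).
  by rewrite -[X in X * _](powRr1 a0) -powRD; [rewrite addrC subrK|rewrite (gt_eqF a1) implybT].
apply: (@le_trans _ _ (a * a `^ (p - 1) * k `^ (1 - p))); last by rewrite lerDr ltW.
rewrite -mulrA ler_peMr//.
have -> : k `^ (1 - p) = (k `^ (p - 1))^-1 by rewrite -powRN opprB.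
by rewrite ler_pdivlMr ?powR_gt0// mul1r ge0_ler_powR ?subr_ge0// ?nnegrE// ltW.
Qed.

Lemma Rint_L1_le_Lp (p : R) D g : 1 <= p -> measurable D -> (m D < +oo)%E -> bmo D g ->
  \int[m]_(x in D) `|g x| <= (fine (m D) + 1) * (\int[m]_(x in D) `|g x| `^ p) `^ p^-1.
Proof.
move=> p1 mD fD bg; have p0 : 0 < p by exact: lt_le_trans p1.
have bp := bmo_powR (ltW p0) bg; set I := \int[m]_(x in D) _ `^ p.
have I0 : 0 <= I by apply: Rintegral_ge0 => x _; exact: powR_ge0.
have key (k : R) : 0 < k -> \int[m]_(x in D) `|g x| <= fine (m D) * k + k `^ (1 - p) * I.
  move=> k0; have bc := bmo_cst D k.
  apply: (@le_trans _ _ (\int[m]_(x in D) (k + k `^ (1 - p) * `|g x| `^ p))).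
    apply: (Rint_le mD fD); [exact: bmo_norm|by apply: bmoD => //; exact: bmoZ|].
    by move=> x _; rewrite [_ `^ (1 - p) * _]mulrC; exact: le_add_powR.
  by rewrite (RintD mD fD bc (bmoZ _ bp)) (RintZ mD fD)// Rintegral_cst// mulrC.
(* If the [L^p] integral is 0, [k] is sent to 0. *)
have [I1|I1] := eqVneq I 0.
  rewrite I1 powR0 ?invr_eq0 ?gt_eqF// mulr0; apply/ler_addgt0Pr => z z0; rewrite add0r.
  have m0 : 0 < fine (m D) + 1 by rewrite ltr_wpDl// fine_ge0.
  apply: le_trans (key (z / (fine (m D) + 1)) _) _; first exact: divr_gt0.
  by rewrite I1 mulr0 addr0 mulrCA ler_piMr ?(ltW z0)// ler_pdivrMr// mul1r lerDl ler01.
have Ip : 0 < I by rewrite lt_neqAle eq_sym I1.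
(* The choice of [k] as the [L^p] norm makes both terms multiples of it, with coefficients the mass
   and 1. *)
apply: le_trans (key (I `^ p^-1) _) _; first by rewrite powR_gt0.
rewrite mulrDl mul1r lerD2l -powRrM -[X in _ * X](powRr1 I0) -powRD; last by rewrite I1 implybT.
by rewrite mulrBr mulr1 mulVf ?gt_eqF// subrK.
Qed.

End essentially_bounded.

(** * Null sets in products *)

Section null_sections.
Context d1 d2 (T1 : measurableType d1) (T2 : measurableType d2) (R : realType).
Context (m1 : {measure set T1 -> \bar R}) (m2 : {sigma_finite_measure set T2 -> \bar R}).

Lemma ae_sections (P : T1 * T2 -> Prop) : {ae (m1 \x m2)%E, forall z, P z} ->
  {ae m1, forall x, {ae m2, forall y, P (x, y)}}.
Proof.
move=> [N [mN N0 PN]].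
have mx : measurable_fun setT (m2 \o xsection N) by exact: measurable_fun_xsection.
have /(ae_eq_integral_abs m1 measurableT mx) : (\int[m1]_x `|(m2 \o xsection N) x| = 0)%E.
  by rewrite -[RHS]N0; apply: eq_integral => x _; rewrite gee0_abs.
apply: filterS => x /(_ I) /= h; exists (xsection N x); split => //.
  exact: measurable_xsection.
by move=> y /= nP; rewrite /xsection /= inE; exact: PN.
Qed.

Lemma ae_fst (P : T1 -> Prop) : {ae m1, forall x, P x} -> {ae (m1 \x m2)%E, forall z, P z.1}.
Proof.
move=> [N [mN N0 PN]]; exists (N `*` setT); split; first exact: measurableX.
  by rewrite product_measure1E// N0 mul0e.
by move=> z /= nP; split => //; exact: PN.
Qed.

End null_sections.

(** * The angle of a direction *)

Section angle_of_direction.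
Context (R : realType).

(** If [s < t], half the difference lies in []0, pi[], where the sine is positive, while
    [cos (t - s) = 1]. *)
Lemma dir_inj (s t : R) : angles s -> angles t -> dir s = dir t -> s = t.
Proof.
wlog st : s t / s <= t.
  by move=> H sa ta st; have [/H|/ltW /H h] := leP s t; [exact|exact/esym/h].
rewrite /angles/= !in_itv/= => /andP[s0 _] /andP[_ t1] [hc hs]; apply/eqP; rewrite eq_le st/= leNgt.
apply/negP => st'; set x := (t - s) / 2.
have x0 : 0 < x < pi by rewrite /x; apply/andP; split; lra.
have := sin_gt0_pi x0; have := cos2Dsin2 x; have : cos (x *+ 2) = 1.
  have -> : x *+ 2 = t - s by rewrite /x -mulr_natr divfK.
  by rewrite cosB hc hs -!expr2 cos2Dsin2.
rewrite cos_mulr2n => h1 h2 h3; have : 0 < sin x ^+ 2 by rewrite exprn_gt0.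
by move: h1 h2; rewrite mulr2n; lra.
Qed.

(** Solutions in the statement depend on the direction vector, the construction on the angle; [arg]
    passes from one to the other. *)
Definition arg (w : R * R) : R := xget 0 [set theta | angles theta /\ dir theta = w].

Lemma arg_dir theta : angles theta -> arg (dir theta) = theta.
Proof.
move=> ath; rewrite /arg; case: xgetP => [t _ [ta tt]|/(_ theta)]; last by case.
exact: dir_inj.
Qed.

End angle_of_direction.

(** * Averages of functions glued from interior values and traces *)

Section averages_of_representatives.
Context (R : realType) (Omega : set (R * R)) (d : R) (OB : cbody Omega d)
        (b : boundary_data Omega).
Notation T1 := (measurableTypeR R).
Notation T2 := (T1 * T1)%type.
Notation T3 := (T1 * T1 * T1)%type.
Notation mu := (@lebesgue_measure R).
Notation c := (curve b).
Notation avg := (avg b).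

Let am : measurable (@angles R : set T1) := @angles_measurable R.
Let af : (mu (@angles R : set T1) < +oo)%E := @angles_finite R.

(** One function on the closed phase space made of interior values and boundary values, so that a
    solution with its trace, or a source with its incoming datum, can be fed to [avg] and [mild]. *)
Definition glue (f : T3 -> R) (h : T2 -> R) (z : T3) : R :=
  \1_Omega z.1 * f z + \1_(frontier Omega) z.1 * h (tb b z.1, z.2).

Lemma glue_body f h z : Omega z.1 -> glue f h z = f z.
Proof.
move=> Oz; have nf : ~ frontier Omega z.1 by move=> /(frontier_notin OB).
by rewrite /glue (indicT R Oz) (indicN R nf) mul1r mul0r addr0.
Qed.

Lemma glue_curve f h t theta : 0 <= t < len b -> glue f h (c t, theta) = h (t, theta).
Proof.
move=> tl; have ft : frontier Omega (c t) by exact: curve_frontier.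
have nO : ~ Omega (c t) by exact: (frontier_notin OB).
by rewrite /glue /= (indicT R ft) (indicN R nO) mul1r mul0r add0r tb_curve.
Qed.

Lemma glue_abs f h M N z : 0 <= M -> 0 <= N -> (forall z, `|f z| <= M) -> (forall y, `|h y| <= N) ->
  `|glue f h z| <= M + N.
Proof.
move=> M0 N0 fM hN; apply: le_trans (ler_normD _ _) _; rewrite !normrM; apply: lerD.
  apply: (le_trans _ (fM z)); rewrite ler_piMl//.
  exact: norm_indic_le1.
apply: (le_trans _ (hN (tb b z.1, z.2))); rewrite ler_piMl//.
exact: norm_indic_le1.
Qed.

Lemma bmo_glue f h : bmo setT f -> bmo setT h -> bmo setT (glue f h).
Proof.
move=> bf bh.
have mi (A : set T2) : measurable A -> bmo setT (fun z : T3 => \1_A z.1 : R).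
  move=> mA; apply: (bmo_bd (M := 1)).
    by apply: (measurableT_comp (measurable_indic mA)); mfun.
  by move=> z _; exact: norm_indic_le1.
apply: bmoD; apply: bmoM => //.
- exact: mi (body_measurable OB).
- exact: mi (frontier_measurable OB).
- apply: (bmo_comp bh (g := fun z : T3 => (tb b z.1, z.2) : T2)) => //.
  by apply: measurable_fun_pair; [exact: (measurableT_comp (measurable_tb OB b))|mfun].
Qed.

Lemma velocity_averageE (u : R * R -> R * R -> R) (F : T3 -> R) x : bmo setT F -> Omega x ->
  measurable_fun (@angles R : set T1) (fun theta : T1 => u x (dir theta)) ->
  {ae mu, forall theta, angles theta -> u x (dir theta) = F (x, theta)} ->
  velocity_average u x = avg F x.
Proof.
move=> bF Ox mu' aeE; have bFx : bmo (@angles R : set T1) (fun theta => F (x, theta)) by exact: bmo_section.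
rewrite /velocity_average (ae_Rintegral am mu' (measurable_funTS bFx.1) aeE) -(RintZ am af)//.
by apply: eq_Rintegral => theta _; rewrite (wt_body OB).
Qed.

Lemma outgoing_averageE (g : R * R -> R * R -> R) (F : T3 -> R) t : bmo setT F -> 0 <= t < len b ->
  measurable_fun (@angles R : set T1) (fun theta : T1 => g (c t) (dir theta)) ->
  {ae mu, forall theta, angles theta -> g (c t) (dir theta) = F (c t, theta)} ->
  outgoing_average b g (c t) = avg F (c t).
Proof.
move=> bF tl mg aeE; have bFx : bmo (@angles R : set T1) (fun theta => F (c t, theta)) by exact: bmo_section.
have mfl : measurable_fun setT (fun theta : T1 => flux b (t, theta)).
  exact: (measurableT_comp (measurable_flux OB b) (pair1_measurable t)).
have bfl : bmo (@angles R : set T1) (fun theta => flux b (t, theta)).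
  by apply: (bmo_bd (M := 1)) => // theta _; exact: flux_bound.
have mP : measurable [set theta : T1 | 0 < flux b (t, theta)] by apply: measurable_lt_set => //; mfun.
rewrite /outgoing_average.
transitivity (2^-1 * \int[mu]_(theta in @angles R `&` [set theta : T1 | 0 < flux b (t, theta)])
   (g (c t) (dir theta) * flux b (t, theta))); first by [].
rewrite Rint_restrictI.
rewrite (ae_Rintegral (g := fun theta => \1_[set theta : T1 | 0 < flux b (t, theta)] theta *
    (F (c t, theta) * flux b (t, theta))) am); last 3 first.
- apply: measurable_funM; first by apply: measurable_funTS; exact: measurable_indic.
  by apply: measurable_funM => //; exact: measurable_funTS.
- apply: measurable_funM; first by apply: measurable_funTS; exact: measurable_indic.
  by apply: measurable_funM; [exact: measurable_funTS bFx.1|exact: measurable_funTS].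
- by apply: ae_imp aeE => theta h /h ->.
rewrite -(RintZ am af); last by apply: bmoM; [exact: bmo_indic|exact: bmoM].
apply: eq_Rintegral => theta _; rewrite (wt_curve OB)//.
have [h|h] := ltP 0 (flux b (t, theta)).
  by rewrite indicT//; ring.
rewrite indicN; first by ring.
by move=> /=; rewrite ltNge h.
Qed.

End averages_of_representatives.

(** * Uniqueness for the problem as stated *)

Section uniqueness_of_solutions.
Context (R : realType) (Omega : set (R * R)) (d : R) (OB : cbody Omega d)
        (b : boundary_data Omega).
Notation T1 := (measurableTypeR R).
Notation T2 := (T1 * T1)%type.
Notation T3 := (T1 * T1 * T1)%type.
Notation mu := (@lebesgue_measure R).
Notation c := (curve b).
Notation avg := (avg b).

Let am : measurable (@angles R : set T1) := @angles_measurable R.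
Let af : (mu (@angles R : set T1) < +oo)%E := @angles_finite R.
Let pm := phase_measurable OB.
Let pf := phase_finite OB.
Let gm := Gamma_measurable b.
Let gf := Gamma_finite b.
Let gmm := Gamma_minus_measurable OB b.
Let gmf := Gamma_minus_finite OB b.

Lemma leb_setT_gt0 : (0 < mu (setT : set T1))%E.
Proof.
apply: (@lt_le_trans _ _ (mu (`[0%R, 1%R]%classic : set T1))).
  by rewrite lebesgue_measure_itv/= lte_fin ltr01 -EFinB lte_fin subr0 ltr01.
by apply: le_measure; rewrite ?inE//; exact: measurable_itv.
Qed.

Lemma leb2_setT_gt0 : (0 < @leb2 R (setT : set T2))%E.
Proof.
rewrite -setXTT [ltRHS](@product_measure1E _ _ _ _ R mu mu)//.
by rewrite mule_gt0// leb_setT_gt0.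
Qed.

Lemma leb3_setT_gt0 : (0 < @leb3 R (setT : set T3))%E.
Proof.
rewrite -setXTT [ltRHS](@product_measure1E _ _ _ _ R (@leb2 R) mu)//.
by rewrite mule_gt0// ?leb_setT_gt0// leb2_setT_gt0.
Qed.

Lemma phase_Linfty_rep (u : R * R -> R * R -> R) : phase_Linfty Omega u ->
  phase_norm Omega +oo u \is a fin_num /\
  exists U : T3 -> R, [/\ measurable_fun setT U, forall z, `|U z| <= fine (phase_norm Omega +oo u) &
    {ae @leb3 R, forall z : T3, phase Omega z -> in_angle u z = U z}].
Proof.
move=> /(Linfty_rep leb3_setT_gt0)[fu [U [mU UM aeU]]]; split => //.
exists U; split => //; apply: ae_imp aeU => z h pz.
by rewrite -h /patch mem_set.
Qed.

Lemma measurable_phase (u : R * R -> R * R -> R) : phase_Linfty Omega u ->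
  measurable_fun (phase Omega) (in_angle u : T3 -> R) /\
  measurable_fun setT (in_angle u \_ (phase Omega) : T3 -> R).
Proof.
rewrite /phase_Linfty inE => /andP[]; rewrite !inE /= => mu' _; split => //.
exact/(measurable_restrictT _ pm).
Qed.

Lemma ae_velocity_average (u : R * R -> R * R -> R) (U F : T3 -> R) : phase_Linfty Omega u -> bmo setT F ->
  (forall z, Omega z.1 -> F z = U z) ->
  {ae @leb3 R, forall z : T3, phase Omega z -> in_angle u z = U z} ->
  {ae @leb3 R, forall z : T3, phase Omega z -> velocity_average u z.1 = avg F z.1}.
Proof.
move=> lu bF FU /(@ae_sections _ _ T2 T1 R (@leb2 R) mu) aeE.
have : {ae @leb2 R, forall x : T2, Omega x -> velocity_average u x = avg F x}.
  apply: ae_imp aeE => x aex Ox; apply: (velocity_averageE OB b bF Ox).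
    have h : measurable_fun (@angles R : set T1) (fun theta : T1 => (in_angle u \_ (phase Omega)) (x, theta)).
      apply: measurable_funTS; apply: (measurableT_comp _ (pair1_measurable x)).
      exact: (measurable_phase lu).2.
    apply: eq_measurable_fun h => theta /set_mem ath.
    by rewrite /patch mem_set.
  by apply: ae_imp aex => theta h ath; rewrite FU// -h.
by move=> /(@ae_fst _ _ T2 T1 R (@leb2 R) mu); apply: ae_imp => z h [/h].
Qed.

Lemma Gamma_Linfty_rep (g : R * R -> R * R -> R) : Gamma_Linfty b g ->
  exists G : T2 -> R, [/\ bmo setT G, {ae @leb2 R, forall z : T2, Gamma b z -> on_boundary b g z = G z} &
    measurable_fun (Gamma b) (on_boundary b g : T2 -> R)].
Proof.
move=> lg; have [fu [G [mG GM aeG]]] := Linfty_rep leb2_setT_gt0 lg.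
exists G; split; first exact: bmo_bd (fun z _ => GM z).
  by apply: ae_imp aeG => z h pz; rewrite -h /patch mem_set.
move: lg; rewrite /Gamma_Linfty inE => /andP[]; rewrite !inE /= => mg _.
exact/(measurable_restrictT _ gm).
Qed.

Lemma ae_outgoing_average (g : R * R -> R * R -> R) (G : T2 -> R) (F : T3 -> R) :
  measurable_fun (Gamma b) (on_boundary b g : T2 -> R) -> bmo setT F ->
  (forall t theta, 0 <= t < len b -> F (c t, theta) = G (t, theta)) ->
  {ae @leb2 R, forall z : T2, Gamma b z -> on_boundary b g z = G z} ->
  {ae @leb2 R, forall z : T2, Gamma b z -> outgoing_average b g (c z.1) = avg F (c z.1)}.
Proof.
move=> mg bF FG /(@ae_sections _ _ T1 T1 R mu mu) aeE.
have : {ae mu, forall t : T1, 0 <= t < len b -> outgoing_average b g (c t) = avg F (c t)}.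
  apply: ae_imp aeE => t aet tl; have tl' : `[0, len b[%classic t by rewrite /= in_itv.
  apply: (outgoing_averageE OB bF tl).
    have h : measurable_fun (@angles R : set T1) (fun theta : T1 => (on_boundary b g \_ (Gamma b)) (t, theta)).
      apply: measurable_funTS; apply: (measurableT_comp _ (pair1_measurable t)).
      exact/(measurable_restrictT _ gm).
    apply: eq_measurable_fun h => theta /set_mem ath.
    by rewrite /patch mem_set.
  by apply: ae_imp aet => theta h ath; rewrite FG// -h.
move=> /(@ae_fst _ _ T1 T1 R mu mu); apply: ae_imp => z h [z1 _].
by apply: h; move: z1; rewrite /= in_itv.
Qed.

(** The classes of the solution, its transport derivative and its trace are replaced by bounded
    functions measurable everywhere, and both kinds of average become [avg] of one glued
    function. *)
Lemma solution_rep (eps : R) f h u : transport_solution b eps f h u ->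
  exists (U V : T3 -> R) (G : T2 -> R), [/\ bmo setT U, bmo setT V & bmo setT G] /\
  [/\ forall phi, C1_test phi ->
        \int[@leb3 R]_(z in phase Omega) (V z * test_val phi z + U z * test_deriv phi z) =
        \int[@leb2 R]_(z in Gamma b) (G z * test_val phi (c z.1, z.2) * flux b z),
      {ae @leb3 R, forall z : T3, phase Omega z ->
         eps * V z + U z - avg (glue b U G) z.1 = in_angle f z},
      {ae @leb2 R, forall z : T2, Gamma_minus b z ->
         G z = avg (glue b U G) (c z.1) + on_boundary b h z},
      \int[@leb3 R]_(z in phase Omega) U z = 0 &
      {ae @leb3 R, forall z : T3, phase Omega z -> in_angle u z = U z}].
Proof.
move=> [lu [v [g [[lv lg] weak eqn inflow mean]]]].
have [_ [U [mU UM aeU]]] := phase_Linfty_rep lu.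
have [_ [V [mV VM aeV]]] := phase_Linfty_rep lv.
have [G [bG aeG mg]] := Gamma_Linfty_rep lg.
have bU : bmo setT U := bmo_bd mU (fun z _ => UM z).
have bV : bmo setT V := bmo_bd mV (fun z _ => VM z).
have bF := bmo_glue OB b bU bG.
have aeu := ae_velocity_average lu bF (fun z Oz => glue_body OB b U G Oz) aeU.
have aeg := ae_outgoing_average mg bF (fun t theta tl => glue_curve OB U G theta tl) aeG.
have [mu' _] := measurable_phase lu; have [mv _] := measurable_phase lv.
exists U, V, G; split => //; split => //.
- move=> phi tp.
  have bt := bmo_test_val OB (continuous_test tp); have bd := bmo_test_deriv OB tp.
  transitivity (phase_int Omega (fun x w => v x w * phi (x, w) + u x w * 'D_w (fun y => phi (y, w)) x)).
    apply/esym; apply: ae_Rintegral => //.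
    + apply: measurable_funD; apply: measurable_funM => //; apply: measurable_funTS; [exact: bt.1|exact: bd.1].
    + by apply: measurable_funTS; apply: measurable_funD; apply: measurable_funM => //; [exact: bt.1|exact: bd.1].
    + by apply: ae_imp2 aeU aeV => z h1 h2 pz; rewrite /in_angle -(h1 pz) -(h2 pz).
  rewrite (weak _ tp); apply: ae_Rintegral => //.
  + apply: measurable_funM; last by apply: measurable_funTS; exact: measurable_flux OB b.
    apply: measurable_funM => //; apply: measurable_funTS; exact: (bmo_curve b setT bt).1.
  + apply: measurable_funTS; apply: measurable_funM; last exact: measurable_flux OB b.
    by apply: measurable_funM => //; [exact: bG.1|exact: (bmo_curve b setT bt).1].
  + by apply: ae_imp aeG => z h1 pz; rewrite -(h1 pz).
- have aeUV : {ae @leb3 R, forall z : T3, phase Omega z -> in_angle u z = U z /\ in_angle v z = V z}.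
    by apply: ae_imp2 aeU aeV => z h1 h2 pz; split; [exact: h1|exact: h2].
  have aeA : {ae @leb3 R, forall z : T3, phase Omega z -> velocity_average u z.1 = avg (glue b U G) z.1 /\
      eps * in_angle v z + in_angle u z - velocity_average u z.1 = in_angle f z}.
    by apply: ae_imp2 aeu eqn => z h1 h2 pz; split; [exact: h1|exact: h2].
  by apply: ae_imp2 aeUV aeA => z h1 h2 pz; have [<- <-] := h1 pz; have [<- <-] := h2 pz.
- have aeA : {ae @leb2 R, forall z : T2, Gamma b z -> outgoing_average b g (c z.1) = avg (glue b U G) (c z.1) /\
      on_boundary b g z = G z}.
    by apply: ae_imp2 aeg aeG => z h1 h2 pz; split; [exact: h1|exact: h2].
  by apply: ae_imp2 aeA inflow => z h1 h2 gz; have [<- <-] := h1 gz.1; exact: h2.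
- rewrite -[RHS]mean; apply/esym; apply: ae_Rintegral => //.
  by apply: measurable_funTS.
Qed.

(** The glued difference of two solutions solves the homogeneous weak problem: the equations give
    the difference of the transport derivatives as [(avg F - F) / eps], and the incoming data
    cancel. *)
Lemma solutions_ae_eq (eps eta : R) (xc : R * R) f h u u' : 0 < eps -> 0 < eta ->
  contains_square Omega xc eta ->
  transport_solution b eps f h u -> transport_solution b eps f h u' ->
  {ae @leb3 R, forall z : T3, phase Omega z -> in_angle u' z = in_angle u z}.
Proof.
move=> e0 eta0 HQ /solution_rep[U [V [G [[bU bV bG] [weak eqn inflow mean aeU]]]]].
move=> /solution_rep[U' [V' [G' [[bU' bV' bG'] [weak' eqn' inflow' mean' aeU']]]]].
set F1 := glue b U G in eqn inflow *; set F2 := glue b U' G' in eqn' inflow' *.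
have bF1 : bmo setT F1 := bmo_glue OB b bU bG.
have bF2 : bmo setT F2 := bmo_glue OB b bU' bG'.
pose F z := F1 z - F2 z; have bF : bmo setT F by exact: bmoB.
have avF x : avg F x = avg F1 x - avg F2 x.
  have := avg_lin OB b (-1) x bF1 bF2; rewrite mulN1r => <-; congr (avg _ x).
  by apply/funext => z; rewrite mulN1r.
have FO z : phase Omega z -> F z = U z - U' z.
  by move=> [Oz _]; rewrite /F /F1 /F2 !(glue_body OB).
have FG z : Gamma b z -> F (c z.1, z.2) = G z - G' z.
  case: z => t theta [/= tl _]; have tl' : 0 <= t < len b by move: tl; rewrite in_itv.
  by rewrite /F /F1 /F2 !(glue_curve OB).
have bWF : bmo setT (fun z : T3 => avg F z.1 - F z).
  by apply: bmoB => //; apply: bmo_fst; exact: bmo_avg OB b F bF.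
have S (A : set T3) (k : T3 -> R) : bmo setT k -> bmo A k by apply: bmoS.
have S2 (A : set T2) (k : T2 -> R) : bmo setT k -> bmo A k by apply: bmoS.
have clo : phase Omega `<=` clph Omega by move=> z [Oz _]; left.
have F0 : \int[@leb3 R]_(z in phase Omega) `|F z| = 0.
  apply: (@weak_solution_unique R Omega d OB b eps e0 F bF _ _ xc eta eta0 HQ).
  - move=> phi tp.
    have bt := bmo_test_val OB (continuous_test tp); have bd := bmo_test_deriv OB tp.
    have btc := bmo_curve b (Gamma b) bt.
    have bfl := bmo_flux OB b (Gamma b).
    have bt' := bmoS clo bt; have bd' := bmoS clo bd.
    transitivity (\int[@leb3 R]_(z in phase Omega) (V z * test_val phi z + U z * test_deriv phi z) -
      \int[@leb3 R]_(z in phase Omega) (V' z * test_val phi z + U' z * test_deriv phi z)).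
      rewrite -(RintB pm pf); last 2 first.
      + by apply: bmoD; apply: bmoM => //; exact: S.
      + by apply: bmoD; apply: bmoM => //; exact: S.
      apply: ae_Rintegral => //.
      + apply: measurable_funTS; apply: measurable_funD; apply: measurable_funM; [|exact: bt.1|exact: bF.1|exact: bd.1].
        exact: (bmoZ eps^-1 bWF).1.
      + by apply: measurable_funTS; apply: measurable_funB; apply: measurable_funD; apply: measurable_funM;
          [exact: bV.1|exact: bt.1|exact: bU.1|exact: bd.1|exact: bV'.1|exact: bt.1|exact: bU'.1|exact: bd.1].
      + apply: ae_imp2 eqn eqn' => z h1 h2 pz; rewrite avF (FO _ pz).
        have hV : eps * (V z - V' z) = avg F1 z.1 - avg F2 z.1 - (U z - U' z).
          by have := h1 pz; rewrite -(h2 pz) => k; apply/eqP; rewrite -subr_eq0; move/eqP: k; rewrite -subr_eq0 => /eqP <-; apply/eqP; ring.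
        by rewrite -hV mulKf ?gt_eqF//; ring.
    rewrite (weak _ tp) (weak' _ tp) -(RintB gm gf); last 2 first.
    + by apply: bmoM => //; apply: bmoM => //; exact: S2.
    + by apply: bmoM => //; apply: bmoM => //; exact: S2.
    by apply: eq_Rintegral => z /set_mem gz; rewrite (FG _ gz); ring.
  - transitivity (\int[@leb2 R]_(z in Gamma_minus b) (0 : R)); last by rewrite Rint_eq0.
    have bAF : bmo (clph Omega) (fun z : T3 => F z - avg F z.1).
      by apply: S; apply: bmoB => //; apply: bmo_fst; exact: bmo_avg OB b F bF.
    apply: ae_Rintegral => //.
      apply: measurable_funTS; apply: measurable_funM.
        exact: (bmo_norm (bmo_curve b setT bAF)).1.
      by apply: measurableT_comp => //; exact: measurable_flux OB b.
    apply: ae_imp2 inflow inflow' => z h1 h2 gz; rewrite (FG _ gz.1) avF (h1 gz) (h2 gz).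
    by rewrite (_ : _ - _ = 0) ?normr0 ?mul0r//; ring.
  transitivity (\int[@leb3 R]_(z in phase Omega) (U z - U' z)).
    by apply: eq_Rintegral => z /set_mem pz; exact: FO.
  by rewrite (RintB pm pf) ?mean ?mean' ?subrr//; exact: S.
have aeF := Rint_norm_eq0_ae pm pf (S _ _ bF) F0.
have aeUU : {ae @leb3 R, forall z : T3, phase Omega z -> in_angle u z = U z /\ in_angle u' z = U' z}.
  by apply: ae_imp2 aeU aeU' => z h1 h2 pz; split; [exact: h1|exact: h2].
apply: ae_imp2 aeF aeUU => z h1 h2 pz; have [-> ->] := h2 pz.
by have := h1 pz; rewrite (FO _ pz) => /eqP; rewrite subr_eq0 => /eqP.
Qed.

End uniqueness_of_solutions.

(** * A solution of the problem as stated from a fixed point *)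

Section existence_of_solutions.
Context (R : realType) (Omega : set (R * R)) (d : R) (OB : cbody Omega d)
        (b : boundary_data Omega).
Notation T1 := (measurableTypeR R).
Notation T2 := (T1 * T1)%type.
Notation T3 := (T1 * T1 * T1)%type.
Notation mu := (@lebesgue_measure R).
Notation c := (curve b).
Notation avg := (avg b).

Let am : measurable (@angles R : set T1) := @angles_measurable R.
Let pm := phase_measurable OB.
Let pf := phase_finite OB.
Let gm := Gamma_measurable b.
Let gf := Gamma_finite b.
Let gmm := Gamma_minus_measurable OB b.
Let gmf := Gamma_minus_finite OB b.

Lemma Gamma_minus_Linfty_rep (h : R * R -> R * R -> R) : Gamma_minus_Linfty b h ->
  Gamma_minus_norm_infty b h \is a fin_num /\
  exists H : T2 -> R, [/\ measurable_fun setT H, forall z, `|H z| <= fine (Gamma_minus_norm_infty b h),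
    {ae @leb2 R, forall z : T2, Gamma_minus b z -> on_boundary b h z = H z} &
    measurable_fun (Gamma_minus b) (on_boundary b h : T2 -> R)].
Proof.
move=> lh; have [fu [H [mH HM aeH]]] := Linfty_rep (@leb2_setT_gt0 R) lh.
split => //; exists H; split => //.
  by apply: ae_imp aeH => z k pz; rewrite -k /patch mem_set.
move: lh; rewrite /Gamma_minus_Linfty inE => /andP[]; rewrite !inE /= => mh _.
exact/(measurable_restrictT _ gmm).
Qed.

Context (eps : R) (e0 : 0 < eps) (f h : R * R -> R * R -> R) (F : T3 -> R) (H : T2 -> R).
Context (bF : bmo setT F) (bH : bmo setT H).
Context (mf : measurable_fun (phase Omega) (in_angle f : T3 -> R)).
Context (mh : measurable_fun (Gamma_minus b) (on_boundary b h : T2 -> R)).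
Context (aef : {ae @leb3 R, forall z : T3, phase Omega z -> in_angle f z = F z}).
Context (aeh : {ae @leb2 R, forall z : T2, Gamma_minus b z -> on_boundary b h z = H z}).

Let S := glue b F H.
Let bS : bmo setT S := bmo_glue OB b bF bH.

Lemma glue_phase z : phase Omega z -> S z = F z.
Proof. by move=> [Oz _]; rewrite /S (glue_body OB). Qed.

Lemma glue_Gamma z : Gamma b z -> S (c z.1, z.2) = H z.
Proof.
case: z => t theta [/= tl _]; have tl' : 0 <= t < len b by move: tl; rewrite in_itv.
by rewrite /S (glue_curve OB).
Qed.

(** On incoming directions the flux is minus its absolute value, which turns the difference in
    [compatible] into the sum required by [mild_fixpoint]. *)
Lemma compatible_glue : compatible b eps f h ->
  \int[@leb3 R]_(z in phase Omega) S z +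
    eps * \int[@leb2 R]_(z in Gamma_minus b) (S (c z.1, z.2) * `|flux b z|) = 0.
Proof.
move=> cfh; rewrite -[RHS]cfh -mulrN; congr (_ + eps * _).
  apply/esym; apply: ae_Rintegral => //; first exact: measurable_funTS bS.1.
  by apply: ae_imp aef => z k pz; rewrite (k pz) glue_phase.
have bHf : bmo (Gamma_minus b) (fun z : T2 => H z * flux b z).
  apply: bmoM; first exact: bmoS bH.
  exact: bmo_flux OB b _.
have -> : \int[@leb2 R]_(z in Gamma_minus b) (on_boundary b h z * flux b z) =
    \int[@leb2 R]_(z in Gamma_minus b) (H z * flux b z).
  apply: ae_Rintegral => //.
  - by apply: measurable_funM => //; apply: measurable_funTS; exact: measurable_flux OB b.
  - by apply: measurable_funTS; exact: bHf.1.
  - by apply: ae_imp aeh => z k /k ->.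
rewrite -(RintN gmm gmf bHf); apply: eq_Rintegral => z /set_mem[gz fz].
by rewrite glue_Gamma// ltr0_norm// mulrN.
Qed.

Context (V : T2 -> R) (bV : bmo setT V) (V0 : \int[@leb2 R]_(x in Omega) V x = 0)
  (VE : forall x, V x = avg (mild Omega eps (fun z => V z.1 + S z)) x).
Let U := mild Omega eps (fun z => V z.1 + S z).
Let bVS : bmo setT (fun z : T3 => V z.1 + S z).
Proof. by apply: bmoD; [exact: bmo_fst|exact: bS]. Qed.
Let bU : bmo setT U. Proof. exact: bmo_mild OB _ e0 _ bVS. Qed.

Definition transport_field (x w : R * R) : R := U (x, arg w).

Lemma transport_field_angle z : angles z.2 -> in_angle transport_field z = U z.
Proof. by case: z => x theta ath; rewrite /in_angle /transport_field /= arg_dir. Qed.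

Lemma phase_patch (k : R * R -> R * R -> R) (K : T3 -> R) :
  (forall z, phase Omega z -> in_angle k z = K z) ->
  (in_angle k \_ (phase Omega) : T3 -> R) = (fun z => \1_(phase Omega) z * K z).
Proof.
move=> kK; apply/funext => z; rewrite /patch indicE; case: ifPn => [/set_mem|_].
  by move=> /kK ->; rewrite mul1r.
by rewrite mul0r.
Qed.

Lemma phase_Linfty_of (k : R * R -> R * R -> R) (K : T3 -> R) (M : R) : measurable_fun setT K -> 0 <= M ->
  (forall z, `|K z| <= M) -> (forall z, phase Omega z -> in_angle k z = K z) ->
  phase_Linfty Omega k /\ (phase_norm Omega +oo k <= M%:E)%E.
Proof.
move=> mK M0 KM kK; rewrite /phase_Linfty /phase_norm (phase_patch kK).
apply: bounded_Linfty => //.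
  by apply: measurable_funM => //; exact: measurable_indic.
move=> z; rewrite normrM; apply: le_trans (KM z); by rewrite ler_piMl// norm_indic_le1.
Qed.

Lemma phase_Linfty_bmo (k : R * R -> R * R -> R) (K : T3 -> R) : bmo setT K ->
  (forall z, phase Omega z -> in_angle k z = K z) -> phase_Linfty Omega k.
Proof.
move=> [mK [M KM]] kK; have M0 : 0 <= M := le_trans (normr_ge0 _) (KM point I).
by have [] := phase_Linfty_of mK M0 (fun z => KM z I) kK.
Qed.

Lemma transport_field_bound M : (forall z, `|V z.1 + S z| <= M) ->
  (phase_norm Omega +oo transport_field <= M%:E)%E.
Proof.
move=> SM; have M0 : 0 <= M := le_trans (normr_ge0 _) (SM point).
have UM z : `|U z| <= M by exact: (mild_abs Omega e0 bVS M0 SM).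
by have [] := phase_Linfty_of bU.1 M0 UM (fun z pz => transport_field_angle pz.2).
Qed.

(** The mild solution is its own trace, with [(V + S - U) / eps] as transport derivative. The
    interior and boundary equations are the fixed-point equation read at interior and at boundary
    points. *)
Lemma transport_field_solution : transport_solution b eps f h transport_field.
Proof.
have tfE z : phase Omega z -> in_angle transport_field z = U z.
  by move=> [_ az]; exact: transport_field_angle.
have tfG z : Gamma b z -> on_boundary b transport_field z = U (c z.1, z.2).
  by move=> [_ az]; rewrite /on_boundary /transport_field arg_dir.
split; first exact: phase_Linfty_bmo tfE.
pose v (x w : R * R) : R := eps^-1 * (V x + S (x, arg w) - U (x, arg w)).
pose v' (z : T3) : R := eps^-1 * (V z.1 + S z - U z).
have bv : bmo setT v' by exact: (bmoZ eps^-1 (bmoB bVS bU)).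
have vE z : phase Omega z -> in_angle v z = v' z.
  by case: z => x theta [_ ath]; rewrite /in_angle /v /v' /= arg_dir.
exists v, transport_field; split.
- split; first exact: phase_Linfty_bmo vE.
  rewrite /Gamma_Linfty.
  have -> : (on_boundary b transport_field \_ (Gamma b) : T2 -> R) =
      (fun z => \1_(Gamma b) z * U (c z.1, z.2)).
    apply/funext => z; rewrite /patch indicE; case: ifPn => [/set_mem|_].
      by move=> /tfG ->; rewrite mul1r.
    by rewrite mul0r.
  have bUc : bmo setT (fun z : T2 => \1_(Gamma b) z * U (c z.1, z.2)).
    apply: bmoM; first exact: bmo_indic.
    by apply: (bmo_curve b setT); exact: bmoS bU.
  have [mU [M UM]] := bUc; have M0 : 0 <= M := le_trans (normr_ge0 _) (UM point I).
  by have [] := bounded_Linfty (@leb2 R) M0 mU (fun z => UM z I).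
- move=> phi tp.
  have := green_test OB b tp (bmoS (@subsetT _ _) bU) (bmoS (@subsetT _ _) bv) (llac_mild OB e0 bVS).
  move=> G; transitivity (\int[@leb3 R]_(z in phase Omega) (v' z * test_val phi z + U z * test_deriv phi z)).
    by apply: eq_Rintegral => z /set_mem pz; rewrite -(vE z pz) -(tfE z pz).
  apply: etrans G _; apply: eq_Rintegral => z /set_mem gz.
  by rewrite /on_boundary /transport_field /= arg_dir//; case: gz.
- apply: ae_imp aef => z k pz; rewrite (k pz) (vE _ pz) (tfE _ pz).
  have -> : velocity_average transport_field z.1 = avg U z.1.
    apply: (velocity_averageE OB b bU pz.1).
      apply: eq_measurable_fun (measurable_funTS (bmo_section z.1 setT bU).1) => theta /set_mem ath.
      by rewrite /transport_field arg_dir.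
    by apply: aeW => theta ath; rewrite /transport_field arg_dir.
  rewrite -VE /v' mulrA mulfV ?gt_eqF// mul1r glue_phase//; ring.
- apply: ae_imp aeh => z k gz; rewrite (k gz) (tfG _ gz.1).
  case: z k gz => t theta k gz; have [[/= tl ath] fz] := gz.
  have tl' : 0 <= t < len b by move: tl; rewrite in_itv.
  have -> : outgoing_average b transport_field (c t) = avg U (c t).
    apply: (outgoing_averageE OB bU tl').
      apply: eq_measurable_fun (measurable_funTS (bmo_section (c t) setT bU).1) => s /set_mem ats.
      by rewrite /transport_field arg_dir.
    by apply: aeW => s ats; rewrite /transport_field arg_dir.
  by rewrite -VE /U (mild_enter OB)//= (glue_Gamma gz.1).
- transitivity (\int[@leb3 R]_(z in phase Omega) U z).
    by apply: eq_Rintegral => z /set_mem; exact: tfE.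
  rewrite -(Rint_avg_body OB b bU) -[X in _ * X]/(\int[@leb2 R]_(x in Omega) avg U x).
  by under eq_Rintegral do rewrite -VE; rewrite V0 mulr0.
Qed.

End existence_of_solutions.

(** Extracts from the hypotheses on the domain the two lengths that control the bound on the
    averages. *)
Lemma bounded_convex_cbody (R : realType) (Omega : set (R * R)) : bounded_convex_C2_domain Omega ->
  exists d xc eta, [/\ cbody Omega d, 0 < eta &
    contains_square Omega xc eta].
Proof.
move=> [oO [xc Oxc] [M [Mr HM]] cO _].
have [r /= r0 Hr] : exists2 r : R, 0 < r & ball xc r `<=` Omega.
  by have /nbhs_ballP[r r0 Hr] := open_nbhs_nbhs (conj oO Oxc); exists r.
(* [2 * eta = r / 2] keeps the square strictly inside the ball. The bound in [bounded_set] holds for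
   numbers strictly above [M], and adding 1 also makes [d] positive. *)
exists (Num.max M 0 + 1), xc, (r / 4); split; last 2 first.
- by rewrite divr_gt0.
- move=> y h1 h2; apply: Hr; split => /=; rewrite -ball_normE /ball_/= distrC.
    by apply: le_lt_trans h1 _; lra.
  by apply: le_lt_trans h2 _; lra.
split => //.
- move=> x y t Ox Oy /andP[t0 t1].
  have s0 : 0 <= 1 - t by rewrite subr_ge0.
  have s1 : 1 - t <= 1 by rewrite gerBl.
  have := cO x y (Itv01 s0 s1) (mem_set Ox) (mem_set Oy) => /set_mem.
  suff E : conv (Itv01 s0 s1) (x : convex_lmodType (R * R)%type) y =
      ((1 - t) * x.1 + t * y.1, (1 - t) * x.2 + t * y.2) by rewrite E.
  transitivity ((1 - t) * x.1 + (1 - (1 - t)) * y.1, (1 - t) * x.2 + (1 - (1 - t)) * y.2); first by [].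
  by rewrite subKr.
- by apply: ltr_wpDl => //; rewrite le_max lexx orbT.
- move=> x Ox; have h : `|x| <= Num.max M 0 + 1.
    by apply: HM Ox; rewrite (@le_lt_trans _ _ (Num.max M 0)) ?ltrDl// le_max lexx.
  by move: h; rewrite prod_normE /= ge_max => /andP[].
Qed.

(** * Norms of the data in terms of representatives, and the final estimate *)

Section transport_estimate.
Context (R : realType) (Omega : set (R * R)) (d : R) (OB : cbody Omega d)
        (b : boundary_data Omega).
Notation T1 := (measurableTypeR R).
Notation T2 := (T1 * T1)%type.
Notation T3 := (T1 * T1 * T1)%type.
Notation c := (curve b).

Let pm := phase_measurable OB.
Let pf := phase_finite OB.
Let gmm := Gamma_minus_measurable OB b.
Let gmf := Gamma_minus_finite OB b.

Lemma phase_normE (p : R) (f : R * R -> R * R -> R) (F : T3 -> R) : 0 < p -> bmo setT F -> phase_Linfty Omega f ->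
  {ae @leb3 R, forall z : T3, phase Omega z -> in_angle f z = F z} ->
  phase_norm Omega p%:E f = ((\int[@leb3 R]_(z in phase Omega) `|F z| `^ p) `^ p^-1)%:E.
Proof.
move=> p0 bF lf aeF; have [mf _] := measurable_phase OB lf.
exact: (Lnorm_patch p0 pm pf (bmoS (@subsetT _ _) bF) mf aeF).
Qed.

Lemma Gamma_minus_normE (p : R) (h : R * R -> R * R -> R) (H : T2 -> R) : 0 < p -> bmo setT H ->
  measurable_fun (Gamma_minus b) (on_boundary b h : T2 -> R) ->
  {ae @leb2 R, forall z : T2, Gamma_minus b z -> on_boundary b h z = H z} ->
  Gamma_minus_norm b p h =
    ((\int[@leb2 R]_(z in Gamma_minus b) (`|H z| `^ p * `|flux b z|)) `^ p^-1)%:E.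
Proof.
move=> p0 bH mh aeH; rewrite /Gamma_minus_norm -poweR_EFin.
have mfl : measurable_fun setT (fun z : T2 => `|flux b z|).
  by apply: measurableT_comp => //; exact: measurable_flux OB b.
have bp : bmo (Gamma_minus b) (fun z : T2 => `|H z| `^ p * `|flux b z|).
  apply: bmoM; first by apply: bmo_powR (ltW p0) _; exact: bmoS bH.
  by apply: (bmo_bd (M := 1)) => // z _; rewrite normr_id; exact: flux_bound.
rewrite (Rint_fin gmm gmf bp); apply: (congr1 (fun z : \bar R => poweR z p^-1)).
apply: ge0_ae_eq_integral => //.
- apply/measurable_EFinP; apply: measurable_funM; last exact: measurable_funTS.
  apply: (measurableT_comp (measurable_powR p)).
  exact: (measurableT_comp (@normr_measurable R setT)).
- by apply/measurable_EFinP; apply: measurable_funTS; exact: bp.1.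
- by apply: ae_imp aeH => x k /k ->.
Qed.

Lemma sqr_powR_half (x : R) : 0 <= x -> (x `^ 2^-1) ^+ 2 = x.
Proof. by move=> x0; rewrite powR12_sqrt// sqr_sqrtr. Qed.

Lemma norm_powR2 (x : R) : `|x| `^ 2 = x ^+ 2.
Proof. by rewrite powR_mulrn// real_normK// num_real. Qed.

End transport_estimate.

Lemma estimate_real (R : realType) (A1 A2 a b1 b2 bf bh C k : R) : 0 <= C -> 0 <= k ->
  0 <= A1 -> 0 <= A2 -> 0 <= a -> 0 <= b1 -> 0 <= b2 -> 0 <= bf -> 0 <= bh ->
  C * (A1 * a + A2 * (k * b1) + (bf + bh) + A1 * b2) + (bf + bh) <=
  (C + 1) * (k + 1) * (A1 * a + A2 * b1 + bf + A1 * b2 + bh).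
Proof.
move=> C0 k0 A10 A20 a0 b10 b20 bf0 bh0; rewrite -subr_ge0.
have p1 := mulr_ge0 A10 a0; have p2 := mulr_ge0 A20 b10; have p3 := mulr_ge0 A10 b20.
have -> : (C + 1) * (k + 1) * (A1 * a + A2 * b1 + bf + A1 * b2 + bh) -
    (C * (A1 * a + A2 * (k * b1) + (bf + bh) + A1 * b2) + (bf + bh)) =
  (C * k + k + 1) * (A1 * a) + (C + k + 1) * (A2 * b1) + (C * k + k) * (bf + bh) + (C * k + k + 1) * (A1 * b2).
  by ring.
by rewrite !addr_ge0// mulr_ge0// ?addr_ge0// ?mulr_ge0.
Qed.

Lemma estimate_ereal (R : realType) (x1 x2 x3 x4 x5 x6 x7 x8 : R) (X : \bar R) : (0 <= X)%E ->
  ((x1 * x2 + x3 * x4 + x5 + x6 * x7 + x8)%:E <=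
   x1%:E * x2%:E + x3%:E * x4%:E + x5%:E + x6%:E * x7%:E + X + x8%:E)%E.
Proof. by move=> X0; rewrite !EFinD !EFinM leeD2r// leeDl. Qed.

Theorem theorem4p9 (R : realType) (Omega : set (R * R))
    (HOmega : bounded_convex_C2_domain Omega) (m : nat) (Hm : (2 < m)%N) :
  exists C eps0 : R, [/\ 0 < C, 0 < eps0 &
    forall (b : boundary_data Omega) (eps : R), 0 < eps -> eps < eps0 ->
    forall f h : R * R -> R * R -> R,
      phase_Linfty Omega f -> Gamma_minus_Linfty b h ->
      compatible b eps f h ->
    exists u : R * R -> R * R -> R,
      [/\ transport_solution b eps f h u,
          (forall u', transport_solution b eps f h u' ->
             {ae @leb3 R, forall z : (R * R) * R, phase Omega z ->
               in_angle u' z = in_angle u z})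
        & (phase_norm Omega +oo u <=
           C%:E *
           (((eps `^ (1 + m%:R^-1))^-1)%:E * phase_norm Omega 2%:E f
            + ((eps `^ (2 + m%:R^-1))^-1)%:E
              * phase_norm Omega ((2 * m%:R) / (2 * m%:R - 1))%:E f
            + phase_norm Omega +oo f
            + ((eps `^ (1 + m%:R^-1))^-1)%:E * Gamma_minus_norm b 2 h
            + ((eps `^ m%:R^-1)^-1)%:E * Gamma_minus_norm b m%:R h
            + Gamma_minus_norm_infty b h))%E]].
Proof.
have [d [xc [eta [OB eta0 HQ]]]] := bounded_convex_cbody HOmega.
have d0 : 0 < d by case: OB.
have m1 : (0 < m)%N by exact: leq_trans Hm.
pose p : R := (2 * m%:R) / (2 * m%:R - 1).
have mR : 1 <= m%:R :> R by rewrite ler1n.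
have p1 : 1 <= p by rewrite /p ler_pdivlMr; lra.
have p0 : 0 < p by exact: lt_le_trans p1.
have two0 : 0 < 2 :> R by [].
have [C [e1 [C0 e10 e11 key]]] := apriori eta0 d0 m1.
(* The constant in the comparison of the [L^1] and [L^p] norms on phase space. *)
set K := fine (@leb3 R (phase Omega)) + 1.
have K0 : 0 < K by rewrite ltr_wpDl// fine_ge0.
exists ((C + 1) * (K + 1)), e1; split => //.
  by rewrite mulr_gt0// addr_gt0.
move=> b eps e0 ee1 f h lf lh cfh.
have [ff [F [mF FM aeF]]] := phase_Linfty_rep lf.
have [fh [H [mH HM aeH mh]]] := Gamma_minus_Linfty_rep OB lh.
have bF : bmo setT F := bmo_bd mF (fun z _ => FM z).
have bH : bmo setT H := bmo_bd mH (fun z _ => HM z).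
have [mf _] := measurable_phase OB lf.
set Nf := fine _ in FM; set Nh := fine _ in HM.
have Nf0 : 0 <= Nf := le_trans (normr_ge0 _) (FM point).
have Nh0 : 0 <= Nh := le_trans (normr_ge0 _) (HM point).
pose S := glue b F H; have bS : bmo setT S := bmo_glue OB b bF bH.
have SM z : `|S z| <= Nf + Nh by exact: glue_abs.
have [V [bV V0 VE]] := mild_fixpoint OB e0 eta0 HQ bS (compatible_glue OB bF bH mf mh aeF aeH cfh).
exists (transport_field b eps F H V); split.
- exact: (transport_field_solution OB e0 bF bH aeF aeH bV V0 VE).
- by move=> u' su'; apply: (solutions_ae_eq OB e0 eta0 HQ _ su');
    exact: (transport_field_solution OB e0 bF bH aeF aeH bV V0 VE).
rewrite -/p.
rewrite (phase_normE OB two0 bF lf aeF) (phase_normE OB p0 bF lf aeF).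
rewrite (Gamma_minus_normE OB two0 bH mh aeH).
set F2 := _ `^ 2^-1; set Fp := _ `^ p^-1; set H2 := _ `^ 2^-1.
have F20 : 0 <= F2 by exact: powR_ge0.
have Fp0 : 0 <= Fp by exact: powR_ge0.
have H20 : 0 <= H2 by exact: powR_ge0.
set E := eps `^ m%:R^-1; have E0 : 0 < E by exact: powR_gt0.
have e01 : 0 < eps < e1 by rewrite e0.
(* The a priori bound is used with [K * Fp] for the [L^1] norm of the source and [Nf + Nh] for its
   supremum. *)
have VM x : `|V x| <= C * (eps^-1 / E * F2 + eps ^- 2 / E * (K * Fp) + (Nf + Nh) + eps^-1 / E * H2).
  apply: (key Omega OB xc HQ b eps e01 V S) => //.
  - rewrite (_ : \int[_]_(z in _) _ = \int[@leb3 R]_(z in phase Omega) `|F z|).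
      apply: (Rint_L1_le_Lp p1 (phase_measurable OB) (phase_finite OB)).
      by apply: bmoS bF; exact: subsetT.
    by apply: eq_Rintegral => z /set_mem pz; rewrite /S (glue_phase OB).
  - rewrite /F2 sqr_powR_half; last by apply: Rintegral_ge0 => z _; exact: powR_ge0.
    apply: eq_ler; apply: eq_Rintegral => z /set_mem pz.
    by rewrite norm_powR2 /S (glue_phase OB).
  - rewrite /H2 sqr_powR_half; last by apply: Rintegral_ge0 => z _; rewrite mulr_ge0// powR_ge0.
    apply: eq_ler; apply: eq_Rintegral => z /set_mem[gz _].
    by rewrite norm_powR2 /S (glue_Gamma OB).
set Mx := C * _ in VM.
(* The solution is the mild solution with datum [V + S], so the maximum principle transfers this
   bound to it. *)
have VSM (z : measurableTypeR R * measurableTypeR R * measurableTypeR R) : `|V z.1 + S z| <= Mx + (Nf + Nh).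
  by apply: le_trans (ler_normD _ _) _; apply: lerD.
apply: le_trans (transport_field_bound OB e0 bF bH bV VSM) _.
have Ee : (eps `^ (1 + m%:R^-1))^-1 = eps^-1 / E.
  by rewrite powRD ?(gt_eqF e0) ?implybT// powRr1 ?(ltW e0)// invfM.
have Ee2 : (eps `^ (2 + m%:R^-1))^-1 = eps ^- 2 / E.
  by rewrite powRD ?(gt_eqF e0) ?implybT// powR_mulrn ?(ltW e0)// invfM.
rewrite Ee Ee2 -(fineK ff) -(fineK fh) -/Nf -/Nh.
apply: (@le_trans _ _ (((C + 1) * (K + 1))%:E * (eps^-1 / E * F2 + eps ^- 2 / E * Fp + Nf +
    eps^-1 / E * H2 + Nh)%:E)%E).
  rewrite -EFinM lee_fin; apply: estimate_real => //; [exact: ltW|exact: ltW| |].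
  - by rewrite divr_ge0 ?invr_ge0 ?ltW.
  - by rewrite divr_ge0 ?invr_ge0 ?exprn_ge0 ?ltW.
apply: lee_wpmul2l; first by rewrite lee_fin mulr_ge0// addr_ge0// ltW.
apply: estimate_ereal; apply: mule_ge0; last exact: poweR_ge0.
by rewrite lee_fin invr_ge0 ltW.
Qed.
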